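(* Assume $V,W$ satisfy assumptions (H) of the context. Assume that $\sup_{N\ge1,\,1\le i\le N}\int|x_i|^{4m^2}\,du_0^{(N)}<+\infty$ and that $u_0$ satisfies a logarithmic Sobolev inequality with constant $c_0$. If moreover either $W(x)=\lambda_W\frac{|x|^2}{2}$ or $d=1$, then there exists a constant $\mathrm C_{\rm init}>0$, depending only on $V,W,d$ and the initial laws, independent of $t$ and $N$, such that for all $t\ge0$ and $N\ge1$, $$\frac{\mathbf{Ent}(u_t^{(N)},u_t^{\otimes N})}{N}\le\frac{\mathrm C_{\rm init}}{N}+e^{-\frac{1}{2\mathrm C_{\rm LSI}}t}\,\frac{\mathbf{Ent}(u_0^{(N)},u_0^{\otimes N})}{N}+e^{-\gamma t}\,\frac{\mathrm C_{\rm init}}{\sqrt N}\,\mathbf W_4^2\left(u_0^{(N)},u_0^{\otimes N}\right).$$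
   Context: Let $V,W:\mathbb R^d\to\mathbb R$ be smooth potentials and $(B^i)_{i\ge1}$ independent Brownian motions on $\mathbb R^d$. Particle system: for each $N\ge1$, $(X^{1,N},\dots,X^{N,N})$ solves $$dX_t^{i,N}=\sqrt2\,dB_t^i-\nabla V(X_t^{i,N})\,dt-\frac1N\sum_{j=1}^N\nabla W(X_t^{i,N}-X_t^{j,N})\,dt,\quad 1\le i\le N,$$ with initial law $u_0^{(N)}$ on $\mathbb R^{dN}$ (not assumed exchangeable or product); $u_t^{(N)}$ denotes the law on $\mathbb R^{dN}$ of the solution at time $t$. Points of $\mathbb R^{dN}$ are written $(x_1,\dots,x_N)$, $x_i\in\mathbb R^d$. Limit equation: $u_t$ is the law at time $t$ of the solution of the McKean-Vlasov equation $$d\bar X_t=\sqrt2\,dB_t-\nabla V(\bar X_t)\,dt-\nabla W\ast u_t(\bar X_t)\,dt,\qquad \mathcal L(\bar X_t)=u_t,$$ with initial law $u_0$ on $\mathbb R^d$. Assumptions (H): - $\nabla W$ is odd: $\nabla W(-x)=-\nabla W(x)$; - $(\nabla W(x)-\nabla W(y))\cdot(x-y)\ge\lambda_W|x-y|^2$ for all $x,y$, with $\lambda_W\in\mathbb R$; - $(\nabla V(x)-\nabla V(y))\cdot(x-y)\ge\lambda_V|x-y|^2$ for all $x,y$, with $\lambda_V>0$; - $\lambda_V+2\lambda_W>0$; - $|\nabla W(x)-\nabla W(y)|\le M(|x-y|\wedge1)(1+|x|^m+|y|^m)$ for all $x,y$, with $m\in\mathbb N$, $M>0$; - $\nabla V$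 is locally Lipschitz with polynomial growth. Relative entropy: $\mathbf{Ent}(\mu,\nu)=\int\frac{d\mu}{d\nu}\ln\frac{d\mu}{d\nu}\,d\nu$ if $\mu\ll\nu$, $+\infty$ otherwise. A probability measure $\mu$ satisfies a logarithmic Sobolev inequality with constant $c$ if for all suitable (smooth) positive $f$, $\int f\ln f\,d\mu-\int f\,d\mu\,\ln\int f\,d\mu\le c\int\frac{|\nabla f|^2}{f}\,d\mu$. For probability measures $\mu,\nu$ on $\mathbb R^{dN}$, $\mathbf W_q^q(\mu,\nu)=\inf_\pi\int\sum_{i=1}^N|x^i-y^i|^q\,d\pi(x,y)$ over couplings $\pi$ of $\mu,\nu$, with $|\cdot|$ Euclidean on $\mathbb R^d$; $\mathbf W_4^2=(\mathbf W_4)^2$. Constants: $\beta=\lambda_V$ if $\lambda_W\ge0$, $\beta=\lambda_V+2\lambda_W$ otherwise; $\mathrm C_{\rm LSI}=\max\left(c_0,\frac{2}{\lambda_V+\lambda_W}\right)$; $\gamma=\min\left(2\beta,\frac1{2\mathrm C_{\rm LSI}}\right)$. *)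

(* Defs.v *)
From HB Require Import structures.
From mathcomp Require Import all_boot all_order all_algebra.
From mathcomp Require Import all_classical all_reals all_analysis.

Set Implicit Arguments.
Unset Strict Implicit.
Unset Printing Implicit Defensive.

Import Order.TTheory GRing.Theory Num.Theory.
Import numFieldNormedType.Exports.

Local Open Scope classical_set_scope.
Local Open Scope ring_scope.

(* R^d is ['rV[R]_d] with its Borel sigma-algebra, and R^(dN) is
   [N.-tuple 'rV[R]_d] with the library's product sigma-algebra. *)
HB.instance Definition _ (R : realType) (m n : nat) :=
  @isMeasurable.Build (sigma_display (@open 'M[R]_(m, n))) 'M[R]_(m, n)
    <<s (@open 'M[R]_(m, n)) >> (@sigma_algebra0 _ setT open)
    (@sigma_algebraC _ open) (@sigma_algebra_bigcup _ setT open).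

Section Euclidean.
Context {R : realType} {d : nat}.
Implicit Types (x y : 'rV[R]_d) (f : 'rV[R]_d -> R).

Definition dotp x y : R := \sum_(k < d) x 0 k * y 0 k.

(* The library norm `|x| on ['rV[R]_d] is the sup norm. *)
Definition enorm x : R := Num.sqrt (dotp x x).

Definition partial (k : 'I_d) f : 'rV[R]_d -> R :=
  fun x => 'D_(delta_mx 0 k) f x.

Definition grad f x : 'rV[R]_d := \row_k partial k f x.

(* C^oo: differentiability of all iterated partial derivatives also makes them
   continuous. *)
Definition smooth f : Prop :=
  forall (s : seq 'I_d) x, differentiable (foldr partial f s) x.

Definition strongly_monotone (lam : R) (b : 'rV[R]_d -> 'rV[R]_d) : Prop :=
  forall x y, lam * enorm (x - y) ^+ 2 <= dotp (b x - b y) (x - y).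

Definition locally_lipschitz (b : 'rV[R]_d -> 'rV[R]_d) : Prop :=
  forall r : R, exists L : R, forall x y, enorm x <= r -> enorm y <= r ->
    enorm (b x - b y) <= L * enorm (x - y).

Definition polynomial_growth (b : 'rV[R]_d -> 'rV[R]_d) : Prop :=
  exists (C : R) (q : nat), forall x, enorm (b x) <= C * (1 + enorm x ^+ q).

End Euclidean.

Record assumption_H {R : realType} {d : nat} (V W : 'rV[R]_d -> R)
    (lamV lamW M : R) (m : nat) : Prop := AssumptionH {
  H_smoothV : smooth V ;
  H_smoothW : smooth W ;
  H_gradW_odd : forall x, grad W (- x) = - grad W x ;
  H_gradW_monotone : strongly_monotone lamW (grad W) ;
  H_lamV_gt0 : 0 < lamV ;
  H_gradV_monotone : strongly_monotone lamV (grad V) ;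
  H_convex : 0 < lamV + 2 * lamW ;
  H_M_gt0 : 0 < M ;
  H_gradW_growth : forall x y, enorm (grad W x - grad W y) <=
    M * Num.min (enorm (x - y)) 1 * (1 + enorm x ^+ m + enorm y ^+ m) ;
  H_gradV_lipschitz : locally_lipschitz (grad V) ;
  H_gradV_growth : polynomial_growth (grad V) }.

Section ProductMeasure.
Context {d : measure_display} {T : measurableType d} {R : realType}.

Definition consT n (z : T * n.-tuple T) : n.+1.-tuple T :=
  [tuple of z.1 :: z.2].

Lemma measurable_consT n : measurable_fun setT (@consT n).
Proof. by apply: measurable_cons. Qed.

HB.instance Definition _ n := @isMeasurableFun.Build _ _ _ _
  (@consT n) (@measurable_consT n).

(* The n-fold product measure, characterized by [iid_box]. *)
Fixpoint iid (mu : probability T R) (n : nat) : probability (n.-tuple T) R :=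
  match n return probability (n.-tuple T) R with
  | 0%N => \d_([tuple] : 0.-tuple T)
  | n'.+1 => distribution (mu \x iid mu n')%E (@consT n')
  end.

Lemma iid_box (mu : probability T R) n (A : 'I_n -> set T) :
  (forall i, measurable (A i)) ->
  iid mu n [set x | forall i, A i (tnth x i)] = (\prod_(i < n) mu (A i))%E.
Proof.
elim: n A => [|n IH] A mA.
  rewrite big_ord0 /= diracE mem_set //=; by case.
rewrite big_ord_recl -(IH (fun i => A (lift ord0 i)))//.
rewrite -product_measure1E//; last first.
  rewrite (_ : mkset _ =
    \bigcap_(i in [set: 'I_n]) ((fun x => tnth x i) @^-1` A (lift ord0 i))).
    apply: fin_bigcap_measurable => // i _.
    rewrite -[X in measurable X]setTI.
    by apply: measurable_tnth.
  by apply/seteqP; split=> x /= Ax i => [_|]; apply: Ax.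
rewrite /= /distribution /pushforward; congr (_ _).
apply/seteqP; split=> -[x y]/=.
  move=> H; split; first exact: (H ord0).
  by move=> i; have := H (lift ord0 i); rewrite tnthS.
move=> [Hx Hy] i; case: (unliftP ord0 i) => [j ->|->//].
by rewrite tnthS.
Qed.

End ProductMeasure.

Section Functionals.
Local Open Scope charge_scope.
Context {disp : measure_display} {T : measurableType disp} {R : realType}.
Implicit Types mu nu : probability T R.

Definition Ent mu nu : \bar R :=
  if `[< mu `<< nu >] then
    (\int[nu]_x (let f := fine (('d (charge_of_finite_measure mu) '/d nu) x)
                 in (f * ln f)%R)%:E)%E
  else +oo%E.

Definition coupling mu nu (pi : probability (T * T)%type R) : Prop :=
  forall A : set T, measurable A ->
    pi (fst @^-1` A) = mu A /\ pi (snd @^-1` A) = nu A.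

End Functionals.

(* W_q on R^(dN), for the cost sum_i |x^i - y^i|^q. *)
Definition wasserstein {R : realType} {d N : nat} (q : nat)
    (mu nu : probability (N.-tuple 'rV[R]_d) R) : \bar R :=
  poweR (ereal_inf
    [set (\int[pi]_z (\sum_(i < N) enorm (tnth z.1 i - tnth z.2 i) ^+ q)%:E)%E
       | pi in coupling mu nu]) (q%:R^-1).

(* The integrability conditions on the test function give a meaning to the
   left-hand side; the right-hand side may be +oo. *)
Definition log_sobolev {R : realType} {d : nat} (mu : probability 'rV[R]_d R)
    (c : R) : Prop :=
  forall f : 'rV[R]_d -> R, smooth f -> (forall x, 0 < f x) ->
    mu.-integrable setT (fun x => (f x)%:E) ->
    mu.-integrable setT (fun x => (f x * ln (f x))%:E) ->
    let I := \int[mu]_x f x in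
    (\int[mu]_x (f x * ln (f x))%:E - (I * ln I)%:E
       <= c%:E * \int[mu]_x (enorm (grad f x) ^+ 2 / f x)%:E)%E.

Section Processes.
Context {disp : measure_display} {Om : measurableType disp} {R : realType}.
Context (P : probability Om R).

Definition filtration (F : R -> set (set Om)) : Prop :=
  (forall t, 0 <= t -> sigma_algebra setT (F t) /\ F t `<=` measurable) /\
  (forall s t, 0 <= s -> s <= t -> F s `<=` F t).

Definition adapted {d : measure_display} {T : measurableType d}
    (F : R -> set (set Om)) (X : R -> Om -> T) : Prop :=
  forall t, 0 <= t -> forall A, measurable A -> F t (X t @^-1` A).

Definition continuous_paths {d : nat} (X : R -> Om -> 'rV[R]_d) : Prop :=
  {ae P, forall w, {within `[0, +oo[, continuous (X ^~ w)}}.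

(* Independent F-Brownian motions (B i) on R^d: given s < t, the increments
   over [s, t] of all the real coordinates are, jointly, independent of F s and
   mutually independent with law N(0, t - s). The second parameter of
   [normal_prob] is the standard deviation. *)
Record brownian_family {d : nat} {I : finType} (F : R -> set (set Om))
    (B : I -> R -> Om -> 'rV[R]_d) : Prop := BrownianFamily {
  brownian_adapted : forall i, adapted F (B i) ;
  brownian_start : forall i, {ae P, forall w, B i 0 w = 0} ;
  brownian_continuous : forall i, continuous_paths (B i) ;
  brownian_increments : forall s t, 0 <= s -> s < t ->
    forall A, F s A ->
    forall E : I -> 'I_d -> set R, (forall i k, measurable (E i k)) ->
    P (A `&` [set w | forall i k, E i k ((B i t w - B i s w) 0 k)]) =
    (P A * \prod_(i : I) \prod_(k < d)
             normal_prob 0 (Num.sqrt (t - s)) (E i k))%E }.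

(* dX = sqrt 2 dB + b dt; since the noise is additive, the stochastic integral
   is sqrt 2 B and the equation makes sense path by path. *)
Definition solves_sde {d : nat} (B : R -> Om -> 'rV[R]_d)
    (b X : R -> Om -> 'rV[R]_d) : Prop :=
  continuous_paths X /\
  {ae P, forall w, forall t, 0 <= t ->
    (forall k, lebesgue_measure.-integrable `[0, t] (fun s => (b s w 0 k)%:E)) /\
    X t w = X 0 w + Num.sqrt 2 *: B t w
            + \row_k \int[lebesgue_measure]_(s in `[0, t]) b s w 0 k}.

Definition has_law {d : measure_display} {T : measurableType d}
    (X : Om -> T) (mu : probability T R) : Prop :=
  forall A, measurable A -> P (X @^-1` A) = mu A.

End Processes.

Definition particle_drift {R : realType} {d N : nat} (V W : 'rV[R]_d -> R)
    (x : N.-tuple 'rV[R]_d) (i : 'I_N) : 'rV[R]_d :=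
  - grad V (tnth x i)
  - N%:R^-1 *: \sum_(j < N) grad W (tnth x i - tnth x j).

(* [uN t], t >= 0, is the law at time t of the N-particle system started
   from [u0]. *)
Definition particle_law {R : realType} {d N : nat} (V W : 'rV[R]_d -> R)
    (u0 : probability (N.-tuple 'rV[R]_d) R)
    (uN : R -> probability (N.-tuple 'rV[R]_d) R) : Prop :=
  exists (disp : measure_display) (Om : measurableType disp)
    (P : probability Om R) (F : R -> set (set Om))
    (B : 'I_N -> R -> Om -> 'rV[R]_d) (X : R -> Om -> N.-tuple 'rV[R]_d),
  [/\ filtration F, brownian_family P F B /\ adapted F X,
      forall i, solves_sde P (B i) (fun s w => particle_drift V W (X s w) i)
                  (fun s w => tnth (X s w) i),
      has_law P (X 0) u0 &
      forall t, 0 <= t -> has_law P (X t) (uN t)].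

Definition grad_conv {R : realType} {d : nat} (W : 'rV[R]_d -> R)
    (mu : probability 'rV[R]_d R) (x : 'rV[R]_d) : 'rV[R]_d :=
  \row_k \int[mu]_y grad W (x - y) 0 k.

(* [u t], t >= 0, is the law at time t of the solution of the McKean-Vlasov
   equation started from [u0]. The locally bounded moment of order p, where p
   is the growth exponent of [grad W], is the usual integrability requirement
   under which [grad W * u t] is well defined and locally bounded. *)
Definition mckean_vlasov_law {R : realType} {d : nat} (V W : 'rV[R]_d -> R)
    (p : nat) (u0 : probability 'rV[R]_d R)
    (u : R -> probability 'rV[R]_d R) : Prop :=
  (forall T : R, exists K : R, forall t, 0 <= t -> t <= T ->
     (\int[u t]_x (enorm x ^+ p)%:E <= K%:E)%E) /\
  exists (disp : measure_display) (Om : measurableType disp)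
    (P : probability Om R) (F : R -> set (set Om))
    (B : R -> Om -> 'rV[R]_d) (X : R -> Om -> 'rV[R]_d),
  [/\ filtration F, brownian_family P F (fun _ : 'I_1 => B) /\ adapted F X,
      solves_sde P B (fun s w => - grad V (X s w) - grad_conv W (u s) (X s w)) X,
      has_law P (X 0) u0 &
      forall t, 0 <= t -> has_law P (X t) (u t)].

Section Constants.
Context {R : realType}.

Definition beta_cst (lamV lamW : R) : R :=
  if 0 <= lamW then lamV else lamV + 2 * lamW.

Definition C_LSI (lamV lamW c0 : R) : R := Num.max c0 (2 / (lamV + lamW)).

Definition gamma_cst (lamV lamW c0 : R) : R :=
  Num.min (2 * beta_cst lamV lamW) (1 / (2 * C_LSI lamV lamW c0)).

End Constants.

(* Main.v *)
(* The laws are compared along an implicit Euler splitting scheme with mesh T / (n + 1), whose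
   McKean-Vlasov version uses the fields grad W * u_s. A synchronous coupling of the two
   N-particle chains contracts in fourth moment at rate beta, up to the empirical fluctuation of
   independent copies, of size N^-1/2.
   In the dual (Donsker-Varadhan) form of the entropy, each Gaussian step costs |shift|^2 / (4 D);
   spreading the coupling gap over a window of steps turns it into an entropy bound, and both
   bounds pass to the limit because the dual form only involves bounded continuous functions. *)
Require Import Defs.
From HB Require Import structures.
From mathcomp Require Import all_boot all_order all_algebra.
From mathcomp Require Import all_classical all_reals all_analysis.
From mathcomp Require Import measurable_realfun.
From mathcomp Require Import zify ring lra.

Set Implicit Arguments.
Unset Strict Implicit.
Unset Printing Implicit Defensive.

Import Order.TTheory GRing.Theory Num.Theory.
Import numFieldNormedType.Exports.

Local Open Scope classical_set_scope.
Local Open Scope ring_scope.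


(** The drifts are only locally Lipschitz, so an explicit step could blow up; an implicit step is
    the resolvent of a monotone operator, defined everywhere and nonexpansive. The local Lipschitz
    constant of [grad W] grows polynomially: a squared difference of forces costs squared gap times
    squared weight, hence fourth powers of the gap, and contraction has to be tested against
    [|u|^2 u]. Two points shape the constants. The mean field [grad W * u_t] is controlled by
    moments of [u_t], whose crude bounds grow with the horizon; moments uniform in time are
    recovered by comparison with a particle system of large auxiliary size, whose moment bounds do
    not see the mean field. The rate [1 / (2 C_LSI)] is needed up to time 1 only: there the smaller
    of the initial entropy and of the transport bound [w / (2 t)] is used, and the fraction of
    entropy lost to the exponential is at most a multiple of [w]. After time 1 the transport bound
    alone suffices, with decay [2 beta >= gamma]. The logarithmic Sobolev inequality enters through
    the moments of [u_0]. *)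

Notation mble f := (measurable_fun setT f).
Notation mcomp := measurableT_comp.
Notation mbleD := measurable_funD.
Notation mbleM := measurable_funM.
Notation mbleX := measurable_funX.
Notation mbleEFin := measurable_EFinP.
Notation mble_pair := measurable_fun_pair.
Notation mble_fst := measurable_fst.
Notation mble_snd := measurable_snd.
Notation mble_tnth := measurable_tnth.
Notation mble_cst := measurable_cst.
Notation mble_sum := measurable_sum.
Notation conf N R d := (N.-tuple 'rV[R]_d).
Notation letr y := (@le_trans _ _ y).

Lemma eqW {dp} {T : porderType dp} (x y : T) : x = y -> (x <= y)%O.
Proof. by move->. Qed.

(** * Euclidean geometry of rows *)

Section EuclideanNorm.
Context {R : realType} {d : nat}.
Implicit Types (x y z : 'rV[R]_d) (a : R).

Lemma dotpC x y : dotp x y = dotp y x.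
Proof. by apply: eq_bigr => k _;rewrite mulrC. Qed.
Lemma dotpDl x y z : dotp (x + y) z = dotp x z + dotp y z.
Proof.
by rewrite -big_split;apply: eq_bigr => k _;rewrite mxE mulrDl.
Qed.
Lemma dotpDr x y z : dotp z (x + y) = dotp z x + dotp z y.
Proof. by rewrite dotpC dotpDl !(dotpC z). Qed.
Lemma dotpZl a x y : dotp (a *: x) y = a * dotp x y.
Proof.
by rewrite /dotp mulr_sumr;apply: eq_bigr => k _;rewrite mxE mulrA.
Qed.
Lemma dotpZr a x y : dotp y (a *: x) = a * dotp y x.
Proof. by rewrite dotpC dotpZl dotpC. Qed.
Lemma dotpNl x y : dotp (- x) y = - dotp x y.
Proof. by rewrite -scaleN1r dotpZl mulN1r. Qed.
Lemma dotpNr x y : dotp y (- x) = - dotp y x.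
Proof. by rewrite dotpC dotpNl dotpC. Qed.
Lemma dotpBl x y z : dotp (x - y) z = dotp x z - dotp y z.
Proof. by rewrite dotpDl dotpNl. Qed.
Lemma dotpBr x y z : dotp z (x - y) = dotp z x - dotp z y.
Proof. by rewrite dotpDr dotpNr. Qed.
Lemma dotp0l x : dotp 0 x = 0.
Proof. by rewrite -(scale0r 0) dotpZl mul0r. Qed.
Lemma dotp0r x : dotp x 0 = 0.
Proof. by rewrite dotpC dotp0l. Qed.
Lemma dotp_ge0 x : 0 <= dotp x x.
Proof. by apply: sumr_ge0 => k _;rewrite -expr2 sqr_ge0. Qed.
Lemma enorm_ge0 x : 0 <= enorm x.
Proof. exact: sqrtr_ge0. Qed.
Lemma enorm_sqr x : enorm x ^+ 2 = dotp x x.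
Proof. by rewrite sqr_sqrtr // dotp_ge0. Qed.
Lemma dotp_eq0 x : dotp x x = 0 -> x = 0.
Proof.
move=> /eqP;rewrite psumr_eq0;last by move=> k _;rewrite -expr2 sqr_ge0.
move=> /allP x0;apply/rowP => k;rewrite mxE.
by have := x0 k (mem_index_enum _);rewrite /= mulf_eq0 orbb => /eqP.
Qed.
Lemma enorm_eq0 x : enorm x = 0 -> x = 0.
Proof. by move=> x0;apply: dotp_eq0;rewrite -enorm_sqr x0 expr0n. Qed.
Lemma enorm0 : enorm (0 : 'rV[R]_d) = 0.
Proof. by rewrite /enorm dotp0l sqrtr0. Qed.
Lemma dotp_le x y : dotp x y <= enorm x * enorm y.
Proof.
have [x0|x0] := eqVneq (enorm x) 0.
 by rewrite (enorm_eq0 x0) dotp0l enorm0 mul0r.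
have [y0|y0] := eqVneq (enorm y) 0.
 by rewrite (enorm_eq0 y0) dotp0r enorm0 mulr0.
have px : 0 < enorm x by rewrite lt_def x0 enorm_ge0.
have py : 0 < enorm y by rewrite lt_def y0 enorm_ge0.
have := dotp_ge0 (enorm y *: x - enorm x *: y).
rewrite dotpBl !dotpBr !dotpZl !dotpZr -!enorm_sqr (dotpC y x).
set a := enorm x;set b := enorm y;set c := dotp x y => H.
have : 0 <= (2 * (a * b)) * (a * b - c) by lra.
by rewrite pmulr_rge0 ?subr_ge0// !mulr_gt0.
Qed.
Lemma enormZ a x : enorm (a *: x) = `|a| * enorm x.
Proof.
by rewrite /enorm dotpZl dotpZr mulrA -expr2 sqrtrM ?sqr_ge0// sqrtr_sqr.
Qed.
Lemma enormN x : enorm (- x) = enorm x.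
Proof. by rewrite -scaleN1r enormZ normrN1 mul1r. Qed.
Lemma enormBC x y : enorm (x - y) = enorm (y - x).
Proof. by rewrite -enormN opprB. Qed.
Lemma enorm_sqrB x y :
 enorm (x - y) ^+ 2 = enorm x ^+ 2 - 2 * dotp x y + enorm y ^+ 2.
Proof. by rewrite !enorm_sqr dotpBl !dotpBr (dotpC y);ring. Qed.
Lemma enorm_sqrD x y :
 enorm (x + y) ^+ 2 = enorm x ^+ 2 + 2 * dotp x y + enorm y ^+ 2.
Proof. by rewrite !enorm_sqr dotpDl !dotpDr (dotpC y);ring. Qed.
Lemma dotp_le_abs x y : `|dotp x y| <= enorm x * enorm y.
Proof.
rewrite ler_norml dotp_le andbT lerNl -dotpNl (le_trans (dotp_le _ _))//.
by rewrite enormN.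
Qed.
Lemma enormD x y : enorm (x + y) <= enorm x + enorm y.
Proof.
rewrite -(@ler_pXn2r _ 2%N) ?nnegrE ?addr_ge0 ?enorm_ge0// enorm_sqr.
rewrite dotpDl !dotpDr -!enorm_sqr (dotpC y).
by have := dotp_le x y;lra.
Qed.
Lemma enormB x y : enorm (x - y) <= enorm x + enorm y.
Proof. by rewrite (le_trans (enormD _ _))// enormN. Qed.
Lemma enorm_dist_abs x y : `|enorm x - enorm y| <= enorm (x - y).
Proof.
rewrite ler_norml;apply/andP;split.
 by rewrite enormBC lerNl opprB lerBlDr (le_trans _ (enormD _ _))// subrK.
by rewrite lerBlDr (le_trans _ (enormD _ _))// subrK.
Qed.
Lemma coord_le_enorm x k : `|x 0 k| <= enorm x.
Proof.
rewrite -sqrtr_sqr ler_wsqrtr// /dotp (bigD1 k)//= expr2 lerDl.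
by apply: sumr_ge0 => j _;rewrite -expr2 sqr_ge0.
Qed.
Lemma enorm_sum (I : Type) (r : seq I) (P : pred I) (F : I -> 'rV[R]_d) :
 enorm (\sum_(i <- r | P i) F i) <= \sum_(i <- r | P i) enorm (F i).
Proof.
elim/big_rec2 : _ => [|i u v _ uv];first by rewrite enorm0.
by rewrite (le_trans (enormD _ _))// lerD2l.
Qed.
Lemma enorm_le_sum x : enorm x <= \sum_(k < d) `|x 0 k|.
Proof.
have {1}-> : x = \sum_(k < d) x 0 k *: delta_mx 0 k.
 by rewrite -row_sum_delta.
apply: (le_trans (enorm_sum _ _ _));apply: ler_sum => k _.
rewrite enormZ /enorm /dotp (bigD1 k)//= big1 ?addr0;last first.
 by move=> j jk;rewrite !mxE (negbTE jk) andbF mulr0.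
by rewrite !mxE !eqxx mulr1 sqrtr1 mulr1.
Qed.
Lemma enorm_le_mx x : enorm x <= d%:R * `|x|.
Proof.
apply: (le_trans (enorm_le_sum x)).
rewrite -[d in d%:R]card_ord -sumr_const mulr_suml;apply: ler_sum => k _.
by rewrite mul1r [leRHS]/Num.norm/= mx_normrE (le_bigmax _ (fun i => `|x i.1 i.2|) (0, k)).
Qed.
Lemma mx_le_enorm x : `|x| <= enorm x.
Proof.
rewrite [leLHS]/Num.norm/= mx_normrE bigmax_le ?enorm_ge0// => -[i k] _ /=.
by rewrite ord1 coord_le_enorm.
Qed.
Lemma enorm_cont_at (f : 'rV[R]_d -> R) x :
 (forall e, 0 < e -> exists2 r, 0 < r &
 forall y, enorm (y - x) < r -> `|f y - f x| < e) -> {for x, continuous f}.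
Proof.
move=> H;apply/(@cvgrPdist_lt _ _ _ (nbhs x)) => e e0.
have [r r0 Hr] := H e e0.
(* Library balls are for the sup norm and [enorm] is at most [d] times it; [d.+1] keeps the divisor
   positive when [d = 0]. *)
apply/nbhs_ballP;exists (r / d.+1%:R);first by rewrite /= divr_gt0.
move=> y;rewrite -ball_normE /= => xy;rewrite distrC;apply: Hr.
rewrite (le_lt_trans (enorm_le_mx _))//.
rewrite (@le_lt_trans _ _ (d.+1%:R * `|y - x|))//.
 by rewrite ler_wpM2r// ler_nat.
by rewrite mulrC -ltr_pdivlMr// distrC.
Qed.

End EuclideanNorm.

(** * Borel structure of rows and configurations *)

Section BorelRows.
Context {R : realType}.

Lemma open_measurable_rV d (U : set 'rV[R]_d) : open U -> measurable U.
Proof. by move=> oU;exact: sub_sigma_algebra. Qed.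
Lemma continuous_measurable_rV d (f : 'rV[R]_d -> R) :
 continuous f -> mble f.
Proof.
move=> cf;apply: (measurability _ (RGenOpens.measurableE R)).
move=> _ [_ [a [b ->] <-]];rewrite setTI;apply: open_measurable_rV.
by move/continuousP : cf;apply;exact: interval_open.
Qed.
Lemma mble_coord d (k : 'I_d) :
 mble (fun x : 'rV[R]_d => x 0 k).
Proof.
apply: continuous_measurable_rV => x;apply: enorm_cont_at => e e0.
exists e => // y yx;apply: le_lt_trans yx.
by rewrite (le_trans _ (coord_le_enorm (y - x) k))// !mxE.
Qed.
Lemma mble_enorm d : mble (@enorm R d).
Proof.
apply: continuous_measurable_rV => x;apply: enorm_cont_at => e e0.
by exists e => // y yx;apply: le_lt_trans yx;exact: enorm_dist_abs.
Qed.

(** Boxes with rational centre and radius form a countable base, so that measurability of the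
    coordinates gives measurability for the sigma-algebra of open sets. *)
Definition ratbox d (p : {ffun 'I_d -> rat} * rat) : set 'rV[R]_d :=
 [set x | forall k, `|x 0 k - ratr (p.1 k)| < ratr p.2].

Lemma open_ratbox d (U : set 'rV[R]_d) x : open U -> U x ->
 exists2 p, ratbox p x & ratbox p `<=` U.
Proof.
move=> oU Ux;have : nbhs x U by exact: open_nbhs_nbhs.
move=> /nbhs_ballP[e /= e0 eU].
have [r] : exists r, (ratr r : R) \in `](0 : R), (e / 2)%R[.
 have /rat_in_itvoo[r rI] : (0 : R) < e / 2 by rewrite divr_gt0.
 by exists r.
rewrite in_itv /= => /andP[r0 re].
have /choice[q qP] : forall k, exists q : rat, `|x 0 k - ratr q| < ratr r.
 move=> k;have /rat_in_itvoo[q] : x 0 k - ratr r < x 0 k + ratr r by lra.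
 by rewrite in_itv /= => ?;exists q;rewrite ltr_norml;lra.
exists ([ffun k => q k], r) => [k|y yB] /=;first by rewrite ffunE.
apply: eU;rewrite -ball_normE /= [ltLHS]/Num.norm/= mx_normrE.
apply: bigmax_lt => // -[i k] _ /=;rewrite ord1 !mxE.
have := yB k;have := qP k;rewrite /= ffunE.
by rewrite !ltr_norml;lra.
Qed.
Lemma mblef_rV disp (T : measurableType disp) d (f : T -> 'rV[R]_d) :
 (forall k, mble (fun t => f t 0 k)) -> mble f.
Proof.
move=> mf;apply: (@measurability _ _ _ _ _ f (@open 'rV[R]_d)) => // _ [U oU <-].
have mbox p : measurable (f @^-1` (ratbox p)).
 have -> : f @^-1` (ratbox p) = \bigcap_(k in [set: 'I_d])
  [set t | `|f t 0 k - ratr (p.1 k)| < ratr p.2].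
 by apply/seteqP;split => t /= H k;[move=> _|];exact: H.
 apply: fin_bigcap_measurable => // k _.
 have -> : [set t | `|f t 0 k - ratr (p.1 k)| < ratr p.2] =
  (fun t => `|f t 0 k - ratr (p.1 k)|) @^-1` `]-oo, (ratr p.2)[.
 by apply/seteqP;split => t /=;rewrite in_itv.
 rewrite -[X in measurable X]setTI.
 suff : mble (fun t => `|f t 0 k - ratr (p.1 k)|) by apply.
 by apply: mcomp => //;apply: measurable_funB => //;exact: mf.
(* [unpickle] enumerates the boxes; codes of nothing, and boxes that leave [U], contribute the empty
   set. *)
have -> : setT `&` f @^-1` U = \bigcup_n
 (if unpickle n is Some p then
  if `[< ratbox p `<=` U >] then f @^-1` (ratbox p) else set0 else set0).
 apply/seteqP;split => [t [_ /= Ut]|t [n _]].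
 have [p pt pU] := open_ratbox oU Ut.
 by exists (pickle p) => //=;rewrite pickleK;case: asboolP.
 by case: unpickle => // p;case: asboolP => // pU /pU.
apply: bigcupT_measurable => n;case: unpickle => // p.
by case: asboolP.
Qed.

Section operations.
Context {disp : measure_display} {T : measurableType disp} {d : nat}.
Implicit Types f g : T -> 'rV[R]_d.

Lemma mblef_coord f k : mble f ->
 mble (fun t => f t 0 k).
Proof. by move=> mf;apply: (mcomp (mble_coord k)). Qed.
Lemma mble_rVD f g : mble f -> mble g ->
 mble (fun t => f t + g t).
Proof.
move=> mf mg;apply: mblef_rV => k.
under eq_fun do rewrite mxE.
by apply: mbleD;exact: mblef_coord.
Qed.
Lemma mble_rVZ (a : T -> R) f : mble a ->
 mble f -> mble (fun t => a t *: f t).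
Proof.
move=> ma mf;apply: mblef_rV => k.
under eq_fun do rewrite mxE.
by apply: mbleM => //;exact: mblef_coord.
Qed.
Lemma mble_rVN f : mble f ->
 mble (fun t => - f t).
Proof.
move=> mf;under eq_fun do rewrite -scaleN1r.
by apply: mble_rVZ.
Qed.
Lemma mble_rVB f g : mble f -> mble g ->
 mble (fun t => f t - g t).
Proof. by move=> mf mg;apply: mble_rVD => //;exact: mble_rVN. Qed.
Lemma mble_rV_sum (I : Type) (r : seq I) (F : I -> T -> 'rV[R]_d) :
 (forall i, mble (F i)) ->
 mble (fun t => \sum_(i <- r) F i t).
Proof.
move=> mF;elim: r => [|i r IH].
 by under eq_fun do rewrite big_nil;exact: mble_cst.
by under eq_fun do rewrite big_cons;exact: mble_rVD.
Qed.
Lemma mblef_enorm f : mble f ->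
 mble (fun t => enorm (f t)).
Proof. exact: (mcomp (@mble_enorm d)). Qed.

End operations.

Lemma mblef_mktuple disp (T : measurableType disp) disp'
 (T' : measurableType disp') n (f : 'I_n -> T -> T') :
 (forall i, mble (f i)) ->
 mble (fun t => [tuple f i t | i < n]).
Proof.
move=> mf;apply/measurable_fun_tnthP => i.
by rewrite (_ : _ \o _ = f i)//;apply/funext => t /=;rewrite tnth_mktuple.
Qed.
Lemma mblef_tnth disp (T : measurableType disp) disp'
 (T' : measurableType disp') n (f : T -> n.-tuple T') i :
 mble f -> mble (fun t => tnth (f t) i).
Proof. by move=> mf;apply: (mcomp (mble_tnth i)). Qed.

(** The class [G] is left free because two are used: all Borel sets when laws are compared,
    half-lines when indicators are approximated by continuous functions. *)
Definition tbox (G : set (set R)) (n d : nat) : set (set (n.-tuple 'rV[R]_d)) :=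
 [set A | exists2 E : 'I_n -> 'I_d -> set R, (forall i k, G (E i k)) &
 A = [set x : n.-tuple 'rV[R]_d | forall i k, E i k (tnth x i 0 k)]].

Arguments tbox : clear implicits.

Lemma tboxI (G : set (set R)) n d : setI_closed G -> setI_closed (tbox G n d).
Proof.
move=> GI _ _ [E GE ->] [F GF ->].
exists (fun i k => E i k `&` F i k) => [i k|];first exact: GI.
apply/seteqP;split => [x [Ex Fx] i k|x H];first by split;[exact: Ex|exact: Fx].
by split => i k;have [] := H i k.
Qed.
(** [G setT] makes a constraint on a single coordinate a box, and these constraints already
    generate. *)
Lemma mble_tbox (G : set (set R)) n d :
 @measurable _ R = <<s G >> -> G setT ->
 @measurable _ (n.-tuple 'rV[R]_d) = <<s tbox G n d >>.
Proof.
move=> GE GT;apply/seteqP;split => A mA;last first.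
 apply: smallest_sub mA;first exact: sigma_algebra_measurable.
 move=> _ [E GEE ->].
 have -> : [set x : n.-tuple 'rV_d | forall i k, E i k (tnth x i 0 k)] =
  \bigcap_(i in [set: 'I_n]) \bigcap_(k in [set: 'I_d])
  [set x : n.-tuple 'rV[R]_d | E i k (tnth x i 0 k)].
 by apply/seteqP;split => x /= H i => [_ k _|k];apply: H.
 apply: fin_bigcap_measurable => // i _;apply: fin_bigcap_measurable => // k _.
 rewrite -[X in measurable X]setTI.
 suff : mble (fun x : n.-tuple 'rV[R]_d => tnth x i 0 k).
 by apply => //;rewrite GE;exact: sub_sigma_algebra.
 by apply: mblef_coord;exact: mble_tnth.
suff : mble
 (idfun : g_sigma_algebraType (tbox G n d) -> n.-tuple 'rV[R]_d).
 by move=> /(_ measurableT A mA);rewrite setTI.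
apply/measurable_fun_tnthP => i;apply: mblef_rV => k.
apply: (measurability _ GE) => _ [B GB <-];rewrite setTI.
apply: sub_sigma_algebra.
exists (fun i' k' => if (i' == i) && (k' == k) then B else setT).
 by move=> i' k';case: ifP.
apply/seteqP;split => x /= => [Bx i' k'|/(_ i k)];last by rewrite !eqxx.
by case: ifP => // /andP[/eqP-> /eqP->].
Qed.
Lemma tbox_unique n d (mu nu : probability (n.-tuple 'rV[R]_d) R) :
 (forall E : 'I_n -> 'I_d -> set R, (forall i k, measurable (E i k)) ->
 mu [set x : n.-tuple 'rV[R]_d | forall i k, E i k (tnth x i 0 k)] =
 nu [set x : n.-tuple 'rV[R]_d | forall i k, E i k (tnth x i 0 k)]) ->
 forall A, measurable A -> mu A = nu A.
Proof.
move=> H A mA;apply: (measure_unique (tbox measurable n d) (fun=> setT)) => //.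
- apply: mble_tbox => //.
 rewrite sigma_algebra_id//;exact: sigma_algebra_measurable.
- by apply: tboxI => B C;exact: measurableI.
- move=> _;exists (fun _ _ => setT) => //.
 by apply/seteqP;split.
- by apply/seteqP;split => // x _;exists 0%N.
- by move=> _ [E mE ->];exact: H.
- by move=> _;exact: fin_num_fun_lty.
Qed.

End BorelRows.

(** * Resolvents of strongly monotone maps *)

Section Resolvent.
Context {R : realType} {n : nat}.
Implicit Types (F : 'rV[R]_n -> 'rV[R]_n) (x y : 'rV[R]_n).

Lemma locally_lipschitz_cont F x : locally_lipschitz F -> forall e, 0 < e ->
 exists2 r, 0 < r & forall y, enorm (y - x) < r -> enorm (F y - F x) < e.
Proof.
move=> lF e e0;have [L LF] := lF (enorm x + 1).
have L1 : 0 < Num.max L 1 by rewrite lt_max ltr01 orbT.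
exists (Num.min 1 (e / Num.max L 1));first by rewrite lt_min ltr01 divr_gt0.
move=> y;rewrite lt_min => /andP[yx1 yxe].
have yx : enorm y <= enorm x + 1.
 by have := enorm_dist_abs y x;rewrite ler_norml;lra.
rewrite (le_lt_trans (LF _ _ yx _))//;first by rewrite lerDl.
rewrite (@le_lt_trans _ _ (Num.max L 1 * enorm (y - x)))//.
 by rewrite ler_wpM2r ?enorm_ge0// le_max lexx.
by rewrite mulrC -ltr_pdivlMr.
Qed.
Lemma compact_enorm_ball r : compact [set x : 'rV[R]_n | enorm x <= r].
Proof.
apply: bounded_closed_compact.
 exists r;split;first exact: num_real.
 move=> M rM x /= xr;rewrite (le_trans (mx_le_enorm _))//.
 by rewrite (le_trans xr)// ltW.
have -> : [set x : 'rV[R]_n | enorm x <= r] = (@enorm R n) @^-1` [set z | z <= r].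
 by [].
apply: closed_comp;last exact: closed_le.
move=> x _;apply: enorm_cont_at => e e0.
by exists e => // y;apply: le_lt_trans;exact: enorm_dist_abs.
Qed.

(* On a large ball, x - eps (F x - y) is a contraction for the Euclidean
 distance;a minimizer of the displacement over the ball is its fixed point. *)
Lemma strongly_monotone_surj F y : strongly_monotone 1 F ->
 locally_lipschitz F -> exists x, F x = y.
Proof.
(* With this radius [|G 0| <= eps * r / 2], which is exactly what the contraction factor
   [1 - eps / 2] leaves for the ball to be stable under [G]. *)
move=> mF lF;pose r := 2 * enorm (F 0 - y) + 1.
have r0 : 0 < r by rewrite ltr_wpDl ?mulr_ge0 ?enorm_ge0.
have [L0 LF0] := lF r;pose L := Num.max L0 1.
have L1 : 1 <= L by rewrite le_max lexx orbT.
have LF x z : enorm x <= r -> enorm z <= r ->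
 enorm (F x - F z) <= L * enorm (x - z).
 move=> xr zr;apply: (le_trans (LF0 _ _ xr zr)).
 by rewrite ler_wpM2r ?enorm_ge0// le_max lexx.
(* The quadratic term [eps^2 L^2 |x - z|^2] is then [eps |x - z|^2], half of the gain
   [2 eps |x - z|^2] given by monotonicity. *)
pose eps := (L ^+ 2)^-1.
have L20 : 0 < L ^+ 2 by rewrite exprn_gt0// (lt_le_trans ltr01).
have eps0 : 0 < eps by rewrite invr_gt0.
have eps1 : eps <= 1 by rewrite invf_le1// -(expr1n _ 2) lerXn2r ?nnegrE// ltW// (lt_le_trans ltr01).
pose G x := x - eps *: (F x - y).
have GG x z : enorm x <= r -> enorm z <= r ->
 enorm (G x - G z) <= (1 - eps / 2) * enorm (x - z).
 move=> xr zr;rewrite -(@ler_pXn2r _ 2%N) ?nnegrE ?enorm_ge0//;last first.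
 by rewrite mulr_ge0 ?enorm_ge0//;lra.
 have -> : G x - G z = (x - z) - eps *: (F x - F z).
 by apply/rowP => k;rewrite !mxE;ring.
 rewrite enorm_sqrB dotpZr enormZ (gtr0_norm eps0) exprMn.
 rewrite (dotpC (x - z) (F x - F z)).
 have H1 : enorm (F x - F z) ^+ 2 <= L ^+ 2 * enorm (x - z) ^+ 2.
 rewrite -exprMn lerXn2r ?nnegrE ?enorm_ge0 ?mulr_ge0 ?enorm_ge0//;last exact: LF.
 by rewrite (le_trans ler01).
 have H1' : eps * enorm (F x - F z) ^+ 2 <= enorm (x - z) ^+ 2.
 by rewrite mulrC ler_pdivrMr// mulrC.
 have H2 := mF x z;rewrite mul1r in H2.
 set a := enorm (x - z) ^+ 2 in H1' H2 *.
 set b := dotp _ _ in H2 *.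
 have Ha : 0 <= a by rewrite sqr_ge0.
 have H3 : eps * (eps * enorm (F x - F z) ^+ 2) <= eps * a by rewrite ler_pM2l.
 have H4 : eps * a <= eps * b by rewrite ler_pM2l.
 have -> : ((1 - eps / 2) * enorm (x - z)) ^+ 2 = a - eps * a + eps ^+ 2 / 4 * a.
 by rewrite exprMn -/a;field.
 have H5 : 0 <= eps ^+ 2 / 4 * a by rewrite mulr_ge0// divr_ge0// sqr_ge0.
 lra.
have z0r : enorm (0 : 'rV[R]_n) <= r by rewrite enorm0 ltW.
have GB x : enorm x <= r -> enorm (G x) <= r.
 move=> xr;rewrite -[G x](subrK (G 0)) (le_trans (enormD _ _))//.
 have H0 : enorm (G 0) <= eps * (r / 2).
 rewrite /G sub0r enormN enormZ gtr0_norm// ler_pM2l// /r;lra.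
 have := GG _ _ xr z0r;rewrite subr0 => H1.
 have H2 : (1 - eps / 2) * enorm x <= (1 - eps / 2) * r.
 by rewrite ler_wpM2l//;lra.
 by have := H0;have := H1;have := H2;rewrite mulrBl mul1r;lra.
have [|||c] := @EVT_min_rV _ _ (fun x => enorm (F x - y))
 [set x : 'rV[R]_n | enorm x <= r].
- by exists 0;rewrite /= enorm0 ltW.
- exact: compact_enorm_ball.
- apply: continuous_subspaceT => x;apply: enorm_cont_at => e e0.
 have [s s0 Hs] := locally_lipschitz_cont x lF e0.
 exists s => // z /Hs;apply: le_lt_trans.
 rewrite (le_trans (enorm_dist_abs _ _))//.
 by rewrite opprB addrA subrK.
rewrite inE /= => cr cmin;exists c;apply/eqP;rewrite -subr_eq0;apply/eqP.
apply: enorm_eq0;apply/eqP;rewrite eq_le enorm_ge0 andbT.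
have Gcr := GB _ cr.
have := cmin (G c);rewrite inE /= => /(_ Gcr) H1.
have := GG _ _ Gcr cr.
have E x : G x - x = - (eps *: (F x - y)) by rewrite /G addrC addKr.
rewrite !E !enormN !enormZ (gtr0_norm eps0) mulrCA ler_pM2l// => H2.
set a := enorm (F c - y) in H1 H2 *.
have := eps0;have a0 : 0 <= a := enorm_ge0 _;nra.
Qed.

(** The inverse of [F], made total by the junk value [0]; under the hypotheses of [resolventK] a
    preimage always exists. *)
Definition resolvent F y := xget 0 [set x | F x = y].

Lemma resolventK F y : strongly_monotone 1 F -> locally_lipschitz F ->
 F (resolvent F y) = y.
Proof.
move=> mF lF;have [x Fx] := strongly_monotone_surj y mF lF.
exact: (@xgetPex _ 0 [set x | F x = y] (ex_intro _ x Fx)).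
Qed.
Lemma strongly_monotone_expand F x y : strongly_monotone 1 F ->
 enorm (x - y) <= enorm (F x - F y).
Proof.
move=> mF;have := le_trans (mF x y) (dotp_le _ _).
rewrite mul1r expr2;have [->|xy0] := eqVneq (enorm (x - y)) 0.
 by rewrite enorm_ge0.
by rewrite ler_pM2r// lt_def xy0 enorm_ge0.
Qed.
Lemma resolvent_nonexpansive F y z :
 strongly_monotone 1 F -> locally_lipschitz F ->
 enorm (resolvent F y - resolvent F z) <= enorm (y - z).
Proof.
move=> mF lF;apply: (le_trans (strongly_monotone_expand _ _ mF)).
by rewrite !resolventK.
Qed.
Lemma mble_resolvent F :
 strongly_monotone 1 F -> locally_lipschitz F ->
 mble (resolvent F).
Proof.
move=> mF lF;apply: mblef_rV => k.
apply: continuous_measurable_rV => x;apply: enorm_cont_at => e e0.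
exists e => // y;apply: le_lt_trans.
rewrite (le_trans _ (resolvent_nonexpansive y x mF lF))//.
by rewrite (le_trans _ (coord_le_enorm _ k))// !mxE.
Qed.

End Resolvent.

(** * Resolvents on configurations of N particles *)

Section TupleResolvent.
Context {R : realType} {N d : nat}.
Local Notation state := (conf N R d).
Implicit Types (x y : state).

(** An isometry between configurations, with the sum of squared norms, and rows of length [N * d]:
    the implicit equation of the whole system becomes one resolvent on rows. *)
Definition flat x : 'rV[R]_(N * d) := mxvec (\matrix_(i, k) tnth x i 0 k).

Definition unflat (v : 'rV[R]_(N * d)) : state := [tuple row i (vec_mx v) | i < N].

Lemma tnth_unflat v i k : tnth (unflat v) i 0 k = v 0 (mxvec_index i k).
Proof. by rewrite tnth_mktuple !mxE. Qed.
Lemma flatE x i k : flat x 0 (mxvec_index i k) = tnth x i 0 k.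
Proof. by rewrite /flat mxvecE mxE. Qed.
Lemma unflatK v : flat (unflat v) = v.
Proof.
by apply/rowP => j;case/mxvec_indexP: j => i k;rewrite flatE tnth_unflat.
Qed.
Lemma flatK x : unflat (flat x) = x.
Proof.
apply: eq_from_tnth => i;apply/rowP => k.
by rewrite tnth_unflat flatE.
Qed.

Definition tdotp (f g : 'I_N -> 'rV[R]_d) : R := \sum_(i < N) dotp (f i) (g i).

Lemma dotp_unflat (v w : 'rV[R]_(N * d)) :
 dotp v w = tdotp (fun i => row i (vec_mx v)) (fun i => row i (vec_mx w)).
Proof.
rewrite /dotp (reindex _ (curry_mxvec_bij _ _)) /=.
rewrite /tdotp pair_bigA /=;apply: eq_bigr => -[i k] _ /=.
by rewrite !mxE.
Qed.
Lemma dotp_unflatB (v w v' w' : 'rV[R]_(N * d)) :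
 dotp (v - w) (v' - w') = \sum_(i < N) dotp (tnth (unflat v) i - tnth (unflat w) i)
 (tnth (unflat v') i - tnth (unflat w') i).
Proof.
rewrite dotp_unflat;apply: eq_bigr => i _.
by rewrite !tnth_mktuple !linearB.
Qed.

Variable A : state -> 'I_N -> 'rV[R]_d.

Definition flat_op (v : 'rV[R]_(N * d)) := flat [tuple A (unflat v) i | i < N].

Definition tresolvent y : state := unflat (resolvent flat_op (flat y)).

Hypothesis mA : forall x y, \sum_(i < N) enorm (tnth x i - tnth y i) ^+ 2 <=
 \sum_(i < N) dotp (A x i - A y i) (tnth x i - tnth y i).

Hypothesis lA : forall r : R, exists L : R, forall x y,
 (forall i, enorm (tnth x i) <= r) -> (forall i, enorm (tnth y i) <= r) ->
 forall i, enorm (A x i - A y i) <= L * \sum_(j < N) enorm (tnth x j - tnth y j).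

Lemma flat_op_monotone : strongly_monotone 1 flat_op.
Proof.
move=> v w;rewrite mul1r enorm_sqr !dotp_unflatB.
under eq_bigr do rewrite -enorm_sqr.
apply: (le_trans (mA _ _));apply: ler_sum => i _.
by rewrite /flat_op !flatK !tnth_mktuple.
Qed.
Lemma tnth_le_enorm v i : enorm (tnth (unflat v) i) <= enorm v.
Proof.
rewrite -(@ler_pXn2r _ 2%N) ?nnegrE ?enorm_ge0// !enorm_sqr dotp_unflat.
rewrite tnth_mktuple /tdotp (bigD1 i)//= lerDl.
by apply: sumr_ge0 => j _;exact: dotp_ge0.
Qed.
Lemma unflatB_le v w i : enorm (tnth (unflat v) i - tnth (unflat w) i) <= enorm (v - w).
Proof.
rewrite (le_trans _ (tnth_le_enorm (v - w) i))// !tnth_mktuple.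
by rewrite !linearB.
Qed.
Lemma flat_op_lipschitz : locally_lipschitz flat_op.
Proof.
move=> r;have [L LA] := lA r;exists (N%:R * (`|L| * N%:R)) => v w vr wr.
have H i : enorm (A (unflat v) i - A (unflat w) i) <= `|L| * N%:R * enorm (v - w).
 have := LA (unflat v) (unflat w) (fun i => le_trans (tnth_le_enorm v i) vr)
 (fun i => le_trans (tnth_le_enorm w i) wr) i.
 move=> /le_trans;apply;rewrite -mulrA.
 apply: (letr (`|L| * \sum_(j < N) enorm (tnth (unflat v) j - tnth (unflat w) j))).
 by rewrite ler_wpM2r ?ler_norm// sumr_ge0// => j _;exact: enorm_ge0.
 rewrite ler_wpM2l//.
 apply: (letr (\sum_(j < N) enorm (v - w))).
 by apply: ler_sum => j _;exact: unflatB_le.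
 by rewrite sumr_const card_ord mulr_natl.
rewrite -(@ler_pXn2r _ 2%N) ?nnegrE ?enorm_ge0 ?mulr_ge0 ?enorm_ge0//.
rewrite enorm_sqr dotp_unflatB /flat_op !flatK.
under eq_bigr do rewrite !tnth_mktuple -enorm_sqr.
set e := enorm (v - w) in H *.
apply: (letr (\sum_(i < N) (`|L| * N%:R * e) ^+ 2)).
 apply: ler_sum => i _;rewrite lerXn2r ?nnegrE ?enorm_ge0//.
 by rewrite !mulr_ge0 ?enorm_ge0.
rewrite sumr_const card_ord -[leLHS]mulr_natl -(mulrA N%:R) [leRHS]exprMn.
rewrite ler_wpM2r ?sqr_ge0//.
by rewrite -natrX ler_nat;case: (N) => // m;rewrite expnS expn1 leq_pmulr.
Qed.
Lemma tresolventK y i : A (tresolvent y) i = tnth y i.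
Proof.
have := resolventK (flat y) flat_op_monotone flat_op_lipschitz.
rewrite /tresolvent /flat_op => /(congr1 unflat).
by rewrite !flatK => /(congr1 (@tnth _ _ ^~ i));rewrite tnth_mktuple.
Qed.
Lemma mble_flat : mble flat.
Proof.
apply: mblef_rV => j;case/mxvec_indexP: j => i k.
under eq_fun do rewrite flatE.
by apply: mblef_coord;exact: mble_tnth.
Qed.
Lemma mble_unflat : mble unflat.
Proof.
apply: mblef_mktuple => i;apply: mblef_rV => k.
under eq_fun do rewrite !mxE.
exact: mble_coord.
Qed.
Lemma mble_tresolvent : mble tresolvent.
Proof.
apply: (mcomp mble_unflat).
apply: (mcomp _ mble_flat).
by apply: mble_resolvent;
 [exact: flat_op_monotone|exact: flat_op_lipschitz].
Qed.

End TupleResolvent.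

Ltac msolve :=
 repeat first
 [ assumption | exact: mble_cst | exact: measurable_id
 | apply: mbleD | apply: measurable_funB | apply: mbleM
 | apply: mbleX | apply: mblef_enorm | apply: mblef_coord
 | apply: mble_rVD | apply: mble_rVB | apply: mble_rVN
 | apply: mble_rVZ | apply: mble_rV_sum;intro
 | apply: mble_sum;intro | apply: mble_tnth | apply: mblef_tnth
 | apply: mble_fst | apply: mble_snd
 | (apply: mcomp;first exact: measurable_expR)
 | (apply: mcomp;first exact: mble_fst)
 | (apply: mcomp;first exact: mble_snd)
 | apply: mble_pair].

(** * Expectations, pushforwards and products *)

Section Expectation.
Context {R : realType} {disp : measure_display} {T : measurableType disp}.
Implicit Types (P : {measure set T -> \bar R}) (f g : T -> R).
Local Open Scope ereal_scope.

(** Extended-valued and applied to nonnegative functions, so that additivity and monotonicity hold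
    without integrability conditions. Inequalities with signed terms are rearranged below until both
    sides are nonnegative. *)
Definition ex P f : \bar R := \int[P]_x (f x)%:E.

Lemma ex_ge0 P f : (forall x, (0 <= f x)%R) -> 0 <= ex P f.
Proof. by move=> f0;apply: integral_ge0 => x _;rewrite lee_fin. Qed.
Lemma ex_le P f g : mble f -> mble g ->
 (forall x, (0 <= f x)%R) -> (forall x, (f x <= g x)%R) -> ex P f <= ex P g.
Proof.
move=> mf mg f0 fg;apply: ge0_le_integral => //.
- by move=> x _;rewrite lee_fin.
- exact/mbleEFin.
- exact/mbleEFin.
- by move=> x _;rewrite lee_fin.
Qed.
Lemma eq_ex P f g : f =1 g -> ex P f = ex P g.
Proof. by move=> /funext ->. Qed.
Lemma exD P f g : mble f -> mble g ->
 (forall x, (0 <= f x)%R) -> (forall x, (0 <= g x)%R) ->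
 ex P (fun x => f x + g x)%R = ex P f + ex P g.
Proof.
move=> mf mg f0 g0;rewrite /ex;under eq_integral do rewrite EFinD.
rewrite ge0_integralD//.
- by move=> x _;rewrite lee_fin.
- exact/mbleEFin.
- by move=> x _;rewrite lee_fin.
- exact/mbleEFin.
Qed.
Lemma exZ P f (a : R) : mble f -> (forall x, (0 <= f x)%R) ->
 (0 <= a)%R -> ex P (fun x => a * f x)%R = a%:E * ex P f.
Proof.
move=> mf f0 a0;rewrite /ex;under eq_integral do rewrite EFinM.
rewrite ge0_integralZl_EFin//.
- by move=> x _;rewrite lee_fin.
- exact/mbleEFin.
Qed.
Lemma ex_sum P (I : Type) (r : seq I) (F : I -> T -> R) :
 (forall i, mble (F i)) -> (forall i x, (0 <= F i x)%R) ->
 ex P (fun x => \sum_(i <- r) F i x)%R = \sum_(i <- r) ex P (F i).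
Proof.
move=> mF F0;rewrite /ex;under eq_integral do rewrite -sumEFin.
rewrite ge0_integral_sum//.
- by move=> i;exact/mbleEFin.
- by move=> i x _;rewrite lee_fin.
Qed.
Lemma ex_cst (P : probability T R) (a : R) : ex P (fun=> a) = a%:E.
Proof. by rewrite /ex integral_cst//= probability_setT mule1. Qed.
Lemma ex_bounded (P : probability T R) f (b : R) : mble f ->
 (forall x, (0 <= f x)%R) -> (forall x, (f x <= b)%R) -> ex P f <= b%:E.
Proof. by move=> mf f0 fb;rewrite -(ex_cst P);exact: ex_le. Qed.
Lemma ex_fin_num (P : probability T R) f (b : R) : mble f ->
 (forall x, (0 <= f x)%R) -> (forall x, (f x <= b)%R) -> ex P f \is a fin_num.
Proof.
move=> mf f0 fb;rewrite ge0_fin_numE ?ex_ge0//.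
by rewrite (le_lt_trans (ex_bounded P mf f0 fb))// ltry.
Qed.
Lemma ex_integrable P f : mble f -> (forall x, (0 <= f x)%R) ->
 ex P f < +oo -> P.-integrable setT (EFin \o f).
Proof.
move=> mf f0 foo;apply/integrableP;split;first exact/mbleEFin.
by under eq_integral do rewrite /= ger0_norm//.
Qed.
Lemma eq_measure_ex (P Q : {measure set T -> \bar R}) f :
 (forall A, measurable A -> P A = Q A) -> ex P f = ex Q f.
Proof. by move=> PQ;apply: eq_measure_integral => A mA _;exact: PQ. Qed.

End Expectation.

Section Pushforward.
Context {R : realType} {d1 d2 : measure_display}.
Context {T1 : measurableType d1} {T2 : measurableType d2}.

Definition push (P : probability T1 R) (f : T1 -> T2)
 (mf : mble f) : probability T2 R :=
 let X : {mfun T1 >-> T2} := HB.pack f (isMeasurableFun.Build _ _ _ _ f mf) in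
 distribution P X.

Lemma pushE P f mf A : @push P f mf A = P (f @^-1` A).
Proof. by []. Qed.
Lemma ex_push P f mf (g : T2 -> R) : mble g ->
 (forall x, 0 <= g x) -> ex (@push P f mf) g = ex P (g \o f).
Proof.
move=> mg g0;rewrite /ex /push ge0_integral_distribution//.
exact/mbleEFin.
Qed.
Lemma ex_prod (P : probability T1 R) (Q : probability T2 R) (g : T1 * T2 -> R) :
 mble g -> (forall x, 0 <= g x) ->
 ex (P \x Q)%E g = (\int[P]_x \int[Q]_y (g (x, y))%:E)%E.
Proof.
move=> mg g0;rewrite /ex fubini_tonelli1//;first exact/mbleEFin.
Qed.
Lemma ex_prodC (P : probability T1 R) (Q : probability T2 R) (g : T1 * T2 -> R) :
 mble g -> (forall x, 0 <= g x) ->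
 ex (P \x Q)%E g = (\int[Q]_y \int[P]_x (g (x, y))%:E)%E.
Proof.
move=> mg g0;rewrite /ex fubini_tonelli2//;first exact/mbleEFin.
Qed.
Lemma mble_ex2 (Q : probability T2 R) (g : T1 * T2 -> R) :
 mble g -> (forall x, 0 <= g x) ->
 mble (fun x => ex Q (fun y => g (x, y))).
Proof.
move=> mg g0;apply: (@measurable_fun_fubini_tonelli_F _ _ _ _ _ Q (EFin \o g)) => //.
exact/mbleEFin.
Qed.
Lemma mble_ex1 (P : probability T1 R) (g : T1 * T2 -> R) :
 mble g -> (forall x, 0 <= g x) ->
 mble (fun y => ex P (fun x => g (x, y))).
Proof.
move=> mg g0;apply: (@measurable_fun_fubini_tonelli_G _ _ _ _ _ P (EFin \o g)) => //.
exact/mbleEFin.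
Qed.

End Pushforward.

Section Iid.
Context {R : realType} {disp : measure_display} {T : measurableType disp}.
Local Open Scope ereal_scope.

Lemma ex_iidS (mu : probability T R) n (g : n.+1.-tuple T -> R) :
 mble g -> (forall x, (0 <= g x)%R) ->
 ex (iid mu n.+1) g = \int[mu]_a \int[iid mu n]_s (g [tuple of a :: s])%:E.
Proof.
move=> mg g0;rewrite /ex /= ge0_integral_distribution//;last first.
 exact/mbleEFin.
rewrite fubini_tonelli1//.
 by apply: mcomp;[exact/mbleEFin|exact: measurable_consT].
by move=> x /=;rewrite lee_fin.
Qed.
Lemma ex_iidSC (mu : probability T R) n (g : n.+1.-tuple T -> R) :
 mble g -> (forall x, (0 <= g x)%R) ->
 ex (iid mu n.+1) g = \int[iid mu n]_s \int[mu]_a (g [tuple of a :: s])%:E.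
Proof.
move=> mg g0;rewrite /ex /= ge0_integral_distribution//;last first.
 exact/mbleEFin.
rewrite fubini_tonelli2//.
 by apply: mcomp;[exact/mbleEFin|exact: measurable_consT].
by move=> x /=;rewrite lee_fin.
Qed.
Lemma ex_iid_coord (mu : probability T R) n (i : 'I_n) (g : T -> R) :
 mble g -> (forall x, (0 <= g x)%R) ->
 ex (iid mu n) (fun x => g (tnth x i)) = ex mu g.
Proof.
move=> mg g0;elim: n i => [[]//|n IH i].
have m1 : mble (fun x : n.+1.-tuple T => g (tnth x i)).
 by apply: mcomp => //;exact: mble_tnth.
case: (unliftP ord0 i) m1 => [j ->|->] m1.
 rewrite ex_iidSC//;rewrite -(IH j);apply: eq_integral => s _.
 by rewrite -[RHS](ex_cst mu);apply: eq_integral => a _;rewrite tnthS.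
rewrite ex_iidS//;apply: eq_integral => a _.
by rewrite -[RHS](ex_cst (iid mu n)).
Qed.

End Iid.

Section IidPush.
Context {R : realType} {d1 d2 d3 : measure_display}.
Context {T1 : measurableType d1} {T2 : measurableType d2} {T3 : measurableType d3}.
Variables (mu : probability T1 R) (ga : probability T2 R) (f : T1 * T2 -> T3).
Hypothesis mf : mble f.
Local Open Scope ereal_scope.

Definition tmap n (x : n.-tuple T1 * n.-tuple T2) : n.-tuple T3 :=
 [tuple f (tnth x.1 i, tnth x.2 i) | i < n].

Lemma mble_tmap n : mble (@tmap n).
Proof.
apply: mblef_mktuple => i;apply: mcomp => //.
apply: mble_pair.
 by apply: mblef_tnth;exact: mble_fst.
by apply: mblef_tnth;exact: mble_snd.
Qed.
Lemma tmap_cons n a b (s : n.-tuple T1) (t : n.-tuple T2) :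
 tmap ([tuple of a :: s], [tuple of b :: t]) = [tuple of f (a, b) :: tmap (s, t)].
Proof.
apply: eq_from_tnth => i;rewrite tnth_mktuple /=.
by case: (unliftP ord0 i) => [j ->|->];rewrite ?tnthS ?tnth_mktuple//.
Qed.
(** Peeling off the head gives the integrals in the order: head position, head noise, other
    positions, other noises. The induction is the Tonelli exchange of the two middle ones. *)
Lemma integral_iid_push n (g : n.-tuple T3 -> \bar R) : mble g ->
 (forall x, 0 <= g x) ->
 \int[iid (push (mu \x ga) mf) n]_z g z =
 \int[iid mu n]_x \int[iid ga n]_y g (tmap (x, y)).
Proof.
elim: n g => [|n IH] g mg g0.
 have -> : g = cst (g [tuple]) by apply/funext => x;rewrite tuple0.
 under [RHS]eq_integral do rewrite integral_cst//= probability_setT mule1.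
 by rewrite !integral_cst//= !probability_setT !mule1.
have mgc : mble (fun x : T3 * n.-tuple T3 => g [tuple of x.1 :: x.2]).
 by apply: (mcomp mg);exact: measurable_consT.
rewrite /= ge0_integral_distribution// fubini_tonelli1//;last by move=> ?;exact: g0.
under eq_integral => a _.
 rewrite /fubini_F /= IH;[over| |by move=> ?;exact: g0].
 by apply: (mcomp mgc);apply: mble_pair.
have mk : mble (fun x : ((T1 * T2) * n.-tuple T1) * n.-tuple T2 =>
 g [tuple of f x.1.1 :: tmap (x.1.2, x.2)]).
 apply: (mcomp mg);apply: measurable_cons.
 by apply: (mcomp mf);apply: mcomp.
 apply: (mcomp (@mble_tmap n));apply: mble_pair => //.
 exact: mcomp.
have mk1 := @measurable_fun_fubini_tonelli_F _ _ _ _ _ (iid ga n) _ mk (fun=> g0 _).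
have mk2 := @measurable_fun_fubini_tonelli_F _ _ _ _ _ (iid mu n) _ mk1
 (fun x => integral_ge0 _ (fun y _ => g0 _)).
have mg' : mble (fun x : (T3 * n.-tuple T1) * n.-tuple T2 =>
 g [tuple of x.1.1 :: tmap (x.1.2, x.2)]).
 apply: (mcomp mg);apply: measurable_cons;first exact: mcomp.
 apply: (mcomp (@mble_tmap n));apply: mble_pair => //.
 exact: mcomp.
have mg1 := @measurable_fun_fubini_tonelli_F _ _ _ _ _ (iid ga n) _ mg' (fun=> g0 _).
have mg2 := @measurable_fun_fubini_tonelli_F _ _ _ _ _ (iid mu n) _ mg1
 (fun x => integral_ge0 _ (fun y _ => g0 _)).
rewrite ge0_integral_distribution//;last first.
 by move=> y;apply: integral_ge0 => ? _;apply: integral_ge0.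
rewrite fubini_tonelli1//;last first.
 by move=> y;apply: integral_ge0 => ? _;apply: integral_ge0.
have mgt : mble (g \o @tmap n.+1).
 by apply: (mcomp mg);exact: mble_tmap.
have mgt1 := @measurable_fun_fubini_tonelli_F _ _ _ _ _ (iid ga n.+1) _ mgt (fun=> g0 _).
rewrite ge0_integral_distribution//;last by move=> y;exact: integral_ge0.
rewrite fubini_tonelli1;last 2 first.
- by apply: (mcomp mgt1);exact: measurable_consT.
- by move=> y;exact: integral_ge0.
apply: eq_integral => u _;rewrite /fubini_F /=.
have ms : mble (fun z : (T2 * n.-tuple T1) * n.-tuple T2 =>
 g [tuple of f (u, z.1.1) :: tmap (z.1.2, z.2)]).
 have mz : mble (fun z : (T2 * n.-tuple T1) * n.-tuple T2 =>
  (((u, z.1.1), z.1.2), z.2)).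
 apply: mble_pair => //;apply: mble_pair.
  by apply: mble_pair => //;exact: mcomp.
 exact: mcomp.
 exact: (mcomp mk mz).
have ms1 := @measurable_fun_fubini_tonelli_F _ _ _ _ _ (iid ga n) _ ms (fun=> g0 _).
rewrite (@fubini_tonelli _ _ _ _ _ ga (iid mu n) (fun z => \int[iid ga n]_y
 g [tuple of f (u, z.1) :: tmap (z.2, y)])) /=;last 2 first.
- exact: ms1.
- by move=> y;exact: integral_ge0.
apply: eq_integral => x _.
have mux : mble (fun y => g (tmap (consT (u, x), y))).
 have my : mble (fun y : n.+1.-tuple T2 => (consT (u, x), y)).
 exact: mble_pair.
 exact: (mcomp mgt my).
rewrite ge0_integral_distribution// fubini_tonelli1;last 2 first.
- by apply: (mcomp mux);exact: measurable_consT.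
- by move=> y;exact: g0.
apply: eq_integral => v _;apply: eq_integral => y _.
by rewrite /= tmap_cons.
Qed.

End IidPush.

(** * Integration against a density *)

Section Density.
Context {R : realType} {disp : measure_display} {T : measurableType disp}.
Variables (mu m : {measure set T -> \bar R}) (w : T -> R).
Hypothesis mw : mble w.
Hypothesis w0 : forall x, 0 <= w x.
Hypothesis mE : forall A, measurable A -> m A = (\int[mu]_(x in A) (w x)%:E)%E.
Import HBNNSimple.
Local Open Scope ereal_scope.

Let integral_density_nnsfun (h : {nnsfun T >-> R}) :
 \int[m]_x (h x)%:E = \int[mu]_x (h x * w x)%:E.
Proof.
under [LHS]eq_integral do rewrite fimfunE -fsumEFin//.
rewrite [LHS]ge0_integral_fsum//;last 2 first.
 - by move=> r;exact/mbleEFin/mcomp.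
 - by move=> n x _;rewrite EFinM nnfun_muleindic_ge0.
under [RHS]eq_integral.
 move=> x _;rewrite EFinM fimfunE -fsumEFin// muleC ge0_mule_fsumr;last first.
 by move=> r;rewrite EFinM nnfun_muleindic_ge0.
 over.
rewrite [RHS]ge0_integral_fsum//;last 2 first.
 - move=> r;apply: emeasurable_funM;first exact/mbleEFin.
 exact/mbleEFin/mcomp.
 - by move=> n x _;rewrite mule_ge0 ?lee_fin// -lee_fin EFinM nnfun_muleindic_ge0.
apply: eq_fsbigr => r _;rewrite integralZl_indic_nnsfun//=. rewrite integral_indic// setIT.
rewrite mE//.
have [r0|r0] := leP 0%R r;last first.
 have -> : h @^-1` [set r] = set0.
 by rewrite -subset0 => x /= hx;have : (0 <= h x)%R by [];rewrite hx leNgt r0.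
 rewrite integral_set0 mule0 integral0_eq// => x _.
 by rewrite indic0 mulr0 mule0.
rewrite -ge0_integralZl//.
- rewrite [LHS]integral_mkcond;apply: eq_integral => x _.
 rewrite patchE indicE;case: ifPn => _;first by rewrite mulr1 muleC.
 by rewrite mulr0 mule0.
- exact/mbleEFin/measurable_funTS.
- by move=> x _;rewrite lee_fin.
Qed.
Lemma ex_density (f : T -> R) : mble f -> (forall x, (0 <= f x)%R) ->
 ex m f = ex mu (fun x => f x * w x)%R.
Proof.
move=> mf f0;have mf' : mble (EFin \o f) by exact/mbleEFin.
pose f_ := nnsfun_approx measurableT mf'.
have cf x : (f_ n x)%:E @[n --> \oo] --> (f x)%:E.
 by apply: cvg_nnsfun_approx => // y _;rewrite lee_fin.
rewrite /ex;transitivity (lim (\int[m]_x (f_ n x)%:E @[n --> \oo])).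
 rewrite -monotone_convergence//=.
 - by apply: eq_integral => x _;apply/esym/cvg_lim.
 - by move=> n;exact/mbleEFin/measurable_funTS.
 - by move=> n ? _;rewrite lee_fin.
 - by move=> ? _ ? ? mn;rewrite lee_fin;exact/lefP/nd_nnsfun_approx.
transitivity (lim (\int[mu]_x (f_ n x * w x)%:E @[n --> \oo])).
 by apply: congr_lim;apply/funext => n;exact: integral_density_nnsfun.
rewrite -monotone_convergence//=.
- apply: eq_integral => x _;apply/cvg_lim => //.
 under eq_fun do rewrite EFinM muleC;rewrite EFinM muleC.
 by apply: cvgeZl => //.
- by move=> n;apply/mbleEFin;apply: mbleM => //;exact: measurable_funTS.
- by move=> n ? _;rewrite lee_fin mulr_ge0.
- by move=> x _ ? ? mn;rewrite lee_fin ler_wpM2r//;exact/lefP/nd_nnsfun_approx.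
Qed.

End Density.

(** * The dual form of entropy and its tensorization *)

Section EntropicDomination.
Context {R : realType}.
Local Open Scope ereal_scope.

(* The dual form of "the law of p under rho has relative entropy at most c with
 respect to nu" (Donsker-Varadhan), with log-Laplace transforms bounded by a. *)
Definition DVle {d1 d2} {S : measurableType d1} {E : measurableType d2}
 (rho : probability S R) (p : S -> E) (nu : probability E R) (c : R) : Prop :=
 forall phi : E -> R, mble phi -> (forall x, (0 <= phi x)%R) ->
 (exists M, forall x, (phi x <= M)%R) ->
 forall a : R, ex nu (fun x => expR (phi x)) <= (expR a)%:E ->
 ex rho (phi \o p) <= (c + a)%:E.

Lemma mble_funexpR {d} {T : measurableType d} (f : T -> R) :
 mble f -> mble (fun x => expR (f x)).
Proof. by move=> mf;apply: (mcomp (@measurable_expR R)). Qed.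
(** The chain rule of entropy in dual form: the log-Laplace transform of [phi (e, _)] in the noise
    variable is itself an admissible test function of the state [e]. The conditional cost [k] is
    averaged under [rho], the law of the tilted system, as in Girsanov's theorem. *)
Lemma DVle_prod {d1 d2 d3} {S : measurableType d1} {E : measurableType d2}
 {G : measurableType d3} (rho : probability S R) (p : S -> E)
 (nu : probability E R) (ga : probability G R) (q : S * G -> G) (k : S -> R)
 (c K : R) :
 mble p -> mble q -> mble k ->
 (forall s, (0 <= k s)%R) -> ex rho k <= K%:E ->
 DVle rho p nu c -> (forall s, DVle ga (fun g => q (s, g)) ga (k s)) ->
 DVle (rho \x ga) (fun sg => (p sg.1, q sg)) (nu \x ga) (c + K).
Proof.
move=> mp mq mk k0 kK Hp Hq phi mphi phi0 [M phiM] a.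
have mephi : mble (fun x => expR (phi x)) by exact: mble_funexpR.
rewrite ex_prod//= => Ha.
pose Z e := fine (ex ga (fun g => expR (phi (e, g)))).
have mphie e : mble (fun g => phi (e, g)).
 by apply: (mcomp mphi);exact: mble_pair.
have Zfin e : ex ga (fun g => expR (phi (e, g))) \is a fin_num.
 apply: (@ex_fin_num _ _ _ _ _ (expR M)) => [|g|g];rewrite ?expR_ge0 ?ler_expR//.
 exact: mble_funexpR.
have ZE e : (Z e)%:E = ex ga (fun g => expR (phi (e, g))) by rewrite /Z fineK.
have Z1 e : (1 <= Z e)%R.
 rewrite -lee_fin ZE -(ex_cst ga);apply: ex_le => //.
 exact: mble_funexpR.
 by move=> g;rewrite -expR0 ler_expR.
have ZM e : (Z e <= expR M)%R.
 rewrite -lee_fin ZE;apply: ex_bounded => [|g|g];rewrite ?expR_ge0 ?ler_expR//.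
 exact: mble_funexpR.
have mZ : mble Z.
 apply: (mcomp (fine_measurable measurableT)) => //.
 by apply: (mble_ex2 ga mephi) => x;exact: expR_ge0.
(* Since [0 <= phi <= M], [Z] lies between 1 and [expR M], so [Psi] is again nonnegative and
   bounded. *)
pose Psi e := ln (Z e).
have PsiE e : expR (Psi e) = Z e by rewrite lnK// posrE (lt_le_trans ltr01).
have mPsi : mble Psi by exact: (mcomp (@measurable_ln R)).
have Psi0 e : (0 <= Psi e)%R by exact: ln_ge0.
have H1 : ex rho (Psi \o p) <= (c + a)%:E.
 apply: Hp => //.
 by exists M => e;rewrite -ler_expR PsiE.
 by rewrite (eq_ex _ PsiE) /ex;under eq_integral do rewrite ZE.
have mpq : mble (fun sg => phi (p sg.1, q sg)).
 apply: (mcomp mphi);apply: mble_pair => //.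
 exact: (mcomp mp).
rewrite ex_prod//;last by move=> x;exact: phi0.
apply: (letr (ex rho (fun s => k s + Psi (p s))%R)).
 apply: ge0_le_integral => //.
 - by move=> s _;apply: integral_ge0 => g _;rewrite lee_fin /=.
 - exact: (mble_ex2 ga mpq (fun=> phi0 _)).
 - apply/mbleEFin;apply: mbleD => //.
 exact: (mcomp mPsi).
 - move=> s _ /=;apply: (Hq s (fun g => phi (p s, g))) => //.
  by exists M.
 by rewrite PsiE ZE.
rewrite exD//;last exact: (mcomp mPsi).
rewrite (_ : (c + K + a)%R = (K + (c + a))%R);last by ring.
by rewrite EFinD leeD.
Qed.
Lemma DVle_comp {d1 d2 d3} {S : measurableType d1} {E : measurableType d2}
 {G : measurableType d3} (rho : probability S R) (p : S -> E)
 (nu : probability E R) (c : R) (f : E -> G) (mf : mble f) :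
 DVle rho p nu c -> DVle rho (f \o p) (push nu mf) c.
Proof.
move=> H phi mphi phi0 [M phiM] a.
rewrite ex_push//;last exact: mble_funexpR.
move=> Ha;apply: (H (phi \o f) (mcomp mphi mf) (fun=> phi0 _) _ a Ha).
by exists M => x;exact: phiM.
Qed.
Lemma DVle_push {d1 d2 d3} {S : measurableType d1} {E : measurableType d2}
 {S' : measurableType d3} (rho : probability S' R) (f : S' -> S)
 (mf : mble f) (p : S -> E) (nu : probability E R) (c : R) :
 mble p ->
 DVle (push rho mf) p nu c <-> DVle rho (p \o f) nu c.
Proof.
move=> mp;split => H phi mphi phi0 phiM a Ha.
 rewrite -(@ex_push _ _ _ _ _ rho f mf (phi \o p));first exact: H.
 exact: (mcomp mphi mp).
 by move=> x;exact: phi0.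
rewrite ex_push;first exact: (H phi).
 exact: (mcomp mphi mp).
by move=> x;exact: phi0.
Qed.
(** Jensen's inequality, by integrating [1 + (phi - a) <= expR (phi - a)] after moving [a], which is
    nonnegative, to the other side. *)
Lemma DVle_id {d1} {E : measurableType d1} (nu : probability E R) :
 DVle nu id nu 0.
Proof.
move=> phi mphi phi0 [M phiM] a Ha;rewrite add0r.
have mephi : mble (fun x => expR (phi x)) by exact: mble_funexpR.
have a0 : (0 <= a)%R.
 rewrite -ler_expR expR0.
 rewrite -lee_fin (le_trans _ Ha)// -(ex_cst nu);apply: ex_le => //.
 by move=> x;rewrite -expR0 ler_expR.
have fphi : ex nu phi \is a fin_num by exact: (@ex_fin_num _ _ _ _ _ M).
have H : ex nu (fun x => phi x + 1)%R <= ex nu (fun x => expR (- a) * expR (phi x) + a)%R.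
 apply: ex_le => [||x|x].
 - exact: mbleD.
 - by apply: mbleD => //;exact: mbleM.
 - by rewrite addr_ge0.
 - by rewrite -expRD;have := expR_ge1Dx (- a + phi x);lra.
have mM : mble (fun x => expR (- a) * expR (phi x))%R.
 exact: mbleM.
have M0 x : (0 <= expR (- a) * expR (phi x))%R by rewrite mulr_ge0 ?expR_ge0.
move: H;rewrite !exD//.
rewrite exZ ?expR_ge0// !ex_cst => H.
rewrite -(@leeD2rE _ 1)// (le_trans H)// addeC leeD2l//.
rewrite (letr ((expR (- a))%:E * (expR a)%:E))//.
 by rewrite lee_wpmul2l// lee_fin expR_ge0.
by rewrite -EFinM -expRD addNr expR0.
Qed.
(** Each coordinate is transformed on its own, so the conditional cost in [DVle_prod] is constant
    and the costs add up. *)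
Lemma DVle_iid {d1} {T : measurableType d1} (ga : probability T R) n
 (tau : 'I_n -> T -> T) (c : 'I_n -> R) :
 (forall i, mble (tau i)) -> (forall i, 0 <= c i)%R ->
 (forall i, DVle ga (tau i) ga (c i)) ->
 DVle (iid ga n) (fun x => [tuple tau i (tnth x i) | i < n]) (iid ga n)
 (\sum_(i < n) c i).
Proof.
elim: n tau c => [|n IH] tau c mtau c0 H.
 rewrite big_ord0 => phi mphi phi0 phiM a Ha.
 have := DVle_id mphi phi0 phiM Ha;congr (_ <= _);apply: eq_ex => x.
 by rewrite /=;congr phi;rewrite [LHS]tuple0 [RHS]tuple0.
pose tau' (i : 'I_n) := tau (lift ord0 i).
pose t' (x : n.-tuple T) := [tuple tau' i (tnth x i) | i < n].
have mt' : mble t'.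
 by apply: mblef_mktuple => i;apply: (mcomp (mtau _));exact: mble_tnth.
have H' : DVle (iid ga n) t' (iid ga n) (\sum_(i < n) c (lift ord0 i)).
 by apply: IH => i;[exact: mtau|exact: c0|exact: H].
have P := @DVle_prod _ _ _ T T (n.-tuple T) ga (tau ord0) ga (iid ga n)
 (fun x => t' x.2) (fun=> \sum_(i < n) c (lift ord0 i))%R (c ord0)
 (\sum_(i < n) c (lift ord0 i)).
have {}P : DVle (ga \x iid ga n) (fun x => (tau ord0 x.1, t' x.2)) (ga \x iid ga n)
 (c ord0 + \sum_(i < n) c (lift ord0 i)).
 apply: P => //.
 - exact: (mcomp mt').
 - by move=> _;exact: sumr_ge0.
 - by rewrite ex_cst.
rewrite big_ord_recl => phi mphi phi0 [M phiM] a.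
pose ph (x : T * n.-tuple T) := phi (consT x).
have mph : mble ph.
 by apply: (mcomp mphi);exact: measurable_consT.
have HP := P ph mph (fun=> phi0 _) (ex_intro _ M (fun=> phiM _)) a.
have mt : mble (fun x : n.+1.-tuple T => [tuple tau i (tnth x i) | i < n.+1]).
 by apply: mblef_mktuple => i;apply: (mcomp (mtau _));exact: mble_tnth.
rewrite (ex_iidS _ (mble_funexpR mphi) (fun=> expR_ge0 _)) => Ha.
rewrite (ex_prod _ _ (mble_funexpR mph) (fun=> expR_ge0 _)) in HP.
apply: le_trans (HP Ha).
rewrite (ex_iidS _ (mcomp mphi mt) (fun=> phi0 _)).
have mpt : mble (ph \o (fun x => (tau ord0 x.1, t' x.2))).
 apply: (mcomp mph);apply: mble_pair.
 exact: (mcomp (mtau _)).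
 exact: (mcomp mt').
rewrite (ex_prod _ _ mpt (fun=> phi0 _));apply: eqW.
apply: eq_integral => x _;apply: eq_integral => s _;congr (phi _)%:E.
apply: eq_from_tnth => i;rewrite tnth_mktuple.
by case: (unliftP ord0 i) => [j ->|->];rewrite ?tnthS ?tnth_mktuple//.
Qed.

End EntropicDomination.

(** * Gaussian laws: moments, symmetry, cost of a shift *)

Section Gaussian1.
Context {R : realType}.
Local Notation leb := (@lebesgue_measure R).

Lemma ex_lebesgue_shift (a : R) (f : R -> R) : mble f ->
 (forall x, 0 <= f x) -> ex leb f = ex leb (fun x => f (x + a)).
Proof.
move=> mf f0;have ma : mble
  ((fun x => x + a) : measurableTypeR R -> measurableTypeR R).
 have : mble (fun x : measurableTypeR R => x + a).
 by apply: mbleD.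
 by [].
pose X : {mfun measurableTypeR R >-> measurableTypeR R} :=
 HB.pack (fun x : measurableTypeR R => x + a) (isMeasurableFun.Build _ _ _ _ _ ma).
pose m : {measure set (measurableTypeR R) -> \bar R} := pushforward leb X.
transitivity (ex (m (measurable_funP X)) f).
 apply: eq_measure_ex => A mA;apply: lebesgue_measure_unique => // _ [[u v]] _ <-.
 rewrite /m /= /pushforward.
 have -> : X @^-1` `]u, v]%classic = `]u - a, v - a]%classic.
 by apply/seteqP;split => x /=;rewrite !in_itv /= ltrBlDr lerBrDr.
 by rewrite /= !lebesgue_measure_itv /= !lte_fin ltrBlDr subrK -!EFinB opprB addrA subrK.
rewrite /ex /m ge0_integral_pushforward//.
 by apply/mbleEFin.
by move=> x _;rewrite lee_fin.
Qed.
Lemma ex_lebesgue_opp (f : R -> R) : mble f ->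
 (forall x, 0 <= f x) -> ex leb f = ex leb (fun x => f (- x)).
Proof.
move=> mf f0;have ma : mble
  ((fun x => - x) : measurableTypeR R -> measurableTypeR R).
 have : mble (fun x : measurableTypeR R => - x).
 exact: measurable_funN.
 by [].
pose X : {mfun measurableTypeR R >-> measurableTypeR R} :=
 HB.pack (fun x : measurableTypeR R => - x) (isMeasurableFun.Build _ _ _ _ _ ma).
pose m : {measure set (measurableTypeR R) -> \bar R} := pushforward leb X.
transitivity (ex (m (measurable_funP X)) f).
 by apply: eq_measure_ex => A mA;rewrite -[LHS]lebesgue_measureN.
rewrite /ex /m ge0_integral_pushforward//.
 by apply/mbleEFin.
by move=> x _;rewrite lee_fin.
Qed.
Let mble_idR : mble (idfun : measurableTypeR R -> R).
Proof.
have : mble (idfun : R -> R) by exact: measurable_id.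
by [].
Qed.

(* [normal_prob] lives on a copy of [R] with another measurability display. *)
Definition gauss1 (s : R) : probability R R :=
 push (normal_prob 0 s) mble_idR.

Variable (s : R).
Hypothesis s0 : 0 < s.
Let sn0 : s != 0. Proof. by rewrite gt_eqF. Qed.
Local Notation N := (gauss1 s).
Local Notation w := (normal_pdf 0 s).

Lemma ex_normal (f : R -> R) : mble f -> (forall x, 0 <= f x) ->
 ex N f = ex leb (fun x => f x * w x).
Proof.
move=> mf f0;rewrite ex_push//.
by apply: ex_density => //;[exact: measurable_normal_pdf|exact: normal_pdf_ge0].
Qed.
Lemma normal0_pdfE x : w x = normal_peak s * expR (- (x ^+ 2 / (s ^+ 2 *+ 2))).
Proof. by rewrite normal_pdfE// /normal_fun subr0 mulNr. Qed.
Lemma ex_normal_opp (f : R -> R) : mble f -> (forall x, 0 <= f x) ->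
 ex N f = ex N (fun x => f (- x)).
Proof.
move=> mf f0;have mfN : mble (fun x : R => f (- x)).
 by apply: (mcomp mf);exact: measurable_funN.
rewrite !ex_normal// ex_lebesgue_opp;last 2 first.
- by apply: mbleM => //;exact: measurable_normal_pdf.
- by move=> x;rewrite mulr_ge0// normal_pdf_ge0.
by apply: eq_ex => x;rewrite !normal0_pdfE sqrrN.
Qed.
(** Pointwise domination by a multiple of the density with standard deviation [Num.sqrt 2 * s],
    which has mass one. With [y = x^2 / (4 s^2)] the density carries [expR (- 2 y)], and
    [y^p <= p! * expR y] consumes half of the exponent; 2 bounds the ratio of the peaks. *)
Lemma ex_normal_moment p :
 (ex N (fun x : R => ((x ^+ 2) ^+ p)%R) <= (2 * p`!%:R * 4 ^+ p * (s ^+ 2) ^+ p)%:E)%E.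
Proof.
have mX : mble (fun x : R => (x ^+ 2) ^+ p).
 by apply: mbleX;exact: mbleX.
have X0 (x : R) : 0 <= (x ^+ 2) ^+ p by rewrite exprn_ge0 ?sqr_ge0.
rewrite ex_normal//.
pose s' := Num.sqrt 2 * s.
have s'0 : 0 < s' by rewrite mulr_gt0// sqrtr_gt0.
have s'E : s' ^+ 2 = 2 * s ^+ 2 by rewrite exprMn sqr_sqrtr.
set C := 2 * _ * _ * _.
have C0 : 0 <= C.
 rewrite /C;apply: mulr_ge0;last by rewrite exprn_ge0 ?sqr_ge0.
 by apply: mulr_ge0;[exact: mulr_ge0|exact: exprn_ge0].
apply: (letr (ex leb (fun x => C * normal_pdf 0 s' x)));last first.
 rewrite exZ//;[|exact: measurable_normal_pdf|exact: normal_pdf_ge0].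
 by rewrite /ex integral_normal_pdf mule1.
have w0 := normal_pdf_ge0 0 s.
suff pw (x : R) : (x ^+ 2) ^+ p * w x <= C * normal_pdf 0 s' x.
 apply: ex_le => //.
 - by apply: mbleM => //;exact: measurable_normal_pdf.
 - by apply: mbleM => //;exact: measurable_normal_pdf.
 - by move=> x;apply: mulr_ge0.
rewrite normal0_pdfE normal_pdfE ?gt_eqF// /normal_fun subr0.
rewrite mulNr s'E.
set y := x ^+ 2 / (4 * s ^+ 2).
have y0 : 0 <= y by rewrite /y divr_ge0 ?sqr_ge0// pmulr_rge0// sqr_ge0.
have s20 : s ^+ 2 != 0 by rewrite expf_neq0.
have -> : x ^+ 2 / (s ^+ 2 *+ 2) = y + y by rewrite /y -mulr_natr;field.
have -> : x ^+ 2 / ((2 * s ^+ 2) *+ 2) = y by rewrite /y -mulr_natr;congr (_ / _);ring.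
have -> : x ^+ 2 = 4 * s ^+ 2 * y by rewrite /y;field.
have peakE : normal_peak s <= 2 * normal_peak s'.
 rewrite /normal_peak s'E.
 have -> : 2 * s ^+ 2 * pi *+ 2 = 2 * (s ^+ 2 * pi *+ 2) by rewrite mulrnAr !mulrA.
 rewrite sqrtrM// invfM mulrA.
 rewrite ler_peMl ?invr_ge0// ler_pdivlMr ?sqrtr_gt0// mul1r.
 by rewrite -(@ler_pXn2r _ 2) ?nnegrE// sqr_sqrtr//;lra.
have yp : y ^+ p <= p`!%:R * expR y.
 case: p {mX X0 C C0} => [|p].
 by rewrite expr0 fact0 mul1r -[leLHS]expR0 ler_expR.
 rewrite mulrC -ler_pdivrMr ?ltr0n ?fact_gt0//.
 by have := expR_ge1Dxn p y0;lra.
rewrite opprD expRD exprMn.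
rewrite [leLHS](_ : _ = (4 ^+ p * (s ^+ 2) ^+ p * expR (- y)) * (normal_peak s * (y ^+ p * expR (- y))));last first.
 by rewrite exprMn;ring.
rewrite [leRHS](_ : _ = (4 ^+ p * (s ^+ 2) ^+ p * expR (- y)) * (2 * normal_peak s' * p`!%:R));last first.
 by rewrite /C;ring.
apply: ler_wpM2l.
 apply: mulr_ge0;last exact: expR_ge0.
 by apply: mulr_ge0;rewrite exprn_ge0// sqr_ge0.
apply: ler_pM;[exact: normal_peak_ge0| |exact: peakE|].
 by apply: mulr_ge0;[rewrite exprn_ge0|exact: expR_ge0].
by rewrite expRN ler_pdivrMr ?expR_gt0.
Qed.
(** Cameron-Martin: after the change of variable the Laplace transform of [phi] is the expectation
    of [expR z], where [z] is the shifted [phi] minus a linear term minus the cost [k]. Jensen's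
    inequality applies to [z], and the linear term has mean zero. *)
Lemma DVle_normal_shift (a : R) :
 DVle N (fun x => x + a) N (a ^+ 2 / (2 * s ^+ 2)).
Proof.
move=> phi mphi phi0 [M phiM] b.
have s20 : s ^+ 2 != 0 by rewrite expf_neq0.
have mephi := mble_funexpR mphi.
move=> Hb';move: (Hb');rewrite (ex_normal mephi (fun=> expR_ge0 _)).
rewrite (ex_lebesgue_shift a);last 2 first.
- by apply: mbleM => //;exact: measurable_normal_pdf.
- by move=> x;rewrite mulr_ge0 ?expR_ge0 ?normal_pdf_ge0.
set k := _ / _.
pose z (x : R) := phi (x + a) - a * x / s ^+ 2 - k.
have mx a' : mble (fun x : R => a' * x / s ^+ 2).
 by apply: mbleM => //;exact: mbleM.
have mpa : mble (fun x : R => phi (x + a)).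
 by apply: (mcomp mphi);exact: mbleD.
have mz : mble z by do 2! apply: measurable_funB => //.
have -> : ex leb (fun x => expR (phi (x + a)) * w (x + a)) = ex N (fun x => expR (z x)).
 rewrite (ex_normal (mble_funexpR mz) (fun=> expR_ge0 _)).
 apply: eq_ex => x;rewrite !normal0_pdfE mulrCA [RHS]mulrCA;congr (_ * _).
 by rewrite -!expRD /z /k -mulr_natr;congr expR;field.
move=> Hb.
have k0 : 0 <= k by rewrite /k divr_ge0 ?sqr_ge0// pmulr_rge0// sqr_ge0.
(* The linear term is the difference of [u] and its reflection. Their expectations agree by symmetry
   and are finite, so they cancel without integrating a signed function. *)
pose u (x : R) := Num.max (a * x / s ^+ 2) 0.
have mu : mble u by exact: measurable_maxr.
have muN : mble (fun x : R => u (- x)).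
 by apply: (mcomp mu);exact: measurable_funN.
have u0 x : 0 <= u x by rewrite le_max lexx orbT.
have fu : ex N u \is a fin_num.
 rewrite ge0_fin_numE ?ex_ge0//.
 pose c := `|a| / s ^+ 2.
 have c0 : 0 <= c by rewrite /c divr_ge0 ?sqr_ge0.
 apply: (@le_lt_trans _ _ (ex N (fun x : R => c * ((x ^+ 2) ^+ 1 + 1))%R)).
 suff pw (x : R) : u x <= c * ((x ^+ 2) ^+ 1 + 1).
  apply: ex_le => //.
  by apply: mbleM => //;apply: mbleD => //;do 2! apply: mbleX.
 rewrite ge_max;apply/andP;split;last by rewrite mulr_ge0// addr_ge0// exprn_ge0// sqr_ge0.
 rewrite /c [leRHS]mulrAC ler_wpM2r ?invr_ge0 ?sqr_ge0//.
 rewrite (le_trans (ler_norm _))// normrM ler_wpM2l// expr1.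
 have := sqr_ge0 (`|x| - 1);have := real_normK (num_real x).
 have := normr_ge0 x;nra.
 rewrite exZ//;[|by apply: mbleD => //;do 2! apply: mbleX|].
 rewrite exD//;[|by do 2! apply: mbleX|by move=> x;rewrite exprn_ge0 ?sqr_ge0].
 rewrite ex_cst lte_mul_pinfty ?lee_fin//.
 by rewrite lte_add_pinfty ?ltry// (le_lt_trans (ex_normal_moment 1)) ?ltry.
 by move=> x;apply: addr_ge0 => //;apply: exprn_ge0;exact: sqr_ge0.
have b0 : 0 <= b.
 rewrite -ler_expR expR0 -lee_fin -(ex_cst N);apply: le_trans Hb'.
 by apply: ex_le => // x;rewrite -expR0 ler_expR.
have H : (ex N (fun x : R => (phi (x + a) + 1) + u (- x))%R <=
   ex N (fun x : R => (expR (- b) * expR (z x) + (k + b)) + u x)%R)%E.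
 suff pw (x : R) : phi (x + a) + 1 + u (- x) <=
  expR (- b) * expR (z x) + (k + b) + u x.
 apply: ex_le => [||x|//].
 - by apply: mbleD => //;exact: mbleD.
 - apply: mbleD => //;apply: mbleD => //.
  by apply: mbleM => //;exact: mble_funexpR.
 - by rewrite !addr_ge0.
 - rewrite -expRD;have := expR_ge1Dx (- b + z x).
 have : u x - u (- x) = a * x / s ^+ 2.
  rewrite /u mulrN mulNr;set t := a * x / s ^+ 2.
  have [t0|t0] := leP t 0.
  by rewrite max_l;lra.
  by rewrite max_r;lra.
 rewrite /z;lra.
have mez : mble (fun x => expR (- b) * expR (z x)).
 by apply: mbleM => //;exact: mble_funexpR.
have ez0 x : 0 <= expR (- b) * expR (z x) by apply: mulr_ge0;exact: expR_ge0.
have p1 x : 0 <= phi (x + a) + 1 by exact: addr_ge0.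
have kb : 0 <= k + b by exact: addr_ge0.
have ezk x : 0 <= expR (- b) * expR (z x) + (k + b) by exact: addr_ge0.
have mp1 : mble (fun x : R => phi (x + a) + 1) by exact: mbleD.
have mezk : mble (fun x : R => expR (- b) * expR (z x) + (k + b)).
 exact: mbleD.
rewrite exD// [leRHS]exD// -(ex_normal_opp mu u0) leeD2rE// in H.
rewrite exD// ex_cst exD// ex_cst exZ ?expR_ge0// in H;last exact: mble_funexpR.
rewrite -(@leeD2rE _ 1)// (le_trans H)// addeC leeD2l//.
rewrite (letr ((expR (- b))%:E * (expR b)%:E)%E)//.
 by rewrite lee_wpmul2l// lee_fin expR_ge0.
by rewrite -EFinM -expRD addNr expR0.
Qed.

End Gaussian1.

Section GaussianRows.
Context {R : realType} {d : nat}.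

Definition rowt (x : d.-tuple R) : 'rV[R]_d := \row_k tnth x k.

Lemma mble_rowt : mble rowt.
Proof.
apply: mblef_rV => k;under eq_fun do rewrite mxE.
exact: mble_tnth.
Qed.

Definition gauss (s : R) : probability 'rV[R]_d R :=
 push (iid (gauss1 s) d) mble_rowt.

Lemma ex_iid_invariant (T : measurableType default_measure_display)
 (ga : probability T R) (tau : T -> T) n :
 mble tau ->
 (forall f : T -> R, mble f -> (forall x, 0 <= f x) ->
 ex ga f = ex ga (f \o tau)) ->
 forall f : n.-tuple T -> R, mble f -> (forall x, 0 <= f x) ->
 ex (iid ga n) f = ex (iid ga n) (fun x => f [tuple tau (tnth x i) | i < n]).
Proof.
move=> mtau H;elim: n => [|n IH] f mf f0.
 by apply: eq_ex => x;congr f;rewrite [LHS]tuple0 [RHS]tuple0.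
pose t' (x : n.-tuple T) := [tuple tau (tnth x i) | i < n].
have mt' : mble t'.
 by apply: mblef_mktuple => i;apply: (mcomp mtau);exact: mble_tnth.
have mt : mble (fun x : n.+1.-tuple T => [tuple tau (tnth x i) | i < n.+1]).
 by apply: mblef_mktuple => i;apply: (mcomp mtau);exact: mble_tnth.
pose g (x : n.-tuple T * T) := f [tuple of x.2 :: x.1].
have mg : mble g by apply: (mcomp mf);apply: measurable_cons.
have mg1 : mble (fun x : T * n.-tuple T => g (x.2, x.1)).
 by apply: (mcomp mg);apply: mble_pair.
have mgt : mble (fun x : T * n.-tuple T => g (t' x.2, x.1)).
 apply: (mcomp mg);apply: mble_pair => //.
 exact: (mcomp mt').
rewrite (ex_iidSC _ mf f0) (ex_iidS _ (mcomp mf mt) (fun=> f0 _)).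
transitivity (\int[ga]_a \int[iid ga n]_s (g (t' s, tau a))%:E)%E;last first.
 apply: eq_integral => a _;apply: eq_integral => s _;congr (f _)%:E.
 apply: eq_from_tnth => i;rewrite tnth_mktuple.
 by case: (unliftP ord0 i) => [j ->|->];rewrite ?tnthS ?tnth_mktuple//.
have mgtt : mble (fun x : T * n.-tuple T => g (t' x.2, tau x.1)).
 apply: (mcomp mg);apply: mble_pair.
 exact: (mcomp mt').
 exact: (mcomp mtau).
rewrite -(ex_prod ga (iid ga n) mgtt (fun=> f0 _)).
rewrite (ex_prodC ga (iid ga n) mgtt (fun=> f0 _)).
transitivity (\int[iid ga n]_s \int[ga]_a (g (t' s, a))%:E)%E;last first.
 apply: eq_integral => r _;apply: (H (fun a => g (t' r, a)));last by move=> ?;exact: f0.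
 by apply: (mcomp mg);apply: mble_pair.
rewrite -[LHS](ex_prodC ga (iid ga n) mg1 (fun=> f0 _)).
rewrite -[RHS](ex_prodC ga (iid ga n) mgt (fun=> f0 _)).
rewrite (ex_prod ga (iid ga n) mg1 (fun=> f0 _)) (ex_prod ga (iid ga n) mgt (fun=> f0 _)).
apply: eq_integral => a _.
rewrite -[LHS]/(ex (iid ga n) (fun s => g (s, a))) (IH (fun s => g (s, a)))//.
 by apply: (mcomp mg);apply: mble_pair.
by move=> ?;exact: f0.
Qed.

Variable s : R.
Hypothesis s0 : 0 < s.

Lemma ex_gauss (f : 'rV[R]_d -> R) : mble f -> (forall x, 0 <= f x) ->
 ex (gauss s) f = ex (iid (gauss1 s) d) (f \o rowt).
Proof. by move=> mf f0;rewrite ex_push. Qed.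
Lemma ex_gauss_opp (f : 'rV[R]_d -> R) : mble f ->
 (forall x, 0 <= f x) -> ex (gauss s) f = ex (gauss s) (fun x => f (- x)).
Proof.
move=> mf f0.
have mfN : mble (fun x : 'rV[R]_d => f (- x)).
 by apply: (mcomp mf);exact: mble_rVN.
rewrite !ex_gauss// (@ex_iid_invariant _ (gauss1 s) (fun x : R => - x)).
- apply: eq_ex => x /=;congr f;apply/rowP => k.
 by rewrite !mxE tnth_mktuple.
- exact: measurable_funN.
- by move=> g mg g0;exact: ex_normal_opp.
- exact: (mcomp mf mble_rowt).
- by move=> x;exact: f0.
Qed.
Lemma DVle_gauss_shift (b : 'rV[R]_d) :
 DVle (gauss s) (fun x => x + b) (gauss s) (enorm b ^+ 2 / (2 * s ^+ 2)).
Proof.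
have mb : mble (fun x : 'rV[R]_d => x + b) by exact: mble_rVD.
apply/(DVle_push (iid (gauss1 s) d) mble_rowt _ _ mb).
have := @DVle_iid R _ _ (gauss1 s) d (fun k x => x + b 0 k)
 (fun k => b 0 k ^+ 2 / (2 * s ^+ 2)).
have -> : \sum_(k < d) b 0 k ^+ 2 / (2 * s ^+ 2) = enorm b ^+ 2 / (2 * s ^+ 2).
 by rewrite -mulr_suml enorm_sqr;congr (_ / _);apply: eq_bigr => k _;rewrite expr2.
move=> H.
have {}H : DVle (iid (gauss1 s) d) (fun x : d.-tuple R => [tuple tnth x i + b 0 i | i < d])
 (iid (gauss1 s) d) (enorm b ^+ 2 / (2 * s ^+ 2)).
 apply: H => k;first by apply: mbleD.
 by rewrite divr_ge0 ?sqr_ge0// pmulr_rge0// sqr_ge0.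
 exact: DVle_normal_shift.
have {}H := DVle_comp (mf := mble_rowt) H.
move=> phi mphi phi0 phiM a Ha.
have := H phi mphi phi0 phiM a Ha;congr (_ <= _)%E;apply: eq_ex => x /=.
by congr phi;apply/rowP => k;rewrite !mxE tnth_mktuple.
Qed.
Lemma ex_gauss_moment p : (ex (gauss s) (fun g : 'rV[R]_d => (enorm g ^+ (2 * p.+1))%R) <=
 (d%:R ^+ p.+1.+1 * (2 * p.+1`!%:R * 4 ^+ p.+1 * (s ^+ 2) ^+ p.+1))%:E)%E.
Proof.
have mrow k : mble (fun x : d.-tuple R => tnth x k) by exact: mble_tnth.
have mX (k : 'I_d) : mble (fun x : d.-tuple R => (tnth x k ^+ 2) ^+ p.+1).
 by do 2! apply: mbleX.
have X0 (k : 'I_d) (x : d.-tuple R) : 0 <= (tnth x k ^+ 2) ^+ p.+1.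
 by rewrite exprn_ge0 ?sqr_ge0.
have mg : mble (fun g : 'rV[R]_d => enorm g ^+ (2 * p.+1)).
 by apply: mbleX;exact: mble_enorm.
rewrite ex_gauss//;last by move=> x;rewrite exprn_ge0 ?enorm_ge0.
apply: (letr (ex (iid (gauss1 s) d)
 (fun x => d%:R ^+ p.+1 * \sum_(k < d) (tnth x k ^+ 2) ^+ p.+1)%R)).
 apply: ex_le => //.
 - exact: (mcomp mg mble_rowt).
 - by apply: mbleM => //;apply: mble_sum.
 - by move=> x;rewrite exprn_ge0 ?enorm_ge0.
 - move=> x;rewrite /= exprM enorm_sqr.
 have -> : dotp (rowt x) (rowt x) = \sum_(k < d) tnth x k ^+ 2.
  by apply: eq_bigr => k _;rewrite mxE expr2.
 case: (pickP 'I_d) => [k0 _|no];last first.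
  rewrite [X in X ^+ p.+1]big1;last by move=> k;have := no k.
  by rewrite expr0n mulr_ge0 ?exprn_ge0// sumr_ge0.
 have [k Hk] : exists k, forall j, tnth x j ^+ 2 <= tnth x k ^+ 2.
  have [k _ Hk] := @arg_maxP _ _ _ k0 predT (fun k => tnth x k ^+ 2) erefl.
  by exists k => j;exact: Hk.
 apply: (letr ((d%:R * tnth x k ^+ 2) ^+ p.+1)).
  rewrite lerXn2r ?nnegrE//.
  - by apply: sumr_ge0 => j _;exact: sqr_ge0.
  - by apply: mulr_ge0 => //;exact: sqr_ge0.
  apply: (letr (\sum_(j < d) tnth x k ^+ 2));first exact: ler_sum.
  by rewrite sumr_const card_ord mulr_natl.
 rewrite exprMn ler_wpM2l ?exprn_ge0// (bigD1 k)//= lerDl.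
 by apply: sumr_ge0 => j _;exact: X0.
rewrite exZ;[|by apply: mble_sum|by move=> x;apply: sumr_ge0 => k _;exact: X0|exact: exprn_ge0].
rewrite ex_sum//.
have c0 : 0 <= 2 * p.+1`!%:R * 4 ^+ p.+1 * (s ^+ 2) ^+ p.+1 :> R.
 apply: mulr_ge0;last by rewrite exprn_ge0 ?sqr_ge0.
 by apply: mulr_ge0;[exact: mulr_ge0|exact: exprn_ge0].
apply: (letr ((d%:R ^+ p.+1)%:E * \sum_(k < d) (2 * p.+1`!%:R * 4 ^+ p.+1 * (s ^+ 2) ^+ p.+1)%:E)%E).
 rewrite lee_wpmul2l ?lee_fin ?exprn_ge0//;apply: lee_sum => k _.
 rewrite (@ex_iid_coord _ _ _ (gauss1 s) d k (fun x : R => (x ^+ 2) ^+ p.+1)).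
 - exact: ex_normal_moment.
 - by do 2! apply: mbleX.
 - by move=> x;apply: exprn_ge0;exact: sqr_ge0.
by rewrite sumEFin -EFinM lee_fin sumr_const card_ord -[X in _ * X]mulr_natl mulrA -exprSr.
Qed.

End GaussianRows.

(** * Even moments under one Gaussian step *)

Section SymmetrizedPower.
Context {R : realFieldType}.
Implicit Types A b t : R.

(** The even and odd parts in [t] of [(A + t)^n] satisfy a coupled recursion in which [t] occurs
    only through [t * odd] and [t^2 * even]. The bound [t^2 <= 4 A b] then makes every correction
    linear in [b], with no term in the square root of [b]. *)
Let even_odd_power_le n : exists c c' : R, [/\ 0 <= c, 0 <= c' &
 forall A b t, 0 <= A -> 0 <= b -> t ^+ 2 <= 4 * A * b -> `|t| <= A ->
 [/\ ((A + t) ^+ n.+1 + (A - t) ^+ n.+1) / 2 <= A ^+ n.+1 + c * A ^+ n * b,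
  ((A + t) ^+ n.+1 + (A - t) ^+ n.+1) / 2 <= (2 * A) ^+ n.+1 &
  t * (((A + t) ^+ n.+1 - (A - t) ^+ n.+1) / 2) <= c' * A ^+ n.+1 * b]].
Proof.
elim: n => [|n [c [c' [c0 c'0 H]]]].
 exists 0, 4;split => // A b t A0 b0 tb tA;rewrite !expr1 expr0.
 by split;[lra|lra|nra].
exists (c + c'), (c' + 4 * 2 ^+ n.+1);split => [||A b t A0 b0 tb tA].
- exact: addr_ge0.
- by rewrite addr_ge0 ?mulr_ge0 ?exprn_ge0.
have [H1 H2 H3] := H A b t A0 b0 tb tA.
set S := (_ + _) / 2 in H1 H2;set D := (_ - _) / 2 in H3.
have ES : ((A + t) ^+ n.+2 + (A - t) ^+ n.+2) / 2 = A * S + t * D.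
 by rewrite !(exprS _ n.+1) /S /D;field.
have ED : ((A + t) ^+ n.+2 - (A - t) ^+ n.+2) / 2 = A * D + t * S.
 by rewrite !(exprS _ n.+1) /S /D;field.
have An : 0 <= A ^+ n.+1 by rewrite exprn_ge0.
have An' : 0 <= A ^+ n by rewrite exprn_ge0.
have S0 : 0 <= S.
 by rewrite divr_ge0// addr_ge0// exprn_ge0//;move: tA;rewrite ler_norml;lra.
have tDS : t * D <= S * A.
 rewrite -subr_ge0.
 have -> : S * A - t * D = ((A - t) * (A + t) ^+ n.+1 + (A + t) * (A - t) ^+ n.+1) / 2.
 by rewrite /S /D;field.
 have [At1 At2] : 0 <= A - t /\ 0 <= A + t by move: tA;rewrite ler_norml;lra.
 by rewrite divr_ge0// addr_ge0// mulr_ge0// exprn_ge0.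
rewrite ES ED;split.
- apply: (le_trans (lerD (ler_wpM2l A0 H1) H3)).
 by apply: eqW;rewrite !exprS;ring.
- have : S * A <= (2 * A) ^+ n.+1 * A by rewrite ler_wpM2r.
 by rewrite (exprS _ n.+1) => h;move: tDS;rewrite (_ : 2 * A * _ = 2 * ((2 * A) ^+ n.+1 * A));[lra|ring].
- have h1 : A * (t * D) <= A * (c' * A ^+ n.+1 * b) by rewrite ler_wpM2l.
 have h2 : t ^+ 2 * S <= 4 * A * b * (2 * A) ^+ n.+1.
 by apply: ler_pM => //;exact: sqr_ge0.
 rewrite (_ : t * _ = A * (t * D) + t ^+ 2 * S);last by ring.
 apply: (le_trans (lerD h1 h2)).
 by apply: eqW;rewrite exprMn !exprS;ring.
Qed.
(** Meant for [a = |v|^2], [b = |h|^2] and [t] twice their scalar product, where [t^2 <= 4 a b] is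
    Cauchy-Schwarz. Averaging over the sign of [t] removes the first-order term, which leaves the
    coefficient of [a^(p+1)] equal to one. *)
Lemma symmetrized_power_le p : exists2 C : R, 0 <= C & forall a b t, 0 <= a -> 0 <= b ->
 t ^+ 2 <= 4 * a * b ->
 ((a + b + t) ^+ p.+1 + (a + b - t) ^+ p.+1) / 2 <=
 a ^+ p.+1 + C * (a ^+ p * b + b ^+ p.+1).
Proof.
have [c [c' [c0 _ H]]] := even_odd_power_le p.
pose K : R := 2 ^+ p * (p.+1%:R + c).
have K0 : 0 <= K by rewrite mulr_ge0 ?exprn_ge0 ?addr_ge0.
exists K => // a b t a0 b0 tab.
have ab0 : 0 <= a + b by exact: addr_ge0.
have [||H1 _ _] := H (a + b) b t ab0 b0.
- by have : 0 <= b * b;[exact: mulr_ge0|nra].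
- rewrite -(@ler_pXn2r _ 2%N) ?nnegrE// real_normK ?num_real//.
 by have := sqr_ge0 (a - b);nra.
apply: (le_trans H1).
have ab2 : (a + b) ^+ p <= 2 ^+ p * (a ^+ p + b ^+ p).
 have [ab|/ltW ab] := leP a b.
 rewrite (letr ((2 * b) ^+ p))//.
  by rewrite lerXn2r ?nnegrE//;lra.
 by rewrite exprMn ler_wpM2l ?exprn_ge0// lerDr exprn_ge0.
 rewrite (letr ((2 * a) ^+ p))//.
 by rewrite lerXn2r ?nnegrE//;lra.
 by rewrite exprMn ler_wpM2l ?exprn_ge0// lerDl exprn_ge0.
have abS : (a + b) ^+ p.+1 <= a ^+ p.+1 + p.+1%:R * (a + b) ^+ p * b.
 elim: (p) => [|n IH];first by rewrite !expr1 expr0;lra.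
 have h1 : a * (a + b) ^+ n.+1 <= a * (a ^+ n.+1 + n.+1%:R * (a + b) ^+ n * b).
 by rewrite ler_wpM2l.
 have h2 : a * ((a + b) ^+ n * b) <= (a + b) * ((a + b) ^+ n * b).
 by rewrite ler_wpM2r ?lerDl// mulr_ge0// exprn_ge0.
 have h3 : n.+1%:R * (a * ((a + b) ^+ n * b)) <= n.+1%:R * ((a + b) ^+ n.+1 * b).
 by rewrite ler_wpM2l// [(a + b) ^+ n.+1]exprS -mulrA.
 rewrite -[n.+2%:R]natr1 (exprS _ n.+1) (exprS a n.+1).
 move: h1 h3;set Q := (a + b) ^+ n.+1;set P := (a + b) ^+ n;lra.
apply: (letr (a ^+ p.+1 + (p.+1%:R + c) * (a + b) ^+ p * b));first by lra.
rewrite lerD2l /K exprSr.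
have -> : 2 ^+ p * (p.+1%:R + c) * (a ^+ p * b + b ^+ p * b) =
 (p.+1%:R + c) * (2 ^+ p * (a ^+ p + b ^+ p)) * b by ring.
by rewrite ler_wpM2r// ler_wpM2l// addr_ge0.
Qed.

End SymmetrizedPower.

Section GaussianPower.
Context {R : realType} {d : nat}.

Lemma expr_le_eps (a e : R) p : 0 <= a -> 0 < e -> a ^+ p <= e * a ^+ p.+1 + e^-1 ^+ p.
Proof.
move=> a0 e0;have [ae|ea] := leP a e^-1.
 rewrite (letr (e^-1 ^+ p))//.
 by rewrite lerXn2r ?nnegrE ?invr_ge0// ltW.
 by rewrite lerDr mulr_ge0 ?exprn_ge0// ltW.
rewrite (letr (e * a ^+ p.+1))//.
 rewrite exprS mulrA ler_peMl ?exprn_ge0//.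
 by rewrite -ler_pdivrMl// mulr1 ltW.
by rewrite lerDl exprn_ge0// invr_ge0 ltW.
Qed.
(** Averaging over [g] and [-g] makes the growth of the moment of order [D], and its rate [kap] can
    be taken as small as needed: smaller than the rate gained by the implicit step. *)
Lemma gauss_power_le p (kap : R) : 0 < kap -> exists2 C : R, 0 <= C &
 forall D, 0 < D -> D <= 1 -> forall v : 'rV[R]_d,
 (ex (gauss (Num.sqrt D)) (fun g => enorm (v + Num.sqrt 2 *: g) ^+ (2 * p.+1))%R <=
 ((1 + kap * D) * enorm v ^+ (2 * p.+1) + C * D)%:E)%E.
Proof.
move=> kap0;have [C1 C10 HC1] := @symmetrized_power_le R p.
pose M j : R := d%:R ^+ j.+1 * (2 * j`!%:R * 4 ^+ j).
have M0 j : 0 <= M j.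
 by apply: mulr_ge0;[exact: exprn_ge0|apply: mulr_ge0;[exact: mulr_ge0|exact: exprn_ge0]].
(* The cross term is [2 * C1 * M 1 * D] times [a^p]; with this [e], [expr_le_eps] turns it into at
   most [kap * D * a^(p+1)] plus a constant times [D]. *)
pose e := kap / (2 * C1 * M 1%N + 1).
have CM0 : 0 <= 2 * C1 * M 1%N by apply: mulr_ge0 => //;exact: mulr_ge0.
have e0 : 0 < e by rewrite divr_gt0// ltr_wpDl.
have eC : 2 * C1 * M 1%N * e <= kap.
 by rewrite /e mulrA ler_pdivrMr ?ltr_wpDl// [leRHS]mulrDr mulr1 mulrC lerDl ltW.
pose C := 2 * C1 * M 1%N * e^-1 ^+ p + C1 * (2 ^+ p.+1 * M p.+1).
have C0 : 0 <= C.
 rewrite /C;apply: addr_ge0;apply: mulr_ge0 => //.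
 by apply: exprn_ge0;rewrite invr_ge0 ltW.
 by apply: mulr_ge0 => //;exact: exprn_ge0.
exists C => // D D0 D1 v.
pose G := @gauss R d (Num.sqrt D);pose F (g : 'rV[R]_d) := enorm (v + Num.sqrt 2 *: g) ^+ (2 * p.+1).
have sD0 : 0 < Num.sqrt D by rewrite sqrtr_gt0.
have mF : mble F.
 by apply: mbleX;apply: mblef_enorm;apply: mble_rVD => //;exact: mble_rVZ.
have F0 g : 0 <= F g by rewrite exprn_ge0 ?enorm_ge0.
have mFN : mble (fun g : 'rV[R]_d => F (- g)).
 by apply: (mcomp mF);exact: mble_rVN.
pose a := enorm v ^+ 2.
have a0 : 0 <= a by rewrite sqr_ge0.
have pw (g : 'rV[R]_d) : (F g + F (- g)) / 2 <= a ^+ p.+1 + C1 * (a ^+ p * (2 * enorm g ^+ (2 * 1)) + 2 ^+ p.+1 * enorm g ^+ (2 * p.+1)).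
 have := HC1 a (2 * enorm g ^+ 2) (2 * dotp v (Num.sqrt 2 *: g)) a0.
 rewrite mulr_ge0 ?sqr_ge0// => /(_ isT).
 have h2 : enorm (Num.sqrt 2 *: g) ^+ 2 = 2 * enorm g ^+ 2.
 by rewrite enormZ exprMn real_normK ?num_real// sqr_sqrtr.
 have E1 : a + 2 * enorm g ^+ 2 + 2 * dotp v (Num.sqrt 2 *: g) = enorm (v + Num.sqrt 2 *: g) ^+ 2.
 by rewrite enorm_sqrD h2 /a;ring.
 have E2 : a + 2 * enorm g ^+ 2 - 2 * dotp v (Num.sqrt 2 *: g) = enorm (v + Num.sqrt 2 *: - g) ^+ 2.
 by rewrite scalerN enorm_sqrB h2 /a;ring.
 rewrite /F muln1 !(exprM _ 2 p.+1) E1 E2 [(2 * enorm g ^+ 2) ^+ p.+1]exprMn => H.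
 apply: H;rewrite exprMn.
 have := dotp_le_abs v (Num.sqrt 2 *: g).
 rewrite -(@ler_pXn2r _ 2%N) ?nnegrE ?mulr_ge0 ?enorm_ge0// real_normK ?num_real//.
 by rewrite exprMn h2 -/a;lra.
have mE j : mble (fun g : 'rV[R]_d => enorm g ^+ (2 * j)).
 by apply: mbleX;exact: mble_enorm.
have E0 j (g : 'rV[R]_d) : 0 <= enorm g ^+ (2 * j) by rewrite exprn_ge0 ?enorm_ge0.
have HE j : (ex G (fun g : 'rV[R]_d => enorm g ^+ (2 * j.+1))%R <= (M j.+1 * D)%:E)%E.
 apply: (le_trans (@ex_gauss_moment R d _ sD0 j)).
 rewrite lee_fin sqr_sqrtr ?(ltW D0)// [d%:R ^+ _ * _]mulrA -/(M j.+1) ler_wpM2l//.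
 by rewrite exprS ler_piMr ?(ltW D0)// exprn_ile1// ltW.
have H1 : ex G F = ex G (fun g : 'rV[R]_d => (F g + F (- g)) / 2).
 under [in RHS]eq_ex do rewrite mulrC.
 rewrite exZ//;[|exact: mbleD|by move=> g;exact: addr_ge0].
 rewrite exD// -(@ex_gauss_opp R d _ sD0 F mF F0) -/G.
 have -> : (ex G F + ex G F = 2%:E * ex G F)%E by rewrite -mule2n muleC mule_natr.
 by rewrite muleA -EFinM mulVf// mul1e.
rewrite -/G -/F H1.
apply: (letr (ex G (fun g : 'rV[R]_d => a ^+ p.+1 + ((C1 * a ^+ p * 2) * enorm g ^+ (2 * 1) + (C1 * 2 ^+ p.+1) * enorm g ^+ (2 * p.+1))))).
 apply: ex_le.
 - by apply: mbleM => //;exact: mbleD.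
 - by apply: mbleD => //;apply: mbleD;apply: mbleM.
 - by move=> g;rewrite divr_ge0 ?addr_ge0.
 - by move=> g;apply: (le_trans (pw g));apply: eqW;ring.
have c1 : 0 <= C1 * a ^+ p * 2.
 by apply: mulr_ge0 => //;apply: mulr_ge0 => //;exact: exprn_ge0.
have c2 : 0 <= C1 * 2 ^+ p.+1 by apply: mulr_ge0 => //;exact: exprn_ge0.
rewrite exD;[|by []|by apply: mbleD;apply: mbleM|by move=> g;exact: exprn_ge0|by move=> g;rewrite addr_ge0// mulr_ge0].
rewrite ex_cst exD;[|exact: mbleM|exact: mbleM|by move=> g;rewrite mulr_ge0|by move=> g;rewrite mulr_ge0].
rewrite !exZ//.
apply: (letr ((a ^+ p.+1)%:E + ((C1 * a ^+ p * 2 * (M 1%N * D))%:E + (C1 * 2 ^+ p.+1 * (M p.+1 * D))%:E))%E).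
 by rewrite leeD2l// leeD// [leRHS]EFinM;apply: lee_wpmul2l;rewrite ?lee_fin//;exact: HE.
rewrite -!EFinD lee_fin exprM -/a.
have := expr_le_eps p a0 e0 => /(ler_wpM2l (mulr_ge0 CM0 (ltW D0))) h.
have h' : 2 * C1 * M 1%N * e * (D * a ^+ p.+1) <= kap * (D * a ^+ p.+1).
 by apply: ler_wpM2r => //;apply: mulr_ge0;[exact: ltW|exact: exprn_ge0].
by rewrite /C;lra.
Qed.

End GaussianPower.

(** * Relative entropy and its dual form *)

Section RelativeEntropy.
Context {R : realType} {disp : measure_display} {T : measurableType disp}.
Local Open Scope ereal_scope.
Implicit Types mu nu : probability T R.

(** [Ent] is a signed integral, but its integrand [w * ln w] is bounded below by -1; the shift
    brings it within reach of the rules for [ex]. *)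
Lemma integral_shift1 (P : probability T R) (h : T -> R) : mble h ->
 (forall x, -1 <= h x)%R ->
 \int[P]_x (h x)%:E = ex P (fun x => h x + 1)%R - 1.
Proof.
move=> mh h1.
pose hp x := Num.max (h x) 0%R;pose hn x := Num.max (- h x)%R 0%R.
have mhp : mble hp by exact: measurable_maxr.
have mhn : mble hn.
 by apply: measurable_maxr => //;exact: measurable_funN.
have hp0 x : (0 <= hp x)%R by rewrite le_max lexx orbT.
have hn0 x : (0 <= hn x)%R by rewrite le_max lexx orbT.
have hn1 x : (hn x <= 1)%R by rewrite ge_max ler01 lerNl h1.
have h10 x : (0 <= h x + 1)%R by have := h1 x;lra.
have fn : ex P hn \is a fin_num by exact: (@ex_fin_num _ _ _ _ _ 1%R).
have -> : \int[P]_x (h x)%:E = ex P hp - ex P hn.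
 by rewrite integralE;congr (_ - _);apply: eq_integral => x _;
 rewrite ?funeposE ?funenegE /= /hp /hn EFin_max.
have H : ex P (fun x => h x + 1)%R + ex P hn = ex P hp + 1.
 rewrite -(ex_cst P 1) -!exD//;last exact: mbleD.
 apply: eq_ex => x;rewrite /hp /hn.
 by have [h0|h0] := leP (h x) 0%R;[rewrite max_l;lra|rewrite max_r;lra].
rewrite -[in RHS](addeK (ex P (fun x => h x + 1)%R) fn) H.
by rewrite [X in _ = X - 1]addeAC addeK.
Qed.
(** The derivative used in [Ent] is fixed only up to null sets. It is replaced here by an almost
    everywhere equal version that is nonnegative and finite at every point. *)
Lemma density_exists mu nu : mu `<< nu -> exists w : T -> R,
 [/\ mble w, forall x, (0 <= w x)%R,
  forall A, measurable A -> mu A = \int[nu]_(x in A) (w x)%:E &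
  Ent mu nu = \int[nu]_x (w x * ln (w x))%:E].
Proof.
move=> munu;pose f := Radon_Nikodym_SigmaFinite.f mu nu.
have f0 : forall x, 0 <= f x by move=> x;exact: Radon_Nikodym_SigmaFinite.f_ge0.
have ffin : forall x, f x \is a fin_num by move=> x;exact: Radon_Nikodym_SigmaFinite.f_fin_num.
have fi : nu.-integrable setT f by exact: Radon_Nikodym_SigmaFinite.f_integrable.
have fE : forall A, measurable A -> mu A = \int[nu]_(x in A) f x.
 by move=> A mA;exact: Radon_Nikodym_SigmaFinite.f_integral.
have mf := measurable_int _ fi.
pose w x := fine (f x).
have mw : mble w.
 by apply: (mcomp (fine_measurable measurableT)).
have wE x : (w x)%:E = f x by rewrite /w fineK.
exists w;split => //.
- by move=> x;rewrite fine_ge0.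
- by move=> A mA;rewrite fE//;apply: eq_integral => x _;rewrite wE.
rewrite /Ent asboolT//.
have mln (g : T -> R) : mble g -> mble (fun x => g x * ln (g x))%R.
 by move=> mg;apply: mbleM => //;apply: (mcomp (@measurable_ln R)).
apply: ae_eq_integral => //.
- apply/mbleEFin;apply: mln.
 apply: (mcomp (fine_measurable measurableT)).
 by apply: measurable_int;apply: Radon_Nikodym_integrable.
- by apply/mbleEFin;exact: mln.
have := @ae_eq_Radon_Nikodym_SigmaFinite _ _ _ mu nu munu setT measurableT.
apply: filterS => x /= H xT;rewrite -H//.
Qed.
Lemma xlnx_ge (x : R) : (0 <= x)%R -> (x - 1 <= x * ln x)%R.
Proof.
rewrite le_eqVlt => /predU1P[<-|x0];first by rewrite mul0r;lra.
have := expR_ge1Dx (- ln x);rewrite expRN lnK ?posrE// => H.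
have := ler_wpM2l (ltW x0) H;rewrite mulfV ?gt_eqF//;lra.
Qed.
(** Legendre duality between [x ln x] and the exponential: pointwise [w * (phi - a) <= w ln w - w +
    expR (phi - a)], integrated against [nu]. *)
Lemma Ent_DVle mu nu (c : R) : Ent mu nu <= c%:E -> DVle mu id nu c.
Proof.
have [munu|nmunu] := pselect (mu `<< nu);last first.
 by rewrite /Ent asboolF.
have [w [mw w0 wE ->]] := density_exists munu.
have mln : mble (fun x => w x * ln (w x))%R.
 by apply: mbleM => //;apply: (mcomp (@measurable_ln R)).
have ln1 x : (-1 <= w x * ln (w x))%R by have := xlnx_ge (w0 x);have := w0 x;lra.
have ln10 x : (0 <= w x * ln (w x) + 1)%R by have := ln1 x;lra.
rewrite integral_shift1// leeBlDr// => Hc phi mphi phi0 [M phiM] a Ha.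
have mephi := mble_funexpR mphi.
have a0 : (0 <= a)%R.
 rewrite -ler_expR expR0 -lee_fin (le_trans _ Ha)// -(ex_cst nu);apply: ex_le => //.
 by move=> x;rewrite -expR0 ler_expR.
have w1 : ex nu w = 1.
 by rewrite -(@probability_setT _ _ _ mu) wE.
rewrite (ex_density mw w0 wE)//.
have mpw : mble (fun x => phi x * w x)%R by exact: mbleM.
have H : ex nu (fun x => (phi x * w x + w x) + 1)%R <=
 ex nu (fun x => ((w x * ln (w x) + 1) + expR (- a) * expR (phi x)) + a * w x)%R.
 apply: ex_le.
 - by apply: mbleD => //;exact: mbleD.
 - apply: mbleD;last exact: mbleM.
 by apply: mbleD;[exact: mbleD|exact: mbleM].
 - by move=> x;rewrite !addr_ge0// mulr_ge0.
 - move=> x;have := w0 x;rewrite -expRD le_eqVlt => /predU1P[wx|wx].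
  by rewrite -wx;have := expR_ge0 (- a + phi x);lra.
 have h := expR_ge1Dx (- a + phi x - ln (w x)).
 have := ler_wpM2l (ltW wx) h.
 by rewrite expRB lnK ?posrE// mulrCA mulfV ?gt_eqF// mulr1;lra.
have ea0 x : (0 <= expR (- a) * expR (phi x))%R by rewrite mulr_ge0 ?expR_ge0.
have aw0 x : (0 <= a * w x)%R by rewrite mulr_ge0.
have pw0 x : (0 <= phi x * w x)%R by rewrite mulr_ge0.
have mea : mble (fun x => expR (- a) * expR (phi x))%R by exact: mbleM.
have maw : mble (fun x => a * w x)%R by exact: mbleM.
have mln1 : mble (fun x => w x * ln (w x) + 1)%R by exact: mbleD.
move: H;rewrite exD//;[|exact: mbleD|by move=> x;exact: addr_ge0].
rewrite exD// ex_cst w1 exD//;[|exact: mbleD|by move=> x;exact: addr_ge0].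
rewrite (exD nu mln1 mea ln10 ea0) (exZ nu mephi (fun=> expR_ge0 _) (expR_ge0 _)).
rewrite (exZ nu mw w0 a0).
rewrite w1 mule1 -addeA => H.
rewrite -(@leeD2rE _ (1 + 1))//;apply: (le_trans H).
rewrite (_ : (c + a)%:E + (1 + 1) = ((c%:E + 1) + 1) + a%:E);last first.
 by rewrite -!EFinD;congr EFin;ring.
rewrite leeD2r// leeD//.
rewrite (letr ((expR (- a))%:E * (expR a)%:E)%E)//.
 by rewrite lee_wpmul2l// lee_fin expR_ge0.
by rewrite -EFinM -expRD addNr expR0.
Qed.
(** On a [nu]-null set [A] the test function [b * \1_A] has Laplace transform 1, so [b * mu A <= c]
    for every [b >= 0]. *)
Lemma DVle_dominates mu nu (c : R) : DVle mu id nu c -> mu `<< nu.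
Proof.
move=> H;apply/null_content_dominatesP => A mA nuA.
have muA : mu A \is a fin_num by exact: fin_num_measure.
rewrite -(fineK muA);congr EFin;apply/eqP;rewrite eq_le fine_ge0 ?measure_ge0// andbT.
apply/ler_addgt0Pl => e e0;rewrite addr0.
have Hb (b : R) : (0 <= b)%R -> (b * fine (mu A) <= c)%R.
 move=> b0.
 have m1 : mble (\1_A : T -> R) by exact: measurable_indic.
 have i0 x : (0 <= \1_A x :> R)%R by [].
 have eb : (0 <= expR b - 1)%R by rewrite subr_ge0 -expR0 ler_expR.
 suff : ex mu (fun x => b * \1_A x)%R <= (c + 0)%:E.
 have E : ex mu \1_A = mu A by rewrite /ex integral_indic// setIT.
 by rewrite (exZ mu m1 i0 b0) E addr0 -{1}(fineK muA) -EFinM lee_fin.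
 apply: (H (fun x => b * \1_A x)%R);first exact: mbleM.
 - by move=> x;rewrite mulr_ge0.
 - by exists b => x;rewrite indicE;case: (_ \in _);rewrite ?mulr1 ?mulr0.
 rewrite expR0 (@eq_ex _ _ _ _ _ (fun x => 1 + (expR b - 1) * \1_A x)%R);last first.
 by move=> x;rewrite indicE;case: (_ \in _);rewrite ?mulr1 ?mulr0 ?expR0;lra.
 rewrite exD//;[|exact: mbleM|by move=> x;rewrite mulr_ge0].
 by rewrite ex_cst exZ// /ex integral_indic// setIT nuA mule0 adde0.
have [c0|c0] := leP c 0%R.
 by have := Hb 1%R ler01;rewrite mul1r;lra.
have := Hb (c / e)%R (ltW (divr_gt0 c0 e0)).
by rewrite mulrAC ler_pdivrMr// ler_pM2l.
Qed.

End RelativeEntropy.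

(** * From the dual form back to the entropy *)

Section Fatou.
Context {R : realType} {disp : measure_display} {T : measurableType disp}.
Local Open Scope ereal_scope.

Lemma limn_einf_ub (u : nat -> \bar R) (b_ : nat -> R) (b : R) n0 :
 (forall n, (n0 <= n)%N -> u n <= (b_ n)%:E) ->
 b_ n @[n --> \oo] --> b -> limn_einf u <= b%:E.
Proof.
move=> ub bb;rewrite limn_einf_lim;apply: lime_le;first exact: is_cvg_einfs.
near=> n;apply/lee_addgt0Pr => e e0.
have [m [mn mn0 bm]] : exists m, [/\ (n <= m)%N, (n0 <= m)%N & (b_ m <= b + e)%R].
 have /cvgrPdist_le /(_ e e0) [N _ HN] := bb.
 exists (maxn N (maxn n n0));split;[by rewrite !leq_max leqnn orbT|by rewrite !leq_max leqnn !orbT|].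
 have := HN (maxn N (maxn n n0)) (leq_maxl _ _);rewrite /= ler_norml;lra.
apply: (letr (u m)).
 by apply: ereal_inf_lbound;exists m.
by apply: (le_trans (ub _ mn0));rewrite -EFinD lee_fin.
Unshelve. all: by end_near. Qed.
Lemma ex_fatou (P : probability T R) (f_ : nat -> T -> R) (f : T -> R)
 (b_ : nat -> R) (b : R) n0 :
 (forall n, mble (f_ n)) -> (forall n x, (0 <= f_ n x)%R) ->
 mble f -> (forall x, (0 <= f x)%R) ->
 {ae P, forall x, f_ n x @[n --> \oo] --> f x} ->
 (forall n, (n0 <= n)%N -> ex P (f_ n) <= (b_ n)%:E) ->
 b_ n @[n --> \oo] --> b -> ex P f <= b%:E.
Proof.
move=> mf_ f_0 mf f0 cf ub bb.
have mE n : mble (EFin \o f_ n) by exact/mbleEFin.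
have := @fatou _ _ _ P setT measurableT (fun n => EFin \o f_ n) mE.
move=> /(_ (fun n x _ => f_0 n x : 0 <= (f_ n x)%:E)).
have -> : \int[P]_x limn_einf (fun n => (EFin \o f_ n) x) = ex P f.
 apply: ae_eq_integral => //.
 - under eq_fun do rewrite limn_einf_lim.
 apply: (emeasurable_fun_cvg (fun n x => einfs (fun n0 => (EFin \o f_ n0) x) n)).
  by move=> n;exact: (measurable_fun_einfs mE).
 by move=> x _;exact: is_cvg_einfs.
 - exact/mbleEFin.
 - apply: filterS cf => x cx _.
 apply: (cvg_limn_einf_sup _).1.
 by apply: continuous_cvg => //;exact: cx.
move/le_trans;apply;exact: (limn_einf_ub ub bb).
Qed.

End Fatou.

Section DVleEnt.
Context {R : realType} {disp : measure_display} {T : measurableType disp}.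
Local Open Scope ereal_scope.
Implicit Types mu nu : probability T R.

(** The optimal test function is [ln w]. It is truncated to [w] between [1 / k] and [k], and shifted
    by [ln k] to become nonnegative; its Laplace transform is then at most [1 + k]. The excess
    [ln (1 + k) - ln k] is at most [1 / k], and Fatou's lemma removes the truncation. *)
Lemma DVle_Ent mu nu (c : R) : DVle mu id nu c -> Ent mu nu <= c%:E.
Proof.
move=> H;have munu := DVle_dominates H.
have [w [mw w0 wE ->]] := density_exists munu.
have mln : mble (fun x => w x * ln (w x))%R.
 by apply: mbleM => //;apply: (mcomp (@measurable_ln R)).
have ln1 x : (-1 <= w x * ln (w x))%R by have := xlnx_ge (w0 x);have := w0 x;lra.
have w1 : ex nu w = 1 by rewrite -(@probability_setT _ _ _ mu) wE.
rewrite integral_shift1// leeBlDr//.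
pose k (n : nat) : R := n.+1%:R.
have k1 n : (1 <= k n)%R by rewrite /k ler1n.
have k0 n : (0 < k n)%R by rewrite /k ltr0n.
pose m n x : R := Num.max (k n)^-1%R (Num.min (w x) (k n)).
have mm n : mble (m n).
 by apply: measurable_maxr => //;exact: measurable_minr.
have m0 n x : (0 < m n x)%R by rewrite lt_max invr_gt0 k0.
have mlm n : mble (fun x => ln (m n x)).
 exact: (mcomp (@measurable_ln R)).
pose psi n x := (w x * ln (m n x) + 1)%R.
have mpsi n : mble (psi n).
 by apply: mbleD => //;exact: mbleM.
have psi0 n x : (0 <= psi n x)%R.
 have := w0 x;rewrite le_eqVlt => /predU1P[wx|wx];first by rewrite /psi -wx mul0r add0r.
 have [w1x|w1x] := leP (w x) 1%R.
 have : (w x * ln (w x) <= w x * ln (m n x))%R.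
  by rewrite ler_wpM2l// ler_ln ?posrE// /m le_max min_l ?lexx ?orbT// (le_trans w1x).
 by have := xlnx_ge (w0 x);rewrite /psi;lra.
 by rewrite /psi addr_ge0// mulr_ge0// ln_ge0// /m le_max le_min k1 andbT (ltW w1x) orbT.
apply: (@ex_fatou _ _ _ nu psi _ (fun n => c + 1 + (k n)^-1)%R _ 0%N) => //.
- exact: mbleD.
- by move=> x;have := ln1 x;lra.
- apply: aeW => x;apply: cvgD;last exact: cvg_cst.
 have := w0 x;rewrite le_eqVlt => /predU1P[wx|wx].
 by rewrite -wx;under eq_fun do rewrite mul0r;rewrite mul0r;exact: cvg_cst.
 apply: cvg_near_cst.
 have [N HN] : exists N : nat, (Num.max (w x) (w x)^-1 <= N%:R)%R.
 exists (Num.bound (Num.max (w x) (w x)^-1)%R).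
 by apply: ltW;apply: archi_boundP;rewrite le_max ltW.
 exists N => // n /= Nn;congr (_ * ln _)%R.
 have kn : (Num.max (w x) (w x)^-1 <= k n)%R.
 by rewrite (le_trans HN)// /k ler_nat (leq_trans Nn).
 move: kn;rewrite ge_max => /andP[k2 k3].
 rewrite /m min_l// max_r// -[leRHS]invrK lef_pV2 ?posrE ?invr_gt0//.
- move=> n _.
 pose phi x := (ln (m n x) + ln (k n))%R.
 have mphi : mble phi by exact: mbleD.
 have phi0 x : (0 <= phi x)%R.
 rewrite /phi -lnM ?posrE// ln_ge0//.
 by rewrite -ler_pdivrMr// mul1r /m le_max lexx.
 have mk x : (m n x <= k n)%R.
 by rewrite /m ge_max ge_min lexx orbT andbT (letr 1%R)// invf_le1.
 have phiM : exists M, forall x, (phi x <= M)%R.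
 by exists (ln (k n) + ln (k n))%R => x;rewrite lerD2r ler_ln ?posrE.
 have Ha : ex nu (fun x => expR (phi x)) <= (expR (ln (1 + k n)))%:E.
 rewrite lnK ?posrE ?addr_gt0// EFinD -(ex_cst nu 1%R) -[X in _ + X]mule1.
 rewrite -w1 -exZ ?(ltW (k0 n))// -exD//;last 2 first.
 - exact: mbleM.
 - by move=> x;rewrite mulr_ge0// ltW.
 apply: ex_le => //.
 + exact: mble_funexpR.
 + by apply: mbleD => //;exact: mbleM.
 + move=> x;rewrite /phi expRD !lnK ?posrE// mulrC.
  have : (m n x <= (k n)^-1 + w x)%R.
  by rewrite /m ge_max lerDl w0 /= ge_min lerDr invr_ge0 (ltW (k0 n)).
  move=> /(ler_wpM2l (ltW (k0 n)));rewrite mulrDr divff// gt_eqF//.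
 have := H phi mphi phi0 phiM _ Ha.
 have mpw : mble (fun x => phi x * w x)%R by exact: mbleM.
 have pw0 x : (0 <= phi x * w x)%R by rewrite mulr_ge0.
 have lk0 : (0 <= ln (k n))%R by rewrite ln_ge0.
 rewrite (ex_density mw w0 wE)// => H1.
 have E : ex nu (fun x => phi x * w x)%R + 1 = ex nu (psi n) + (ln (k n))%:E.
 rewrite -[X in _ = _ + X]mule1 -{2}w1 -(exZ nu mw w0 lk0) -exD//;last 2 first.
 - exact: mbleM.
 - by move=> x;rewrite mulr_ge0.
 rewrite -(ex_cst nu 1%R) -exD//;apply: eq_ex => x.
 by rewrite /psi /phi;ring.
 rewrite -(@leeD2rE _ (ln (k n))%:E)// -E.
 apply: (le_trans (leeD2r _ H1));rewrite -!EFinD lee_fin.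
 have : (ln (1 + k n) <= ln (k n) + (k n)^-1)%R.
 have -> : (1 + k n = k n * (1 + (k n)^-1))%R.
  by rewrite mulrDr mulr1 divff ?gt_eqF// addrC.
 rewrite lnM ?posrE ?addr_gt0 ?invr_gt0// lerD2l.
 by rewrite -ler_expR lnK ?posrE ?addr_gt0 ?invr_gt0// expR_ge1Dx.
 by move: (ln (1 + k n)%R) (ln (k n)) ((k n)^-1)%R => x y z;lra.
- rewrite -[X in _ --> X]addr0;apply: cvgD;first exact: cvg_cst.
 exact: cvg_harmonic.
Qed.

End DVleEnt.

Section BoundedConvergence.
Context {R : realType} {disp : measure_display} {T : measurableType disp}.

Lemma ex_bounded_cvg0 (P : probability T R) (f_ : nat -> T -> R) (B : R) :
 (forall n, mble (f_ n)) -> (forall n x, 0 <= f_ n x) ->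
 (forall n x, f_ n x <= B) -> {ae P, forall x, f_ n x @[n --> \oo] --> 0} ->
 forall e, 0 < e -> exists N, forall n, (N <= n)%N -> (ex P (f_ n) <= e%:E)%E.
Proof.
move=> mf f0 fB cf e e0.
have [] := @dominated_convergence _ _ _ P setT measurableT (fun n => EFin \o f_ n)
 (cst 0%E) (cst B%:E).
- by move=> n;exact/mbleEFin.
- exact: mble_cst.
- apply: filterS cf => x cx _;apply: continuous_cvg => //;exact: cx.
- exact: finite_measure_integrable_cst.
- by apply: aeW => x n _;rewrite /= ger0_norm// lee_fin.
move=> _ _;rewrite integral0 => H.
have /fine_cvgP[_ /cvgrPdist_le /(_ e e0) [N _ HN]] := H.
exists N => n Nn;have := HN n Nn.
have fin : ex P (f_ n) \is a fin_num by exact: (ex_fin_num P (mf n) (f0 n) (fB n)).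
rewrite /= sub0r normrN -(fineK fin) lee_fin;apply: le_trans;exact: ler_norm.
Qed.

End BoundedConvergence.

(** * Reduction to continuous test functions *)

Section ContinuousClass.
Context {R : realType} {N d : nat}.
Local Notation state := (conf N R d).

(** Sequential continuity for coordinatewise convergence: the passage to the limit is along a
    sequence of meshes, path by path. *)
Definition scont (phi : state -> R) : Prop := forall (z : nat -> state) (z0 : state),
 (forall i k, tnth (z n) i 0 k @[n --> \oo] --> tnth z0 i 0 k) ->
 phi (z n) @[n --> \oo] --> phi z0.

Lemma scont_cst c : scont (fun=> c).
Proof. by move=> z z0 _;exact: cvg_cst. Qed.
Lemma scontD f g : scont f -> scont g -> scont (fun x => f x + g x).
Proof. by move=> cf cg z z0 zz;apply: cvgD;[exact: cf|exact: cg]. Qed.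
Lemma scontM f g : scont f -> scont g -> scont (fun x => f x * g x).
Proof. by move=> cf cg z z0 zz;apply: cvgM;[exact: cf|exact: cg]. Qed.
Lemma scontB f g : scont f -> scont g -> scont (fun x => f x - g x).
Proof. by move=> cf cg z z0 zz;apply: cvgB;[exact: cf|exact: cg]. Qed.
Lemma scont_sum (I : Type) (r : seq I) (F : I -> state -> R) :
 (forall i, scont (F i)) -> scont (fun x => \sum_(i <- r) F i x).
Proof.
move=> cF;elim: r => [|i r IH].
 by under eq_fun do rewrite big_nil;exact: scont_cst.
by under eq_fun do rewrite big_cons;exact: scontD.
Qed.
Lemma scont_prod (I : Type) (r : seq I) (F : I -> state -> R) :
 (forall i, scont (F i)) -> scont (fun x => \prod_(i <- r) F i x).
Proof.
move=> cF;elim: r => [|i r IH].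
 by under eq_fun do rewrite big_nil;exact: scont_cst.
by under eq_fun do rewrite big_cons;exact: scontM.
Qed.
Let halflines : set (set R) := [set A | A = setT \/ exists a, A = `]a, +oo[%classic].

Let mble_halflines : @measurable _ R = <<s halflines >>.
Proof.
have H : @measurable _ R = (@RGenOInfty.G R).-sigma.-measurable.
 exact: RGenOInfty.measurableE.
rewrite H;apply/seteqP;split => A mA.
 apply: smallest_sub mA;first exact: smallest_sigma_algebra.
 by move=> B [x ->];apply: sub_sigma_algebra;right;exists x.
apply: smallest_sub mA;first exact: sigma_algebra_measurable.
move=> B [->|[x ->]];first exact: measurableT.
by apply: sub_sigma_algebra;exists x.
Qed.
Let halflinesI : setI_closed halflines.
Proof.
move=> A B [->|[a ->]] [->|[b ->]].
- by left;rewrite setTI.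
- by right;exists b;rewrite setTI.
- by right;exists a;rewrite setIT.
- right;exists (Num.max a b);apply/seteqP;split => x /=;rewrite !in_itv /= !andbT gt_max.
 by move=> [-> ->].
 by move=> /andP[].
Qed.
Let halfline_approx (E : set R) : halflines E -> exists c : nat -> R -> R,
 [/\ forall n, continuous (c n), forall n x, 0 <= c n x <= 1 &
  forall x, c n x @[n --> \oo] --> (\1_E x : R)].
Proof.
case=> [->|[a ->]].
 exists (fun _ _ => 1);split => [n x|n x|x];first exact: cvg_cst.
 by rewrite ler01 lexx.
 by rewrite indicE in_setT;exact: cvg_cst.
(* [y] is the positive part of [x - a], so [1 - 1 / (1 + n y)] vanishes up to [a] and tends to 1
   beyond it. *)
pose y (x : R) := (`|x - a| + (x - a)) / 2.
have y0 x : 0 <= y x.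
 by rewrite /y divr_ge0//;have := ler_norm (a - x);rewrite distrC;lra.
have cy : continuous y.
 move=> x;apply: cvgM;last exact: cvg_cst.
 have cxa : (x0 - a) @[x0 --> x] --> (x - a).
 by apply: cvgB;[exact: cvg_id|exact: cvg_cst].
 by apply: cvgD => //;exact: cvg_norm.
have d0 n x : 0 < 1 + n%:R * y x by apply: ltr_wpDr => //;exact: mulr_ge0.
exists (fun n x => 1 - (1 + n%:R * y x)^-1);split => [n x|n x|x].
- apply: cvgB;first exact: cvg_cst.
 apply: cvgV;first by rewrite gt_eqF.
 by apply: cvgD;[exact: cvg_cst|apply: cvgM;[exact: cvg_cst|exact: cy]].
- rewrite subr_ge0 lerBlDr lerDl invr_ge0 (ltW (d0 n x)) andbT invf_le1//.
 by rewrite lerDl;exact: mulr_ge0.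
- rewrite indicE mem_setE in_itv /= andbT;case: ltP => ax.
 rewrite -[X in _ --> X]subr0;apply: cvgB;first exact: cvg_cst.
 have yx : 0 < y x by rewrite /y gtr0_norm ?subr_gt0//;lra.
 pose K := Num.max 1 (y x)^-1.
 have K1 : 1 <= K by rewrite le_max lexx.
 have Ky : 1 <= K * y x by rewrite -ler_pdivrMr// div1r le_max lexx orbT.
 apply: (@squeeze_cvgr _ _ _ _ (fun=> 0) (fun n => K * harmonic n) (fun n : nat => (1 + n%:R * y x)^-1)).
 - near=> n;rewrite invr_ge0 (ltW (d0 n x)) /= ler_pdivlMr// mulrC ler_pdivrMr//.
  have := ler_wpM2l (ler0n R n) Ky;rewrite -natr1;lra.
 - exact: cvg_cst.
 - by rewrite -[X in _ --> X](mulr0 K);apply: cvgM;[exact: cvg_cst|exact: cvg_harmonic].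
 have -> : y x = 0 by rewrite /y ler0_norm;lra.
 under eq_fun do rewrite mulr0 addr0 invr1 subrr.
 exact: cvg_cst.
Unshelve. all: by end_near. Qed.

Variables P Q : probability state R.

(** The same continuous function must serve for [P] and for [Q], because the dual inequality tests
    both with one function. *)
Let approximable (A : set state) := forall e : R, 0 < e -> exists psi : state -> R,
 [/\ mble psi, scont psi, forall x, 0 <= psi x <= 1,
  (ex P (fun x => `|\1_A x - psi x|)%R <= e%:E)%E &
  (ex Q (fun x => `|\1_A x - psi x|)%R <= e%:E)%E].

Let mabs (A : set state) (psi : state -> R) : measurable A ->
 mble psi -> mble (fun x => `|\1_A x - psi x|).
Proof.
move=> mA mp;apply: mcomp => //.
by apply: measurable_funB => //;exact: measurable_indic.
Qed.
Let approximable_lim (A : set state) (psi_ : nat -> state -> R) : measurable A ->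
 (forall n, mble (psi_ n)) -> (forall n x, 0 <= psi_ n x <= 1) ->
 (forall x, psi_ n x @[n --> \oo] --> (\1_A x : R)) ->
 forall e, 0 < e -> exists n,
 (ex P (fun x => `|\1_A x - psi_ n x|)%R <= e%:E)%E /\
 (ex Q (fun x => `|\1_A x - psi_ n x|)%R <= e%:E)%E.
Proof.
move=> mA mp p01 cp e e0.
have H (P' : probability state R) : exists N, forall n, (N <= n)%N ->
 (ex P' (fun x => `|\1_A x - psi_ n x|)%R <= e%:E)%E.
 apply: (@ex_bounded_cvg0 _ _ _ P' (fun n x => `|\1_A x - psi_ n x|) 1) => //.
 - by move=> n;exact: mabs.
 - move=> n x;have := p01 n x;rewrite ler_norml indicE.
 by case: (_ \in _) => /=;lra.
 - apply: aeW => x;rewrite -(@normr0 _ R^o) -(subrr (\1_A x : R)).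
 by apply: cvg_norm;apply: cvgB;[exact: cvg_cst|exact: cp].
have [n1 h1] := H P;have [n2 h2] := H Q.
exists (maxn n1 n2);split;[apply: h1;exact: leq_maxl|apply: h2;exact: leq_maxr].
Qed.
Let approximable_box A : @tbox R halflines N d A -> approximable A.
Proof.
move=> tA;have mA : measurable A.
 rewrite (@mble_tbox _ halflines N d mble_halflines (or_introl erefl)).
 exact: sub_sigma_algebra.
case: tA mA => E GE -> mA e e0.
have /choice[c Hc] : forall ik : 'I_N * 'I_d, exists c : nat -> R -> R,
 [/\ forall n, continuous (c n), forall n x, 0 <= c n x <= 1 &
  forall x, c n x @[n --> \oo] --> (\1_(E ik.1 ik.2) x : R)].
 by move=> [i k];exact: halfline_approx.
pose psi n (x : state) := \prod_(i < N) \prod_(k < d) c (i, k) n (tnth x i 0 k).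
have mpsi n : mble (psi n).
 have mprod (I : Type) (r : seq I) (F : I -> state -> R) :
  (forall i, mble (F i)) ->
  mble (fun x => \prod_(i <- r) F i x).
 move=> mF;elim: r => [|i r IH].
  by under eq_fun do rewrite big_nil;exact: mble_cst.
 by under eq_fun do rewrite big_cons;exact: mbleM.
 apply: (mprod _ _ (fun i x => \prod_(k < d) c (i, k) n (tnth x i 0 k))) => i.
 apply: (mprod _ _ (fun k x => c (i, k) n (tnth x i 0 k))) => k.
 apply: (mcomp (f := c (i, k) n)).
 by apply: continuous_measurable_fun;have [] := Hc (i, k).
 by apply: mblef_coord;exact: mble_tnth.
have psi01 n x : 0 <= psi n x <= 1.
 apply/andP;split.
 by apply: prodr_ge0 => i _;apply: prodr_ge0 => k _;have [_ /(_ n (tnth x i 0 k))/andP[]] := Hc (i, k).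
 apply: prodr_ile1 => i _;apply/andP;split.
 by apply: prodr_ge0 => k _;have [_ /(_ n (tnth x i 0 k))/andP[]] := Hc (i, k).
 by apply: prodr_ile1 => k _;have [_ /(_ n (tnth x i 0 k))] := Hc (i, k).
have cpsi n : scont (psi n).
 apply: scont_prod => i;apply: scont_prod => k z z0 zz.
 have [cc _ _] := Hc (i, k).
 by apply: continuous_cvg;[exact: cc|exact: zz].
have [] := @approximable_lim _ psi mA mpsi psi01 _ e e0.
 move=> x;rewrite /psi.
 have -> : \1_[set x0 : state | forall i k, E i k (tnth x0 i 0 k)] x =
  \prod_(i < N) \prod_(k < d) (\1_(E i k) (tnth x i 0 k) : R).
 rewrite indicE;case: (boolP (_ \in _)) => [|/negP].
  rewrite inE /= => H;rewrite big1// => i _;rewrite big1// => k _.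
  by rewrite indicE mem_set.
 rewrite inE /= => /existsNP[i /existsNP[k nE]].
 rewrite (bigD1 i)//= (bigD1 k)//= indicE memNset// !mul0r//.
 have cvg_prod (I : Type) (r : seq I) (F : I -> nat -> R) (l : I -> R) :
  (forall i, F i n @[n --> \oo] --> l i) ->
  (\prod_(i <- r) F i n) @[n --> \oo] --> \prod_(i <- r) l i.
 move=> cF;elim: r => [|i r IH].
  by under eq_fun do rewrite big_nil;rewrite big_nil;exact: cvg_cst.
 by under eq_fun do rewrite big_cons;rewrite big_cons;exact: cvgM.
 apply: (cvg_prod _ _ (fun i n => \prod_(k < d) c (i, k) n (tnth x i 0 k))
 (fun i => \prod_(k < d) \1_(E i k) (tnth x i 0 k))) => i.
 apply: (cvg_prod _ _ (fun k n => c (i, k) n (tnth x i 0 k))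
 (fun k => \1_(E i k) (tnth x i 0 k))) => k.
 by have [_ _] := Hc (i, k);apply.
by move=> n [h1 h2];exists (psi n);split.
Qed.
Let approximableC A : approximable A -> approximable (~` A).
Proof.
move=> H e e0;have [psi [mp cp p01 h1 h2]] := H e e0.
have E x : `|\1_(~` A) x - (1 - psi x)| = `|\1_A x - psi x|.
 rewrite distrC !indicE in_setC;case: (_ \in _) => /=;first by rewrite subr0.
 by rewrite addrAC subrr.
exists (fun x => 1 - psi x);split.
- exact: measurable_funB.
- by apply: scontB => //;exact: scont_cst.
- by move=> x;have := p01 x;lra.
- by rewrite (eq_ex _ E).
- by rewrite (eq_ex _ E).
Qed.
Let approximableU A B : measurable A -> measurable B ->
 approximable A -> approximable B -> approximable (A `|` B).
Proof.
move=> mA mB HA HB e e0.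
have [f [mf cf f01 f1 f2]] := HA (e / 2) (divr_gt0 e0 (ltr0Sn R 1)).
have [g [mg cg g01 g1 g2]] := HB (e / 2) (divr_gt0 e0 (ltr0Sn R 1)).
pose h x := f x + g x - f x * g x.
have mh : mble h.
 by apply: measurable_funB;[exact: mbleD|exact: mbleM].
have pw x : `|\1_(A `|` B) x - h x| <= `|\1_A x - f x| + `|\1_B x - g x|.
 have /andP[f0 f1'] := f01 x;have /andP[g0 g1'] := g01 x.
 have nf : `|1 - f x| = 1 - f x by rewrite ger0_norm// subr_ge0.
 have ng : `|1 - g x| = 1 - g x by rewrite ger0_norm// subr_ge0.
 have p1 : 0 <= f x * g x by exact: mulr_ge0.
 have p2 : 0 <= (1 - f x) * (1 - g x) by rewrite mulr_ge0// subr_ge0.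
 have p3 : 0 <= (1 - f x) * g x by rewrite mulr_ge0// subr_ge0.
 have p4 : 0 <= f x * (1 - g x) by rewrite mulr_ge0// subr_ge0.
 rewrite !indicE in_setU /h;case: (_ \in A);case: (_ \in B) => /=;
 rewrite ?sub0r ?normrN ?nf ?ng ?(ger0_norm f0) ?(ger0_norm g0).
 - by rewrite ger0_norm;lra.
 - by rewrite ger0_norm;lra.
 - by rewrite ger0_norm;lra.
 - by rewrite ger0_norm;lra.
have key (P' : probability state R) :
 (ex P' (fun x => `|\1_A x - f x|)%R <= (e / 2)%:E)%E ->
 (ex P' (fun x => `|\1_B x - g x|)%R <= (e / 2)%:E)%E ->
 (ex P' (fun x => `|\1_(A `|` B) x - h x|)%R <= e%:E)%E.
 move=> k1 k2;rewrite [e]splitr EFinD;apply: le_trans (leeD k1 k2).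
 rewrite -exD//;[|exact: mabs|exact: mabs].
 apply: ex_le => //;first by apply: mabs => //;exact: measurableU.
 by apply: mbleD;exact: mabs.
exists h;split => //;[|by move=> x;have := f01 x;have := g01 x;rewrite /h;nra|exact: key|exact: key].
by apply: scontB;[exact: scontD|exact: scontM].
Qed.
(** Dynkin's argument: boxes of half-lines are approximable and stable under intersection,
    complements are immediate, and a countable union is first cut to a finite one, which is close to
    it under both measures. *)
Let approximable_measurable A : measurable A -> approximable A.
Proof.
have GE := @mble_tbox _ halflines N d mble_halflines (or_introl erefl).
have box0 : approximable set0.
 move=> e e0;exists (fun=> 0);split => //;[exact: scont_cst|by move=> _;rewrite lexx ler01| |].
 by rewrite (eq_ex _ (_ : _ =1 fun=> 0)) ?ex_cst ?lee_fin ?ltW// => x;rewrite indic0 subrr normr0.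
 by rewrite (eq_ex _ (_ : _ =1 fun=> 0)) ?ex_cst ?lee_fin ?ltW// => x;rewrite indic0 subrr normr0.
rewrite GE;apply: (dynkin_induction GE) => //.
- by apply: tboxI;exact: halflinesI.
- by rewrite -setC0;exact: approximableC.
- by move=> S _;exact: approximableC.
move=> F mF _ HF.
pose U n := \big[setU/set0]_(k < n) F k.
have mU n : measurable (U n) by apply: bigsetU_measurable.
have HU n : approximable (U n).
 elim: n => [|n IH];first by rewrite /U big_ord0.
 by rewrite /U big_ord_recr /=;apply: approximableU => //;exact: mU.
have mFF : measurable (\bigcup_k F k) by exact: bigcupT_measurable.
move=> e e0;have e2 : 0 < e / 2 by rewrite divr_gt0.
have [] := @approximable_lim _ (fun n => \1_(U n)) mFF _ _ _ (e / 2) e2.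
- by move=> n;exact: measurable_indic.
- by move=> n x;rewrite indicE;case: (_ \in _);rewrite ?lexx ?ler01.
- move=> x;apply: cvg_near_cst.
 case: (boolP (x \in \bigcup_k F k)) => [|xF].
 move=> /[dup] xF;rewrite inE => -[k _ Fk].
 exists k.+1 => // n /= kn;rewrite !indicE xF mem_set//.
 by rewrite /U -bigcup_mkord;exists k.
 apply: nearW => n;rewrite !indicE (negbTE xF) memNset//.
 rewrite /U -bigcup_mkord => -[k _ Fk];move: xF;rewrite notin_setE;apply.
 by exists k.
move=> n [h1 h2];have [psi [mp cp p01 k1 k2]] := HU n (e / 2) e2.
have key (P' : probability state R) :
 (ex P' (fun x => `|\1_(\bigcup_k F k) x - \1_(U n) x|)%R <= (e / 2)%:E)%E ->
 (ex P' (fun x => `|\1_(U n) x - psi x|)%R <= (e / 2)%:E)%E ->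
 (ex P' (fun x => `|\1_(\bigcup_k F k) x - psi x|)%R <= e%:E)%E.
 move=> q1 q2;rewrite [e]splitr EFinD;apply: le_trans (leeD q1 q2).
 have mI : mble (\1_(U n) : state -> R) by exact: measurable_indic.
 rewrite -exD//;[|exact: mabs|exact: mabs].
 apply: ex_le => //;first exact: mabs.
 by apply: mbleD;exact: mabs.
 by move=> x;rewrite (le_trans _ (ler_normD _ _))// addrA subrK.
by exists psi;split => //;exact: key.
Qed.
(** For positive [dl] and nonnegative [y], the integer part of [y / dl] capped at [n]. *)
Let layers (dl y : R) n : R := \sum_(j < n) (((j.+1)%:R * dl <= y)%R)%:R.

Let layersP (dl y : R) n : 0 <= dl -> 0 <= y ->
 [/\ dl * layers dl y n <= y, y <= n.+1%:R * dl -> y <= dl * layers dl y n + dl &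
  n%:R * dl <= y -> layers dl y n = n%:R].
Proof.
move=> dl0 y0;elim: n => [|n [IH1 IH2 IH3]].
 by rewrite /layers big_ord0 mulr0 mul1r add0r;split.
rewrite /layers big_ord_recr /= -/(layers dl y n).
case: (leP (n.+1%:R * dl) y) => h;last first.
 rewrite addr0;split => //.
 by move=> _;apply: IH2;exact: ltW.
rewrite IH3;last by apply: le_trans h;rewrite ler_wpM2r// ler_nat.
rewrite natr1 mulrC;split => // h'.
by apply: (le_trans h');rewrite -[n.+2%:R]natr1 mulrDl mul1r.
Qed.
(** Layer-cake decomposition: [phi] is within [dl] of [dl] times the sum of the indicators of its
    superlevel sets. Since [n * dl = M], an error [e / (2 M)] on each indicator adds up to
    [e / 2]. *)
Lemma scont_approx (phi : state -> R) (M e : R) : mble phi ->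
 (forall x, 0 <= phi x <= M) -> 0 < M -> 0 < e ->
 exists psi, [/\ mble psi, scont psi, forall x, 0 <= psi x <= M,
  (ex P (fun x => `|phi x - psi x|)%R <= e%:E)%E &
  (ex Q (fun x => `|phi x - psi x|)%R <= e%:E)%E].
Proof.
move=> mphi phiM M0 e0.
have [n n0 Hn] : exists2 n : nat, (0 < n)%N & M / n%:R <= e / 2.
 have e2 : 0 < e / 2 by rewrite divr_gt0.
 have h0 : 0 <= M / (e / 2) by rewrite divr_ge0// ltW.
 exists (Num.bound (M / (e / 2))).
 rewrite lt0n;apply/eqP => h;have := archi_boundP h0;rewrite h => h'.
 by have := le_lt_trans h0 h';rewrite ltxx.
 have h := archi_boundP h0.
 have b0 : 0 < (Num.bound (M / (e / 2)))%:R :> R by exact: le_lt_trans h.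
 by rewrite ler_pdivrMr// mulrC -ler_pdivrMr// ltW.
pose dl := M / n%:R.
have nR : 0 < n%:R :> R by rewrite ltr0n.
have dl0 : 0 < dl by exact: divr_gt0.
have ndl : n%:R * dl = M by rewrite /dl mulrC divfK// gt_eqF.
pose A (j : 'I_n) := [set x | j.+1%:R * dl <= phi x].
have mA j : measurable (A j).
 rewrite -[A j]setTI (_ : A j = phi @^-1` `[j.+1%:R * dl, +oo[%classic).
 by apply: mphi => //;exact: measurable_itv.
 by apply/seteqP;split => x /=;rewrite in_itv /= andbT.
have e2 : 0 < e / (2 * M) by rewrite divr_gt0// mulr_gt0.
have /choice[psi_ Hpsi] := fun j => @approximable_measurable _ (mA j) (e / (2 * M)) e2.
pose psi x := dl * \sum_(j < n) psi_ j x.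
have mpsi : mble psi.
 apply: mbleM => //;apply: (@measurable_sum _ _ _ _ _ _ psi_) => j.
 by have [] := Hpsi j.
have pw x : `|phi x - psi x| <= dl + \sum_(j < n) dl * `|\1_(A j) x - psi_ j x|.
 have /andP[y0 yM] := phiM x.
 have [h1 h2 _] := @layersP dl (phi x) n (ltW dl0) y0.
 have {}h2 : phi x <= dl * layers dl (phi x) n + dl.
 by apply: h2;rewrite -natr1 mulrDl mul1r ndl (le_trans yM)// lerDl ltW.
 have -> : phi x - psi x = (phi x - dl * layers dl (phi x) n) +
 \sum_(j < n) dl * (\1_(A j) x - psi_ j x).
 rewrite -mulr_sumr sumrB mulrBr /psi addrA;congr (_ - _).
 rewrite -[LHS](subrK (dl * layers dl (phi x) n));congr (_ + dl * _).
 apply: eq_bigr => j _;rewrite indicE;congr (_%:R);congr nat_of_bool.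
 by apply/idP/idP => [H|];[rewrite inE|rewrite inE].
 apply: (le_trans (ler_normD _ _));apply: lerD.
 by rewrite ger0_norm ?subr_ge0// lerBlDl.
 apply: (le_trans (ler_norm_sum _ _ _));apply: ler_sum => j _.
 by rewrite normrM gtr0_norm.
have key (P' : probability state R) :
 (forall j, (ex P' (fun x => `|\1_(A j) x - psi_ j x|)%R <= (e / (2 * M))%:E)%E) ->
 (ex P' (fun x => `|phi x - psi x|)%R <= e%:E)%E.
 move=> HP.
 have mj j : mble (fun x => `|\1_(A j) x - psi_ j x|).
 by apply: mabs => //;have [] := Hpsi j.
 apply: (letr (ex P' (fun x => dl + \sum_(j < n) dl * `|\1_(A j) x - psi_ j x|)%R)).
 apply: ex_le => //.
  by apply: mcomp => //;exact: measurable_funB.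
 apply: mbleD => //.
 apply: (@measurable_sum _ _ _ _ _ _ (fun j x => dl * `|\1_(A j) x - psi_ j x|)) => j.
 by apply: mbleM => //;exact: mj.
 have dj0 j x : 0 <= dl * `|\1_(A j) x - psi_ j x| by rewrite mulr_ge0// ltW.
 have mdj j : mble (fun x => dl * `|\1_(A j) x - psi_ j x|).
 by apply: mbleM => //;exact: mj.
 have msum : mble (fun x => \sum_(j < n) dl * `|\1_(A j) x - psi_ j x|).
 by apply: (@measurable_sum _ _ _ _ _ _ (fun j x => dl * `|\1_(A j) x - psi_ j x|)) => j.
 rewrite (exD P' (f := fun=> dl) _ msum)//;[|by move=> _;exact: ltW|by move=> x;exact: sumr_ge0].
 rewrite ex_cst ex_sum//.
 apply: (letr ((e / 2)%:E + \sum_(j < n) (dl * (e / (2 * M)))%:E)%E).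
 apply: leeD;first by rewrite lee_fin.
 have Hj j : (ex P' (fun x => dl * `|\1_(A j) x - psi_ j x|)%R <= (dl * (e / (2 * M)))%:E)%E.
  rewrite (exZ P' (mj j))//;last exact: ltW.
  by rewrite (EFinM dl) lee_wpmul2l// lee_fin ltW.
 by elim/big_ind2: _ => // *;exact: leeD.
 rewrite sumEFin -EFinD lee_fin big_const_ord iter_addr_0.
 have -> : dl * (e / (2 * M)) *+ n = e / 2.
 by rewrite -mulrnAl -[dl *+ n]mulr_natl ndl;field;rewrite gt_eqF.
 lra.
exists psi;split => //.
- apply: scontM;first exact: scont_cst.
 by apply: scont_sum => j;have [] := Hpsi j.
- move=> x;apply/andP;split.
 by apply: mulr_ge0;[exact: ltW|apply: sumr_ge0 => j _;have [_ _ /(_ x)/andP[]] := Hpsi j].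
 rewrite -ndl /psi mulrC;apply: ler_wpM2r;first exact: ltW.
 rewrite -[X in _ <= X%:R](card_ord n) -sum1_card natr_sum;apply: ler_sum => j _.
 by have [_ _ /(_ x)/andP[]] := Hpsi j.
- by apply: key => j;have [] := Hpsi j.
- by apply: key => j;have [] := Hpsi j.
Qed.
Lemma DVle_scont (c : R) :
 (forall phi : state -> R, mble phi -> (forall x, 0 <= phi x) ->
 (exists M, forall x, phi x <= M) -> scont phi ->
 forall a : R, (ex Q (fun x => expR (phi x)) <= (expR a)%:E)%E ->
  (ex P phi <= (c + a)%:E)%E) -> DVle P id Q c.
Proof.
move=> H phi mphi phi0 [M0 phiM0] a Ha.
pose M := Num.max M0 1.
have M1 : 0 < M by rewrite lt_max ltr01 orbT.
have phiM x : 0 <= phi x <= M by rewrite phi0 le_max phiM0.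
apply/lee_addgt0Pr => e1 e10;rewrite -EFinD.
(* Replacing [phi] by [psi] costs [e] in the mean under [P], and raises the Laplace parameter [a] by
   at most [expR (M - a) * e] because the exponential is [expR M]-Lipschitz below [M]. The two add
   up to [e1]. *)
pose e := e1 / (1 + expR (M - a)).
have E0 : 0 < 1 + expR (M - a) by rewrite addr_gt0// expR_gt0.
have e0 : 0 < e by exact: divr_gt0.
have [psi [mpsi cpsi psiM k1 k2]] := scont_approx mphi phiM M1 e0.
have psi0 x : 0 <= psi x by have /andP[] := psiM x.
have mabsd : mble (fun x => `|phi x - psi x|).
 by apply: mcomp => //;exact: measurable_funB.
have Hpsi : (ex P psi <= (c + (a + expR (M - a) * e))%:E)%E.
 apply: H => //;first by exists M => x;have /andP[] := psiM x.
 have pw x : expR (psi x) <= expR (phi x) + expR M * `|phi x - psi x|.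
 have /andP[_ pM] := psiM x.
 have h1 : expR (psi x) - expR (phi x) <= expR (psi x) * `|phi x - psi x|.
  have h := expR_ge1Dx (phi x - psi x).
  have -> : expR (phi x) = expR (psi x) * expR (phi x - psi x).
  by rewrite -expRD addrC subrK.
  rewrite -{1}[expR (psi x)]mulr1 -mulrBr ler_wpM2l ?expR_ge0//.
  have := ler_norm (psi x - phi x);rewrite distrC;lra.
 rewrite addrC -lerBlDr;apply: (le_trans h1);apply: ler_wpM2r => //.
 by rewrite ler_expR.
 have mE : mble (fun x => expR (phi x)) by exact: mble_funexpR.
 have mE' : mble (fun x => expR (psi x)) by exact: mble_funexpR.
 have mM : mble (fun x => expR M * `|phi x - psi x|) by exact: mbleM.
 apply: (letr (ex Q (fun x => expR (phi x) + expR M * `|phi x - psi x|)%R)).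
 apply: ex_le => //;exact: mbleD.
 have M0' x : 0 <= expR M * `|phi x - psi x| by rewrite mulr_ge0// expR_ge0.
 rewrite (exD Q mE mM)//.
 rewrite (exZ Q mabsd (fun=> normr_ge0 _) (expR_ge0 M)).
 apply: (letr (expR a + expR M * e)%:E).
 by rewrite EFinD (EFinM (expR M));apply: leeD => //;rewrite lee_wpmul2l// lee_fin expR_ge0.
 rewrite lee_fin expRD.
 have -> : expR a + expR M * e = expR a * (1 + expR (M - a) * e).
 by rewrite mulrDr mulr1 mulrA -expRD addrCA subrr addr0.
 by rewrite ler_wpM2l ?expR_ge0// expR_ge1Dx.
have -> : ex P (phi \o id) = ex P phi by [].
apply: (letr (ex P (fun x => psi x + `|phi x - psi x|)%R)).
 apply: ex_le => //;first exact: mbleD.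
 by move=> x;have := ler_norm (phi x - psi x);lra.
rewrite exD//;apply: le_trans (leeD Hpsi k1) _;rewrite -EFinD lee_fin.
have : e + expR (M - a) * e = e1.
 by rewrite -{1}[e]mul1r -mulrDl mulrC /e divfK// gt_eqF.
lra.
Qed.

End ContinuousClass.

Lemma cvg_expr {R : realType} (u : nat -> R) (l : R) p :
 u n @[n --> \oo] --> l -> (u n ^+ p) @[n --> \oo] --> l ^+ p.
Proof.
move=> ul;elim: p => [|p IH].
 by under eq_fun do rewrite expr0;rewrite expr0;exact: cvg_cst.
by under eq_fun do rewrite exprS;rewrite exprS;exact: cvgM.
Qed.

(** * Moments from a logarithmic Sobolev inequality *)

Section SmoothExpressions.
Context {R : realType} {d : nat}.
Implicit Types (f g : 'rV[R]_d -> R).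

(** A syntactic class stable under partial derivatives, so that membership gives differentiability
    at every order by one induction. *)
Inductive sexpr : ('rV[R]_d -> R) -> Prop :=
| sexpr_cst c : sexpr (fun=> c)
| sexpr_coord k : sexpr (fun x => x 0 k)
| sexprD f g : sexpr f -> sexpr g -> sexpr (fun x => f x + g x)
| sexprM f g : sexpr f -> sexpr g -> sexpr (fun x => f x * g x)
| sexprV f : sexpr f -> (forall x, f x != 0) -> sexpr (fun x => (f x)^-1).

Lemma sexpr_differentiable f x : sexpr f -> differentiable f x.
Proof.
move=> ef;elim: ef x => {f}
 [c|k|f g _ df _ dg|f g _ df _ dg|f _ df f0] x.
- exact: differentiable_cst.
- exact: differentiable_coord.
- exact: differentiableD.
- exact: differentiableM.
- exact: differentiableV.
Qed.
Lemma is_derive_coord (k j : 'I_d) (x : 'rV[R]_d) :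
 is_derive x (delta_mx 0 k) (fun y : 'rV[R]_d => y 0 j) ((j == k)%:R : R).
Proof.
have df : differentiable (fun y : 'rV[R]_d => y 0 j) x by exact: differentiable_coord.
apply: DeriveDef;first exact: diff_derivable.
rewrite /derive;apply: cvg_lim => //=.
apply: (@cvg_trans _ (cst ((j == k)%:R : R) h @[h --> 0^']));last exact: cvg_cst.
apply: near_eq_cvg;near=> h.
have h0 : h != 0 by near: h;exact: nbhs_dnbhs_neq.
by rewrite !mxE /= addrK /GRing.scale /= mulrA mulVf// mul1r.
Unshelve. all: by end_near. Qed.
Lemma sexpr_measurable f : sexpr f -> mble f.
Proof.
move=> ef;apply: continuous_measurable_rV => x.
by apply: differentiable_continuous;exact: sexpr_differentiable.
Qed.
Lemma sexpr_partial k f : sexpr f -> sexpr (partial k f).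
Proof.
elim => {f} [c|j|f g ef df eg dg|f g ef df eg dg|f ef df f0].
- rewrite (_ : partial k _ = fun=> 0);first exact: sexpr_cst.
 by apply/funext => x;exact: derive_cst.
- rewrite (_ : partial k _ = fun=> (j == k)%:R);first exact: sexpr_cst.
 by apply/funext => x;have := is_derive_coord k j x => H;rewrite /partial derive_val.
- rewrite (_ : partial k _ = fun x => partial k f x + partial k g x);first exact: sexprD.
 by apply/funext => x;apply: deriveD;apply/diff_derivable/sexpr_differentiable.
- rewrite (_ : partial k _ = fun x => f x * partial k g x + g x * partial k f x).
 by apply: sexprD;exact: sexprM.
 by apply/funext => x;apply: deriveM;apply/diff_derivable/sexpr_differentiable.
- rewrite (_ : partial k _ = fun x => (-1 * ((f x)^-1 * (f x)^-1)) * partial k f x).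
 apply: sexprM => //;apply: sexprM;first exact: sexpr_cst.
 by apply: sexprM;exact: sexprV.
 apply/funext => x;rewrite /partial deriveV//;last exact/diff_derivable/sexpr_differentiable.
 by rewrite mulN1r expr2 invfM.
Qed.
Lemma sexpr_smooth f : sexpr f -> smooth f.
Proof.
move=> ef s x;apply: sexpr_differentiable.
by elim: s => //= k s IH;exact: sexpr_partial.
Qed.
Lemma sexprX f p : sexpr f -> sexpr (fun x => f x ^+ p).
Proof.
move=> ef;elim: p => [|p IH].
 by under eq_fun do rewrite expr0;exact: sexpr_cst.
by under eq_fun do rewrite exprS;exact: sexprM.
Qed.
Lemma sexpr_sum n (F : 'I_n -> 'rV[R]_d -> R) : (forall i, sexpr (F i)) ->
 sexpr (fun x => \sum_(i < n) F i x).
Proof.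
elim: n F => [|n IH] F eF.
 by under eq_fun do rewrite big_ord0;exact: sexpr_cst.
by under eq_fun do rewrite big_ord_recl;apply: sexprD => //;exact: IH.
Qed.
Lemma enorm_sqr_sum (x : 'rV[R]_d) : enorm x ^+ 2 = \sum_(k < d) x 0 k * x 0 k.
Proof. by rewrite enorm_sqr. Qed.
Lemma sexpr_sqr : sexpr (fun x : 'rV[R]_d => enorm x ^+ 2).
Proof.
under eq_fun do rewrite enorm_sqr_sum;apply: sexpr_sum => k.
by apply: sexprM;exact: sexpr_coord.
Qed.
Lemma is_derive_sqr (k : 'I_d) (x : 'rV[R]_d) :
 is_derive x (delta_mx 0 k) (fun y : 'rV[R]_d => enorm y ^+ 2) (2 * x 0 k).
Proof.
have H (j : 'I_d) : is_derive x (delta_mx 0 k) (fun y : 'rV[R]_d => y 0 j * y 0 j)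
 (x 0 j *: ((j == k)%:R : R) + x 0 j *: ((j == k)%:R : R)).
 by have h := is_derive_coord k j x;exact: (is_deriveM h h).
have := is_derive_sum H.
rewrite (_ : \sum_(j < d) _ = fun y : 'rV[R]_d => enorm y ^+ 2);last first.
 by apply/funext => y;rewrite enorm_sqr_sum fct_sumE.
rewrite (_ : \sum_(j < d) _ = 2 * x 0 k)//.
rewrite (bigD1 k)//= big1 ?addr0 => [|j jk];last first.
 by rewrite (negbTE jk) scaler0 addr0.
by rewrite eqxx /GRing.scale /= mulr1;ring.
Qed.

End SmoothExpressions.

Section LogSobolevMoments.
Context {R : realType} {d : nat}.
Variables (mu : probability 'rV[R]_d R) (c : R).
Hypothesis lsi : log_sobolev mu c.

(** A bounded smooth substitute for [1 + |x|^2], with values between 1 and [1 / e] when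
    [0 < e <= 1], which increases to it as [e] goes to 0. *)
Let weight (e : R) (x : 'rV[R]_d) : R :=
 (1 + enorm x ^+ 2) * (1 + e * enorm x ^+ 2)^-1.

Section weight.
Variable e : R.
Hypothesis e01 : 0 < e <= 1.

Let e0 : 0 < e. Proof. by case/andP: e01. Qed.
Let den0 (x : 'rV[R]_d) : 0 < 1 + e * enorm x ^+ 2.
Proof. by apply: ltr_wpDr => //;apply: mulr_ge0;[exact: ltW|exact: sqr_ge0]. Qed.
Lemma weight_ge1 x : 1 <= weight e x.
Proof.
rewrite /weight ler_pdivlMr// mul1r lerD2l ler_piMl ?sqr_ge0//.
by case/andP: e01.
Qed.
Let weight_gt0 x : 0 < weight e x.
Proof. exact: lt_le_trans (weight_ge1 x). Qed.
Let weight_le x : weight e x <= e^-1.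
Proof.
rewrite /weight ler_pdivrMr// mulrDr mulr1 mulrA mulVf ?gt_eqF// mul1r lerD2r.
by rewrite invf_ge1//;case/andP: e01.
Qed.
Let is_derive_weight (k : 'I_d) (x : 'rV[R]_d) :
 is_derive x (delta_mx 0 k) (weight e)
 ((1 - e) * (2 * x 0 k) / (1 + e * enorm x ^+ 2) ^+ 2).
Proof.
have ds := is_derive_sqr k x.
have d1 : is_derive x (delta_mx 0 k) (fun y : 'rV[R]_d => 1 + enorm y ^+ 2) (0 + 2 * x 0 k).
 by apply: (@is_deriveD _ _ _ (cst (1 : R)) (fun y : 'rV[R]_d => enorm y ^+ 2)).
have d2 : is_derive x (delta_mx 0 k) (fun y : 'rV[R]_d => 1 + e * enorm y ^+ 2)
 (0 + e * (2 * x 0 k)).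
 by apply: (@is_deriveD _ _ _ (cst (1 : R)) (e \*: (fun y : 'rV[R]_d => enorm y ^+ 2))).
have d3 : is_derive x (delta_mx 0 k) (fun y : 'rV[R]_d => (1 + e * enorm y ^+ 2)^-1)
 (- (1 + e * enorm x ^+ 2) ^- 2 * (0 + e * (2 * x 0 k))).
 apply: DeriveDef;first by apply: derivableV;[rewrite gt_eqF|exact: ex_derive].
 have dd2 : derivable (fun y : 'rV[R]_d => 1 + e * enorm y ^+ 2) x (delta_mx 0 k) by exact: ex_derive.
 by rewrite (deriveV _ dd2) ?gt_eqF// (@derive_val _ _ _ _ _ _ _ d2).
rewrite (_ : (1 - e) * (2 * x 0 k) / (1 + e * enorm x ^+ 2) ^+ 2 =
 (1 + enorm x ^+ 2) *: (- (1 + e * enorm x ^+ 2) ^- 2 * (0 + e * (2 * x 0 k))) +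
 (1 + e * enorm x ^+ 2)^-1 *: (0 + 2 * x 0 k));first exact: (is_deriveM d1 d3).
rewrite /GRing.scale /=;field.
by rewrite gt_eqF.
Qed.

Variable p : nat.
Let f (x : 'rV[R]_d) := weight e x ^+ p.

Let f_ge1 x : 1 <= f x. Proof. exact: exprn_ege1 (weight_ge1 x). Qed.
Let f_gt0 x : 0 < f x. Proof. exact: exprn_gt0. Qed.
Let f_le x : f x <= e^-1 ^+ p.
Proof. by apply: lerXn2r => //;rewrite nnegrE ltW// invr_gt0. Qed.
Let weight_sexpr : sexpr (weight e).
Proof.
apply: sexprM;first by apply: sexprD;[exact: sexpr_cst|exact: sexpr_sqr].
apply: sexprV;last by move=> x;rewrite gt_eqF.
apply: sexprD;first exact: sexpr_cst.
by apply: sexprM;[exact: sexpr_cst|exact: sexpr_sqr].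
Qed.
Let f_sexpr : sexpr f. Proof. exact: sexprX. Qed.
Lemma weight_measurable : mble f. Proof. exact: sexpr_measurable. Qed.
Let mf := weight_measurable.

Let f_smooth : smooth f. Proof. exact: sexpr_smooth. Qed.
Let grad_f x : grad f x = (p%:R * weight e x ^+ p.-1 *
 ((1 - e) * 2 / (1 + e * enorm x ^+ 2) ^+ 2)) *: x.
Proof.
apply/rowP => k;rewrite !mxE /partial.
have h := is_derive_weight k x.
have := is_deriveX p h;rewrite exprfctE => H.
rewrite (_ : f = fun y => weight e y ^+ p)// derive_val /GRing.scale /=;ring.
Qed.
(** The gradient of the logarithm of [weight] has norm at most 1 whatever [e] is, so the right-hand
    side of the logarithmic Sobolev inequality is controlled by [f] itself, uniformly in the
    regularization. *)
Let grad_f_le x : enorm (grad f x) ^+ 2 / f x <= p%:R ^+ 2 * f x.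
Proof.
rewrite grad_f enormZ ler_pdivrMr// -[X in _ <= X]mulrA -expr2 -exprMn.
apply: lerXn2r;rewrite ?nnegrE.
- by apply: mulr_ge0 => //;exact: enorm_ge0.
- by apply: mulr_ge0 => //;exact: ltW.
have [p0|p0] := posnP p;first by rewrite p0 !mul0r normr0 mul0r.
rewrite !normrM normr_nat -!mulrA ler_wpM2l//.
rewrite /f -[in X in _ <= X](prednK p0) [weight e x ^+ p.-1.+1]exprSr ger0_norm ?exprn_ge0//;last exact: ltW.
rewrite ler_wpM2l ?exprn_ge0//;first exact: ltW.
have /andP[_ e1] := e01.
have s0 := enorm_ge0 x;have dx := den0 x.
rewrite ger0_norm ?subr_ge0// ger0_norm// normfV ger0_norm ?sqr_ge0//.
set s := enorm x in s0 dx *.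
rewrite (_ : (1 - e) * (2 * ((1 + e * s ^+ 2) ^- 2 * s)) =
 ((1 - e) * 2 * s) / (1 + e * s ^+ 2) ^+ 2);last by ring.
rewrite ler_pdivrMr ?exprn_gt0// /weight -/s.
rewrite (_ : (1 + s ^+ 2) / (1 + e * s ^+ 2) * (1 + e * s ^+ 2) ^+ 2 =
 (1 + e * s ^+ 2) * (1 + s ^+ 2));last by field;rewrite gt_eqF.
have h1 : 0 <= e * s by rewrite mulr_ge0// ltW.
have h2 : 0 <= (1 - s) ^+ 2 by exact: sqr_ge0.
have h3 : 0 <= e * s ^+ 2 by rewrite mulr_ge0 ?sqr_ge0// ltW.
have h4 : 0 <= (e * s ^+ 2) * (1 + s ^+ 2) by rewrite mulr_ge0// addr_ge0 ?sqr_ge0.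
rewrite !expr2 in h2 h3 h4 *;nra.
Qed.
(** The logarithmic Sobolev inequality bounds the entropy of [f] by [p^2 |c|] times its mean [I].
    Tested against [a] times the indicator of the complement of a ball, whose Laplace transform is
    at most 2, it shows that the part of [f] outside the ball has integral at most [I / 2]: the
    factor 2 in [a] is chosen for that. Inside the ball [f] is at most [(1 + rr^2)^p]. *)
Lemma weight_moment (rr : R) :
 (expR (2 * (p%:R ^+ 2 * `|c| + 1)) * fine (mu [set x | rr < enorm x]) <= 1)%R ->
 (ex mu f <= (2 * (1 + rr ^+ 2) ^+ p)%:E)%E.
Proof.
move=> Hr;set a := 2 * (p%:R ^+ 2 * `|c| + 1) in Hr.
have a0 : 0 <= a by rewrite mulr_ge0// addr_ge0// mulr_ge0// sqr_ge0.
pose A := [set x : 'rV[R]_d | rr < enorm x].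
have mA : measurable A.
 rewrite -[A]setTI (_ : A = (@enorm R d) @^-1` `]rr, +oo[%classic).
 by apply: mble_enorm => //;exact: measurable_itv.
 by apply/seteqP;split => x /=;rewrite in_itv /= andbT.
have fin : ex mu f \is a fin_num.
 by apply: (ex_fin_num mu mf _ f_le) => x;exact: ltW.
pose I := fine (ex mu f).
have IE : ex mu f = I%:E by rewrite fineK.
have I1 : 1 <= I.
 rewrite -lee_fin -IE -(ex_cst mu 1);apply: ex_le;[exact: mble_cst|exact: mf|by move=> _;exact: ler01|exact: f_ge1].
have I0 : 0 < I by exact: lt_le_trans I1.
have mln : mble (fun x => f x * ln (f x)).
 by apply: mbleM => //;apply: (mcomp (@measurable_ln R)).
have ln0 x : 0 <= f x * ln (f x).
 by apply: mulr_ge0;[exact: ltW|exact: ln_ge0].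
have lnB x : f x * ln (f x) <= e^-1 ^+ p * ln (e^-1 ^+ p).
 have f1 : 1 <= e^-1 ^+ p by apply: le_trans (f_le x).
 apply: ler_pM => //;[exact: ltW|exact: ln_ge0|].
 by rewrite ler_ln// posrE//;exact: lt_le_trans f1.
have finl : ex mu (fun x => f x * ln (f x)) \is a fin_num by exact: (ex_fin_num mu mln ln0 lnB).
pose L := fine (ex mu (fun x => f x * ln (f x))).
have LE : ex mu (fun x => f x * ln (f x)) = L%:E by rewrite fineK.
have H1 : L - I * ln I <= `|c| * (p%:R ^+ 2 * I).
 have fi : mu.-integrable setT (fun x => (f x)%:E).
 by apply: ex_integrable => //;[move=> x;exact: ltW|rewrite IE ltry].
 have li : mu.-integrable setT (fun x => (f x * ln (f x))%:E).
 by apply: (ex_integrable mln) => //;rewrite LE ltry.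
 have := lsi f_smooth f_gt0 fi li;cbv zeta.
 have -> : \int[mu]_x f x = I by [].
 rewrite -/(ex mu (fun x => f x * ln (f x))) LE -EFinB => H.
 rewrite -lee_fin;apply: le_trans H _.
 have mg : mble (fun x => enorm (grad f x) ^+ 2 / f x).
 apply: sexpr_measurable;apply: sexprM;last by apply: sexprV => // x;rewrite gt_eqF.
 under eq_fun do rewrite enorm_sqr_sum;apply: sexpr_sum => k.
 rewrite (_ : (fun x => _) = fun x => partial k f x * partial k f x).
  by apply: sexprM;exact: sexpr_partial.
 by apply/funext => x;rewrite !mxE.
 have g0 x : 0 <= enorm (grad f x) ^+ 2 / f x by rewrite divr_ge0 ?sqr_ge0// ltW.
 have K : (ex mu (fun x => enorm (grad f x) ^+ 2 / f x)%R <= (p%:R ^+ 2 * I)%:E)%E.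
 rewrite EFinM -IE -exZ ?sqr_ge0//;last by move=> x;exact: ltW.
 by apply: ex_le;[exact: mg|apply: mbleM;[exact: mble_cst|exact: mf]|exact: g0|exact: grad_f_le].
 have G0 : (0 <= ex mu (fun x => enorm (grad f x) ^+ 2 / f x)%R)%E by exact: ex_ge0.
 apply: (letr (`|c|%:E * ex mu (fun x => enorm (grad f x) ^+ 2 / f x)%R)%E).
 by apply: lee_wpmul2r => //;rewrite lee_fin ler_norm.
 by rewrite EFinM lee_wpmul2l// lee_fin.
pose phi x := a * \1_A x.
have mphi : mble phi by apply: mbleM => //;exact: measurable_indic.
have phi0 x : 0 <= phi x by apply: mulr_ge0 => //;rewrite indicE;case: (_ \in _).
have Ephi : (ex mu (fun x => expR (phi x)) <= 2%:E)%E.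
 have P x : expR (phi x) <= 1 + expR a * \1_A x.
 rewrite /phi indicE;case: (_ \in _);first by rewrite !mulr1 lerDr.
 by rewrite !mulr0 addr0 expR0.
 have mI : mble (fun x => expR a * \1_A x).
 by apply: mbleM => //;exact: measurable_indic.
 have I0' x : 0 <= (\1_A x : R) by rewrite indicE;case: (_ \in _).
 apply: (letr (ex mu (fun x => 1 + expR a * \1_A x)%R)).
 apply: ex_le => //;first exact: mble_funexpR.
 exact: mbleD.
 have I0'' x : 0 <= expR a * \1_A x by rewrite mulr_ge0// expR_ge0.
 rewrite (exD mu (f := fun=> 1))//.
 rewrite ex_cst (exZ mu (measurable_indic mA) I0' (expR_ge0 a)).
 rewrite /ex integral_indic// setIT.
 have Af : (mu A : \bar R) \is a fin_num by exact: fin_num_measure.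
 apply: (letr (1 + (expR a)%:E * (fine (mu A))%:E)%E);first by rewrite fineK.
 by rewrite -EFinM -EFinD lee_fin -[leRHS]/(1 + 1) lerD2l.
have pw x : f x * phi x + (f x + ln I * f x) <=
 f x * ln (f x) + (ln 2 * f x + I / 2 * expR (phi x)).
 have fx := f_gt0 x.
 have := expR_ge1Dx (phi x - (ln (f x) - ln I + ln 2)).
 rewrite expRD opprD opprB expRD expRN lnK ?posrE// expRB lnK ?posrE// lnK ?posrE// => h.
 have := ler_wpM2l (ltW fx) h.
 have -> : f x * (expR (phi x) * (I / f x / 2)) = I / 2 * expR (phi x).
 by field;rewrite gt_eqF.
 lra.
have mfp : mble (fun x => f x * phi x) by exact: mbleM.
have mep := mble_funexpR mphi.
have fp0 x : 0 <= f x * phi x by apply: mulr_ge0 => //;exact: ltW.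
have fpB x : f x * phi x <= e^-1 ^+ p * a.
 apply: ler_pM => //;first exact: ltW.
 by rewrite /phi indicE;case: (_ \in _);rewrite ?mulr1 ?mulr0.
have finp : ex mu (fun x => f x * phi x) \is a fin_num by exact: (ex_fin_num mu mfp fp0 fpB).
pose Q := fine (ex mu (fun x => f x * phi x)).
have QE : ex mu (fun x => f x * phi x) = Q%:E by rewrite fineK.
have f0' x : 0 <= f x by exact: ltW.
have lnI0 : 0 <= ln I by exact: ln_ge0.
have ln20 : 0 <= ln 2 :> R by apply: ln_ge0;rewrite ler1n.
have H2 : Q + (I + ln I * I) <= L + (ln 2 * I + I / 2 * 2).
 have mc k : mble (fun x => k * f x) by exact: mbleM.
 have := ex_le mu (f := fun x => f x * phi x + (f x + ln I * f x))
 (g := fun x => f x * ln (f x) + (ln 2 * f x + I / 2 * expR (phi x))).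
 rewrite !exD//;last first.
 all: try by move=> x;rewrite ?addr_ge0 ?mulr_ge0 ?expR_ge0// ltW.
 all: try by do ?apply: mbleD => //;apply: mbleM.
 rewrite !exZ//;last by rewrite divr_ge0// ltW.
 rewrite IE QE LE => /(_ _ _ _ pw) h.
 have {}h := h _ _ _.
 rewrite -lee_fin;apply: le_trans (h _ _ _) _.
 - by do ?apply: mbleD => //;apply: mbleM.
 - by do ?apply: mbleD => //;apply: mbleM.
 - by move=> x;rewrite !addr_ge0 ?mulr_ge0.
 rewrite !EFinD;apply: leeD => //;apply: leeD => //.
 by rewrite [X in (_ <= X)%E]EFinM lee_wpmul2l// lee_fin divr_ge0// ltW.
have ln2 : ln 2 <= 1 :> R.
 have h : -1 < 1 :> R by lra.
 by have := le_ln1Dx h;apply: le_trans;apply: eqW.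
have H3 : Q <= a / 2 * I.
 have : ln 2 * I <= I by rewrite ler_piMl// ltW.
 rewrite /a;have : ln I * I = I * ln I by rewrite mulrC.
 move: H1 H2;lra.
pose B := (1 + rr ^+ 2) ^+ p.
have B0 : 0 <= B by rewrite exprn_ge0// addr_ge0// sqr_ge0.
have H4 : a * I <= Q + a * B.
 rewrite -lee_fin EFinM -IE EFinD -QE -(ex_cst mu (a * B)) -exZ// -exD//;last first.
 by move=> _;exact: mulr_ge0.
 apply: ex_le => //;[by apply: mbleM|by apply: mbleD|by move=> x;rewrite mulr_ge0|].
 move=> x;rewrite /phi indicE;case: (boolP (_ \in _)) => [_|].
 by rewrite mulr1 mulrC lerDl mulr_ge0.
 rewrite notin_setE /A /= => /negP;rewrite -leNgt => xr.
 rewrite !mulr0 add0r ler_wpM2l//;apply: lerXn2r;rewrite ?nnegrE;[exact: ltW|by rewrite addr_ge0// sqr_ge0|].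
 rewrite /weight ler_pdivrMr//.
 have : enorm x ^+ 2 <= rr ^+ 2.
 by rewrite lerXn2r ?nnegrE ?enorm_ge0// (le_trans _ xr)// enorm_ge0.
 have h0 : 0 <= e * enorm x ^+ 2 by rewrite mulr_ge0 ?sqr_ge0// ltW.
 have := mulr_ge0 h0 (addr_ge0 ler01 (sqr_ge0 rr));lra.
rewrite IE lee_fin -/B.
have a1 : 0 < a by rewrite /a mulr_gt0// ltr_wpDl// mulr_ge0 ?sqr_ge0.
rewrite -(ler_pM2l a1);lra.
Qed.

End weight.

(** The radius is fixed by the tail of [mu] alone, before the regularization; the bound of
    [weight_moment] is then uniform in [e] and passes to the limit by Fatou's lemma. *)
Lemma log_sobolev_moments p : exists C : R,
 (ex mu (fun x => enorm x ^+ (2 * p))%R <= C%:E)%E.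
Proof.
pose a : R := expR (2 * (p%:R ^+ 2 * `|c| + 1)).
have a0 : 0 < a by exact: expR_gt0.
have [rr Hr] : exists rr : R, a * fine (mu [set x | rr < enorm x]) <= 1.
 pose F n := [set x : 'rV[R]_d | n%:R < enorm x].
 have mF n : measurable (F n).
 rewrite -[F n]setTI (_ : F n = (@enorm R d) @^-1` `]n%:R, +oo[%classic).
  by apply: mble_enorm => //;exact: measurable_itv.
 by apply/seteqP;split => x /=;rewrite in_itv /= andbT.
 have F0 : \bigcap_n F n = set0.
 apply/seteqP;split => // x /(_ (Num.bound (enorm x)) I) /=.
 by have := archi_boundP (enorm_ge0 x) => h /(lt_trans h);rewrite ltxx.
 have := @nonincreasing_cvg_mu _ _ _ mu F _ mF _ _.
 rewrite F0 measure0 => /(_ _ _ _) H.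
 have {}H : mu \o F @ \oo --> 0%E.
 apply: H => //;first by rewrite (le_lt_trans (probability_le1 mu (mF 0%N)))// ltry.
 move=> n m nm;apply/subsetPset => x /=;apply: le_lt_trans.
 by rewrite ler_nat.
 have /fine_cvgP[_ /cvgrPdist_le/(_ a^-1)] := H.
 rewrite invr_gt0 => /(_ a0)[n _ /(_ n (leqnn n))] /=.
 rewrite sub0r normrN => h;exists n%:R;rewrite mulrC -ler_pdivlMr// mul1r.
 by apply: le_trans h;exact: ler_norm.
exists (2 * (1 + rr ^+ 2) ^+ p).
have h01 n : 0 < (harmonic n : R) <= 1.
 by rewrite /harmonic invr_gt0 ltr0n /= invf_le1 ?ltr0n// ler1n.
have m2 : mble (fun x : 'rV[R]_d => (1 + enorm x ^+ 2) ^+ p).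
 by apply: mbleX;msolve;exact: measurable_id.
apply: (letr (ex mu (fun x => (1 + enorm x ^+ 2) ^+ p)%R)).
 apply: ex_le => //;first by apply: mbleX;exact: mble_enorm.
 by move=> x;rewrite exprn_ge0// enorm_ge0.
 move=> x;rewrite exprM lerXn2r ?nnegrE ?addr_ge0 ?sqr_ge0//.
 by rewrite lerDr.
apply: (@ex_fatou _ _ _ mu (fun n x => weight (harmonic n) x ^+ p) (fun x => (1 + enorm x ^+ 2) ^+ p)
 (fun=> 2 * (1 + rr ^+ 2) ^+ p) _ 0%N) => //.
- by move=> n;apply: weight_measurable.
- by move=> n x;apply: exprn_ge0;apply: (le_trans ler01);exact: weight_ge1.
- by move=> x;rewrite exprn_ge0// addr_ge0// sqr_ge0.
- apply: aeW => x.
 have -> : (1 + enorm x ^+ 2) ^+ p = ((1 + enorm x ^+ 2) * 1) ^+ p by rewrite mulr1.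
 apply: cvg_expr.
 apply: cvgM;first exact: cvg_cst.
 rewrite -[X in _ --> X]invr1;apply: cvgV;first exact: oner_neq0.
 rewrite -[X in _ --> X]addr0;apply: cvgD;first exact: cvg_cst.
 rewrite -(mul0r (enorm x ^+ 2));apply: cvgM;last exact: cvg_cst.
 exact: cvg_harmonic.
- by move=> n _;exact: weight_moment.
- exact: cvg_cst.
Qed.

End LogSobolevMoments.

(** * Fourth moments of sums of centred terms *)

Section FourthMoment.
Context {R : realType} {disp : measure_display} {T : measurableType disp}.
Variable mu : probability T R.
Local Open Scope ereal_scope.

Lemma ex_iidS_le n (g : n.+1.-tuple T -> R) (h : T -> R) :
 mble g -> (forall x, (0 <= g x)%R) -> mble h ->
 (forall a, ex (iid mu n) (fun t => g [tuple of a :: t]) <= (h a)%:E) ->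
 ex (iid mu n.+1) g <= ex mu h.
Proof.
move=> mg g0 mh H;rewrite ex_iidS//.
have mg' : mble (fun p : T * n.-tuple T => g (consT p)).
 by apply: (mcomp mg);exact: measurable_consT.
apply: ge0_le_integral => //.
- by move=> a _;exact: ex_ge0.
- exact: (mble_ex2 (iid mu n) mg').
- exact/mbleEFin.
- by move=> a _;exact: H.
Qed.
Lemma ex_iidSC_le n (g : n.+1.-tuple T -> R) (h : n.-tuple T -> R) :
 mble g -> (forall x, (0 <= g x)%R) -> mble h ->
 (forall t : n.-tuple T, ex mu (fun a => g [tuple of a :: t]) <= (h t)%:E) ->
 ex (iid mu n.+1) g <= ex (iid mu n) h.
Proof.
move=> mg g0 mh H;rewrite ex_iidSC//.
have mg' : mble (fun p : T * n.-tuple T => g (consT p)).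
 by apply: (mcomp mg);exact: measurable_consT.
apply: ge0_le_integral => //.
- by move=> t _;exact: ex_ge0.
- exact: (mble_ex1 mu mg').
- exact/mbleEFin.
- by move=> t _;exact: H.
Qed.

Section centered.
Variables (f : T -> R) (s : R).
Hypotheses (mf : mble f) (s0 : (0 < s)%R).
Hypothesis f4 : ex mu (fun x => f x ^+ 4)%R <= (s ^+ 2)%:E.
Hypothesis f0 : \int[mu]_x (f x)%:E = 0.

Let mf4 : mble (fun x => f x ^+ 4)%R. Proof. exact: mbleX. Qed.
Let mf2 : mble (fun x => f x ^+ 2)%R. Proof. exact: mbleX. Qed.
Let f40 x : (0 <= f x ^+ 4)%R.
Proof. by rewrite -[4%N]/(2 * 2)%N exprM sqr_ge0. Qed.
Let f2 : ex mu (fun x => f x ^+ 2)%R <= s%:E.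
Proof.
apply: (letr (ex mu (fun x => s / 2 + (2 * s)^-1 * f x ^+ 4)%R)).
 apply: ex_le => //.
 - by apply: mbleD => //;exact: mbleM.
 - by move=> x;exact: sqr_ge0.
 move=> x;rewrite -[4%N]/(2 * 2)%N exprM;set q := (f x ^+ 2)%R.
 have h : (0 <= (2 * s)^-1 * (s - q) ^+ 2)%R by rewrite mulr_ge0 ?sqr_ge0// invr_ge0 mulr_ge0// ltW.
 rewrite -subr_ge0 (_ : (_ - _)%R = ((2 * s)^-1 * (s - q) ^+ 2)%R)//.
 by field;rewrite gt_eqF.
have i0 : (0 <= (2 * s)^-1)%R by rewrite invr_ge0 mulr_ge0// ltW.
rewrite exD//;last first.
- by move=> x;apply: mulr_ge0.
- by move=> _;rewrite divr_ge0// ltW.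
- exact: mbleM.
rewrite ex_cst exZ//.
apply: (letr ((s / 2)%:E + ((2 * s)^-1)%:E * (s ^+ 2)%:E)).
 by apply: leeD => //;rewrite lee_wpmul2l// lee_fin.
rewrite -EFinM -EFinD lee_fin;apply: eqW.
by field;rewrite gt_eqF.
Qed.
Let fp x := Num.max (f x) 0%R.
Let fn x := Num.max (- f x)%R 0%R.
Let fp0 x : (0 <= fp x)%R. Proof. by rewrite le_max lexx orbT. Qed.
Let fn0 x : (0 <= fn x)%R. Proof. by rewrite le_max lexx orbT. Qed.
Let mfp : mble fp. Proof. exact: measurable_maxr. Qed.
Let mfn : mble fn.
Proof. by apply: measurable_maxr => //;exact: measurable_funN. Qed.
Let f1le x : (`|f x| <= 1 + f x ^+ 2)%R.
Proof.
rewrite -real_normK ?num_real//;set q := `|f x|%R.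
have : (0 <= (q - 1) ^+ 2)%R by exact: sqr_ge0.
have : (0 <= q)%R by exact: normr_ge0.
rewrite sqrrB;nra.
Qed.
Let fin1 (h : T -> R) : mble h -> (forall x, (0 <= h x)%R) ->
 (forall x, (h x <= `|f x|)%R) -> ex mu h \is a fin_num.
Proof.
move=> mh h0 hf;rewrite ge0_fin_numE ?ex_ge0//.
apply: (@le_lt_trans _ _ (1 + s)%:E);last by rewrite ltry.
apply: (letr (ex mu (fun x => 1 + f x ^+ 2)%R)).
 apply: ex_le => //;first by exact: mbleD.
 by move=> x;exact: le_trans (f1le x).
rewrite (exD mu (f := fun=> 1%R))//;last by move=> x;exact: sqr_ge0.
by rewrite ex_cst EFinD;exact: leeD.
Qed.
Let ffp : ex mu fp \is a fin_num.
Proof.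
by apply: fin1 => // x;rewrite /fp ge_max normr_ge0 andbT ler_norm.
Qed.
Let ffn : ex mu fn \is a fin_num.
Proof.
by apply: fin1 => // x;rewrite /fn ge_max normr_ge0 andbT -normrN ler_norm.
Qed.
Let fpn : ex mu fp = ex mu fn.
Proof.
have := f0;rewrite integralE.
rewrite (_ : \int[mu]_x _ = ex mu fp);last first.
 by apply: eq_integral => x _;rewrite funeposE /= /fp EFin_max.
rewrite (_ : \int[mu]_x _ = ex mu fn);last first.
 by apply: eq_integral => x _;rewrite funenegE /= /fn EFin_max.
by move=> h;rewrite -(subeK (ex mu fp) ffn) h add0e.
Qed.
Let fpnE x : f x = (fp x - fn x)%R.
Proof. by rewrite /fp /fn;have [h|h] := leP (f x) 0%R;[rewrite max_l;lra|rewrite max_r;lra]. Qed.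
(** The positive and negative parts of [f] have the same finite expectation. They are put on
    whichever side keeps the integrands nonnegative, according to the sign of [k], and then
    cancelled. *)
Lemma ex_centered (g w : T -> R) (k : R) : mble g ->
 mble w -> (forall x, (0 <= g x)%R) -> (forall x, (0 <= w x)%R) ->
 (forall x, g x = w x + k * f x)%R -> ex mu g = ex mu w.
Proof.
move=> mg mw g0 w0 gE.
wlog k0 : k gE / (0 <= k)%R.
 have [|k0 _] := leP 0%R k;first by move=> k0 H;exact: (H k).
 have H : ex mu (fun x => g x + (- k) * fp x)%R = ex mu (fun x => w x + (- k) * fn x)%R.
 by apply: eq_ex => x;rewrite gE (fpnE x);ring.
 have k0' : (0 <= - k)%R by rewrite oppr_ge0 ltW.
 move: H;rewrite !exD//;try by [exact: mbleM|move=> x;exact: mulr_ge0].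
 rewrite !exZ// fpn => H.
 have kf : (- k)%:E * ex mu fn \is a fin_num by rewrite fin_numM.
 by rewrite -(addeK (ex mu g) kf) H addeK.
have H : ex mu (fun x => g x + k * fn x)%R = ex mu (fun x => w x + k * fp x)%R.
 by apply: eq_ex => x;rewrite gE (fpnE x);ring.
move: H;rewrite !exD//;try by [exact: mbleM|move=> x;exact: mulr_ge0].
rewrite !exZ// fpn => H.
have kf : k%:E * ex mu fn \is a fin_num by rewrite fin_numM.
by rewrite -(addeK (ex mu g) kf) H addeK.
Qed.
Lemma shifted_moment2 c : ex mu (fun x => (c + f x) ^+ 2)%R <= (c ^+ 2 + s)%:E.
Proof.
have mw : mble (fun x => c ^+ 2 + f x ^+ 2)%R by exact: mbleD.
rewrite (@ex_centered _ (fun x => c ^+ 2 + f x ^+ 2)%R (2 * c))//.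
- rewrite (exD mu (f := fun=> (c ^+ 2)%R))//;last by move=> x;exact: sqr_ge0.
 by rewrite ex_cst EFinD;exact: leeD.
 by move=> _;exact: sqr_ge0.
- by apply: mbleX;exact: mbleD.
- by move=> x;exact: sqr_ge0.
- by move=> x;rewrite addr_ge0// sqr_ge0.
- by move=> x;ring.
Qed.
(** In the expansion of [(c + f)^4] the term [4 c^3 f] is centred and the cubic one is absorbed by
    [4 c f^3 <= 2 c^2 f^2 + 2 f^4]: hence the coefficients 8 and 3. *)
Lemma shifted_moment4 c :
 ex mu (fun x => (c + f x) ^+ 4)%R <= (c ^+ 4 + 8 * s * c ^+ 2 + 3 * s ^+ 2)%:E.
Proof.
pose w x := (c ^+ 4 + (8 * c ^+ 2 * f x ^+ 2 + 3 * f x ^+ 4))%R.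
have p4 (y : R) : (0 <= y ^+ 4)%R by rewrite -[4%N]/(2 * 2)%N exprM sqr_ge0.
have m1 : mble (fun x => 8 * c ^+ 2 * f x ^+ 2)%R by exact: mbleM.
have m2 : mble (fun x => 3 * f x ^+ 4)%R by exact: mbleM.
have m3 : mble (fun x => 8 * c ^+ 2 * f x ^+ 2 + 3 * f x ^+ 4)%R by exact: mbleD.
have mw : mble w by exact: mbleD.
have c8 : (0 <= 8 * c ^+ 2)%R by rewrite mulr_ge0// sqr_ge0.
have q1 x : (0 <= 8 * c ^+ 2 * f x ^+ 2)%R by rewrite mulr_ge0// sqr_ge0.
have q2 x : (0 <= 3 * f x ^+ 4)%R by rewrite mulr_ge0.
have w0 x : (0 <= w x)%R by rewrite !addr_ge0.
have pw x : ((c + f x) ^+ 4 <= w x + 4 * c ^+ 3 * f x)%R.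
 have : (0 <= 2 * f x ^+ 2 * (c - f x) ^+ 2)%R by rewrite mulr_ge0 ?sqr_ge0// mulr_ge0// sqr_ge0.
 rewrite -subr_ge0 => h;rewrite -subr_ge0 /w (_ : (_ - _)%R = (2 * f x ^+ 2 * (c - f x) ^+ 2 - 0)%R)//.
 by ring.
have mg : mble (fun x => w x + 4 * c ^+ 3 * f x)%R.
 by apply: mbleD => //;exact: mbleM.
apply: (letr (ex mu (fun x => w x + 4 * c ^+ 3 * f x)%R)).
 apply: ex_le => //.
 by apply: mbleX;exact: mbleD.
rewrite (@ex_centered _ w (4 * c ^+ 3))//;last by move=> x;exact: le_trans (pw x).
rewrite (exD mu (f := fun=> (c ^+ 4)%R) _ m3)//;last by move=> x;rewrite addr_ge0.
rewrite (exD mu m1 m2)// ex_cst !exZ//;last by move=> x;exact: sqr_ge0.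
rewrite -(addrA (c ^+ 4)%R) (EFinD (c ^+ 4)%R) (EFinD (8 * s * c ^+ 2)%R);apply: leeD => //;apply: leeD.
 rewrite (_ : (8 * s * c ^+ 2)%R = (8 * c ^+ 2 * s)%R);last by ring.
 by rewrite [in leRHS]EFinM lee_wpmul2l// lee_fin.
by rewrite [in leRHS]EFinM lee_wpmul2l// lee_fin.
Qed.
Lemma iid_sum_moment2 n :
 ex (iid mu n) (fun y => (\sum_(j < n) f (tnth y j)) ^+ 2)%R <= (n%:R * s)%:E.
Proof.
have msum m : mble (fun y : m.-tuple T => \sum_(j < m) f (tnth y j))%R.
 by apply: mble_sum => j;apply: (mcomp mf);exact: mble_tnth.
elim: n => [|n IH].
 rewrite (eq_ex _ (_ : _ =1 fun=> 0%R)) => [|y];last by rewrite big_ord0 expr0n.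
 by rewrite ex_cst mul0r.
apply: (letr (ex (iid mu n) (fun t => (\sum_(j < n) f (tnth t j)) ^+ 2 + s)%R)).
 apply: ex_iidSC_le.
 - exact: mbleX (msum _).
 - by move=> x;exact: sqr_ge0.
 - by apply: mbleD => //;exact: mbleX (msum _).
 move=> t;apply: le_trans (shifted_moment2 _);apply: eqW.
 apply: eq_ex => a;rewrite big_ord_recl tnth0 addrC;congr ((_ + _) ^+ 2)%R.
 by apply: eq_bigr => j _;rewrite tnthS.
rewrite (exD _ (g := fun=> s))//;last first.
- by move=> _;exact: ltW.
- by move=> x;exact: sqr_ge0.
- exact: mbleX (msum _).
by rewrite ex_cst -natr1 mulrDl mul1r EFinD;exact: leeD.
Qed.
(** The recursion of [shifted_moment4] adds [8 n + 3] to the coefficient of [s^2], and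
    [4 n^2 + 8 n + 3 <= 4 (n + 1)^2]. *)
Lemma iid_sum_moment4 n :
 ex (iid mu n) (fun y => (\sum_(j < n) f (tnth y j)) ^+ 4)%R <= (4 * n%:R ^+ 2 * s ^+ 2)%:E.
Proof.
have p4 (y : R) : (0 <= y ^+ 4)%R by rewrite -[4%N]/(2 * 2)%N exprM sqr_ge0.
have msum m : mble (fun y : m.-tuple T => \sum_(j < m) f (tnth y j))%R.
 by apply: mble_sum => j;apply: (mcomp mf);exact: mble_tnth.
elim: n => [|n IH].
 rewrite (eq_ex _ (_ : _ =1 fun=> 0%R)) => [|y];last by rewrite big_ord0 expr0n.
 by rewrite ex_cst expr0n mulr0 mul0r.
pose S (t : n.-tuple T) := (\sum_(j < n) f (tnth t j))%R.
have mS : mble S by exact: msum.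
have mS2 : mble (fun t => 8 * s * S t ^+ 2)%R.
 by apply: mbleM => //;exact: mbleX.
have mS4 : mble (fun t => S t ^+ 4)%R by exact: mbleX.
have s80 : (0 <= 8 * s)%R by rewrite mulr_ge0// ltW.
have S20 t : (0 <= 8 * s * S t ^+ 2)%R by rewrite mulr_ge0// sqr_ge0.
have S40 t : (0 <= S t ^+ 4 + 8 * s * S t ^+ 2)%R by rewrite addr_ge0.
apply: (letr (ex (iid mu n) (fun t => S t ^+ 4 + 8 * s * S t ^+ 2 + 3 * s ^+ 2)%R)).
 apply: ex_iidSC_le.
 - exact: mbleX (msum _).
 - by move=> x;exact: p4.
 - by apply: mbleD => //;exact: mbleD.
 move=> t;apply: le_trans (shifted_moment4 _);apply: eqW.
 apply: eq_ex => a;rewrite big_ord_recl tnth0 addrC;congr ((_ + _) ^+ 4)%R.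
 by apply: eq_bigr => j _;rewrite tnthS.
rewrite (exD (iid mu n) (mbleD mS4 mS2) (mble_cst (3 * s ^+ 2)%R) S40)//;last first.
 by move=> x;rewrite /cst;apply: mulr_ge0 => //;exact: sqr_ge0.
rewrite (exD (iid mu n) mS4 mS2)// ex_cst exZ//;last first.
- by move=> t;exact: sqr_ge0.
- exact: mbleX.
apply: (letr ((4 * n%:R ^+ 2 * s ^+ 2)%:E + (8 * s)%:E * (n%:R * s)%:E + (3 * s ^+ 2)%:E)).
 apply: leeD => //;apply: leeD => //;rewrite lee_wpmul2l ?lee_fin//.
 exact: iid_sum_moment2.
rewrite -EFinM -!EFinD lee_fin -natr1.
have := sqr_ge0 s;nra.
Qed.

End centered.

Section diagonal.
Variables (f : T -> T -> R) (s : T -> R) (e : R).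
Hypothesis mf : mble (fun p : T * T => f p.1 p.2).
Hypotheses (ms : mble s) (s0 : forall x, (0 < s x)%R).
Hypothesis f4 : forall x, ex mu (fun a => f x a ^+ 4)%R <= (s x ^+ 2)%:E.
Hypothesis f0 : forall x, \int[mu]_a (f x a)%:E = 0.
Hypothesis se : ex mu (fun x => s x ^+ 2)%R <= e%:E.

(** For the interaction this is the fluctuation of the force felt by particle [i]. Given [tnth y i]
    the terms are independent and centred; the diagonal term, which is not centred, is left out. *)
Definition others n (y : n.-tuple T) i : R :=
 (\sum_(j < n | j != i) f (tnth y i) (tnth y j))%R.

Let mfx x : mble (f x).
Proof. exact: (mcomp mf (measurable_pair1 x)). Qed.
Let p4 (y : R) : (0 <= y ^+ 4)%R. Proof. by rewrite -[4%N]/(2 * 2)%N exprM sqr_ge0. Qed.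
Let mothers n i : mble (fun y => @others n y i).
Proof.
rewrite /others;under eq_fun do rewrite big_mkcond /=.
apply: (@measurable_sum _ _ _ _ _ _
 (fun j (y : n.-tuple T) => if j != i then f (tnth y i) (tnth y j) else 0%R)) => j.
case: (j != i);last exact: mble_cst.
apply: (mcomp (f := fun p : T * T => f p.1 p.2)
 (g := fun y : n.-tuple T => (tnth y i, tnth y j))) => //.
by apply: mble_pair;exact: mble_tnth.
Qed.
Let e0 : (0 <= e)%R.
Proof. by rewrite -lee_fin;apply: le_trans se;apply: ex_ge0 => x;exact: sqr_ge0. Qed.
Let others0 n a (t : n.-tuple T) :
 others [tuple of a :: t] ord0 = (\sum_(j < n) f a (tnth t j))%R.
Proof.
rewrite /others big_mkcond big_ord_recl eqxx /= add0r.
by apply: eq_bigr => j _;rewrite tnthS tnth0.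
Qed.
Let othersS n a (t : n.-tuple T) i :
 others [tuple of a :: t] (lift ord0 i) = (others t i + f (tnth t i) a)%R.
Proof.
rewrite /others big_mkcond big_ord_recl /= tnth0 !tnthS addrC;congr (_ + _)%R.
rewrite [in RHS]big_mkcond;apply: eq_bigr => j _.
by rewrite (inj_eq (@lift_inj _ ord0)) tnthS.
Qed.
(** If the head is particle [i], the others are independent and centred given it; otherwise the head
    is one more centred term in the sum of another particle. The weight [s] at particle [i] is the
    one that the fourth-moment recursion produces. *)
Lemma others_moment2 n i : ex (iid mu n) (fun y => s (tnth y i) * others y i ^+ 2)%R <=
 (n%:R * e)%:E.
Proof.
have ms' m (j : 'I_m) : mble (fun y : m.-tuple T => s (tnth y j)).
 by apply: (mcomp ms);exact: mble_tnth.
have mg m j : mble (fun y : m.-tuple T => s (tnth y j) * others y j ^+ 2)%R.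
 by apply: mbleM;[exact: ms'|exact: mbleX (mothers _)].
have g0 m j (y : m.-tuple T) : (0 <= s (tnth y j) * others y j ^+ 2)%R.
 by rewrite mulr_ge0 ?sqr_ge0// ltW.
elim: n i => [[]//|n IH] i;case: (unliftP ord0 i) => [i' ->|->].
 apply: (letr (ex (iid mu n) (fun t => s (tnth t i') * others t i' ^+ 2 + s (tnth t i') ^+ 2)%R)).
 apply: ex_iidSC_le => //.
  by apply: mbleD;[exact: mg|exact: mbleX (ms' _ _)].
 move=> t;rewrite (eq_ex _ (_ : _ =1 fun a => s (tnth t i') * (others t i' + f (tnth t i') a) ^+ 2)%R);last first.
  by move=> a;rewrite othersS tnthS.
 rewrite exZ//;[|by apply: mbleX;exact: mbleD|by move=> x;exact: sqr_ge0|exact: ltW].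
 rewrite expr2 -mulrDr EFinM lee_wpmul2l ?lee_fin//;first exact: ltW.
 exact: shifted_moment2.
 have ms2 : mble (fun y : n.-tuple T => s (tnth y i') ^+ 2)%R.
 exact: mbleX (ms' _ _).
 have s20 (y : n.-tuple T) : (0 <= s (tnth y i') ^+ 2)%R by exact: sqr_ge0.
 rewrite (exD (iid mu n) (mg n i') ms2)//.
 rewrite -natr1 mulrDl mul1r EFinD;apply: leeD => //.
 rewrite (ex_iid_coord mu i' (g := fun x => s x ^+ 2)%R)//;first exact: mbleX.
 by move=> x;exact: sqr_ge0.
apply: (letr (ex mu (fun a => n%:R * s a ^+ 2)%R)).
 apply: ex_iidS_le => //.
 by apply: mbleM => //;exact: mbleX.
 move=> a;rewrite (eq_ex _ (_ : _ =1 fun t => s a * (\sum_(j < n) f a (tnth t j)) ^+ 2)%R);last first.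
 by move=> t;rewrite others0 tnth0.
 have ma : mble (fun t : n.-tuple T => \sum_(j < n) f a (tnth t j))%R.
 by apply: mble_sum => j;apply: (mcomp (mfx a));exact: mble_tnth.
 rewrite exZ//;[|exact: mbleX|by move=> x;exact: sqr_ge0|exact: ltW].
 rewrite expr2 mulrCA EFinM lee_wpmul2l ?lee_fin//;first exact: ltW.
 exact: iid_sum_moment2.
rewrite exZ//;[|exact: mbleX|by move=> x;exact: sqr_ge0].
rewrite EFinM;apply: (letr (n%:R%:E * e%:E));first by rewrite lee_wpmul2l ?lee_fin.
by rewrite lee_wpmul2r ?lee_fin// ler_nat.
Qed.
Lemma others_moment4 n i : ex (iid mu n) (fun y => others y i ^+ 4)%R <=
 (4 * n%:R ^+ 2 * e)%:E.
Proof.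
have ms' m (j : 'I_m) : mble (fun y : m.-tuple T => s (tnth y j)).
 by apply: (mcomp ms);exact: mble_tnth.
have mg m j : mble (fun y : m.-tuple T => s (tnth y j) * others y j ^+ 2)%R.
 by apply: mbleM;[exact: ms'|exact: mbleX (mothers _)].
have mg4 m j : mble (fun y : m.-tuple T => others y j ^+ 4)%R by exact: mbleX (mothers _).
have mg8 m j : mble (fun y : m.-tuple T => 8 * (s (tnth y j) * others y j ^+ 2))%R.
 exact: mbleM (mble_cst _) (mg _ _).
have ms2 m (j : 'I_m) : mble (fun y : m.-tuple T => s (tnth y j) ^+ 2)%R.
 exact: mbleX (ms' _ _).
have ms3 m (j : 'I_m) : mble (fun y : m.-tuple T => 3 * s (tnth y j) ^+ 2)%R.
 exact: mbleM (mble_cst _) (ms2 _ _).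
have g0 m j (y : m.-tuple T) : (0 <= s (tnth y j) * others y j ^+ 2)%R.
 by rewrite mulr_ge0 ?sqr_ge0// ltW.
have g80 m j (y : m.-tuple T) : (0 <= 8 * (s (tnth y j) * others y j ^+ 2))%R by rewrite mulr_ge0.
have s20 m j (y : m.-tuple T) : (0 <= s (tnth y j) ^+ 2)%R by exact: sqr_ge0.
have s30 m j (y : m.-tuple T) : (0 <= 3 * s (tnth y j) ^+ 2)%R by rewrite mulr_ge0.
elim: n i => [[]//|n IH] i;case: (unliftP ord0 i) => [i' ->|->].
 apply: (letr (ex (iid mu n) (fun t => others t i' ^+ 4 +
  (8 * (s (tnth t i') * others t i' ^+ 2) + 3 * s (tnth t i') ^+ 2))%R)).
 apply: ex_iidSC_le => //.
  by apply: mbleD;[exact: mg4|apply: mbleD;[exact: mg8|exact: ms3]].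
 move=> t;rewrite (eq_ex _ (_ : _ =1 fun a => (others t i' + f (tnth t i') a) ^+ 4)%R);last first.
  by move=> a;rewrite othersS.
 apply: le_trans (shifted_moment4 (mfx _) (s0 _) (f4 _) (f0 _) _) _.
 by rewrite lee_fin;apply: eqW;ring.
 have m83 : mble (fun y : n.-tuple T =>
  8 * (s (tnth y i') * others y i' ^+ 2) + 3 * s (tnth y i') ^+ 2)%R.
 exact: mbleD (mg8 _ _) (ms3 _ _).
 have p83 (y : n.-tuple T) : (0 <= 8 * (s (tnth y i') * others y i' ^+ 2) + 3 * s (tnth y i') ^+ 2)%R.
 exact: addr_ge0.
 have n8 : (0 <= 8 :> R)%R by []. have n3 : (0 <= 3 :> R)%R by [].
 rewrite (exD (iid mu n) (mg4 n i') m83)//.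
 rewrite (exD (iid mu n) (mg8 n i') (ms3 n i'))//.
 rewrite (exZ (iid mu n) (mg n i') (g0 n i') n8) (exZ (iid mu n) (ms2 n i') (s20 n i') n3).
 rewrite (ex_iid_coord mu i' (g := fun x => s x ^+ 2)%R)//;[|exact: mbleX|by move=> x;exact: sqr_ge0].
 apply: (letr ((4 * n%:R ^+ 2 * e)%:E + (8%:E * (n%:R * e)%:E + 3%:E * e%:E))).
 apply: leeD => //;apply: leeD;rewrite lee_wpmul2l ?lee_fin//.
 exact: others_moment2.
 by rewrite -!EFinM -!EFinD lee_fin -natr1;have := e0;nra.
apply: (letr (ex mu (fun a => 4 * n%:R ^+ 2 * s a ^+ 2)%R)).
 apply: ex_iidS_le => //.
 by apply: mbleM => //;exact: mbleX.
 move=> a;rewrite (eq_ex _ (_ : _ =1 fun t => (\sum_(j < n) f a (tnth t j)) ^+ 4)%R);last first.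
 by move=> t;rewrite others0.
 exact: iid_sum_moment4.
have n20 : (0 <= 4 * n%:R ^+ 2 :> R)%R by rewrite mulr_ge0// sqr_ge0.
rewrite exZ//;[|exact: mbleX|by move=> x;exact: sqr_ge0].
rewrite EFinM;apply: (letr ((4 * n%:R ^+ 2)%:E * e%:E));first by rewrite lee_wpmul2l ?lee_fin.
rewrite -EFinM lee_fin ler_wpM2r// ler_wpM2l// lerXn2r ?nnegrE ?ler0n// ler_nat//.
Qed.

End diagonal.

End FourthMoment.

Lemma sum_pairD {R : realFieldType} {N : nat} (f : 'I_N -> R) :
 \sum_(i < N) \sum_(j < N) (f i + f j) = 2 * N%:R * \sum_(i < N) f i.
Proof.
rewrite (eq_bigr (fun i => N%:R * f i + \sum_(j < N) f j));last first.
 by move=> i _;rewrite big_split /= sumr_const card_ord mulr_natl.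
rewrite big_split /= -mulr_sumr sumr_const card_ord -[X in _ + X]mulr_natl;ring.
Qed.

(** * Testing against powers *)

Section PowerDuality.
Context {R : realType} {d : nat}.
Implicit Types (u v x y : 'rV[R]_d) (a b : R).

(** Young's inequality with integer exponents: the excess at [k + 1] is [a] times the excess at [k]
    plus [(k + 1) b^k (a - b)^2]. *)
Lemma young_power a b k : 0 <= a -> 0 <= b ->
 k.+1%:R * (a * b ^+ k) <= a ^+ k.+1 + k%:R * b ^+ k.+1.
Proof.
move=> a0 b0;elim: k => [|k IH];first by rewrite !mul1r mul0r addr0 mulr1 expr1.
have h : 0 <= k.+1%:R * b ^+ k * (a - b) ^+ 2.
 by rewrite mulr_ge0 ?sqr_ge0// mulr_ge0// exprn_ge0.
have := ler_wpM2l a0 IH;rewrite -subr_ge0 => h1.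
rewrite -subr_ge0.
have -> : a ^+ k.+2 + k.+1%:R * b ^+ k.+2 - k.+2%:R * (a * b ^+ k.+1) =
 (a * (a ^+ k.+1 + k%:R * b ^+ k.+1) - a * (k.+1%:R * (a * b ^+ k))) +
 k.+1%:R * b ^+ k * (a - b) ^+ 2.
 by rewrite -!natr1 !exprS;ring.
exact: addr_ge0.
Qed.

(** The gradient of [|u|^(2p+2) / (2p+2)]: pairing a drift with it gives the derivative of this
    power along the flow. *)
Definition psi p u : 'rV[R]_d := enorm u ^+ (2 * p) *: u.

Lemma dotp_psi p u : dotp u (psi p u) = enorm u ^+ (2 * p.+1).
Proof. by rewrite dotpZr -enorm_sqr -exprD mulnS addnC. Qed.
Lemma dotp_psi_le p u v : dotp u (psi p v) <= enorm u * enorm v ^+ (2 * p).+1.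
Proof.
have -> : enorm u * enorm v ^+ (2 * p).+1 = enorm v ^+ (2 * p) * (enorm u * enorm v).
 by rewrite exprS;ring.
by rewrite dotpZr ler_wpM2l ?exprn_ge0 ?enorm_ge0// dotp_le.
Qed.
Let monotone_power a b k : 0 <= a -> 0 <= b -> 0 <= (a ^+ k - b ^+ k) * (a - b).
Proof.
move=> a0 b0;have [ab|ba] := leP a b.
 by rewrite mulr_le0// subr_le0// lerXn2r.
by rewrite mulr_ge0// subr_ge0 ?lerXn2r// ltW.
Qed.
Let psiBE p u v : dotp (u - v) (psi p u - psi p v) =
 enorm u ^+ (2 * p.+1) + enorm v ^+ (2 * p.+1)
 - (enorm u ^+ (2 * p) + enorm v ^+ (2 * p)) * dotp u v.
Proof.
rewrite dotpBl !dotpBr !dotp_psi !dotpZr (dotpC v u);ring.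
Qed.
Let powE (a : R) p : a ^+ (2 * p.+1) = a ^+ (2 * p) * a * a /\ a ^+ (2 * p).+1 = a ^+ (2 * p) * a.
Proof. by split;rewrite ?mulnS ?addSn -?exprSr. Qed.
Lemma psi_monotone p u v : 0 <= dotp (u - v) (psi p u - psi p v).
Proof.
rewrite psiBE.
have h := @monotone_power _ _ (2 * p).+1 (enorm_ge0 u) (enorm_ge0 v).
have h1 : (enorm u ^+ (2 * p) + enorm v ^+ (2 * p)) * dotp u v <=
 (enorm u ^+ (2 * p) + enorm v ^+ (2 * p)) * (enorm u * enorm v).
 by rewrite ler_wpM2l ?dotp_le// addr_ge0// exprn_ge0// enorm_ge0.
have [eu fu] := powE (enorm u) p;have [ev fv] := powE (enorm v) p.
rewrite fu fv in h;rewrite eu ev;lra.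
Qed.
(** Serves for negative [lamW]: an upper bound on the pairing then limits what a nonconvex
    interaction can lose. *)
Lemma psi_monotone_le p u v : dotp (u - v) (psi p u - psi p v) <=
 2 * (enorm u ^+ (2 * p.+1) + enorm v ^+ (2 * p.+1)).
Proof.
rewrite psiBE.
have h := @monotone_power _ _ (2 * p).+1 (enorm_ge0 u) (enorm_ge0 v).
have h1 : - ((enorm u ^+ (2 * p) + enorm v ^+ (2 * p)) * (enorm u * enorm v)) <=
 (enorm u ^+ (2 * p) + enorm v ^+ (2 * p)) * dotp u v.
 rewrite -mulrN ler_wpM2l//;first by rewrite addr_ge0// exprn_ge0// enorm_ge0.
 by have := dotp_le_abs u v;rewrite ler_norml => /andP[].
have [eu fu] := powE (enorm u) p;have [ev fv] := powE (enorm v) p.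
rewrite fu fv in h;rewrite eu ev;lra.
Qed.

End PowerDuality.

(** * Forces of the particle system *)

Section Systems.
Context {R : realType} {d : nat}.
Variables (gV gW : 'rV[R]_d -> 'rV[R]_d) (lamV lamW M : R) (m : nat).

(* [sys_pair] is where quadratic W or d = 1 enters: the interaction has to be
 monotone when tested against |u|^(2p) u instead of u. *)
Record convex_system : Prop := ConvexSystem {
 sys_V : strongly_monotone lamV gV ;
 sys_lamV : 0 < lamV ;
 sys_lip : locally_lipschitz gV ;
 sys_growthV : polynomial_growth gV ;
 sys_odd : forall x, gW (- x) = - gW x ;
 sys_W : strongly_monotone lamW gW ;
 sys_convex : 0 < lamV + 2 * lamW ;
 sys_M : 0 < M ;
 sys_growthW : forall x y, enorm (gW x - gW y) <=
 M * Num.min (enorm (x - y)) 1 * (1 + enorm x ^+ m + enorm y ^+ m) ;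
 sys_pair : forall p u v a b, a - b = u - v ->
 lamW * dotp (u - v) (psi p u - psi p v) <=
 dotp (gW a - gW b) (psi p u - psi p v) }.

(** The properties of a mean field [grad W * u_s] that the scheme relies on, with a single constant
    [CG] for all the times of a mesh. *)
Record drift_field (G : 'rV[R]_d -> 'rV[R]_d) (CG : R) : Prop := DriftField {
 field_monotone : strongly_monotone lamW G ;
 field_lip : forall x y, enorm (G x - G y) <=
 CG * enorm (x - y) * (1 + enorm x ^+ m + enorm y ^+ m) ;
 field_0 : enorm (G 0) <= CG }.

Hypothesis sys : convex_system.

Local Notation beta := (beta_cst lamV lamW).

Lemma beta_gt0 : 0 < beta.
Proof. by rewrite /beta_cst;case: ifP => _;[exact: sys_lamV|exact: sys_convex]. Qed.
Lemma sum_lam_gt0 : 0 < lamV + lamW.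
Proof. by have := sys_lamV sys;have := sys_convex sys;lra. Qed.
Lemma gW0 : gW 0 = 0.
Proof.
have := sys_odd sys 0;rewrite oppr0 => h.
have h2 : (2 : R) *: gW 0 = 0 by rewrite scaler_nat mulr2n {1}h addNr.
by move/eqP: h2;rewrite scaler_eq0 pnatr_eq0 /= => /eqP.
Qed.
Lemma gW_lip x y : enorm (gW x - gW y) <=
 M * enorm (x - y) * (1 + enorm x ^+ m + enorm y ^+ m).
Proof.
apply: (le_trans (sys_growthW sys x y));apply: ler_wpM2r.
 by rewrite !addr_ge0// exprn_ge0// enorm_ge0.
by rewrite ler_wpM2l// ?ge_min ?lexx//;exact: ltW (sys_M sys).
Qed.
Lemma gW_bound x : enorm (gW x) <= M * (2 + enorm x ^+ m).
Proof.
have := sys_growthW sys x 0;rewrite gW0 !subr0 enorm0 => h.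
apply: (le_trans h);rewrite -mulrA ler_wpM2l//;first exact: ltW (sys_M sys).
have e0 : 0 <= enorm x ^+ m by rewrite exprn_ge0// enorm_ge0.
have z1 : 0 <= (0 : R) ^+ m <= 1 by rewrite expr0n;case: m => [|?] /=;lra.
have mm : 0 <= Num.min (enorm x) 1 <= 1 by rewrite le_min enorm_ge0 ler01 ge_min lexx orbT.
have : 0 <= 1 + enorm x ^+ m + 0 ^+ m by lra.
move: mm => /andP[m0 m1] h0;apply: (le_trans (ler_wpM2r h0 m1));lra.
Qed.
Lemma growth_locally_lipschitz (g : 'rV[R]_d -> 'rV[R]_d) (C : R) :
 (forall x y, enorm (g x - g y) <= C * enorm (x - y) * (1 + enorm x ^+ m + enorm y ^+ m)) ->
 locally_lipschitz g.
Proof.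
move=> H r;exists (`|C| * (1 + `|r| ^+ m + `|r| ^+ m)) => x y xr yr.
apply: (le_trans (H x y)).
rewrite mulrAC -[leRHS]mulrA [leRHS]mulrA;apply: ler_wpM2r;first exact: enorm_ge0.
have P0 z : 0 <= enorm z ^+ m :> R by rewrite exprn_ge0// enorm_ge0.
have Pr z : enorm z <= r -> enorm z ^+ m <= `|r| ^+ m.
 move=> zr;rewrite lerXn2r ?nnegrE ?enorm_ge0//.
 exact: le_trans zr (ler_norm _).
apply: (letr (`|C| * (1 + enorm x ^+ m + enorm y ^+ m))).
 by rewrite ler_wpM2r ?ler_norm// !addr_ge0.
by rewrite ler_wpM2l// !lerD// Pr.
Qed.
Lemma gW_locally_lipschitz : locally_lipschitz gW.
Proof. exact: growth_locally_lipschitz gW_lip. Qed.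
Lemma field_locally_lipschitz G CG : drift_field G CG -> locally_lipschitz G.
Proof. by move=> fG;exact: growth_locally_lipschitz (field_lip fG). Qed.

Section ParticleOperator.
Context {N : nat}.
Local Notation state := (conf N R d).
Implicit Types (x y u v : state).

Definition pforce x (i : 'I_N) : 'rV[R]_d :=
 gV (tnth x i) + N%:R^-1 *: \sum_(j < N) gW (tnth x i - tnth x j).

(** Oddness of [gW] antisymmetrizes the double sum, so each pair is tested against
    [psi p (dd i) - psi p (dd j)] and [sys_pair] applies. For [lamW >= 0] the interaction is
    discarded; otherwise the loss per pair, summed over pairs with the factor one half and divided
    by [N], is [2 lamW] per particle. This is the two-case definition of [beta]. *)
Lemma pforce_contraction p x y :
 beta * \sum_(i < N) enorm (tnth x i - tnth y i) ^+ (2 * p.+1) <=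
 \sum_(i < N) dotp (pforce x i - pforce y i) (psi p (tnth x i - tnth y i)).
Proof.
pose dd i := tnth x i - tnth y i.
pose q i := enorm (dd i) ^+ (2 * p.+1).
pose w i j := gW (tnth x i - tnth x j) - gW (tnth y i - tnth y j).
have q0 i : 0 <= q i by rewrite exprn_ge0// enorm_ge0.
have wC i j : w j i = - w i j.
 by rewrite /w -(opprB (tnth x i)) -(opprB (tnth y i)) !(sys_odd sys) opprB opprK addrC.
have E i : dotp (pforce x i - pforce y i) (psi p (dd i)) =
 dotp (gV (tnth x i) - gV (tnth y i)) (psi p (dd i)) +
 N%:R^-1 * \sum_(j < N) dotp (w i j) (psi p (dd i)).
 have -> : pforce x i - pforce y i = (gV (tnth x i) - gV (tnth y i)) +
  N%:R^-1 *: \sum_(j < N) w i j.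
 by rewrite /pforce /w sumrB scalerBr opprD addrACA.
 rewrite dotpDl dotpZl;congr (_ + _ * _).
 elim/big_ind2: _ => [|a b a' b' <- <-|//];first by rewrite dotp0l.
 by rewrite dotpDl.
rewrite (eq_bigr _ (fun i _ => E i)) big_split /= -mulr_sumr.
have HV : lamV * \sum_(i < N) q i <=
 \sum_(i < N) dotp (gV (tnth x i) - gV (tnth y i)) (psi p (dd i)).
 rewrite mulr_sumr;apply: ler_sum => i _;rewrite dotpZr.
 have := sys_V sys (tnth x i) (tnth y i);rewrite -/(dd i) => h.
 have e0 : 0 <= enorm (dd i) ^+ (2 * p) by rewrite exprn_ge0// enorm_ge0.
 by have := ler_wpM2l e0 h;rewrite mulrCA -exprD addnC -mulnS.
pose S := \sum_(i < N) \sum_(j < N) dotp (w i j) (psi p (dd i)).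
have SE : S = 2^-1 * \sum_(i < N) \sum_(j < N) dotp (w i j) (psi p (dd i) - psi p (dd j)).
 have -> : \sum_(i < N) \sum_(j < N) dotp (w i j) (psi p (dd i) - psi p (dd j)) = S + S.
 transitivity (\sum_(i < N) (\sum_(j < N) dotp (w i j) (psi p (dd i)) +
  \sum_(j < N) dotp (w j i) (psi p (dd j)))).
  apply: eq_bigr => i _;rewrite -big_split /=;apply: eq_bigr => j _.
  by rewrite dotpBr (wC i j) dotpNl.
 by rewrite big_split /= [X in _ + X]exchange_big.
 by field.
have HS : (if 0 <= lamW then 0 else 2 * lamW * \sum_(i < N) q i) <= N%:R^-1 * S.
 have N0 : 0 <= (N%:R : R)^-1 by rewrite invr_ge0.
 have pair i j : lamW * dotp (dd i - dd j) (psi p (dd i) - psi p (dd j)) <=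
  dotp (w i j) (psi p (dd i) - psi p (dd j)).
 by apply: (sys_pair sys);rewrite /dd !opprB;apply/rowP => k;rewrite !mxE;ring.
 case: ifPn => [l0|];last rewrite -ltNge => l0.
 rewrite mulr_ge0// SE mulr_ge0 ?invr_ge0//.
 apply: sumr_ge0 => i _;apply: sumr_ge0 => j _;apply: le_trans (pair i j).
 by rewrite mulr_ge0// psi_monotone.
 case: (posnP N) => [N0'|Ngt0].
 have nI (i : 'I_N) : False by case: i => i;rewrite N0'.
 by rewrite /S big1 ?mulr0 => [|i];[rewrite big1 ?mulr0// => i;have := nI i|have := nI i].
 have NR : N%:R != 0 :> R by rewrite pnatr_eq0 -lt0n.
 rewrite -(ler_pM2l (_ : 0 < N%:R :> R)) ?ltr0n// [leRHS]mulrA mulfV// mul1r SE.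
 have -> : N%:R * (2 * lamW * \sum_(i < N) q i) =
  2^-1 * \sum_(i < N) \sum_(j < N) (2 * lamW * (q i + q j)).
 under [X in _ = _ * X]eq_bigr => i _ do rewrite -mulr_sumr.
 by rewrite -mulr_sumr sum_pairD;field.
 rewrite ler_wpM2l ?invr_ge0//;apply: ler_sum => i _;apply: ler_sum => j _.
 apply: le_trans (pair i j).
 rewrite [2 * lamW]mulrC -mulrA ler_wnM2l//;first exact: ltW.
 exact: psi_monotone_le.
rewrite -/S;apply: (le_trans _ (lerD HV HS)).
by rewrite /beta_cst;case: ifP => _;rewrite ?addr0// -mulrDl.
Qed.
(** The discrete form of differentiating a power: the tested inequality is turned into powers by
    Young's inequality, and the exponent [2p+2] multiplies the rate [beta]. *)
Lemma pforce_step p (D : R) x y : 0 <= D ->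
 (1 + (2 * p.+1)%:R * beta * D) * \sum_(i < N) enorm (tnth x i - tnth y i) ^+ (2 * p.+1) <=
 \sum_(i < N) enorm (tnth x i - tnth y i + D *: (pforce x i - pforce y i)) ^+ (2 * p.+1).
Proof.
move=> D0;pose dd i := tnth x i - tnth y i.
pose dl i := dd i + D *: (pforce x i - pforce y i).
rewrite -/(dd _).
have h1 : (1 + D * beta) * \sum_(i < N) enorm (dd i) ^+ (2 * p.+1) <=
 \sum_(i < N) dotp (dl i) (psi p (dd i)).
 rewrite mulrDl mul1r -mulrA.
 have := ler_wpM2l D0 (pforce_contraction p x y).
 rewrite [in X in _ <= X]mulr_sumr => h.
 rewrite [leRHS](eq_bigr (fun i => enorm (dd i) ^+ (2 * p.+1) + D * dotp (pforce x i - pforce y i) (psi p (dd i)))).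
 by rewrite big_split /=;apply: lerD.
 by move=> i _;rewrite /dl dotpDl dotpZl dotp_psi.
have h2 : (2 * p.+1)%:R * \sum_(i < N) dotp (dl i) (psi p (dd i)) <=
 \sum_(i < N) (enorm (dl i) ^+ (2 * p.+1) + (2 * p).+1%:R * enorm (dd i) ^+ (2 * p.+1)).
 rewrite mulr_sumr;apply: ler_sum => i _.
 have := young_power (2 * p).+1 (enorm_ge0 (dl i)) (enorm_ge0 (dd i)).
 rewrite !mulnS /= => h;apply: le_trans h.
 by rewrite ler_wpM2l// dotp_psi_le.
move: h2;rewrite big_split /= -mulr_sumr.
set Q := \sum_(i < N) enorm (dd i) ^+ _ in h1 *;set S := \sum_(i < N) dotp _ _ in h1 *.
set T := \sum_(i < N) enorm (dl i) ^+ _ => h2.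
have := ler_wpM2l (ler0n R (2 * p.+1)) h1 => h3.
have := le_trans h3 h2.
rewrite (_ : (2 * p.+1)%:R = (2 * p).+1%:R + 1 :> R);last by rewrite natr1 mulnS.
by lra.
Qed.
Lemma pforce_lipschitz r : exists L : R, forall x y,
 (forall i, enorm (tnth x i) <= r) -> (forall i, enorm (tnth y i) <= r) ->
 forall i, enorm (pforce x i - pforce y i) <=
 L * \sum_(j < N) enorm (tnth x j - tnth y j).
Proof.
have [L1 H1] := sys_lip sys r;have [L2 H2] := gW_locally_lipschitz (2 * r).
exists (`|L1| + 2 * `|L2|) => x y xr yr i.
have leS j : enorm (tnth x j - tnth y j) <= \sum_(j < N) enorm (tnth x j - tnth y j).
 by rewrite (bigD1 j)//= lerDl sumr_ge0// => k _;exact: enorm_ge0.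
set S := \sum_(j < N) _ in leS *.
rewrite /pforce opprD addrACA;apply: (le_trans (enormD _ _));rewrite mulrDl;apply: lerD.
 apply: (le_trans (H1 _ _ (xr i) (yr i)));apply: (letr (`|L1| * enorm (tnth x i - tnth y i))).
 by rewrite ler_wpM2r ?enorm_ge0// ler_norm.
 by rewrite ler_wpM2l.
have N0 : (0 < N)%N by apply: leq_trans (ltn_ord i).
have NR : 0 < N%:R :> R by rewrite ltr0n.
rewrite -scalerBr -sumrB enormZ ger0_norm ?invr_ge0// ler_pdivrMl//.
apply: (le_trans (enorm_sum _ _ _)).
apply: (letr (\sum_(j < N) (2 * `|L2| * S)));last first.
 by rewrite sumr_const card_ord -[leLHS]mulr_natl.
apply: ler_sum => j _.
have hr k (z : state) : (forall i, enorm (tnth z i) <= r) -> enorm (tnth z i - tnth z k) <= 2 * r.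
 by move=> zr;apply: (le_trans (enormB _ _));have := zr i;have := zr k;lra.
apply: (le_trans (H2 _ _ (hr j x xr) (hr j y yr))).
apply: (letr (`|L2| * enorm (tnth x i - tnth x j - (tnth y i - tnth y j)))).
 by rewrite ler_wpM2r ?enorm_ge0// ler_norm.
rewrite [2 * _]mulrC -mulrA ler_wpM2l//.
have -> : tnth x i - tnth x j - (tnth y i - tnth y j) =
 (tnth x i - tnth y i) - (tnth x j - tnth y j).
 by apply/rowP => k;rewrite !mxE;ring.
by apply: (le_trans (enormB _ _));have := leS i;have := leS j;lra.
Qed.

(** The error made when the empirical average of the interaction is replaced by the mean field
    [G]. *)
Definition imbalance (G : 'rV[R]_d -> 'rV[R]_d) u (i : 'I_N) : 'rV[R]_d :=
 G (tnth u i) - N%:R^-1 *: \sum_(j < N) gW (tnth u i - tnth u j).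

Definition pweight u v (i : 'I_N) : R := 1 + enorm (tnth u i) ^+ m + enorm (tnth v i) ^+ m.

Let sqr_mean (a : 'I_N -> R) : (0 < N)%N ->
 (N%:R^-1 * \sum_(j < N) a j) ^+ 2 <= N%:R^-1 * \sum_(j < N) a j ^+ 2.
Proof.
move=> N0;have NR : 0 < N%:R :> R by rewrite ltr0n.
set A := N%:R^-1 * _.
have AE : \sum_(j < N) a j = N%:R * A by rewrite /A mulrA mulfV ?mul1r// gt_eqF.
have : 0 <= \sum_(j < N) (a j - A) ^+ 2 by apply: sumr_ge0 => j _;exact: sqr_ge0.
have -> : \sum_(j < N) (a j - A) ^+ 2 = \sum_(j < N) a j ^+ 2 - N%:R * A ^+ 2.
 rewrite (eq_bigr (fun j => a j ^+ 2 + (- 2 * A * a j + A ^+ 2)));last first.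
 by move=> j _;rewrite sqrrB;ring.
 rewrite big_split /= big_split /= -mulr_sumr AE sumr_const card_ord -mulr_natl;ring.
by rewrite subr_ge0 ler_pdivlMl.
Qed.
Lemma powD_le (a b : R) k : 0 <= a -> 0 <= b -> (a + b) ^+ k <= 2 ^+ k * (a ^+ k + b ^+ k).
Proof.
move=> a0 b0;wlog ab : a b a0 b0 / a <= b.
 have [ab|/ltW ba] := leP a b;first by move=> H;exact: H.
 by move=> H;rewrite addrC [_ ^+ k + _]addrC;exact: H.
apply: (letr ((2 * b) ^+ k)).
 by rewrite lerXn2r ?nnegrE ?addr_ge0// ?mulr_ge0//;lra.
by rewrite exprMn ler_wpM2l ?exprn_ge0// lerDr exprn_ge0.
Qed.
(** The forces are Lipschitz with a polynomial weight, so the square is a product of gap squared and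
    weight squared, split into fourth powers. The parameter [theta] is left free: it is later taken
    of order the square root of [N], over the squared size of the gap. *)
Lemma imbalance_dist G CG u v theta : drift_field G CG -> (0 < N)%N -> 0 < theta ->
 \sum_(i < N) enorm (imbalance G u i - imbalance G v i) ^+ 2 <=
 8 * (CG + M * 2 ^+ m) ^+ 2 * (theta * \sum_(i < N) enorm (tnth u i - tnth v i) ^+ 4
  + theta^-1 * \sum_(i < N) pweight u v i ^+ 4).
Proof.
move=> fG N0;pose K1 := CG + M * 2 ^+ m;rewrite -/K1;move: theta => th th0.
have M0 := sys_M sys.
have CG0 : 0 <= CG by apply: le_trans (field_0 fG);exact: enorm_ge0.
have K10 : 0 <= K1 by rewrite addr_ge0// mulr_ge0 ?exprn_ge0// ltW.
have NR : 0 < N%:R :> R by rewrite ltr0n.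
pose dd i := enorm (tnth u i - tnth v i);pose P i := pweight u v i.
have dd0 i : 0 <= dd i by exact: enorm_ge0.
have pw0 (z : state) i : 0 <= enorm (tnth z i) ^+ m by rewrite exprn_ge0// enorm_ge0.
have P0 i : 1 <= P i by rewrite /P /pweight -addrA lerDl addr_ge0.
have P0' i : 0 <= P i by exact: le_trans (P0 i).
have pw (z : state) i j : enorm (tnth z i - tnth z j) ^+ m <=
 2 ^+ m * (enorm (tnth z i) ^+ m + enorm (tnth z j) ^+ m).
 apply: le_trans (powD_le m (enorm_ge0 _) (enorm_ge0 _)).
 by rewrite lerXn2r ?nnegrE ?addr_ge0 ?enorm_ge0// enormB.
have two1 : 1 <= 2 ^+ m :> R by rewrite exprn_ege1// ler1n.
have step i j : enorm (gW (tnth u i - tnth u j) - gW (tnth v i - tnth v j)) <=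
 M * 2 ^+ m * ((dd i + dd j) * (P i + P j)).
 apply: (le_trans (gW_lip _ _)).
 rewrite -!mulrA ler_wpM2l//;first exact: ltW.
 rewrite [leRHS]mulrCA;apply: ler_pM;[exact: enorm_ge0|by rewrite !addr_ge0// exprn_ge0// enorm_ge0| |].
 rewrite /dd (_ : _ - _ - _ = (tnth u i - tnth v i) - (tnth u j - tnth v j));last first.
  by apply/rowP => k;rewrite !mxE;ring.
 exact: enormB.
 rewrite /P /pweight;have := pw u i j;have := pw v i j.
 have := pw0 u i;have := pw0 u j;have := pw0 v i;have := pw0 v j.
 move: two1;set t := 2 ^+ m;nra.
have H i : enorm (imbalance G u i - imbalance G v i) <=
 N%:R^-1 * \sum_(j < N) K1 * ((dd i + dd j) * (P i + P j)).
 have -> : imbalance G u i - imbalance G v i = (G (tnth u i) - G (tnth v i)) -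
 N%:R^-1 *: \sum_(j < N) (gW (tnth u i - tnth u j) - gW (tnth v i - tnth v j)).
 rewrite /imbalance sumrB scalerBr;apply/rowP => k;rewrite !mxE;ring.
 apply: (le_trans (enormB _ _)).
 have HG : enorm (G (tnth u i) - G (tnth v i)) <=
  N%:R^-1 * \sum_(j < N) CG * ((dd i + dd j) * (P i + P j)).
 rewrite ler_pdivlMl// -mulr_sumr.
 apply: (letr (\sum_(j < N) CG * (dd i * P i))).
  rewrite sumr_const card_ord -[leRHS]mulr_natl ler_wpM2l//.
  by apply: le_trans (field_lip fG _ _) _;rewrite -mulrA.
 rewrite -mulr_sumr ler_wpM2l//;apply: ler_sum => j _.
 by apply: ler_pM => //;rewrite lerDl.
 have HW : enorm (N%:R^-1 *: \sum_(j < N) (gW (tnth u i - tnth u j) - gW (tnth v i - tnth v j))) <=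
  N%:R^-1 * \sum_(j < N) M * 2 ^+ m * ((dd i + dd j) * (P i + P j)).
 rewrite enormZ ger0_norm ?invr_ge0// ler_wpM2l ?invr_ge0//.
 by apply: (le_trans (enorm_sum _ _ _));exact: ler_sum.
 apply: (le_trans (lerD HG HW));rewrite -mulrDr ler_wpM2l ?invr_ge0//.
 rewrite -big_split /=;apply: ler_sum => j _.
 by rewrite /K1 [leRHS]mulrDl.
have pair i j : (K1 * ((dd i + dd j) * (P i + P j))) ^+ 2 <=
 4 * K1 ^+ 2 * (th * (dd i ^+ 4 + dd j ^+ 4) + th^-1 * (P i ^+ 4 + P j ^+ 4)).
 have q4 (a b : R) : (a + b) ^+ 4 <= 8 * (a ^+ 4 + b ^+ 4).
 have h1 : 0 <= (a - b) ^+ 2 by exact: sqr_ge0.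
 have h2 : 0 <= (a ^+ 2 - b ^+ 2) ^+ 2 by exact: sqr_ge0.
 have h3 : 0 <= (a - b) ^+ 2 * (a + b) ^+ 2 by rewrite mulr_ge0// sqr_ge0.
 have h4 : 0 <= ((a - b) ^+ 2) * ((a - b) ^+ 2) by rewrite mulr_ge0.
 have h5 : 0 <= (a - b) ^+ 2 * (a ^+ 2 + b ^+ 2) by rewrite mulr_ge0// addr_ge0// sqr_ge0.
 rewrite -subr_ge0 (_ : _ - _ = (a - b) ^+ 2 * (a ^+ 2 + b ^+ 2) * 2 + 5 * (a ^+ 2 - b ^+ 2) ^+ 2);last by ring.
 lra.
 set A := dd i + dd j;set B := P i + P j.
 have h : (A * B) ^+ 2 <= 2^-1 * (th * A ^+ 4 + th^-1 * B ^+ 4).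
 have h1 : 0 <= th^-1 * (th * A ^+ 2 - B ^+ 2) ^+ 2 by rewrite mulr_ge0 ?sqr_ge0// invr_ge0 ltW.
 rewrite -subr_ge0 (_ : _ - _ = 2^-1 * (th^-1 * (th * A ^+ 2 - B ^+ 2) ^+ 2)).
  by rewrite mulr_ge0// invr_ge0.
 by field;rewrite gt_eqF.
 rewrite exprMn [4 * _]mulrC -[leRHS]mulrA ler_wpM2l ?sqr_ge0//;apply: (le_trans h).
 have hA := q4 (dd i) (dd j);have hB := q4 (P i) (P j);rewrite -/A -/B in hA hB.
 have := ler_wpM2l (ltW th0) hA;have thV : 0 <= th^-1 by rewrite invr_ge0 ltW.
 have := ler_wpM2l thV hB;lra.
apply: (letr (\sum_(i < N) N%:R^-1 * \sum_(j < N)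
 4 * K1 ^+ 2 * (th * (dd i ^+ 4 + dd j ^+ 4) + th^-1 * (P i ^+ 4 + P j ^+ 4)))).
 apply: ler_sum => i _.
 apply: (letr ((N%:R^-1 * \sum_(j < N) K1 * ((dd i + dd j) * (P i + P j))) ^+ 2)).
 rewrite lerXn2r ?nnegrE ?enorm_ge0//;apply: mulr_ge0;first by rewrite invr_ge0.
 by apply: sumr_ge0 => j _;rewrite mulr_ge0// mulr_ge0// addr_ge0.
 apply: (le_trans (sqr_mean _ N0));rewrite ler_wpM2l ?invr_ge0//.
 by apply: ler_sum => j _;exact: pair.
rewrite -mulr_sumr.
under eq_bigr => i _ do rewrite -mulr_sumr big_split /= -!mulr_sumr.
rewrite -mulr_sumr big_split /= -!mulr_sumr !sum_pairD.
have -> : \sum_(i < N) enorm (tnth u i - tnth v i) ^+ 4 = \sum_(i < N) dd i ^+ 4 by [].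
have -> : \sum_(i < N) pweight u v i ^+ 4 = \sum_(i < N) P i ^+ 4 by [].
apply: eqW.
by field;rewrite !gt_eqF.
Qed.

End ParticleOperator.

End Systems.

Section IidMap.
Context {R : realType} {d1 d2 : measure_display}.
Context {T1 : measurableType d1} {T2 : measurableType d2}.
Variables (mu : probability T1 R) (f : T1 -> T2) (mf : mble f).
Local Open Scope ereal_scope.

Definition tuple_map n (x : n.-tuple T1) : n.-tuple T2 := [tuple f (tnth x i) | i < n].

Lemma mble_tuple_map n : mble (@tuple_map n).
Proof.
apply: mblef_mktuple => i.
by apply: (mcomp mf);exact: mble_tnth.
Qed.
Lemma tuple_map_cons n a (s : n.-tuple T1) :
 tuple_map [tuple of a :: s] = [tuple of f a :: tuple_map s].
Proof.
apply: eq_from_tnth => i;rewrite tnth_mktuple.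
by case: (unliftP ord0 i) => [j ->|->];rewrite ?tnthS ?tnth0 ?tnth_mktuple.
Qed.
Lemma ex_iid_map n (g : n.-tuple T2 -> R) : mble g ->
 (forall x, (0 <= g x)%R) ->
 ex (iid (push mu mf) n) g = ex (iid mu n) (g \o @tuple_map n).
Proof.
elim: n g => [|n IH] g mg g0.
 rewrite /ex !integral_dirac//;last first.
 - exact/mbleEFin.
 - by apply/mbleEFin;apply: (mcomp mg);exact: mble_tuple_map.
 by rewrite !diracT !mul1e /=;congr (g _)%:E;apply: eq_from_tnth => -[].
have mga a : mble (fun t : n.-tuple T2 => g [tuple of a :: t]).
 by apply: (mcomp mg);apply: measurable_cons.
have mg' : mble (fun p : T2 * n.-tuple T2 => g (consT p)).
 by apply: (mcomp mg);exact: measurable_consT.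
rewrite ex_iidS//.
transitivity (\int[push mu mf]_a \int[iid mu n]_s (g [tuple of a :: tuple_map s])%:E).
 by apply: eq_integral => a _;exact: (IH _ (mga a)).
rewrite ge0_integral_distribution//;last first.
- move=> a;exact: ex_ge0.
- have mm : mble (fun p : T2 * n.-tuple T1 => g [tuple of p.1 :: tuple_map p.2]).
 apply: (mcomp mg'
  (g := fun p : T2 * n.-tuple T1 => (p.1, tuple_map p.2))).
 apply: mble_pair;first exact: mble_fst.
 by apply: (mcomp (@mble_tuple_map n));exact: mble_snd.
 exact: (mble_ex2 (iid mu n) mm).
have mgt : mble (g \o @tuple_map n.+1).
 exact: (mcomp mg (@mble_tuple_map n.+1)).
rewrite (@ex_iidS _ _ _ mu n (g \o @tuple_map n.+1) mgt (fun x => g0 _)).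
by apply: eq_integral => a _;apply: eq_integral => s _ /=;rewrite tuple_map_cons.
Qed.

End IidMap.

(** * Chains driven by independent noise *)

Section Chains.
Context {R : realType} {dE dG : measure_display}.
Context {E : measurableType dE} {G : measurableType dG}.
Variables (ga : probability G R) (f : nat -> E * G -> E).
Hypothesis mf : forall k, mble (f k).
Local Open Scope ereal_scope.

Fixpoint chain (mu0 : probability E R) k : probability E R :=
 if k is k'.+1 then push (chain mu0 k' \x ga)%E (mf k') else mu0.

Lemma ex_chainS mu0 k (g : E -> R) : mble g -> (forall x, (0 <= g x)%R) ->
 ex (chain mu0 k.+1) g = ex (chain mu0 k \x ga)%E (g \o f k).
Proof. by move=> mg g0;rewrite /= ex_push. Qed.
Lemma ex_chain_le mu0 k (g h : E -> R) : mble g ->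
 (forall x, (0 <= g x)%R) -> mble h ->
 (forall x, ex ga (fun w => g (f k (x, w))) <= (h x)%:E) ->
 ex (chain mu0 k.+1) g <= ex (chain mu0 k) h.
Proof.
move=> mg g0 mh H;rewrite ex_chainS//.
have mgf : mble (g \o f k) by exact: (mcomp mg (mf k)).
rewrite ex_prod//;last by move=> x /=.
apply: ge0_le_integral => //.
- by move=> x _;apply: integral_ge0 => w _;rewrite lee_fin /=.
- by apply: (mble_ex2 ga mgf) => x /=.
- exact/mbleEFin.
- by move=> x _;exact: H.
Qed.

End Chains.

Section ChainMap.
Context {R : realType} {dE dE' dG : measure_display}.
Context {E : measurableType dE} {E' : measurableType dE'} {G : measurableType dG}.
Variables (ga : probability G R) (f : nat -> E * G -> E) (f' : nat -> E' * G -> E').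
Hypothesis mf : forall k, mble (f k).
Hypothesis mf' : forall k, mble (f' k).
Variables (h : E -> E') (mu0 : probability E R) (mu0' : probability E' R).
Hypothesis mh : mble h.
Hypothesis hf : forall k x w, h (f k (x, w)) = f' k (h x, w).
Hypothesis h0 : forall g : E' -> R, mble g -> (forall x, 0 <= g x) ->
 ex mu0 (g \o h) = ex mu0' g.

(** Since [h] intertwines the two steps, the law of the second chain is the image of that of the
    first. Applied to the projections, it gives the marginals of the coupled chains. *)
Lemma chain_map k (g : E' -> R) : mble g -> (forall x, 0 <= g x) ->
 ex (chain ga mf mu0 k) (g \o h) = ex (chain ga mf' mu0' k) g.
Proof.
elim: k g => [|k IH] g mg g0;first exact: h0.
have mgh : mble (g \o h) by exact: (mcomp mg).
rewrite !ex_chainS//;last by move=> x /=.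
rewrite !ex_prodC//;try by [move=> x /=|exact: (mcomp mgh (mf k))|exact: (mcomp mg (mf' k))].
apply: eq_integral => w _.
have mw : mble (fun y => g (f' k (y, w))).
 apply: (mcomp mg);apply: (mcomp (mf' k)).
 by apply: mble_pair;[exact: measurable_id|exact: mble_cst].
rewrite -[RHS](IH (fun y => g (f' k (y, w))))//.
by apply: eq_integral => x _ /=;rewrite hf.
Qed.

End ChainMap.

Section IidChain.
Context {R : realType} {dE dG : measure_display}.
Context {E : measurableType dE} {G : measurableType dG}.
Variables (ga : probability G R) (f : nat -> E * G -> E).
Hypothesis mf : forall k, mble (f k).
Variables (mu0 : probability E R) (n : nat).

Definition tstep k : n.-tuple E * n.-tuple G -> n.-tuple E := @tmap _ _ _ _ _ _ (f k) n.

Lemma mble_tstep k : mble (tstep k).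
Proof. exact: mble_tmap. Qed.
Lemma ex_iid_chain k (g : n.-tuple E -> R) : mble g ->
 (forall x, 0 <= g x) ->
 ex (iid (chain ga mf mu0 k) n) g =
 ex (chain (iid ga n) mble_tstep (iid mu0 n) k) g.
Proof.
elim: k g => [//|k IH] g mg g0.
rewrite ex_chainS// {1}/ex /= integral_iid_push//;last exact/mbleEFin.
have mgt : mble (g \o tstep k) by exact: (mcomp mg (mble_tstep k)).
have ng p : 0 <= (g \o tstep k) p by exact: g0.
rewrite -(ex_prod (iid (chain ga mf mu0 k) n) (iid ga n) mgt ng).
rewrite (ex_prodC _ _ mgt ng) (ex_prodC _ _ mgt ng).
apply: eq_integral => w _;apply: (IH (fun y => (g \o tstep k) (y, w))) => //.
apply: (mcomp mg);apply: (mcomp (mble_tstep k)).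
by apply: mble_pair;[exact: measurable_id|exact: mble_cst].
Qed.

End IidChain.

Section EntropicChain.
Context {R : realType} {dS dE dG : measure_display}.
Context {S : measurableType dS} {E : measurableType dE} {G : measurableType dG}.
Variables (ga : probability G R).
Variables (f : nat -> E * G -> E) (q : nat -> S * G -> S) (p : S -> E).
Hypothesis mf : forall k, mble (f k).
Hypothesis mq : forall k, mble (q k).
Hypothesis mp : mble p.
Variables (tau : nat -> S * G -> G) (c : nat -> S -> R).
Hypothesis mtau : forall k, mble (tau k).
Hypothesis mc : forall k, mble (c k).
Hypothesis c0 : forall k s, 0 <= c k s.
Hypothesis pq : forall k s w, p (q k (s, w)) = f k (p s, tau k (s, w)).
Hypothesis DVtau : forall k s, DVle ga (fun w => tau k (s, w)) ga (c k s).

(** A discrete Girsanov theorem: under the modified noise [tau] the component [p] moves like the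
    reference chain, and each step adds its cost averaged along the coupled chain. *)
Lemma DVle_chain (rho0 : probability S R) (nu0 : probability E R) (a : R) (C : nat -> R) K :
 DVle rho0 p nu0 a ->
 (forall k, (k < K)%N -> (ex (chain ga mq rho0 k) (c k) <= (C k)%:E)%E) ->
 DVle (chain ga mq rho0 K) p (chain ga mf nu0 K) (a + \sum_(k < K) C k).
Proof.
move=> H0;elim: K => [|K IH] HC;first by rewrite big_ord0 addr0.
rewrite big_ord_recr /= addrA;apply/DVle_push => //.
have H := DVle_prod mp (mtau K) (mc K) (c0 K) (HC K (ltnSn K))
 (IH (fun k kK => HC k (leqW kK))) (DVtau K).
have := DVle_comp (mf := mf K) H.
by congr DVle;apply/funext => -[s w] /=;rewrite pq.
Qed.

End EntropicChain.

(** * The mean-field force *)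

Section Convolution.
Context {R : realType} {d : nat}.
Variables (gV gW : 'rV[R]_d -> 'rV[R]_d) (lamV lamW M : R) (m : nat).
Hypothesis sys : convex_system gV gW lamV lamW M m.

Definition conv (mu : probability 'rV[R]_d R) (x : 'rV[R]_d) : 'rV[R]_d :=
 \row_k \int[mu]_y gW (x - y) 0 k.

Lemma locally_lipschitz_measurable (g : 'rV[R]_d -> 'rV[R]_d) :
 locally_lipschitz g -> mble g.
Proof.
move=> lg;apply: mblef_rV => k;apply: continuous_measurable_rV => x.
apply: enorm_cont_at => e e0;have [r r0 H] := locally_lipschitz_cont x lg e0.
exists r => // y yr;apply: le_lt_trans (H y yr).
by have := coord_le_enorm (g y - g x) k;rewrite !mxE.
Qed.
Lemma mble_gW : mble gW.
Proof. by apply: locally_lipschitz_measurable;exact: gW_locally_lipschitz sys. Qed.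
Lemma mble_gV : mble gV.
Proof. by apply: locally_lipschitz_measurable;exact: sys_lip sys. Qed.
Lemma Rintegral_bound {dT} {T : measurableType dT} (mu : probability T R) (h g : T -> R) (c : R) :
 mble h -> mble g -> (forall x, `|h x| <= g x) ->
 (ex mu g <= c%:E)%E ->
 mu.-integrable setT (EFin \o h) /\ `|\int[mu]_x h x| <= c.
Proof.
move=> mh mg hg gc.
have nh : (ex mu (fun x => `|h x|)%R <= c%:E)%E.
 apply: le_trans gc;apply: ex_le => //.
 by apply: mcomp.
have ih : mu.-integrable setT (EFin \o h).
 apply/integrableP;split;first exact/mbleEFin.
 by apply: (le_lt_trans nh);rewrite ltry.
split => //;rewrite -lee_fin;apply: le_trans nh.
rewrite EFin_normr_Rintegral//;apply: le_abse_integral => //.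
exact/mbleEFin.
Qed.

Variables (mu : probability 'rV[R]_d R) (K : R).
Hypothesis muK : (ex mu (fun x => enorm x ^+ m)%R <= K%:E)%E.

Let K0 : 0 <= K.
Proof. by rewrite -lee_fin;apply: le_trans muK;apply: ex_ge0 => x;rewrite exprn_ge0// enorm_ge0. Qed.
Let mW x k : mble (fun y : 'rV[R]_d => gW (x - y) 0 k).
Proof.
apply: mblef_coord;apply: (mcomp mble_gW).
by apply: mble_rVB;[exact: mble_cst|exact: measurable_id].
Qed.
Let mP a b : mble (fun y : 'rV[R]_d => a + b * enorm y ^+ m).
Proof.
apply: mbleD => //;apply: mbleM => //.
by apply: mbleX;exact: mble_enorm.
Qed.
Let eP a b : 0 <= a -> 0 <= b ->
 (ex mu (fun y => a + b * enorm y ^+ m)%R <= (a + b * K)%:E)%E.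
Proof.
move=> a0 b0;have p0 (y : 'rV[R]_d) : 0 <= enorm y ^+ m by rewrite exprn_ge0// enorm_ge0.
have m1 : mble (fun y : 'rV[R]_d => enorm y ^+ m).
 by apply: mbleX;exact: mble_enorm.
rewrite (exD mu (f := fun=> a) _ (mbleM (mble_cst b) m1))//;last first.
 by move=> y;exact: mulr_ge0.
rewrite ex_cst EFinD;apply: leeD => //.
by rewrite exZ// EFinM lee_wpmul2l// lee_fin.
Qed.
Let M0 : 0 <= M. Proof. exact: ltW (sys_M sys). Qed.
Let two1 : 1 <= 2 ^+ m :> R. Proof. by rewrite exprn_ege1// ler1n. Qed.
Let en0 (x : 'rV[R]_d) : 0 <= enorm x ^+ m.
Proof. by rewrite exprn_ge0// enorm_ge0. Qed.
Lemma enormB_pow (x y : 'rV[R]_d) : enorm (x - y) ^+ m <= 2 ^+ m * (enorm x ^+ m + enorm y ^+ m).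
Proof.
apply: le_trans (powD_le m (enorm_ge0 _) (enorm_ge0 _)).
by rewrite lerXn2r ?nnegrE ?addr_ge0 ?enorm_ge0// enormB.
Qed.
Let gW_le x k y : `|gW (x - y) 0 k| <= M * (2 + 2 ^+ m * enorm x ^+ m) + (M * 2 ^+ m) * enorm y ^+ m.
Proof.
apply: (le_trans (coord_le_enorm _ _));apply: (le_trans (gW_bound sys _)).
rewrite -mulrA -mulrDr ler_wpM2l//;have := enormB_pow x y;lra.
Qed.
Lemma conv_integrable x k : mu.-integrable setT (fun y => (gW (x - y) 0 k)%:E).
Proof.
have [] := Rintegral_bound (mW x k) (mP (M * (2 + 2 ^+ m * enorm x ^+ m)) (M * 2 ^+ m)) (gW_le x k)
 (eP _ _) => //.
 by rewrite mulr_ge0// addr_ge0// mulr_ge0// exprn_ge0.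
by rewrite mulr_ge0// exprn_ge0.
Qed.

Definition conv_cst : R := d%:R * (M * (2 ^+ m * (2 + 2 * K))).

Lemma conv_cst_ge0 : 0 <= conv_cst.
Proof. by rewrite /conv_cst !mulr_ge0// ?exprn_ge0// addr_ge0// mulr_ge0. Qed.
Lemma conv_lip x y : enorm (conv mu x - conv mu y) <=
 conv_cst * enorm (x - y) * (1 + enorm x ^+ m + enorm y ^+ m).
Proof.
apply: (le_trans (enorm_le_sum _)).
apply: (letr (\sum_(k < d) M * (2 ^+ m * (2 + 2 * K)) * enorm (x - y) *
 (1 + enorm x ^+ m + enorm y ^+ m)));last first.
 by rewrite sumr_const card_ord -[leLHS]mulr_natl /conv_cst !mulrA.
apply: ler_sum => k _;rewrite !mxE -RintegralB//;try exact: conv_integrable.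
have e0 := enorm_ge0 (x - y).
have p0 := en0 x;have p0' := en0 y.
pose a := M * enorm (x - y) * (1 + 2 ^+ m * (enorm x ^+ m + enorm y ^+ m)).
pose b := M * enorm (x - y) * (2 * 2 ^+ m).
have a0 : 0 <= a by rewrite /a !mulr_ge0// addr_ge0// mulr_ge0 ?exprn_ge0// addr_ge0.
have b0 : 0 <= b by rewrite /b !mulr_ge0// exprn_ge0.
have [||_ H] := Rintegral_bound (h := fun z : 'rV[R]_d => gW (x - z) 0 k - gW (y - z) 0 k) _ (mP a b) _ (eP a0 b0).
- exact: measurable_funB.
- move=> z;have := coord_le_enorm (gW (x - z) - gW (y - z)) k;rewrite !mxE => h.
 apply: (le_trans h);apply: (le_trans (gW_lip sys _ _)).
 rewrite opprB addrA subrK.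
 have -> : a + b * enorm z ^+ m = M * enorm (x - y) *
  (1 + 2 ^+ m * (enorm x ^+ m + enorm y ^+ m) + 2 * 2 ^+ m * enorm z ^+ m).
 by rewrite /a /b;ring.
 rewrite ler_wpM2l ?mulr_ge0//.
 have := enormB_pow x z;have := enormB_pow y z;lra.
apply: (le_trans H);rewrite /a /b.
rewrite (_ : M * (2 ^+ m * (2 + 2 * K)) * enorm (x - y) * (1 + enorm x ^+ m + enorm y ^+ m) =
 M * enorm (x - y) * (2 ^+ m * (2 + 2 * K) * (1 + enorm x ^+ m + enorm y ^+ m)));last by ring.
rewrite -[M * _ * (2 * _) * K]mulrA -mulrDr ler_wpM2l ?mulr_ge0//.
move: two1 K0 p0 p0';set t := 2 ^+ m;set u := enorm x ^+ m;set v := enorm y ^+ m => t1 k0 u0 v0.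
have h1 : 0 <= t * K * u by rewrite !mulr_ge0// (le_trans ler01).
have h2 : 0 <= t * K * v by rewrite !mulr_ge0// (le_trans ler01).
have h3 : 0 <= t * K by rewrite !mulr_ge0// (le_trans ler01).
have h4 : 0 <= t * u by rewrite !mulr_ge0// (le_trans ler01).
have h5 : 0 <= t * v by rewrite !mulr_ge0// (le_trans ler01).
lra.
Qed.
Lemma conv_bound x : enorm (conv mu x) <= conv_cst * (1 + enorm x ^+ m).
Proof.
apply: (le_trans (enorm_le_sum _)).
apply: (letr (\sum_(k < d) M * (2 ^+ m * (2 + 2 * K)) * (1 + enorm x ^+ m)));last first.
 by rewrite sumr_const card_ord -[leLHS]mulr_natl /conv_cst !mulrA.
apply: ler_sum => k _;rewrite !mxE.
have a0 : 0 <= M * (2 + 2 ^+ m * enorm x ^+ m) by rewrite mulr_ge0// addr_ge0// mulr_ge0// exprn_ge0.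
have b0 : 0 <= M * 2 ^+ m by rewrite mulr_ge0// exprn_ge0.
have [_ H] := Rintegral_bound (mW x k) (mP _ _) (gW_le x k) (eP a0 b0).
apply: (le_trans H);rewrite -!mulrA -mulrDr ler_wpM2l//.
move: two1 K0 (en0 x);set t := 2 ^+ m;set u := enorm x ^+ m => t1 k0 u0.
have h1 : 0 <= t * K * u by rewrite !mulr_ge0// (le_trans ler01).
have h3 : 0 <= t * K by rewrite !mulr_ge0// (le_trans ler01).
have h4 : 0 <= t * u by rewrite !mulr_ge0// (le_trans ler01).
lra.
Qed.
Lemma conv_monotone : strongly_monotone lamW (conv mu).
Proof.
move=> x y.
have ik k : mu.-integrable setT (EFin \o (fun z => (gW (x - z) 0 k - gW (y - z) 0 k) * (x - y) 0 k)).
 have H : mu.-integrable setT (EFin \o (fun z => gW (x - z) 0 k - gW (y - z) 0 k)).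
 have := integrableB measurableT (conv_integrable x k) (conv_integrable y k).
 by apply: eq_integrable.
 have := integrableZl measurableT ((x - y) 0 k) H;apply: eq_integrable => // z _ /=.
 by rewrite -EFinM mulrC.
have isum : forall r : seq 'I_d, mu.-integrable setT (EFin \o (fun z => \sum_(k <- r)
 (gW (x - z) 0 k - gW (y - z) 0 k) * (x - y) 0 k)) /\
 \int[mu]_z (\sum_(k <- r) (gW (x - z) 0 k - gW (y - z) 0 k) * (x - y) 0 k) =
 \sum_(k <- r) (conv mu x - conv mu y) 0 k * (x - y) 0 k.
 elim => [|k r [i1 e1]].
 split;last by rewrite big_nil;under eq_Rintegral do rewrite big_nil;rewrite Rintegral_cst// mul0r.
 rewrite (_ : _ \o _ = cst 0%E);first exact: integrable0.
 by apply/funext => z /=;rewrite big_nil.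
 split.
 have := integrableD measurableT (ik k) i1;apply: eq_integrable => // z _ /=.
 by rewrite big_cons EFinD.
 rewrite big_cons;under eq_Rintegral do rewrite big_cons.
 rewrite RintegralD// e1;congr (_ + _).
 rewrite RintegralZr//;last first.
 by have := integrableB measurableT (conv_integrable x k) (conv_integrable y k);apply: eq_integrable.
 by rewrite RintegralB//;[rewrite !mxE|exact: conv_integrable|exact: conv_integrable].
have [i1 e1] := isum (index_enum 'I_d).
rewrite /dotp -e1.
have -> : lamW * enorm (x - y) ^+ 2 = \int[mu]_z (lamW * enorm (x - y) ^+ 2).
 by rewrite /Rintegral -/(ex mu (fun=> _)) ex_cst.
apply: le_Rintegral => //;first exact: finite_measure_integrable_cst.
move=> z _;have := sys_W sys (x - z) (y - z).
rewrite opprB addrA subrK /dotp;under eq_bigr do rewrite [(gW _ - gW _) 0 _]mxE [(- gW _) 0 _]mxE.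
by [].
Qed.
Lemma conv_field : drift_field lamW m (conv mu) conv_cst.
Proof.
split;[exact: conv_monotone|exact: conv_lip|].
have a0 : 0 <= M * 2 by rewrite mulr_ge0.
apply: (le_trans (enorm_le_sum _)).
apply: (letr (\sum_(k < d) M * (2 ^+ m * (2 + 2 * K))));last first.
 by rewrite sumr_const card_ord -[leLHS]mulr_natl.
apply: ler_sum => k _;rewrite mxE.
have g0 y : `|gW (0 - y) 0 k| <= M * 2 + M * enorm y ^+ m.
 rewrite sub0r;apply: (le_trans (coord_le_enorm _ _));apply: (le_trans (gW_bound sys _)).
 by rewrite enormN mulrDr.
have [_ H] := Rintegral_bound (mW 0 k) (mP _ _) g0 (eP a0 M0).
apply: (le_trans H);rewrite -mulrDr ler_wpM2l//.
move: two1 K0;set t := 2 ^+ m => t1 k0;have h3 : 0 <= (t - 1) * K by rewrite mulr_ge0// subr_ge0.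
have := mulr_ge0 (le_trans ler01 t1) k0;lra.
Qed.

End Convolution.

Lemma sqr_sum_le {R : realFieldType} {n : nat} (a : 'I_n -> R) :
 (\sum_(j < n) a j) ^+ 2 <= n%:R * \sum_(j < n) a j ^+ 2.
Proof.
have : 0 <= \sum_(i < n) \sum_(j < n) (a i - a j) ^+ 2.
 by apply: sumr_ge0 => i _;apply: sumr_ge0 => j _;exact: sqr_ge0.
have -> : \sum_(i < n) \sum_(j < n) (a i - a j) ^+ 2 =
 \sum_(i < n) \sum_(j < n) (a i ^+ 2 + a j ^+ 2) - 2 * (\sum_(j < n) a j) ^+ 2.
 rewrite expr2 big_distrlr /= mulr_sumr -sumrB;apply: eq_bigr => i _.
 by rewrite mulr_sumr -sumrB;apply: eq_bigr => j _;ring.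
by rewrite sum_pairD;lra.
Qed.
Lemma expr4D3 {R : realFieldType} (a b c : R) :
 (a + b + c) ^+ 4 <= 27 * (a ^+ 4 + b ^+ 4 + c ^+ 4).
Proof.
have h2 (x y z : R) : (x + y + z) ^+ 2 <= 3 * (x ^+ 2 + y ^+ 2 + z ^+ 2).
 rewrite -subr_ge0 (_ : _ - _ = (x - y) ^+ 2 + (y - z) ^+ 2 + (x - z) ^+ 2);last by ring.
 by rewrite !addr_ge0// sqr_ge0.
have h := h2 a b c;have h' := h2 (a ^+ 2) (b ^+ 2) (c ^+ 2).
rewrite -[4%N]/(2 * 2)%N !exprM.
apply: (letr ((3 * (a ^+ 2 + b ^+ 2 + c ^+ 2)) ^+ 2)).
 by rewrite lerXn2r ?nnegrE ?sqr_ge0// mulr_ge0// !addr_ge0// sqr_ge0.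
by rewrite exprMn;lra.
Qed.
Lemma expr4_ge0 {R : realDomainType} (a : R) : 0 <= a ^+ 4.
Proof. by rewrite -[4%N]/(2 * 2)%N exprM sqr_ge0. Qed.
Lemma abs_expr4_le {R : realDomainType} (t u : R) : `|t| <= u -> t ^+ 4 <= u ^+ 4.
Proof.
move=> tu;rewrite -(ger0_norm (expr4_ge0 t)) normrX lerXn2r ?nnegrE//.
exact: le_trans tu.
Qed.
Lemma rVB_coord {d : nat} (V : zmodType) (x y : 'rV[V]_d) k :
 (x - y) 0 k = x 0 k - y 0 k.
Proof. by rewrite !mxE. Qed.
Lemma rVZ_coord {R : pzRingType} {d : nat} (a : R) (x : 'rV[R]_d) k :
 (a *: x) 0 k = a * x 0 k.
Proof. by rewrite !mxE. Qed.

(** * Fluctuations of the empirical force of independent copies *)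

Section ImbalanceMoment.
Context {R : realType} {d : nat}.
Variables (gV gW : 'rV[R]_d -> 'rV[R]_d) (lamV lamW M : R) (m : nat).
Hypothesis sys : convex_system gV gW lamV lamW M m.
Variables (K Mv : R).

Let cc := @conv_cst R d M m K.
Let L := cc + 2 * M * 2 ^+ m.
Let s0 := 27 * L ^+ 4 * (2 + Mv) + 1.
Let e := s0 ^+ 2 * (2 * (2 + Mv)).
Let Ck := 27 * (8 * (1 + Mv) + 8 * cc ^+ 4 * (2 + Mv) + 4 * e).

(** It sees the law only through the moment bounds [K] and [Mv]. Both factors [d] come from working
    coordinate by coordinate: one from the fourth power of the norm, one from the sum over
    coordinates. *)
Definition imbalance_cst : R := d%:R ^+ 2 * Ck.

Variables (tau : probability 'rV[R]_d R) (G : 'rV[R]_d -> 'rV[R]_d) (N : nat) (eps : R).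
Hypotheses (tauK : (ex tau (fun x => enorm x ^+ m)%R <= K%:E)%E)
 (tauM : (ex tau (fun x => enorm x ^+ (8 * m))%R <= Mv%:E)%E)
 (mG : mble G) (N0 : (0 < N)%N) (epsN : eps <= N%:R^-1)
 (bias : forall z, enorm (G z - conv gW tau z) <= eps * (1 + enorm z ^+ (2 * m))).

Let K0 : 0 <= K.
Proof. by rewrite -lee_fin;apply: le_trans tauK;apply: ex_ge0 => x;rewrite exprn_ge0// enorm_ge0. Qed.
Let Mv0 : 0 <= Mv.
Proof. by rewrite -lee_fin;apply: le_trans tauM;apply: ex_ge0 => x;rewrite exprn_ge0// enorm_ge0. Qed.
Let M0 : 0 <= M. Proof. exact: ltW (sys_M sys). Qed.
Let cc0 : 0 <= cc. Proof. exact: (conv_cst_ge0 sys tauK). Qed.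
Let two1 : 1 <= 2 ^+ m :> R. Proof. by rewrite exprn_ege1// ler1n. Qed.
Let L0 : 0 <= L. Proof. by rewrite addr_ge0// !mulr_ge0// exprn_ge0. Qed.
Let s01 : 1 <= s0.
Proof. by rewrite lerDr !mulr_ge0// ?expr4_ge0// addr_ge0. Qed.
Let NR : 0 < N%:R :> R. Proof. by rewrite ltr0n. Qed.
Let N1 : 1 <= N%:R :> R. Proof. by rewrite ler1n. Qed.
Let en0 (x : 'rV[R]_d) p : 0 <= enorm x ^+ p. Proof. by rewrite exprn_ge0// enorm_ge0. Qed.
Let e0 : 0 <= e. Proof. by rewrite mulr_ge0 ?sqr_ge0// mulr_ge0// addr_ge0. Qed.
Let mconv : mble (conv gW tau).
Proof.
apply: locally_lipschitz_measurable.
exact: field_locally_lipschitz (conv_field sys tauK).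
Qed.
Let mpow p : mble (fun x : 'rV[R]_d => enorm x ^+ p).
Proof. by apply: mbleX;exact: mble_enorm. Qed.
Let pow4 (x : 'rV[R]_d) : enorm x ^+ (4 * m) <= 1 + enorm x ^+ (8 * m).
Proof.
rewrite (_ : 8 * m = (4 * m) * 2)%N;last by rewrite mulnAC.
rewrite [enorm x ^+ (4 * m * 2)]exprM;have := en0 x (4 * m);move: (enorm x ^+ (4 * m)) => t t0.
by have := sqr_ge0 (t - 1);rewrite sqrrB mulr1 expr1n;nra.
Qed.
Let ex4 : (ex tau (fun x => enorm x ^+ (4 * m))%R <= (1 + Mv)%:E)%E.
Proof.
apply: (letr (ex tau (fun x => 1 + enorm x ^+ (8 * m))%R)).
 by apply: ex_le => //;exact: mbleD.
by rewrite (exD tau (f := fun=> 1))// ex_cst EFinD leeD.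
Qed.

Section coordinate.
Variable k : 'I_d.

Let f (x a : 'rV[R]_d) : R := (conv gW tau x - gW (x - a)) 0 k.
Let s (x : 'rV[R]_d) : R := s0 * (1 + enorm x ^+ (2 * m)).

Let mf : mble (fun p : 'rV[R]_d * 'rV[R]_d => f p.1 p.2).
Proof.
apply: mblef_coord;apply: mble_rVB.
 by apply: (mcomp mconv);exact: mble_fst.
apply: (mcomp (mble_gW sys)).
by apply: mble_rVB;[exact: mble_fst|exact: mble_snd].
Qed.
Let ms : mble s.
Proof. by apply: mbleM => //;exact: mbleD. Qed.
Let s_gt0 x : 0 < s x.
Proof. by apply: mulr_gt0;[exact: lt_le_trans s01|rewrite ltr_wpDr]. Qed.
Let f_le x a : `|f x a| <= L * (1 + enorm x ^+ m + enorm a ^+ m).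
Proof.
apply: (le_trans (coord_le_enorm _ _));apply: (le_trans (enormB _ _)).
have h1 := conv_bound sys tauK x;have h2 := gW_bound sys (x - a).
have h3 := ler_wpM2l M0 (enormB_pow m x a).
have x0 := en0 x m;have a0 := en0 a m.
have : M * 2 <= M * 2 * 2 ^+ m by rewrite ler_peMr// mulr_ge0.
have : 0 <= cc * enorm a ^+ m by exact: mulr_ge0.
have : 0 <= M * 2 ^+ m * enorm x ^+ m by rewrite !mulr_ge0// exprn_ge0.
have : 0 <= M * 2 ^+ m * enorm a ^+ m by rewrite !mulr_ge0// exprn_ge0.
rewrite /L -/cc in h1 *;lra.
Qed.
Let f4 x : (ex tau (fun a => f x a ^+ 4)%R <= (s x ^+ 2)%:E)%E.
Proof.
have mx : mble (f x) by exact: (mcomp mf (measurable_pair1 x)).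
pose a := 27 * L ^+ 4 * (1 + enorm x ^+ (4 * m));pose b := 27 * L ^+ 4.
have b0 : 0 <= b by rewrite mulr_ge0// expr4_ge0.
have a0 : 0 <= a by rewrite mulr_ge0// addr_ge0.
apply: (letr (ex tau (fun y => a + b * enorm y ^+ (4 * m))%R)).
 apply: ex_le => //.
 - exact: mbleX.
 - by apply: mbleD => //;exact: mbleM.
 - by move=> y;exact: expr4_ge0.
 move=> y;apply: (letr ((L * (1 + enorm x ^+ m + enorm y ^+ m)) ^+ 4)).
 exact: abs_expr4_le.
 rewrite exprMn;have h := expr4D3 1 (enorm x ^+ m) (enorm y ^+ m).
 rewrite expr1n -!exprM ![(m * 4)%N]mulnC in h.
 have := ler_wpM2l (expr4_ge0 L) h;rewrite /a /b;lra.
rewrite (exD tau (f := fun=> a))//;last 2 first.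
 exact: mbleM.
 by move=> y;exact: mulr_ge0.
rewrite ex_cst exZ//.
apply: (letr (a%:E + b%:E * (1 + Mv)%:E)%E).
 by rewrite leeD2l// lee_wpmul2l// lee_fin.
rewrite -EFinM -EFinD lee_fin.
have x4 := en0 x (4 * m);have x2 := en0 x (2 * m).
have : s x ^+ 2 >= s0 * (1 + enorm x ^+ (4 * m)).
 rewrite /s exprMn expr2 -mulrA ler_pM2l;last exact: lt_le_trans s01.
 have h : 1 + enorm x ^+ (4 * m) <= (1 + enorm x ^+ (2 * m)) ^+ 2.
 rewrite (_ : 4 * m = (2 * m) * 2)%N;last by rewrite mulnAC.
 by rewrite exprM;lra.
 apply: (le_trans h);rewrite ler_peMl// sqr_ge0//.
apply: le_trans;rewrite /a /b /s0 -/b.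
have : 0 <= b * (1 + Mv) * enorm x ^+ (4 * m) by rewrite !mulr_ge0// addr_ge0.
rewrite /b;lra.
Qed.
Let f0 x : (\int[tau]_a (f x a)%:E = 0)%E.
Proof.
have ii := conv_integrable sys tauK x k.
rewrite /f (_ : (fun a => _) = (fun a : 'rV[R]_d => ((conv gW tau x) 0 k)%:E - (gW (x - a) 0 k)%:E)%E);last first.
 by apply/funext => a;rewrite -EFinB !mxE.
rewrite integralB//;last exact: finite_measure_integrable_cst.
rewrite -/(ex tau (fun=> _)) ex_cst /conv mxE /Rintegral fineK ?subee//.
 exact: integrable_fin_num.
exact: integrable_fin_num.
Qed.
Let se : (ex tau (fun x => s x ^+ 2)%R <= e%:E)%E.
Proof.
pose b := s0 ^+ 2 * 2.
have b0 : 0 <= b by rewrite mulr_ge0// sqr_ge0.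
apply: (letr (ex tau (fun x => b + b * enorm x ^+ (4 * m))%R)).
 apply: ex_le => //.
 - exact: mbleX.
 - by apply: mbleD => //;exact: mbleM.
 - by move=> x;exact: sqr_ge0.
 move=> x;rewrite /s exprMn (_ : 4 * m = (2 * m) * 2)%N;last by rewrite mulnAC.
 rewrite [enorm x ^+ (2 * m * 2)]exprM;set t := enorm x ^+ (2 * m).
 have h : (1 + t) ^+ 2 <= 2 * (1 + t ^+ 2) by have := sqr_ge0 (1 - t);lra.
 have := ler_wpM2l (sqr_ge0 s0) h;rewrite /b;lra.
rewrite (exD tau (f := fun=> b))//;last 2 first.
 exact: mbleM.
 by move=> y;exact: mulr_ge0.
rewrite ex_cst exZ//.
apply: (letr (b%:E + b%:E * (1 + Mv)%:E)%E).
 by rewrite leeD2l// lee_wpmul2l// lee_fin.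
by rewrite -EFinM -EFinD lee_fin /b /e;lra.
Qed.
(** As [gW 0 = 0], the average has [N - 1] effective terms while the mean field is counted [N]
    times: the difference is the middle term, of order [1 / N]. The first term is the bias between
    [G] and the field of the actual law [tau]. *)
Let imbalance_coord (v : conf N R d) i :
 imbalance gW G v i 0 k = (G (tnth v i) - conv gW tau (tnth v i)) 0 k +
 N%:R^-1 * conv gW tau (tnth v i) 0 k + N%:R^-1 * others f v i.
Proof.
have H : \sum_(j < N) gW (tnth v i - tnth v j) 0 k =
 (N%:R - 1) * conv gW tau (tnth v i) 0 k - others f v i.
 rewrite (bigD1 i)//= subrr (gW0 sys) mxE add0r /others.
 rewrite [X in _ = _ - X](eq_bigr (fun j => conv gW tau (tnth v i) 0 k - gW (tnth v i - tnth v j) 0 k));last first.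
 by move=> j _;rewrite /f [LHS]mxE [(- gW _) 0 _]mxE.
 rewrite sumrB sumr_const.
 have -> : #|[pred j : 'I_N | j != i]| = N.-1 by rewrite cardC1 card_ord.
 have E : N.-1%:R = N%:R - 1 :> R by rewrite -subn1 natrB.
 by rewrite -[conv gW tau (tnth v i) 0 k *+ _]mulr_natl E;ring.
rewrite /imbalance !rVB_coord rVZ_coord summxE H.
by field;rewrite gt_eqF.
Qed.
Let Q (x : 'rV[R]_d) : R := 8 * (1 + enorm x ^+ (8 * m)) + 8 * cc ^+ 4 * (2 + enorm x ^+ (8 * m)).

Let Q0 x : 0 <= Q x.
Proof.
by apply: addr_ge0;apply: mulr_ge0 => //;rewrite ?addr_ge0// mulr_ge0// expr4_ge0.
Qed.
Let mQ : mble Q.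
Proof. by apply: mbleD;apply: mbleM => //;exact: mbleD. Qed.
Let imbalance_coord4 (v : conf N R d) i : imbalance gW G v i 0 k ^+ 4 <=
 27 * N%:R^-1 ^+ 4 * Q (tnth v i) + 27 * N%:R^-1 ^+ 4 * others f v i ^+ 4.
Proof.
rewrite imbalance_coord;apply: (le_trans (expr4D3 _ _ _)).
set x := tnth v i.
have q2 (t : R) : 0 <= t -> (1 + t) ^+ 4 <= 8 * (1 + t ^+ 4).
 move=> t0;rewrite -[4%N]/(2 * 2)%N !exprM.
 have h : (1 + t) ^+ 2 <= 2 * (1 + t ^+ 2) by have := sqr_ge0 (1 - t);lra.
 apply: (letr ((2 * (1 + t ^+ 2)) ^+ 2)).
 by rewrite lerXn2r ?nnegrE ?sqr_ge0// mulr_ge0// addr_ge0// sqr_ge0.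
 by rewrite exprMn;have := sqr_ge0 (1 - t ^+ 2);lra.
have h1 : (G x - conv gW tau x) 0 k ^+ 4 <= N%:R^-1 ^+ 4 * (8 * (1 + enorm x ^+ (8 * m))).
 apply: (letr ((N%:R^-1 * (1 + enorm x ^+ (2 * m))) ^+ 4)).
 apply: abs_expr4_le;apply: (le_trans (coord_le_enorm _ _));apply: (le_trans (bias x)).
 by rewrite ler_wpM2r// addr_ge0.
 rewrite exprMn ler_wpM2l ?expr4_ge0//.
 apply: (le_trans (q2 _ (en0 _ _))).
 by rewrite -exprM (_ : 2 * m * 4 = 8 * m)%N// mulnAC.
have h2 : (N%:R^-1 * conv gW tau x 0 k) ^+ 4 <=
 N%:R^-1 ^+ 4 * (8 * cc ^+ 4 * (2 + enorm x ^+ (8 * m))).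
 rewrite exprMn ler_wpM2l ?expr4_ge0//.
 apply: (letr ((cc * (1 + enorm x ^+ m)) ^+ 4)).
 have hb := conv_bound sys tauK x.
 by apply: abs_expr4_le;apply: le_trans hb;exact: coord_le_enorm.
 rewrite exprMn.
 have := ler_wpM2l (expr4_ge0 cc) (q2 _ (en0 x m)).
 rewrite -exprM mulnC;have := ler_wpM2l (expr4_ge0 cc) (pow4 x);lra.
rewrite [(_ * others _ _ _) ^+ 4]exprMn /Q;lra.
Qed.
Lemma imbalance_coord_moment i :
 (ex (iid tau N) (fun v => imbalance gW G v i 0 k ^+ 4)%R <= (Ck / N%:R ^+ 2)%:E)%E.
Proof.
have mo : mble (fun v : conf N R d => others f v i).
 rewrite /others;under eq_fun do rewrite big_mkcond /=.
 apply: (@measurable_sum _ _ _ _ _ _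
 (fun j (y : conf N R d) => if j != i then f (tnth y i) (tnth y j) else 0)) => j.
 case: (j != i);last exact: mble_cst.
 apply: (mcomp (f := fun p : 'rV[R]_d * 'rV[R]_d => f p.1 p.2)
 (g := fun y : conf N R d => (tnth y i, tnth y j))) => //.
 by apply: mble_pair;exact: mble_tnth.
have c0 : 0 <= 27 * N%:R^-1 ^+ 4 :> R by rewrite mulr_ge0// expr4_ge0.
have mQi : mble (fun v : conf N R d => Q (tnth v i)).
 by apply: (mcomp mQ);exact: mble_tnth.
have mo4 : mble (fun v : conf N R d => others f v i ^+ 4) by exact: mbleX.
have m1 : mble (fun v : conf N R d => 27 * N%:R^-1 ^+ 4 * Q (tnth v i)).
 exact: mbleM.
have m2 : mble (fun v : conf N R d => 27 * N%:R^-1 ^+ 4 * others f v i ^+ 4).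
 exact: mbleM.
have o40 (v : conf N R d) : 0 <= others f v i ^+ 4 by exact: expr4_ge0.
have p1 (v : conf N R d) : 0 <= 27 * N%:R^-1 ^+ 4 * Q (tnth v i) by exact: mulr_ge0.
have p2 (v : conf N R d) : 0 <= 27 * N%:R^-1 ^+ 4 * others f v i ^+ 4 by exact: mulr_ge0.
have mi : mble (fun v : conf N R d => imbalance gW G v i 0 k ^+ 4).
 under eq_fun do rewrite imbalance_coord.
 apply: mbleX;apply: mbleD;last exact: mbleM.
 apply: mbleD.
 apply: mblef_coord;apply: mble_rVB.
  by apply: (mcomp mG);exact: mble_tnth.
 by apply: (mcomp mconv);exact: mble_tnth.
 apply: mbleM => //;apply: mblef_coord.
 by apply: (mcomp mconv);exact: mble_tnth.
apply: (le_trans (ex_le (iid tau N) mi (mbleD m1 m2) (fun=> expr4_ge0 _) (fun v => imbalance_coord4 v i))).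
rewrite (exD (iid tau N) m1 m2 p1 p2).
rewrite (exZ (iid tau N) mQi (fun=> Q0 _) c0) (exZ (iid tau N) mo4 o40 c0).
rewrite (ex_iid_coord tau i mQ Q0).
have HQ : (ex tau Q <= (8 * (1 + Mv) + 8 * cc ^+ 4 * (2 + Mv))%:E)%E.
 have mb a b : mble (fun x : 'rV[R]_d => a * (b + enorm x ^+ (8 * m))).
 by apply: mbleM => //;exact: mbleD.
 have nb a b (x : 'rV[R]_d) : 0 <= a -> 0 <= b -> 0 <= a * (b + enorm x ^+ (8 * m)).
 by move=> a0 b0;rewrite mulr_ge0// addr_ge0.
 have cc4 : 0 <= 8 * cc ^+ 4 by rewrite mulr_ge0// expr4_ge0.
 have eb a b : 0 <= a -> 0 <= b -> (ex tau (fun x => a * (b + enorm x ^+ (8 * m)))%R <= (a * (b + Mv))%:E)%E.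
 move=> a0 b0;rewrite exZ//;[|exact: mbleD|by move=> x;rewrite addr_ge0].
 rewrite EFinM lee_wpmul2l ?lee_fin//.
 by rewrite (exD tau (f := fun=> b))// ex_cst EFinD leeD.
 rewrite (exD tau (mb 8 1) (mb (8 * cc ^+ 4) 2))//;try by move=> x;exact: nb.
 by rewrite EFinD;apply: leeD;exact: eb.
have HO := others_moment4 mf ms s_gt0 f4 f0 se i.
(* Bias and diagonal are of order [N^-4]; the fluctuation brings [N^-4 * N^2] and dominates. *)
apply: (le_trans (leeD (lee_wpmul2l _ HQ) (lee_wpmul2l _ HO)));rewrite ?lee_fin//.
rewrite ler_pdivlMr ?exprn_gt0// /Ck.
set a := 8 * (1 + Mv) + _.
have a0 : 0 <= a.
 by rewrite /a;apply: addr_ge0;apply: mulr_ge0 => //;rewrite ?addr_ge0// mulr_ge0// expr4_ge0.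
rewrite (_ : (27 * N%:R^-1 ^+ 4 * a + 27 * N%:R^-1 ^+ 4 * (4 * N%:R ^+ 2 * e)) * N%:R ^+ 2 =
 27 * (a * N%:R^-1 ^+ 2 + 4 * e));last by field;rewrite gt_eqF.
rewrite ler_wpM2l// lerD2r ler_piMr// exprn_ile1 ?invr_ge0//.
by rewrite invf_le1.
Qed.

End coordinate.

Lemma imbalance_moment4 :
 (ex (iid tau N) (fun v => \sum_(i < N) enorm (imbalance gW G v i) ^+ 4)%R
 <= (imbalance_cst / N%:R)%:E)%E.
Proof.
have mi i : mble (fun v : conf N R d => imbalance gW G v i).
 apply: mble_rVB;first by apply: (mcomp mG);exact: mble_tnth.
 apply: mble_rVZ;first exact: mble_cst.
 apply: mble_rV_sum => j;apply: (mcomp (mble_gW sys)).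
 by apply: mble_rVB;exact: mble_tnth.
have mik i k : mble (fun v : conf N R d => imbalance gW G v i 0 k ^+ 4).
 by apply: mbleX;apply: mblef_coord.
have mi4 i : mble (fun v : conf N R d => enorm (imbalance gW G v i) ^+ 4).
 by apply: mbleX;apply: mblef_enorm.
have d0 : 0 <= d%:R :> R by [].
rewrite (ex_sum (iid tau N) (index_enum 'I_N) mi4);last by move=> i v;exact: expr4_ge0.
have Hi i : (ex (iid tau N) (fun v => enorm (imbalance gW G v i) ^+ 4)%R <=
 (d%:R * (d%:R * (Ck / N%:R ^+ 2)))%:E)%E.
 have msum : mble (fun v : conf N R d => \sum_(k < d) imbalance gW G v i 0 k ^+ 4).
 by apply: (@measurable_sum _ _ _ _ _ _ (fun k (v : conf N R d) => imbalance gW G v i 0 k ^+ 4)) => k.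
 have nsum (v : conf N R d) : 0 <= \sum_(k < d) imbalance gW G v i 0 k ^+ 4.
 by apply: sumr_ge0 => k _;exact: expr4_ge0.
 apply: (letr (ex (iid tau N) (fun v => d%:R * \sum_(k < d) imbalance gW G v i 0 k ^+ 4)%R)).
 apply: ex_le => //;first exact: mbleM.
 move=> v;rewrite -[4%N]/(2 * 2)%N exprM enorm_sqr;apply: (le_trans (sqr_sum_le _)).
 rewrite ler_wpM2l//;apply: ler_sum => k _.
 by rewrite exprM [X in X ^+ 2 <= _](_ : _ = imbalance gW G v i 0 k ^+ 2)// expr2.
 rewrite (exZ (iid tau N) msum nsum d0) EFinM lee_wpmul2l ?lee_fin//.
 rewrite (ex_sum (iid tau N) (index_enum 'I_d) (mik i));last by move=> k v;exact: expr4_ge0.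
 apply: (letr (\sum_(k < d) (Ck / N%:R ^+ 2)%:E)%E).
 by elim/big_ind2: _ => // [*|k _];[exact: leeD|exact: imbalance_coord_moment].
 by rewrite sumEFin lee_fin sumr_const card_ord mulr_natl.
apply: (letr (\sum_(i < N) (d%:R * (d%:R * (Ck / N%:R ^+ 2)))%:E)%E).
 by elim/big_ind2: _ => // *;exact: leeD.
rewrite sumEFin lee_fin sumr_const card_ord -[X in X <= _]mulr_natl /imbalance_cst.
apply: eqW;field.
by rewrite gt_eqF.
Qed.

End ImbalanceMoment.

Section ChainMoment.
Context {R : realType} {dE dG : measure_display}.
Context {E : measurableType dE} {G : measurableType dG}.
Variables (ga : probability G R) (f : nat -> E * G -> E).
Hypothesis mf : forall k, mble (f k).
Variables (mu0 : probability E R) (Phi : E -> R) (kap a C D B : R).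
Hypotheses (mPhi : mble Phi) (Phi0 : forall x, 0 <= Phi x).
Hypotheses (kap0 : 0 < kap) (a0 : 0 <= a) (C0 : 0 <= C) (D0 : 0 < D) (D1 : D <= 1).
Hypothesis step : forall k x, (ex ga (fun w => Phi (f k (x, w))) <=
 ((1 + kap * D) * ((Phi x + a * D) / (1 + 2 * kap * D)) + C * D)%:E)%E.
Hypothesis init : (ex mu0 Phi <= B%:E)%E.
Hypothesis BE : (1 + kap) * a + C * (1 + 2 * kap) <= kap * B.

(** The implicit drift divides by [1 + 2 kap D] and the noise multiplies by at most [1 + kap D], so
    a contraction remains. The condition on [B] makes it an invariant bound for every [D <= 1],
    hence uniform in the number of steps. *)
Lemma chain_moment k : (ex (chain ga mf mu0 k) Phi <= B%:E)%E.
Proof.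
elim: k => [//|k IH].
have den : 0 < 1 + 2 * kap * D by rewrite ltr_wpDr// !mulr_ge0// ltW.
pose r := (1 + kap * D) / (1 + 2 * kap * D).
have r0 : 0 <= r by rewrite divr_ge0 ?ltW// ltr_wpDr// mulr_ge0// ltW.
have kD : 0 <= kap * D by rewrite mulr_ge0// ltW.
pose b := r * (a * D) + C * D.
have b0 : 0 <= b by rewrite /b;apply: addr_ge0;[apply: mulr_ge0 => //|];exact: mulr_ge0 (ltW D0).
have mrP : mble (fun x => r * Phi x) by exact: mbleM.
apply: (letr (ex (chain ga mf mu0 k) (fun x => r * Phi x + b)%R)).
 apply: ex_chain_le => //;first by exact: mbleD.
 move=> x;apply: (le_trans (step k x)).
 by rewrite lee_fin;apply: eqW;rewrite /b /r;field;rewrite gt_eqF.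
rewrite (exD _ mrP (mble_cst b))//;last by move=> x;exact: mulr_ge0.
rewrite ex_cst exZ//.
apply: (letr (r%:E * B%:E + b%:E)%E);first by rewrite leeD2r// lee_wpmul2l// lee_fin.
rewrite -EFinM -EFinD lee_fin.
rewrite (_ : r * B + b = ((1 + kap * D) * (B + a * D) + C * D * (1 + 2 * kap * D)) / (1 + 2 * kap * D));last first.
 by rewrite /b /r;field;rewrite gt_eqF.
rewrite ler_pdivrMr//.
have h1 : (1 + kap * D) * a <= (1 + kap) * a.
 by rewrite ler_wpM2r// lerD2l ler_piMr// ltW.
have h2 : C * (1 + 2 * kap * D) <= C * (1 + 2 * kap).
 by rewrite ler_wpM2l// lerD2l ler_piMr// mulr_ge0// ltW.
have h3 : (1 + kap * D) * a + C * (1 + 2 * kap * D) <= kap * B.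
 by apply: le_trans BE;exact: lerD.
have h4 := ler_wpM2l (ltW D0) h3;lra.
Qed.

End ChainMoment.

(** * Implicit steps of the two systems *)

Section Operators.
Context {R : realType} {d : nat}.
Variables (gV gW : 'rV[R]_d -> 'rV[R]_d) (lamV lamW M : R) (m : nat).
Hypothesis sys : convex_system gV gW lamV lamW M m.

Local Notation beta := (beta_cst lamV lamW).
Local Notation lam := (lamV + lamW).

Definition vstep (G : 'rV[R]_d -> 'rV[R]_d) (D : R) : 'rV[R]_d -> 'rV[R]_d :=
 resolvent (fun y => y + D *: (gV y + G y)).

(* Dividing the tested inequality by |v|^(2p+1) is done with Young's inequality. *)
Let absorb (a v c l D : R) p : 0 <= a -> 0 <= v -> 0 <= c -> 0 < l -> 0 <= D ->
 (1 + l * D) * v ^+ p.+1 <= (a + D * c) * v ^+ p ->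
 (1 + l * D) * v ^+ p.+1 <= a ^+ p.+1 + l * (c / l) ^+ p.+1 * D.
Proof.
move=> a0 v0 c0 l0 D0 h.
have lD : 0 <= l * D by rewrite mulr_ge0// ltW.
have h1 := young_power p a0 v0.
have h2 := young_power p (divr_ge0 c0 (ltW l0)) v0.
have p0 : 0 <= p.+1%:R :> R by [].
have h3 := ler_wpM2l p0 h.
have h4 := ler_wpM2l lD h2.
have E : p.+1%:R * ((a + D * c) * v ^+ p) =
 p.+1%:R * (a * v ^+ p) + l * D * (p.+1%:R * (c / l * v ^+ p)).
 by field;rewrite gt_eqF.
rewrite E in h3;rewrite -natr1 in h1 h3 h4 *;lra.
Qed.

Section vstep.
Variables (G : 'rV[R]_d -> 'rV[R]_d) (CG D : R).
Hypotheses (fG : drift_field lamW m G CG) (D0 : 0 <= D).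

Let op y := y + D *: (gV y + G y).

Let F_mono x y : lam * enorm (x - y) ^+ 2 <= dotp (gV x + G x - (gV y + G y)) (x - y).
Proof.
rewrite opprD addrACA dotpDl mulrDl;apply: lerD;first exact: sys_V sys x y.
exact: field_monotone fG x y.
Qed.
Let op_mono : strongly_monotone 1 op.
Proof.
move=> x y;rewrite mul1r /op opprD addrACA -scalerBr dotpDl dotpZl -enorm_sqr lerDl.
rewrite mulr_ge0//;apply: le_trans (F_mono x y).
by rewrite mulr_ge0 ?sqr_ge0// ltW// (sum_lam_gt0 sys).
Qed.
Let op_lip : locally_lipschitz op.
Proof.
move=> r;have [L1 H1] := sys_lip sys r;have [L2 H2] := field_locally_lipschitz fG r.
exists (1 + D * (L1 + L2)) => x y xr yr.
rewrite /op opprD addrACA -scalerBr;apply: (le_trans (enormD _ _)).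
rewrite enormZ ger0_norm// mulrDl mul1r lerD2l -mulrA ler_wpM2l//.
rewrite opprD addrACA;apply: (le_trans (enormD _ _));rewrite mulrDl.
by apply: lerD;[exact: H1|exact: H2].
Qed.
Lemma vstepK y : vstep G D y + D *: (gV (vstep G D y) + G (vstep G D y)) = y.
Proof. exact: (resolventK y op_mono op_lip). Qed.
Lemma vstep_nonexpansive y z : enorm (vstep G D y - vstep G D z) <= enorm (y - z).
Proof. exact: resolvent_nonexpansive. Qed.
Lemma mble_vstep : mble (vstep G D).
Proof. exact: mble_resolvent. Qed.
Lemma vstep_expand u v : enorm (u - v) <= enorm (op u - op v).
Proof. exact: strongly_monotone_expand. Qed.

Definition field_size := enorm (gV 0) + CG.

Lemma field_size_ge0 : 0 <= field_size.
Proof.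
by rewrite addr_ge0 ?enorm_ge0//;apply: le_trans (field_0 fG);exact: enorm_ge0.
Qed.
Lemma vstep_bound y : (1 + lam * D) * enorm (vstep G D y) <= enorm y + D * field_size.
Proof.
set v := vstep G D y;have vE : v + D *: (gV v + G v) = y by exact: vstepK.
have h : (1 + lam * D) * enorm v ^+ 2 <= (enorm y + D * field_size) * enorm v.
 have : dotp y v <= enorm y * enorm v by exact: dotp_le.
 rewrite -{1}vE dotpDl dotpZl -enorm_sqr.
 have := F_mono v 0;rewrite subr0 dotpBl => h1.
 have : - (field_size * enorm v) <= dotp (gV 0 + G 0) v.
 have := dotp_le_abs (gV 0 + G 0) v;rewrite ler_norml => /andP[+ _].
 apply: le_trans;rewrite lerN2 ler_wpM2r ?enorm_ge0//.
 by apply: (le_trans (enormD _ _));rewrite lerD2l;exact: field_0 fG.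
 move=> h2 h3;have h4 : lam * enorm v ^+ 2 - field_size * enorm v <= dotp (gV v + G v) v by lra.
 by have := ler_wpM2l D0 h4;lra.
have := enorm_ge0 v;rewrite le_eqVlt => /predU1P[<-|v0].
 by rewrite mulr0 addr_ge0 ?enorm_ge0// mulr_ge0// field_size_ge0.
by rewrite -(ler_pM2r v0) -mulrA -expr2.
Qed.
Lemma vstep_power p y : (1 + lam * D) * enorm (vstep G D y) ^+ p.+1 <=
 enorm y ^+ p.+1 + lam * (field_size / lam) ^+ p.+1 * D.
Proof.
apply: absorb => //;rewrite ?enorm_ge0 ?field_size_ge0 ?(sum_lam_gt0 sys)//.
by rewrite exprS mulrA ler_wpM2r ?exprn_ge0 ?enorm_ge0// vstep_bound.
Qed.

End vstep.

Section pstep.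
Context {N : nat}.
Local Notation state := (conf N R d).
Variables (D : R).
Hypothesis D0 : 0 <= D.

Let op (x : state) i := tnth x i + D *: pforce gV gW x i.

Definition pstep : state -> state := tresolvent op.

Let op_mono (x y : state) : \sum_(i < N) enorm (tnth x i - tnth y i) ^+ 2 <=
 \sum_(i < N) dotp (op x i - op y i) (tnth x i - tnth y i).
Proof.
have H := pforce_contraction sys 0 x y.
rewrite [leRHS](eq_bigr (fun i => enorm (tnth x i - tnth y i) ^+ 2 +
 D * dotp (pforce gV gW x i - pforce gV gW y i) (psi 0 (tnth x i - tnth y i)))).
 rewrite big_split /= lerDl -mulr_sumr mulr_ge0//;apply: le_trans H.
 rewrite mulr_ge0//;first exact: ltW (beta_gt0 sys).
 by apply: sumr_ge0 => i _;rewrite exprn_ge0// enorm_ge0.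
move=> i _;rewrite /psi muln0 expr0 scale1r.
have -> : op x i - op y i = (tnth x i - tnth y i) + D *: (pforce gV gW x i - pforce gV gW y i).
 by rewrite /op opprD addrACA scalerBr.
by rewrite dotpDl dotpZl -enorm_sqr.
Qed.
Let op_lip (r : R) : exists L : R, forall x y : state,
 (forall i, enorm (tnth x i) <= r) -> (forall i, enorm (tnth y i) <= r) ->
 forall i, enorm (op x i - op y i) <= L * \sum_(j < N) enorm (tnth x j - tnth y j).
Proof.
have [L H] := pforce_lipschitz sys (N := N) r.
exists (1 + D * L) => x y xr yr i.
rewrite /op opprD addrACA -scalerBr;apply: (le_trans (enormD _ _)).
rewrite enormZ ger0_norm// mulrDl mul1r -mulrA;apply: lerD.
 by rewrite (bigD1 i)//= lerDl sumr_ge0// => j _;exact: enorm_ge0.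
by rewrite ler_wpM2l// H.
Qed.
Lemma pstepK x i : tnth (pstep x) i + D *: pforce gV gW (pstep x) i = tnth x i.
Proof. exact: (tresolventK op_mono op_lip). Qed.
Lemma mble_pstep : mble pstep.
Proof. exact: mble_tresolvent op_mono op_lip. Qed.
(** Contraction against the configuration at the origin, where all interactions vanish and the force
    is [gV 0]; Young's inequality with exponent [2p+2] then disposes of both scalar products. *)
Lemma pstep_power p x : (1 + beta * D) * \sum_(i < N) enorm (tnth (pstep x) i) ^+ (2 * p.+1) <=
 \sum_(i < N) enorm (tnth x i) ^+ (2 * p.+1) +
 N%:R * (beta * (enorm (gV 0) / beta) ^+ (2 * p.+1)) * D.
Proof.
set u := pstep x;pose z : state := [tuple 0 | i < N].
have zE i : tnth z i = 0 by rewrite tnth_mktuple.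
have fz i : pforce gV gW z i = gV 0.
 by rewrite /pforce zE big1 ?scaler0 ?addr0// => j _;rewrite !zE subrr (gW0 sys).
have b0 := beta_gt0 sys;set c := enorm (gV 0).
have H := pforce_contraction sys p u z.
have H' : beta * \sum_(i < N) enorm (tnth u i) ^+ (2 * p.+1) <=
 \sum_(i < N) dotp (pforce gV gW u i - gV 0) (psi p (tnth u i)).
 have E1 : \sum_(i < N) enorm (tnth u i - tnth z i) ^+ (2 * p.+1) = \sum_(i < N) enorm (tnth u i) ^+ (2 * p.+1).
 by apply: eq_bigr => i _;rewrite zE subr0.
 rewrite E1 in H;apply: (le_trans H);apply: eqW.
 by apply: eq_bigr => i _;rewrite fz zE subr0.
set S := \sum_(i < N) enorm (tnth u i) ^+ _ in H' *.
have q0 : 0 <= (2 * p.+1)%:R :> R by [].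
have term i : (2 * p.+1)%:R * (dotp (tnth x i) (psi p (tnth u i)) - D * dotp (gV 0) (psi p (tnth u i))) <=
 enorm (tnth x i) ^+ (2 * p.+1) + beta * (c / beta) ^+ (2 * p.+1) * D +
 (1 + beta * D) * (2 * p).+1%:R * enorm (tnth u i) ^+ (2 * p.+1).
 have y1 := young_power (2 * p).+1 (enorm_ge0 (tnth x i)) (enorm_ge0 (tnth u i)).
 have y2 := young_power (2 * p).+1 (divr_ge0 (enorm_ge0 (gV 0)) (ltW b0)) (enorm_ge0 (tnth u i)).
 rewrite -/c in y2.
 have d1 := dotp_psi_le p (tnth x i) (tnth u i).
 have d2 : - dotp (gV 0) (psi p (tnth u i)) <= c * enorm (tnth u i) ^+ (2 * p).+1.
 by rewrite -dotpNl;apply: (le_trans (dotp_psi_le _ _ _));rewrite enormN.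
 have d3 := ler_wpM2l D0 d2.
 have bD : 0 <= beta * D by rewrite mulr_ge0// ltW.
 have y3 := ler_wpM2l bD y2.
 have d4 : dotp (tnth x i) (psi p (tnth u i)) - D * dotp (gV 0) (psi p (tnth u i)) <=
 enorm (tnth x i) * enorm (tnth u i) ^+ (2 * p).+1 + D * (c * enorm (tnth u i) ^+ (2 * p).+1) by lra.
 have d5 := ler_wpM2l q0 d4.
 have qE : (2 * p.+1 = (2 * p).+2)%N by rewrite mulnS.
 have E : D * (c * enorm (tnth u i) ^+ (2 * p).+1) =
 beta * D * (c / beta * enorm (tnth u i) ^+ (2 * p).+1) by field;rewrite gt_eqF.
 rewrite E qE in d5;rewrite qE;lra.
have sum : (2 * p.+1)%:R * (S + D * \sum_(i < N) dotp (pforce gV gW u i - gV 0) (psi p (tnth u i))) <=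
 \sum_(i < N) enorm (tnth x i) ^+ (2 * p.+1) + N%:R * (beta * (c / beta) ^+ (2 * p.+1) * D) +
 (1 + beta * D) * (2 * p).+1%:R * S.
 rewrite [leRHS](_ : _ = \sum_(i < N) (enorm (tnth x i) ^+ (2 * p.+1) + beta * (c / beta) ^+ (2 * p.+1) * D +
 (1 + beta * D) * (2 * p).+1%:R * enorm (tnth u i) ^+ (2 * p.+1)));last first.
 rewrite big_split /= big_split /= sumr_const card_ord.
 by congr (_ + _ + _);[rewrite mulr_natl|rewrite /S mulr_sumr].
 rewrite /S mulr_sumr -big_split /= mulr_sumr;apply: ler_sum => i _.
 apply: le_trans (term i);rewrite ler_wpM2l// -(dotp_psi p).
 have -> : dotp (tnth x i) (psi p (tnth u i)) =
  dotp (tnth u i) (psi p (tnth u i)) + D * dotp (pforce gV gW u i) (psi p (tnth u i)).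
 by rewrite -dotpZl -dotpDl pstepK.
 by rewrite dotpBl;lra.
have := ler_wpM2l D0 H' => h1.
have := ler_wpM2l q0 h1;have -> : (2 * p.+1)%:R = (2 * p).+1%:R + 1 :> R by rewrite natr1 mulnS.
move: sum;have -> : (2 * p.+1)%:R = (2 * p).+1%:R + 1 :> R by rewrite natr1 mulnS.
lra.
Qed.
(** The step of the copies solves the implicit equation of the particle system up to the imbalance
    at its own end point. Subtracting the two equations puts the difference in the form to which
    [pforce_step] applies. *)
Lemma sync_step p (G : 'rV[R]_d -> 'rV[R]_d) CG (x y v : state) :
 drift_field lamW m G CG -> v = tuple_map (vstep G D) y ->
 (1 + (2 * p.+1)%:R * beta * D) *
 \sum_(i < N) enorm (tnth (pstep x) i - tnth v i) ^+ (2 * p.+1) <=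
 \sum_(i < N) enorm (tnth x i - tnth y i + D *: imbalance gW G v i) ^+ (2 * p.+1).
Proof.
move=> fG vE;have vi i : tnth v i = vstep G D (tnth y i) by rewrite vE tnth_mktuple.
apply: (le_trans (pforce_step sys p (pstep x) v D0)).
apply: eqW;apply: eq_bigr => i _;congr (enorm _ ^+ _).
rewrite -[in RHS](pstepK x i) -[tnth y i in RHS](vstepK fG D0) -vi.
by rewrite /pforce /imbalance;apply/rowP => k;rewrite !mxE;ring.
Qed.
(** Both steps start from the same point. Inserting the end point of the particle step in the
    mean-field equation leaves [D] times the imbalance, and the mean-field operator is expanding. *)
Lemma pstep_vstep (G : 'rV[R]_d -> 'rV[R]_d) CG (x : state) i : drift_field lamW m G CG ->
 enorm (tnth (pstep x) i - vstep G D (tnth x i)) <= D * enorm (imbalance gW G (pstep x) i).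
Proof.
move=> fG;set u := pstep x;set v := vstep G D (tnth x i).
apply: (le_trans (vstep_expand fG D0 _ _));rewrite -[D in leRHS](ger0_norm D0) -enormZ.
rewrite (vstepK fG D0) -(pstepK x i) -/u /pforce /imbalance.
apply: eqW;congr enorm.
apply/rowP => k;rewrite !mxE;ring.
Qed.

End pstep.

End Operators.

Lemma chain_shift {R : realType} {dE dG : measure_display} {E : measurableType dE}
 {G : measurableType dG} (ga : probability G R) (f : nat -> E * G -> E)
 (mf : forall k, mble (f k)) (mu0 : probability E R) k0 k :
 chain ga mf mu0 (k0 + k) =
 chain ga (f := fun j => f (k0 + j)%N) (fun j => mf (k0 + j)%N) (chain ga mf mu0 k0) k.
Proof. by elim: k => [|k IH];rewrite ?addn0// addnS /= IH. Qed.

(** * The synchronous coupling *)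

Section Couplings.
Context {R : realType} {d : nat}.
Variables (gV gW : 'rV[R]_d -> 'rV[R]_d) (lamV lamW M : R) (m : nat).
Hypothesis sys : convex_system gV gW lamV lamW M m.
Context {N : nat}.
Local Notation state := (conf N R d).
Variables (G : nat -> 'rV[R]_d -> 'rV[R]_d) (CG D : R).
Hypothesis fG : forall k, drift_field lamW m (G k) CG.
Hypothesis D0 : 0 < D.

Local Notation beta := (beta_cst lamV lamW).
Local Notation ga := (gauss (Num.sqrt D) : probability 'rV[R]_d R).
Local Notation gaN := (iid ga N).
Local Notation vs k := (vstep gV (G k) D).
Local Notation ps := (pstep gV gW D : state -> state).
Let s2 : R := Num.sqrt 2.
Let D0' : 0 <= D. Proof. exact: ltW. Qed.
Let s20 : 0 < s2. Proof. by rewrite sqrtr_gt0. Qed.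

Definition mv_step k (p : 'rV[R]_d * 'rV[R]_d) : 'rV[R]_d := vs k p.1 + s2 *: p.2.

Lemma mble_mv_step k : mble (mv_step k).
Proof.
apply: mble_rVD;last by apply: mble_rVZ;[exact: mble_cst|exact: mble_snd].
by apply: (mcomp (mble_vstep sys (fG k) D0'));exact: mble_fst.
Qed.

Definition ps_step (k : nat) (p : state * state) : state :=
 [tuple tnth (ps p.1) i + s2 *: tnth p.2 i | i < N].

Lemma mble_ps_step k : mble (ps_step k).
Proof.
apply: mblef_mktuple => i;apply: mble_rVD.
 apply: mblef_tnth;apply: (mcomp (mble_pstep sys D0')).
 exact: mble_fst.
apply: mble_rVZ;first exact: mble_cst.
by apply: mblef_tnth;exact: mble_snd.
Qed.
Let mvs k : mble (vs k). Proof. exact: (mble_vstep sys (fG k) D0'). Qed.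
Let mps : mble ps. Proof. exact: (mble_pstep sys D0'). Qed.
Let mfst2 : mble (fun q : (state * state) * state => (q.1.1, q.2)).
Proof.
apply: mble_pair;last exact: mble_snd.
by apply: (mcomp mble_fst);exact: mble_fst.
Qed.
Let msnd2 : mble (fun q : (state * state) * state => (q.1.2, q.2)).
Proof.
apply: mble_pair;last exact: mble_snd.
by apply: (mcomp mble_snd);exact: mble_fst.
Qed.

Section Synchronous.

Definition sync_pair k (q : (state * state) * state) : state * state :=
 (ps_step k (q.1.1, q.2), tstep mv_step k (q.1.2, q.2)).

Lemma mble_sync_pair k : mble (sync_pair k).
Proof.
apply: mble_pair.
 exact: (mcomp (mble_ps_step k) mfst2).
exact: (mcomp (mble_tstep mble_mv_step k) msnd2).
Qed.

Variables (x0 y0 : probability state R) (pi0 : probability (state * state)%type R).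
Hypothesis pi_fst : forall g : state -> R, mble g -> (forall x, 0 <= g x) ->
 ex pi0 (g \o fst) = ex x0 g.
Hypothesis pi_snd : forall g : state -> R, mble g -> (forall x, 0 <= g x) ->
 ex pi0 (g \o snd) = ex y0 g.

Local Notation Pi := (chain gaN mble_sync_pair pi0).
Local Notation mu := (chain gaN mble_ps_step x0).
Local Notation nu := (chain gaN (@mble_tstep _ _ _ _ _ mble_mv_step N) y0).

Lemma sync_fst k (g : state -> R) : mble g -> (forall x, 0 <= g x) ->
 ex (Pi k) (g \o fst) = ex (mu k) g.
Proof. by move=> mg g0;apply: chain_map => //;exact: mble_fst. Qed.
Lemma sync_snd k (g : state -> R) : mble g -> (forall x, 0 <= g x) ->
 ex (Pi k) (g \o snd) = ex (nu k) g.
Proof. by move=> mg g0;apply: chain_map => //;exact: mble_snd. Qed.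

Definition gap4 (q : state * state) : R := \sum_(i < N) enorm (tnth q.1 i - tnth q.2 i) ^+ 4.

Definition gap4_step k (q : state * state) : R :=
 \sum_(i < N) enorm (tnth (ps q.1) i - vs k (tnth q.2 i)) ^+ 4.

Definition noise4 k (y : state) : R :=
 \sum_(i < N) enorm (imbalance gW (G k) (tuple_map (vs k) y) i) ^+ 4.

Let mgap4 : mble gap4.
Proof.
apply: (@measurable_sum _ _ _ _ _ _ (fun i (q : state * state) => enorm (tnth q.1 i - tnth q.2 i) ^+ 4)) => i.
apply: mbleX;apply: mblef_enorm;apply: mble_rVB.
 by apply: mblef_tnth;exact: mble_fst.
by apply: mblef_tnth;exact: mble_snd.
Qed.
Let mgap4_step k : mble (gap4_step k).
Proof.
apply: (@measurable_sum _ _ _ _ _ _ (fun i (q : state * state) => enorm (tnth (ps q.1) i - vs k (tnth q.2 i)) ^+ 4)) => i.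
apply: mbleX;apply: mblef_enorm;apply: mble_rVB.
 by apply: mblef_tnth;apply: (mcomp mps);exact: mble_fst.
by apply: (mcomp (mvs k));apply: mblef_tnth;exact: mble_snd.
Qed.
Lemma mble_imbalance k i :
 mble (fun u : state => imbalance gW (G k) u i).
Proof.
have mG : mble (G k).
 by apply: locally_lipschitz_measurable;exact: (field_locally_lipschitz (fG k)).
apply: mble_rVB;first by apply: (mcomp mG);exact: mble_tnth.
apply: mble_rVZ;first exact: mble_cst.
apply: mble_rV_sum => j;apply: (mcomp (mble_gW sys)).
by apply: mble_rVB;exact: mble_tnth.
Qed.
Let mnoise4 k : mble (noise4 k).
Proof.
apply: (@measurable_sum _ _ _ _ _ _ (fun i (y : state) =>
 enorm (imbalance gW (G k) (tuple_map (vs k) y) i) ^+ 4)) => i.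
apply: mbleX;apply: mblef_enorm.
apply: (mcomp (mble_imbalance k i)).
exact: (mble_tuple_map (mvs k) (n := N)).
Qed.
Let gap40 q : 0 <= gap4 q. Proof. by apply: sumr_ge0 => i _;exact: expr4_ge0. Qed.
Let gap4_step0 k q : 0 <= gap4_step k q. Proof. by apply: sumr_ge0 => i _;exact: expr4_ge0. Qed.
Let noise40 k y : 0 <= noise4 k y. Proof. by apply: sumr_ge0 => i _;exact: expr4_ge0. Qed.

(* The noise is common to both marginals, so it cancels in the difference. *)
Let gap4_sync k q g : gap4 (sync_pair k (q, g)) = gap4_step k q.
Proof.
apply: eq_bigr => i _;congr (enorm _ ^+ 4).
rewrite /sync_pair /ps_step /tstep /tmap /mv_step /= !tnth_mktuple /=.
by rewrite opprD addrACA subrr addr0.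
Qed.
Let expr4D_le (a b th : R) : 0 <= a -> 0 <= b -> 0 < th ->
 (a + b) ^+ 4 <= (1 + th) ^+ 3 * a ^+ 4 + (1 + th^-1) ^+ 3 * b ^+ 4.
Proof.
move=> a0 b0 th0;have thV : 0 < th^-1 by rewrite invr_gt0.
have sq (x y : R) : (x + y) ^+ 2 <= (1 + th) * x ^+ 2 + (1 + th^-1) * y ^+ 2.
 have : 0 <= th^-1 * (th * x - y) ^+ 2 by rewrite mulr_ge0 ?sqr_ge0// ltW.
 rewrite (_ : th^-1 * (th * x - y) ^+ 2 = th * x ^+ 2 - 2 * x * y + th^-1 * y ^+ 2);last first.
 by field;rewrite gt_eqF.
 by lra.
have h1 := sq a b;have h2 := sq ((1 + th) * a ^+ 2) ((1 + th^-1) * b ^+ 2).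
rewrite -[4%N]/(2 * 2)%N !exprM.
apply: (letr (((1 + th) * a ^+ 2 + (1 + th^-1) * b ^+ 2) ^+ 2)).
 by rewrite lerXn2r ?nnegrE ?sqr_ge0// addr_ge0//;apply: mulr_ge0;rewrite ?sqr_ge0// addr_ge0// ltW.
by apply: (le_trans h2);rewrite !exprMn;lra.
Qed.

Variable eta : R.
Hypothesis eta0 : 0 < eta.

Lemma gap4_step_le k (B : R) : 0 < B -> (ex (nu k) (noise4 k) <= (eta ^+ 4)%:E)%E ->
 (ex (Pi k) gap4 <= (B ^+ 4)%:E)%E ->
 (ex (Pi k) (gap4_step k) <= ((B + D * eta) ^+ 4 / (1 + 4 * beta * D))%:E)%E.
Proof.
move=> B0 Hn Hg.
have b0 := beta_gt0 sys.
have De0 : 0 < D * eta by exact: mulr_gt0.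
(* The optimal weight: with it the two terms of [expr4D_le] recombine exactly into
   [(B + D * eta)^4], as in Minkowski's inequality. *)
pose th := D * eta / B;have th0 : 0 < th by exact: divr_gt0.
have den : 0 < 1 + 4 * beta * D by rewrite ltr_wpDr// !mulr_ge0// ltW.
pose r := (1 + 4 * beta * D)^-1;have r0 : 0 <= r by rewrite invr_ge0 ltW.
pose a := r * (1 + th) ^+ 3;pose b := r * ((1 + th^-1) ^+ 3 * D ^+ 4).
have t1 : 0 <= 1 + th by rewrite addr_ge0// ltW.
have t2 : 0 <= 1 + th^-1 by rewrite addr_ge0// invr_ge0 ltW.
have a0 : 0 <= a by rewrite mulr_ge0// exprn_ge0.
have b0' : 0 <= b by rewrite mulr_ge0// mulr_ge0// exprn_ge0.
have mn2 : mble (noise4 k \o snd : state * state -> R).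
 exact: (mcomp (mnoise4 k) mble_snd).
have m1 : mble (fun q => a * gap4 q) by exact: mbleM.
have m2 : mble (fun q : state * state => b * (noise4 k \o snd) q) by exact: mbleM.
have pw q : gap4_step k q <= a * gap4 q + b * (noise4 k \o snd) q.
 have h := sync_step sys D0' 1 q.1 (fG k) (erefl (tuple_map (vs k) q.2)).
 have h' : (1 + 4 * beta * D) * gap4_step k q <=
  \sum_(i < N) enorm (tnth q.1 i - tnth q.2 i + D *: imbalance gW (G k) (tuple_map (vs k) q.2) i) ^+ 4.
 apply: le_trans h;apply: eqW;congr (_ * _).
 by rewrite /gap4_step;apply: eq_bigr => i _;rewrite [tnth (tuple_map _ _) i]tnth_mktuple.
 rewrite /a /b -!mulrA -mulrDr /r -ler_pdivrMl ?invrK ?invr_gt0//.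
 apply: (le_trans h');rewrite /gap4 /noise4 /= !mulr_sumr -big_split /=;apply: ler_sum => i _.
 apply: (letr ((enorm (tnth q.1 i - tnth q.2 i) + D * enorm (imbalance gW (G k) (tuple_map (vs k) q.2) i)) ^+ 4)).
 apply: abs_expr4_le;rewrite ger0_norm ?enorm_ge0//;apply: (le_trans (enormD _ _)).
 by rewrite enormZ ger0_norm.
 apply: (le_trans (expr4D_le (enorm_ge0 _) (mulr_ge0 D0' (enorm_ge0 _)) th0)).
 by rewrite exprMn;apply: eqW;ring.
apply: (le_trans (ex_le (Pi k) (mgap4_step k) (mbleD m1 m2) (gap4_step0 k) pw)).
rewrite (exD _ m1 m2);[|by move=> q;exact: mulr_ge0|by move=> q;apply: mulr_ge0 => //=].
rewrite (exZ _ mgap4 gap40 a0) (exZ _ mn2 (fun q => noise40 k q.2) b0') (sync_snd _ (mnoise4 k) (noise40 k)).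
apply: (le_trans (leeD (lee_wpmul2l _ Hg) (lee_wpmul2l _ Hn)));rewrite ?lee_fin//.
rewrite /a /b /r /th;apply: eqW.
by field;rewrite !gt_eqF// ?mulr_gt0//.
Qed.

Variables (r B0 : R).
Hypotheses (r01 : 0 < r < 1) (rE : r ^+ 4 * (1 + 4 * beta * D) = 1) (B00 : 0 < B0).

Let En := D * eta * r / (1 - r).
(** [En] is the fixed point of [b |-> r * (b + D * eta)] and [gap_bound] is an orbit of this map,
    which is the recursion obeyed by the fourth root of the moment of the gap. *)
Definition gap_bound k : R := r ^+ k * B0 + En.

Lemma gap_bound_gt0 k : 0 < gap_bound k.
Proof.
case/andP: r01 => r0 r1;apply: addr_gt0;first by rewrite mulr_gt0// exprn_gt0.
by rewrite divr_gt0 ?subr_gt0// !mulr_gt0.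
Qed.
Let gap_boundS k : r * (gap_bound k + D * eta) = gap_bound k.+1.
Proof.
case/andP: r01 => r0 r1.
by rewrite /gap_bound /En exprS;field;rewrite subr_eq0 gt_eqF.
Qed.
Lemma gap4_le k : (ex pi0 gap4 <= (B0 ^+ 4)%:E)%E ->
 (forall j, (j <= k)%N -> (ex (nu j) (noise4 j) <= (eta ^+ 4)%:E)%E) ->
 (ex (Pi k) gap4 <= (gap_bound k ^+ 4)%:E)%E /\
 (ex (Pi k) (gap4_step k) <= (gap_bound k.+1 ^+ 4)%:E)%E.
Proof.
have b0 := beta_gt0 sys.
have den : 0 < 1 + 4 * beta * D by rewrite ltr_wpDr// !mulr_ge0// ltW.
move=> H0;elim: k => [|k IH] Hn.
 have H1 : (ex (Pi 0%N) gap4 <= (gap_bound 0 ^+ 4)%:E)%E.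
 apply: (le_trans H0);rewrite lee_fin lerXn2r ?nnegrE//;[exact: ltW|exact: ltW (gap_bound_gt0 0)|].
 rewrite /gap_bound expr0 mul1r lerDl.
 by case/andP: r01 => r0 r1;rewrite ltW// divr_gt0 ?subr_gt0// !mulr_gt0.
 split => //;apply: (le_trans (gap4_step_le (gap_bound_gt0 0) (Hn 0%N isT) H1)).
 rewrite lee_fin -gap_boundS exprMn ler_pdivrMr// mulrAC rE mul1r//.
have [_ IH2] := IH (fun j jk => Hn j (leqW jk)).
have H1 : (ex (Pi k.+1) gap4 <= (gap_bound k.+1 ^+ 4)%:E)%E.
 apply: le_trans IH2;apply: ex_chain_le => // q.
 have -> : (fun w => gap4 (sync_pair k (q, w))) = fun=> gap4_step k q.
 by apply/funext => w;exact: gap4_sync.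
 by rewrite ex_cst.
split => //;apply: (le_trans (gap4_step_le (gap_bound_gt0 _) (Hn _ (leqnn _)) H1)).
rewrite lee_fin -(gap_boundS k.+1) exprMn ler_pdivrMr// mulrAC rE mul1r//.
Qed.
Lemma gap4_leS k : (ex pi0 gap4 <= (B0 ^+ 4)%:E)%E ->
 (forall j, (j <= k)%N -> (ex (nu j) (noise4 j) <= (eta ^+ 4)%:E)%E) ->
 (ex (Pi k.+1) gap4 <= (gap_bound k.+1 ^+ 4)%:E)%E.
Proof.
move=> h0 h;apply: (le_trans _ (proj2 (gap4_le h0 h))).
apply: ex_chain_le => // q.
have -> : (fun w => gap4 (sync_pair k (q, w))) = fun=> gap4_step k q.
 by apply/funext => w;exact: gap4_sync.
by rewrite ex_cst.
Qed.


Variable (Kd Mx : R).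
Hypotheses (Kd0 : 0 <= Kd) (Mx0 : 0 <= Mx) (N0 : (0 < N)%N).
Hypothesis HKd : forall k (u v : state) theta, 0 < theta ->
 \sum_(i < N) enorm (imbalance gW (G k) u i - imbalance gW (G k) v i) ^+ 2 <=
 Kd * (theta * \sum_(i < N) enorm (tnth u i - tnth v i) ^+ 4
  + theta^-1 * \sum_(i < N) pweight m u v i ^+ 4).

(** The imbalance at the particles is compared with that at the coupled copies: the latter is
    [noise4], and the difference is controlled by the gap and by the moments of both systems. *)
Lemma imbalance_mu k : (ex (nu k) (noise4 k) <= (eta ^+ 4)%:E)%E ->
 (ex (Pi k) (gap4_step k) <= (gap_bound k.+1 ^+ 4)%:E)%E ->
 (ex (mu k) (fun x => \sum_(i < N) enorm (tnth (ps x) i) ^+ (4 * m))%R <= (N%:R * Mx)%:E)%E ->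
 (ex (nu k) (fun y => \sum_(i < N) enorm (vs k (tnth y i)) ^+ (4 * m))%R <= (N%:R * Mx)%:E)%E ->
 (ex (mu k) (fun x => \sum_(i < N) enorm (imbalance gW (G k) (ps x) i) ^+ 2)%R <=
 (2 * Kd * (1 + 27 * (1 + 2 * Mx)) * (Num.sqrt N%:R * gap_bound k.+1 ^+ 2)
 + (1 + N%:R * eta ^+ 4))%:E)%E.
Proof.
move=> Hn Hg Hx Hy;set A := gap_bound k.+1;have A0 : 0 < A by exact: gap_bound_gt0.
have NR : 0 < N%:R :> R by rewrite ltr0n.
set sN := Num.sqrt N%:R;have sN0 : 0 < sN by rewrite sqrtr_gt0.
have sN2 : sN ^+ 2 = N%:R by rewrite sqr_sqrtr.
(* This choice balances [theta * A^4] against [N / theta]: both are then [sN * A^2]. *)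
pose th := sN / A ^+ 2;have A20 : 0 < A ^+ 2 by exact: exprn_gt0.
have th0 : 0 < th by exact: divr_gt0.
pose vst (y : state) := tuple_map (vs k) y.
pose X4 (x : state) := \sum_(i < N) enorm (tnth (ps x) i) ^+ (4 * m).
pose Y4 (y : state) := \sum_(i < N) enorm (vs k (tnth y i)) ^+ (4 * m).
have p0 (x : 'rV[R]_d) q : 0 <= enorm x ^+ q by rewrite exprn_ge0// enorm_ge0.
have X40 x : 0 <= X4 x by apply: sumr_ge0.
have Y40 y : 0 <= Y4 y by apply: sumr_ge0.
have mX4 : mble X4.
 apply: (@measurable_sum _ _ _ _ _ _ (fun i (x : state) => enorm (tnth (ps x) i) ^+ (4 * m))) => i.
 by apply: mbleX;apply: mblef_enorm;apply: mblef_tnth.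
have mY4 : mble Y4.
 apply: (@measurable_sum _ _ _ _ _ _ (fun i (y : state) => enorm (vs k (tnth y i)) ^+ (4 * m))) => i.
 apply: mbleX;apply: mblef_enorm;apply: (mcomp (mvs k)).
 exact: mble_tnth.
pose c1 := 2 * Kd * th;pose c2 := 2 * Kd * th^-1 * 27.
have Kd2 : 0 <= 2 * Kd by exact: mulr_ge0.
have thV0 : 0 <= th^-1 by rewrite invr_ge0 ltW.
have c10 : 0 <= c1 by exact: mulr_ge0 Kd2 (ltW th0).
have c20 : 0 <= c2 by exact: mulr_ge0 (mulr_ge0 Kd2 thV0) _.
have pw q : \sum_(i < N) enorm (imbalance gW (G k) (ps q.1) i) ^+ 2 <=
 c1 * gap4_step k q + (c2 * (X4 q.1) + (c2 * Y4 q.2 + (c2 * N%:R + (1 + N%:R * noise4 k q.2)))).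
 have h1 i : enorm (imbalance gW (G k) (ps q.1) i) ^+ 2 <=
  2 * enorm (imbalance gW (G k) (ps q.1) i - imbalance gW (G k) (vst q.2) i) ^+ 2 +
  (N%:R^-1 + N%:R * enorm (imbalance gW (G k) (vst q.2) i) ^+ 4).
 set a := imbalance _ _ (ps _) i;set b := imbalance _ _ (vst _) i.
 have : enorm a <= enorm (a - b) + enorm b by rewrite -{1}(subrK b a);exact: enormD.
 set ea := enorm a;set eab := enorm (a - b);set eb := enorm b => h.
 have h2 : ea ^+ 2 <= (eab + eb) ^+ 2 by rewrite lerXn2r ?nnegrE ?addr_ge0 ?enorm_ge0.
 have h3 : 0 <= (eab - eb) ^+ 2 by exact: sqr_ge0.
 (* Summed over [i] this gives [1 + N * noise4], which is bounded in [N] because [noise4] has mean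
    of order [1 / N]. *)
 have h4 : 2 * eb ^+ 2 <= N%:R^-1 + N%:R * eb ^+ 4.
  have : 0 <= N%:R^-1 * (1 - N%:R * eb ^+ 2) ^+ 2 by rewrite mulr_ge0 ?sqr_ge0// invr_ge0 ltW.
  rewrite (_ : N%:R^-1 * (1 - N%:R * eb ^+ 2) ^+ 2 = N%:R^-1 + N%:R * eb ^+ 4 - 2 * eb ^+ 2);last first.
  by field;rewrite gt_eqF.
  by rewrite subr_ge0.
 lra.
 apply: (letr (2 * (\sum_(i < N) enorm (imbalance gW (G k) (ps q.1) i - imbalance gW (G k) (vst q.2) i) ^+ 2) +
  (1 + N%:R * noise4 k q.2))).
 apply: (letr (\sum_(i < N) (2 * enorm (imbalance gW (G k) (ps q.1) i - imbalance gW (G k) (vst q.2) i) ^+ 2 +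
  (N%:R^-1 + N%:R * enorm (imbalance gW (G k) (vst q.2) i) ^+ 4))));first exact: ler_sum.
 rewrite big_split /= -mulr_sumr lerD2l big_split /= -mulr_sumr sumr_const card_ord.
 by rewrite -[_ *+ N]mulr_natl mulfV// gt_eqF.
 have h5 := HKd k (ps q.1) (vst q.2) th0.
 have h6 : \sum_(i < N) pweight m (ps q.1) (vst q.2) i ^+ 4 <= 27 * (N%:R + X4 q.1 + Y4 q.2).
 rewrite (_ : 27 * _ = \sum_(i < N) 27 * (1 + enorm (tnth (ps q.1) i) ^+ (4 * m) + enorm (vs k (tnth q.2 i)) ^+ (4 * m)));last first.
  by rewrite -mulr_sumr !big_split /= sumr_const card_ord.
 apply: ler_sum => i _;rewrite /pweight;apply: (le_trans (expr4D3 _ _ _)).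
 have pm (t : R) : t ^+ m ^+ 4 = t ^+ (4 * m) by rewrite -exprM mulnC.
 by rewrite expr1n !pm [tnth (vst _) i]tnth_mktuple.
 have h7 : \sum_(i < N) enorm (tnth (ps q.1) i - tnth (vst q.2) i) ^+ 4 = gap4_step k q.
 by rewrite /gap4_step;apply: eq_bigr => i _;rewrite [tnth (vst _) i]tnth_mktuple.
 rewrite h7 in h5.
 have thV : 0 <= th^-1 by rewrite invr_ge0 ltW.
 have h8 := ler_wpM2l (mulr_ge0 Kd0 thV) h6.
 rewrite /c1 /c2;lra.
have mfst : mble (fst : state * state -> state) by exact: mble_fst.
have msnd : mble (snd : state * state -> state) by exact: mble_snd.
pose F (x : state) := \sum_(i < N) enorm (imbalance gW (G k) (ps x) i) ^+ 2.
have mF : mble F.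
 apply: (@measurable_sum _ _ _ _ _ _ (fun i (x : state) => enorm (imbalance gW (G k) (ps x) i) ^+ 2)) => i.
 apply: mbleX;apply: mblef_enorm.
 exact: (mcomp (mble_imbalance k i) mps).
have F0 x : 0 <= F x by apply: sumr_ge0.
rewrite -/(F) -(sync_fst k mF F0).
have mX : mble (fun q : state * state => X4 q.1) by exact: (mcomp mX4 mfst).
have mY : mble (fun q : state * state => Y4 q.2) by exact: (mcomp mY4 msnd).
have mn : mble (fun q : state * state => noise4 k q.2) by exact: (mcomp (mnoise4 k) msnd).
have mNn : mble (fun q : state * state => N%:R * noise4 k q.2) by exact: mbleM.
have m5 : mble (fun q : state * state => 1 + N%:R * noise4 k q.2) by exact: mbleD.
have m4 : mble (fun q : state * state => c2 * N%:R + (1 + N%:R * noise4 k q.2)) by exact: mbleD.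
have mY' : mble (fun q : state * state => c2 * Y4 q.2) by exact: mbleM.
have mX' : mble (fun q : state * state => c2 * X4 q.1) by exact: mbleM.
have m3 : mble (fun q : state * state => c2 * Y4 q.2 + (c2 * N%:R + (1 + N%:R * noise4 k q.2))).
 exact: mbleD.
have m2 : mble (fun q : state * state => c2 * (X4 q.1) + (c2 * Y4 q.2 + (c2 * N%:R + (1 + N%:R * noise4 k q.2)))).
 exact: mbleD.
have mg1 : mble (fun q => c1 * gap4_step k q) by exact: mbleM.
have Nn0 (q : state * state) : 0 <= N%:R * noise4 k q.2 by rewrite mulr_ge0.
have n5 (q : state * state) : 0 <= 1 + N%:R * noise4 k q.2 by rewrite addr_ge0.
have cN0 : 0 <= c2 * N%:R by rewrite mulr_ge0.
have n4 (q : state * state) : 0 <= c2 * N%:R + (1 + N%:R * noise4 k q.2) by rewrite addr_ge0.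
have nY (q : state * state) : 0 <= c2 * Y4 q.2 by rewrite mulr_ge0.
have nX (q : state * state) : 0 <= c2 * X4 q.1 by rewrite mulr_ge0.
have n3 (q : state * state) : 0 <= c2 * Y4 q.2 + (c2 * N%:R + (1 + N%:R * noise4 k q.2)) by exact: addr_ge0.
have n2 (q : state * state) : 0 <= c2 * (X4 q.1) + (c2 * Y4 q.2 + (c2 * N%:R + (1 + N%:R * noise4 k q.2))) by exact: addr_ge0.
have ng1 q : 0 <= c1 * gap4_step k q by rewrite mulr_ge0.
apply: (le_trans (ex_le (Pi k) (mcomp mF mfst) (mbleD mg1 m2) (fun q => F0 q.1) pw)).
rewrite (exD _ mg1 m2 ng1 n2) (exD _ mX' m3 nX n3) (exD _ mY' m4 nY n4).
rewrite (exD (Pi k) (mble_cst (c2 * N%:R)) m5 (fun=> cN0) n5).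
rewrite (exD (Pi k) (mble_cst (1 : R)) mNn (fun=> ler01) Nn0) !ex_cst.
rewrite (exZ _ (mgap4_step k) (gap4_step0 k) c10) (exZ _ mX (fun q => X40 q.1) c20) (exZ _ mY (fun q => Y40 q.2) c20).
rewrite (exZ _ mn (fun q => noise40 k q.2) (ler0n R N)).
rewrite (sync_fst k mX4 X40) (sync_snd k mY4 Y40) (sync_snd k (mnoise4 k) (noise40 k)).
have lz (a : R) : 0 <= a -> (0 <= a%:E)%E by rewrite lee_fin.
apply: (le_trans (leeD (lee_wpmul2l (lz _ c10) Hg) (leeD (lee_wpmul2l (lz _ c20) Hx) (leeD (lee_wpmul2l (lz _ c20) Hy)
 (leeD (lexx _) (leeD (lexx _) (lee_wpmul2l (lz _ (ler0n R N)) Hn))))))).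
rewrite -!EFinM -!EFinD lee_fin -/A /c1 /c2 /th -sN2.
apply: eqW.
by field;rewrite !gt_eqF.
Qed.

End Synchronous.

End Couplings.

(** * Closing the gap at an entropic cost *)

Section Windows.
Context {R : realType} {d : nat}.
Variables (gV gW : 'rV[R]_d -> 'rV[R]_d) (lamV lamW M : R) (m : nat).
Hypothesis sys : convex_system gV gW lamV lamW M m.
Context {N : nat}.
Local Notation state := (conf N R d).
Variables (G : nat -> 'rV[R]_d -> 'rV[R]_d) (CG D : R).
Hypothesis fG : forall k, drift_field lamW m (G k) CG.
Hypothesis D0 : 0 < D.

Local Notation ga := (gauss (Num.sqrt D) : probability 'rV[R]_d R).
Local Notation gaN := (iid ga N).
Local Notation vs k := (vstep gV (G k) D).
Local Notation ps := (pstep gV gW D : state -> state).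
Local Notation s2 := (Num.sqrt (2 : R)).
Let D0' : 0 <= D. Proof. exact: ltW. Qed.
Let s20 : 0 < s2. Proof. by rewrite sqrtr_gt0. Qed.
Let s22 : s2 ^+ 2 = 2. Proof. by rewrite sqr_sqrtr. Qed.
Let mvs k : mble (vs k). Proof. exact: (mble_vstep sys (fG k) D0'). Qed.
Let mps : mble ps. Proof. exact: (mble_pstep sys D0'). Qed.

Variable K : nat.
Hypothesis K0 : (0 < K)%N.

(* The drift added to the second component both replaces its force by that of
 the particle system and closes the remaining gap at constant speed: the two
 components agree after K steps. *)
Definition push_drift j (q : state * state) i : 'rV[R]_d :=
 tnth (ps q.1) i - vs j (tnth q.1 i) +
 (K - j)%:R^-1 *: (vs j (tnth q.1 i) - vs j (tnth q.2 i)).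

Definition push_noise j (q : (state * state) * state) : state :=
 [tuple tnth q.2 i + s2^-1 *: push_drift j q.1 i | i < N].

Definition push_pair j (q : (state * state) * state) : state * state :=
 (ps_step gV gW D j (q.1.1, q.2), tstep (mv_step gV G D) j (q.1.2, push_noise j q)).

Definition push_cost j (q : state * state) : R :=
 \sum_(i < N) enorm (push_drift j q i) ^+ 2 / (4 * D).

Definition gap2 (q : state * state) : R := \sum_(i < N) enorm (tnth q.1 i - tnth q.2 i) ^+ 2.

Definition unbalance2 j (x : state) : R := \sum_(i < N) enorm (imbalance gW (G j) (ps x) i) ^+ 2.

Let mf1 i : mble (fun q : state * state => tnth q.1 i).
Proof. by apply: mblef_tnth;exact: mble_fst. Qed.
Let mf2 i : mble (fun q : state * state => tnth q.2 i).
Proof. by apply: mblef_tnth;exact: mble_snd. Qed.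
Let mdrift j i : mble (fun q => push_drift j q i).
Proof.
have m1 : mble (fun q : state * state => vs j (tnth q.1 i)).
 exact: (mcomp (mvs j) (mf1 i)).
have m2 : mble (fun q : state * state => vs j (tnth q.2 i)).
 exact: (mcomp (mvs j) (mf2 i)).
apply: mble_rVD.
 apply: mble_rVB => //;apply: mblef_tnth.
 by apply: (mcomp mps);exact: mble_fst.
by apply: mble_rVZ;[exact: mble_cst|exact: mble_rVB].
Qed.
Let mnoise j : mble (push_noise j).
Proof.
apply: mblef_mktuple => i;apply: mble_rVD.
 by apply: mblef_tnth;exact: mble_snd.
apply: mble_rVZ;first exact: mble_cst.
by apply: (mcomp (mdrift j i));exact: mble_fst.
Qed.
Lemma mble_push_pair j : mble (push_pair j).
Proof.
apply: mble_pair.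
 apply: (mcomp (mble_ps_step sys D0 j)).
 apply: mble_pair;last exact: mble_snd.
 by apply: (mcomp mble_fst);exact: mble_fst.
apply: (mcomp (mble_tstep (mble_mv_step sys fG D0) j)).
apply: mble_pair;last exact: mnoise.
by apply: (mcomp mble_snd);exact: mble_fst.
Qed.
Let mcost j : mble (push_cost j).
Proof.
apply: (@measurable_sum _ _ _ _ _ _ (fun i q => enorm (push_drift j q i) ^+ 2 / (4 * D))) => i.
apply: mbleM => //;apply: mbleX;apply: mblef_enorm;exact: mdrift.
Qed.
Let cost0 j q : 0 <= push_cost j q.
Proof. by apply: sumr_ge0 => i _;rewrite divr_ge0 ?sqr_ge0// mulr_ge0. Qed.
Let mgap : mble gap2.
Proof.
apply: (@measurable_sum _ _ _ _ _ _ (fun i (q : state * state) => enorm (tnth q.1 i - tnth q.2 i) ^+ 2)) => i.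
by apply: mbleX;apply: mblef_enorm;exact: mble_rVB.
Qed.
Let gap0 q : 0 <= gap2 q. Proof. by apply: sumr_ge0 => i _;exact: sqr_ge0. Qed.
Let munb j : mble (unbalance2 j).
Proof.
apply: (@measurable_sum _ _ _ _ _ _ (fun i (x : state) => enorm (imbalance gW (G j) (ps x) i) ^+ 2)) => i.
apply: mbleX;apply: mblef_enorm.
exact: (mcomp (mble_imbalance sys fG j i) mps).
Qed.
Let unb0 j x : 0 <= unbalance2 j x. Proof. by apply: sumr_ge0 => i _;exact: sqr_ge0. Qed.
(** The noise of variance [D] is multiplied by the square root of 2 in the step, so a drift [b] is a
    shift by [b] over this root, at cost [|b|^2 / (4 D)]. *)
Let DV_push j q : DVle gaN (fun g => push_noise j (q, g)) gaN (push_cost j q).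
Proof.
pose tau (i : 'I_N) (g : 'rV[R]_d) := g + s2^-1 *: push_drift j q i.
have mtau i : mble (tau i).
 by apply: mble_rVD;[exact: measurable_id|exact: mble_cst].
pose c (i : 'I_N) := enorm (push_drift j q i) ^+ 2 / (4 * D).
have c0 i : 0 <= c i by rewrite divr_ge0 ?sqr_ge0// mulr_ge0.
have sD : 0 < Num.sqrt D by rewrite sqrtr_gt0.
apply: (DVle_iid mtau c0) => i.
have := DVle_gauss_shift sD (s2^-1 *: push_drift j q i).
have i0 : 0 <= s2^-1 by rewrite invr_ge0 ltW.
rewrite enormZ exprMn (sqr_sqrtr D0') (ger0_norm i0) exprVn s22.
by rewrite (_ : 2^-1 * _ / (2 * D) = c i)// /c;field;rewrite gt_eqF.
Qed.
Let pushE j q w : snd (push_pair j (q, w)) = tstep (mv_step gV G D) j (snd q, push_noise j (q, w)).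
Proof. by []. Qed.
Let cost_le j q : (j < K)%N ->
 push_cost j q <= D / 2 * unbalance2 j q.1 + (2 * D * (K - j)%:R ^+ 2)^-1 * gap2 q.
Proof.
move=> jK;have kj : 0 < (K - j)%:R :> R by rewrite ltr0n subn_gt0.
rewrite /push_cost /unbalance2 /gap2 !mulr_sumr -big_split /=;apply: ler_sum => i _.
set a := tnth (ps q.1) i - vs j (tnth q.1 i).
set b := (K - j)%:R^-1 *: (vs j (tnth q.1 i) - vs j (tnth q.2 i)).
have ha : enorm a <= D * enorm (imbalance gW (G j) (ps q.1) i) by exact: (pstep_vstep sys D0' _ _ (fG j)).
have hb : enorm b <= (K - j)%:R^-1 * enorm (tnth q.1 i - tnth q.2 i).
 rewrite enormZ ger0_norm ?invr_ge0// ler_wpM2l ?invr_ge0//.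
 exact: (vstep_nonexpansive sys (fG j) D0' _ _).
have hab : enorm (push_drift j q i) <= enorm a + enorm b by exact: enormD.
have h1 : enorm (push_drift j q i) ^+ 2 <= 2 * enorm a ^+ 2 + 2 * enorm b ^+ 2.
 apply: (letr ((enorm a + enorm b) ^+ 2)).
 by rewrite lerXn2r ?nnegrE ?addr_ge0 ?enorm_ge0.
 by have := sqr_ge0 (enorm a - enorm b);lra.
have ha2 : enorm a ^+ 2 <= D ^+ 2 * enorm (imbalance gW (G j) (ps q.1) i) ^+ 2.
 by rewrite -exprMn lerXn2r ?nnegrE ?enorm_ge0// mulr_ge0 ?enorm_ge0.
have hb2 : enorm b ^+ 2 <= (K - j)%:R^-1 ^+ 2 * enorm (tnth q.1 i - tnth q.2 i) ^+ 2.
 by rewrite -exprMn lerXn2r ?nnegrE ?enorm_ge0// mulr_ge0 ?enorm_ge0 ?invr_ge0.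
rewrite ler_pdivrMr ?mulr_gt0//.
rewrite (_ : (D / 2 * enorm (imbalance gW (G j) (ps q.1) i) ^+ 2 +
 (2 * D * (K - j)%:R ^+ 2)^-1 * enorm (tnth q.1 i - tnth q.2 i) ^+ 2) * (4 * D) =
 2 * (D ^+ 2 * enorm (imbalance gW (G j) (ps q.1) i) ^+ 2) +
 2 * ((K - j)%:R^-1 ^+ 2 * enorm (tnth q.1 i - tnth q.2 i) ^+ 2));last first.
 by field;rewrite !gt_eqF.
lra.
Qed.
(** The added drift leaves the fraction [(K - j - 1) / (K - j)] of the difference of the two
    mean-field steps, and these are nonexpansive. The fractions telescope to [(K - k) / K]. *)
Let gap_step j q w : (j < K)%N ->
 (K - j)%:R ^+ 2 * gap2 (push_pair j (q, w)) <= (K - j.+1)%:R ^+ 2 * gap2 q.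
Proof.
move=> jK;have kj : 0 < (K - j)%:R :> R by rewrite ltr0n subn_gt0.
have kE : (K - j.+1)%:R = (K - j)%:R - 1 :> R by rewrite subnS -subn1 natrB// subn_gt0.
have kj1 : 0 <= (K - j)%:R - 1 :> R by rewrite -kE.
rewrite /gap2 !mulr_sumr;apply: ler_sum => i _.
have -> : tnth (push_pair j (q, w)).1 i - tnth (push_pair j (q, w)).2 i =
 ((K - j.+1)%:R / (K - j)%:R) *: (vs j (tnth q.1 i) - vs j (tnth q.2 i)).
 have -> : tnth (push_pair j (q, w)).1 i = tnth (ps q.1) i + s2 *: tnth w i.
 by rewrite /push_pair /ps_step /= tnth_mktuple.
 have -> : tnth (push_pair j (q, w)).2 i = vs j (tnth q.2 i) +
  s2 *: (tnth w i + s2^-1 *: push_drift j q i).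
 by rewrite /push_pair /tstep /tmap /mv_step /= tnth_mktuple /= /push_noise tnth_mktuple.
 rewrite scalerDr scalerA mulfV ?gt_eqF// scale1r /push_drift kE.
 apply/rowP => k;rewrite !mxE;field;rewrite gt_eqF//.
rewrite enormZ exprMn ger0_norm ?divr_ge0// exprMn exprVn.
rewrite mulrA [_ ^+ 2 * (_ / _)]mulrC mulfVK ?expf_neq0 ?gt_eqF//.
rewrite ler_wpM2l ?sqr_ge0// lerXn2r ?nnegrE ?enorm_ge0//.
exact: (vstep_nonexpansive sys (fG j) D0' _ _).
Qed.

Variables (x0 y0 : probability state R) (rho0 : probability (state * state)%type R).
Variables (c w : R) (H : nat -> R).
Hypothesis rho_fst : forall g : state -> R, mble g -> (forall x, 0 <= g x) ->
 ex rho0 (g \o fst) = ex x0 g.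
Hypothesis rho_snd : DVle rho0 snd y0 c.
Hypothesis rho_gap : (ex rho0 gap2 <= w%:E)%E.

Local Notation rho := (chain gaN mble_push_pair rho0).
Local Notation mu := (chain gaN (mble_ps_step sys D0) x0).
Local Notation nu := (chain gaN (@mble_tstep _ _ _ _ _ (mble_mv_step sys fG D0) N) y0).

Hypothesis muH : forall j, (j < K)%N -> (ex (mu j) (unbalance2 j) <= (H j)%:E)%E.

Let rho_mu k (g : state -> R) : mble g -> (forall x, 0 <= g x) ->
 ex (rho k) (g \o fst) = ex (mu k) g.
Proof. by move=> mg g0;apply: chain_map => //;exact: mble_fst. Qed.
Let KR : 0 < K%:R :> R. Proof. by rewrite ltr0n. Qed.
Let rho_gap_le k : (k <= K)%N -> (ex (rho k) gap2 <= ((K - k)%:R ^+ 2 / K%:R ^+ 2 * w)%:E)%E.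
Proof.
elim: k => [_|k IH kK].
 by rewrite subn0 mulfV ?expf_neq0 ?gt_eqF// mul1r.
have kj : 0 < (K - k)%:R :> R by rewrite ltr0n subn_gt0.
pose r : R := (K - k.+1)%:R ^+ 2 / (K - k)%:R ^+ 2.
have r0 : 0 <= r by rewrite divr_ge0 ?sqr_ge0.
apply: (letr (ex (rho k) (fun q => r * gap2 q))).
 apply: ex_chain_le => //;first exact: mbleM.
 move=> q;apply: (letr (ex gaN (fun=> r * gap2 q)));last by rewrite ex_cst.
 apply: ex_le => //.
 by apply: (mcomp mgap);apply: (mcomp (mble_push_pair k));exact: measurable_pair1.
 move=> v;rewrite /r mulrAC ler_pdivlMr ?exprn_gt0// mulrC.
 exact: gap_step.
rewrite exZ//;apply: (le_trans (lee_wpmul2l _ (IH (ltnW kK))));first by rewrite lee_fin.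
rewrite -EFinM lee_fin /r;apply: eqW.
by field;rewrite !gt_eqF.
Qed.
(** The weight [1 / (K - j)^2] in the cost compensates the decrease of the gap, so closing it costs
    the same at every step, in total [w / (2 D K)]. At step [K] the components agree almost surely,
    and the entropic bound on the second one becomes a bound on the law of the particles. *)
Lemma window_DVle : DVle (mu K) id (nu K) (c + (w / (2 * D * K%:R) + \sum_(j < K) D / 2 * H j)).
Proof.
pose C (j : nat) := D / 2 * H j + (2 * D * K%:R ^+ 2)^-1 * w.
have HC k : (k < K)%N -> (ex (rho k) (push_cost k) <= (C k)%:E)%E.
 move=> kK;have kj : 0 < (K - k)%:R :> R by rewrite ltr0n subn_gt0.
 pose a := D / 2;pose b := (2 * D * (K - k)%:R ^+ 2)^-1.
 have a0 : 0 <= a by rewrite divr_ge0.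
 have b0 : 0 <= b by rewrite invr_ge0 !mulr_ge0.
 have mu1 : mble (fun q : state * state => unbalance2 k q.1).
 by apply: (mcomp (munb k));exact: mble_fst.
 have m1 : mble (fun q : state * state => a * unbalance2 k q.1) by exact: mbleM.
 have m2 : mble (fun q => b * gap2 q) by exact: mbleM.
 apply: (le_trans (ex_le (rho k) (mcost k) (mbleD m1 m2) (cost0 k) (fun q => cost_le q kK))).
 rewrite (exD _ m1 m2);[|by move=> q;rewrite mulr_ge0|by move=> q;rewrite mulr_ge0].
 rewrite (exZ _ mu1 (fun q => unb0 k q.1) a0) (exZ _ mgap gap0 b0) (rho_mu k (munb k) (unb0 k)).
 rewrite EFinD;apply: leeD;first by rewrite (EFinM (D / 2)) lee_wpmul2l ?lee_fin// muH.
 apply: (le_trans (lee_wpmul2l _ (rho_gap_le (ltnW kK))));first by rewrite lee_fin.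
 rewrite -EFinM lee_fin /b;apply: eqW.
 by field;rewrite !gt_eqF.
have msnd : mble (snd : state * state -> state) by exact: mble_snd.
have HD := @DVle_chain _ _ _ _ _ _ _ gaN _ push_pair snd
 (@mble_tstep _ _ _ _ _ (mble_mv_step sys fG D0) N) mble_push_pair msnd
 push_noise push_cost mnoise mcost cost0 pushE DV_push rho0 y0 c C K rho_snd HC.
have E : c + (w / (2 * D * K%:R) + \sum_(j < K) D / 2 * H j) = c + \sum_(j < K) C j.
 have Ew : w / (2 * D * K%:R) = (2 * D * K%:R ^+ 2)^-1 * w *+ K.
 by rewrite -[RHS]mulr_natl;field;rewrite !gt_eqF.
 by rewrite /C big_split /= sumr_const card_ord Ew [X in c + X]addrC.
rewrite E => phi mphi phi0 phiM a Ha.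
have := HD phi mphi phi0 phiM a Ha.
(* The factor [(K - k)^2] vanishes at [k = K]. *)
have g0 : ex (rho K) gap2 = 0%E.
 apply/eqP;rewrite eq_le ex_ge0// andbT;apply: (le_trans (rho_gap_le (leqnn K))).
 by rewrite subnn expr0n mul0r mul0r.
have ae : {ae rho K, forall q, gap2 q = 0}.
 have mE : mble (EFin \o gap2) by exact/mbleEFin.
 have [H1 _] := ae_eq_integral_abs (rho K) measurableT mE.
 have {}H1 : ae_eq (rho K) setT (EFin \o gap2) (cst 0%E).
 apply: H1;rewrite -[RHS]g0;apply: eq_integral => q _ /=.
 by rewrite ger0_norm.
 by apply: filterS H1 => q /(_ I) /= [].
have -> : ex (rho K) (phi \o snd) = ex (rho K) (phi \o fst).
 apply: ae_eq_integral => //.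
 - by apply/mbleEFin;exact: (mcomp mphi msnd).
 - by apply/mbleEFin;apply: (mcomp mphi);exact: mble_fst.
 apply: filterS ae => -[x y] /= gq _;congr (phi _)%:E.
 apply: eq_from_tnth => i;apply/esym/eqP;rewrite -subr_eq0;apply/eqP;apply: enorm_eq0.
 move/eqP: gq;rewrite /gap2 psumr_eq0;last by move=> j _;exact: sqr_ge0.
 by move=> /allP /(_ i (mem_index_enum i)) /= /eqP/eqP;rewrite expf_eq0 /= => /eqP.
by rewrite rho_mu.
Qed.

End Windows.

Lemma expr_le1D {R : realDomainType} (t : R) r q : 0 <= t -> (r <= q)%N -> t ^+ r <= 1 + t ^+ q.
Proof.
move=> t0 rq;have [t1|t1] := leP t 1.
 by apply: (letr 1);[rewrite exprn_ile1|rewrite lerDl exprn_ge0].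
by apply: (letr (t ^+ q));[apply: ler_weXn2l => //;exact: ltW|rewrite lerDr].
Qed.

(** * Moments of the chains, uniform in the mesh *)

Section DiscreteMoments.
Context {R : realType} {d : nat}.
Variables (gV gW : 'rV[R]_d -> 'rV[R]_d) (lamV lamW M : R) (m : nat).
Hypothesis sys : convex_system gV gW lamV lamW M m.

Let moment_bound (kap a C m0 : R) : R := Num.max m0 (((1 + kap) * a + C * (1 + 2 * kap)) / kap).

Let moment_boundP kap a C m0 : 0 < kap ->
 (1 + kap) * a + C * (1 + 2 * kap) <= kap * moment_bound kap a C m0.
Proof. by move=> k0;rewrite [X in _ <= X]mulrC -ler_pdivrMr// /moment_bound le_max lexx orbT. Qed.
Let menp q : mble (fun x : 'rV[R]_d => enorm x ^+ q).
Proof. by apply: mbleX;exact: mble_enorm. Qed.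
Let en0 (x : 'rV[R]_d) q : 0 <= enorm x ^+ q. Proof. by rewrite exprn_ge0// enorm_ge0. Qed.
(** [B] is fixed before the fields, the mesh and the time: it sees the fields through [CG] only. The
    second bound, after the implicit step, is the one needed where the imbalance is evaluated. *)
Lemma mv_chain_moment p (CG m0 : R) : exists2 B : R, 0 <= B &
 forall (G : nat -> 'rV[R]_d -> 'rV[R]_d) (D : R)
 (fG : forall k, drift_field lamW m (G k) CG) (D0 : 0 < D), D <= 1 ->
 forall u0 : probability 'rV[R]_d R,
 (ex u0 (fun x => enorm x ^+ (2 * p.+1))%R <= m0%:E)%E -> forall k,
 (ex (chain (gauss (Num.sqrt D)) (mble_mv_step sys fG D0) u0 k)
 (fun x => enorm x ^+ (2 * p.+1))%R <= B%:E)%E /\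
 (ex (chain (gauss (Num.sqrt D)) (mble_mv_step sys fG D0) u0 k)
 (fun x => enorm (vstep gV (G k) D x) ^+ (2 * p.+1))%R <= B%:E)%E.
Proof.
have lam0 := sum_lam_gt0 sys;set lam := lamV + lamW in lam0 *.
pose kap := lam / 2;have kap0 : 0 < kap by rewrite divr_gt0.
have [C C0 HC] := @gauss_power_le R d p kap kap0.
pose a := lam * (field_size gV `|CG| / lam) ^+ (2 * p.+1).
have fs0 : 0 <= field_size gV `|CG| by rewrite addr_ge0// enorm_ge0.
have a0 : 0 <= a by rewrite mulr_ge0// ?exprn_ge0 ?divr_ge0// ltW.
pose B1 := moment_bound kap a C m0.
have B10 : 0 <= B1.
 rewrite /B1 /moment_bound le_max;apply/orP;right.
 apply: divr_ge0;last exact: ltW.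
 apply: addr_ge0;apply: mulr_ge0 => //;apply: addr_ge0 => //;first exact: ltW.
 by apply: mulr_ge0 => //;exact: ltW.
exists (B1 + a);first exact: addr_ge0.
move=> G D fG D0 D1 u0 H0 k.
have CG0 : 0 <= CG by apply: le_trans (field_0 (fG 0%N));exact: enorm_ge0.
have vp j x : (1 + 2 * kap * D) * enorm (vstep gV (G j) D x) ^+ (2 * p.+1) <=
 enorm x ^+ (2 * p.+1) + a * D.
 have := vstep_power sys (fG j) (ltW D0) (2 * p).+1 x.
 by rewrite /a (ger0_norm CG0) !mulnS /= (_ : 2 * kap = lam)// /kap mulrC divfK.
have den : 0 < 1 + 2 * kap * D by rewrite ltr_wpDr// !mulr_ge0// ltW.
have H1 : (ex (chain (gauss (Num.sqrt D)) (mble_mv_step sys fG D0) u0 k)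
 (fun x => enorm x ^+ (2 * p.+1))%R <= B1%:E)%E.
 apply: (@chain_moment _ _ _ _ _ _ _ _ _ _ kap a C D) => //.
 - move=> j x;have := HC D D0 D1 (vstep gV (G j) D x);rewrite /mv_step /= => h.
 apply: (le_trans h);rewrite lee_fin lerD2r ler_wpM2l//.
  by rewrite addr_ge0// mulr_ge0// ltW.
 by rewrite (ler_pdivlMr _ _ den) [leLHS]mulrC;exact: vp.
 - by apply: (le_trans H0);rewrite lee_fin le_max lexx.
 - exact: moment_boundP.
split;first by apply: (le_trans H1);rewrite lee_fin lerDl.
have mv : mble (fun x => enorm (vstep gV (G k) D x) ^+ (2 * p.+1)).
 apply: mbleX;apply: mblef_enorm.
 exact: (mble_vstep sys (fG k) (ltW D0)).
apply: (letr (ex (chain (gauss (Num.sqrt D)) (mble_mv_step sys fG D0) u0 k)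
 (fun x => enorm x ^+ (2 * p.+1) + a)%R)).
 apply: ex_le => //;first exact: mbleD.
 move=> x;apply: (letr (enorm x ^+ (2 * p.+1) + a * D));last first.
 by rewrite lerD2l ler_piMr.
 apply: le_trans (vp k x);rewrite ler_peMl// lerDl.
 by apply: mulr_ge0;[apply: mulr_ge0 => //|];apply: ltW.
rewrite (exD _ (menp _) (mble_cst a))// ex_cst EFinD.
exact: leeD.
Qed.
Lemma ps_chain_moment p (m0 : R) : 0 <= m0 -> exists2 B : R, 0 <= B &
 forall (N : nat) (D : R) (D0 : 0 < D), D <= 1 ->
 forall x0 : probability (conf N R d) R,
 (ex x0 (fun x => \sum_(i < N) enorm (tnth x i) ^+ (2 * p.+1))%R <= (N%:R * m0)%:E)%E -> forall k,
 (ex (chain (iid (gauss (Num.sqrt D)) N) (mble_ps_step sys D0) x0 k)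
 (fun x => \sum_(i < N) enorm (tnth x i) ^+ (2 * p.+1))%R <= (N%:R * B)%:E)%E /\
 (ex (chain (iid (gauss (Num.sqrt D)) N) (mble_ps_step sys D0) x0 k)
 (fun x => \sum_(i < N) enorm (tnth (pstep gV gW D x) i) ^+ (2 * p.+1))%R <= (N%:R * B)%:E)%E.
Proof.
move=> m00;have lam0 := beta_gt0 sys;set lam := beta_cst lamV lamW in lam0 *.
pose kap := lam / 2;have kap0 : 0 < kap by rewrite divr_gt0.
have [C C0 HC] := @gauss_power_le R d p kap kap0.
pose a := lam * (enorm (gV 0) / lam) ^+ (2 * p.+1).
have a0 : 0 <= a by rewrite mulr_ge0// ?exprn_ge0 ?divr_ge0 ?enorm_ge0// ltW.
pose B1 := moment_bound kap a C m0.
have B10 : 0 <= B1 by rewrite /B1 /moment_bound le_max m00.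
exists (B1 + a);first exact: addr_ge0.
move=> N D D0 D1 x0 H0 k.
pose Phi (x : conf N R d) := \sum_(i < N) enorm (tnth x i) ^+ (2 * p.+1).
pose ps := (pstep gV gW D : conf N R d -> conf N R d).
have mPhi : mble Phi.
 apply: (@measurable_sum _ _ _ _ _ _ (fun i (x : conf N R d) => enorm (tnth x i) ^+ (2 * p.+1))) => i.
 by apply: mbleX;apply: mblef_enorm;exact: mble_tnth.
have Phi0 x : 0 <= Phi x by apply: sumr_ge0.
have vp x : (1 + 2 * kap * D) * Phi (ps x) <= Phi x + N%:R * a * D.
 have := pstep_power sys (N := N) (ltW D0) p x.
 by rewrite (_ : 2 * kap = lam)// /kap mulrC divfK.
have den : 0 < 1 + 2 * kap * D by rewrite ltr_wpDr// !mulr_ge0// ltW.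
have H1 : (ex (chain (iid (gauss (Num.sqrt D)) N) (mble_ps_step sys D0) x0 k) Phi <= (N%:R * B1)%:E)%E.
 apply: (@chain_moment _ _ _ _ _ _ _ _ _ _ kap (N%:R * a) (N%:R * C) D) => //;try exact: mulr_ge0.
 - move=> j x.
 pose g i (w : 'rV[R]_d) := enorm (tnth (ps x) i + Num.sqrt 2 *: w) ^+ (2 * p.+1).
 have mg i : mble (g i).
  apply: mbleX;apply: mblef_enorm;apply: mble_rVD => //.
  by apply: mble_rVZ;[exact: mble_cst|exact: measurable_id].
 have mgi i : mble (fun w : conf N R d => g i (tnth w i)).
  by apply: (mcomp (mg i));exact: mble_tnth.
 rewrite (eq_ex _ (_ : _ =1 fun w : conf N R d => \sum_(i < N) g i (tnth w i)));last first.
  by move=> w;apply: eq_bigr => i _;rewrite /ps_step [tnth (mktuple _) i]tnth_mktuple.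
 rewrite (ex_sum (iid (gauss (Num.sqrt D)) N) (index_enum 'I_N) mgi);last by move=> i w;exact: en0.
 apply: (letr (\sum_(i < N) ((1 + kap * D) * enorm (tnth (ps x) i) ^+ (2 * p.+1) + C * D)%:E)%E).
  elim/big_ind2: _ => // [*|i _];first exact: leeD.
  rewrite (ex_iid_coord (gauss (Num.sqrt D)) i (mg i)) => [|w];last exact: en0.
  exact: HC.
 have E : \sum_(i < N) ((1 + kap * D) * enorm (tnth (ps x) i) ^+ (2 * p.+1) + C * D) =
  (1 + kap * D) * Phi (ps x) + N%:R * C * D.
  by rewrite big_split /= -mulr_sumr sumr_const card_ord -[_ *+ N]mulr_natl (mulrA N%:R).
 rewrite sumEFin lee_fin E lerD2r ler_wpM2l//;first by rewrite addr_ge0// mulr_ge0// ltW.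
 by rewrite ler_pdivlMr// [X in X <= _]mulrC;exact: vp.
 - by apply: (le_trans H0);rewrite lee_fin ler_wpM2l// le_max lexx.
 - have := ler_wpM2l (ler0n R N) (moment_boundP a C m0 kap0);rewrite -/B1;lra.
split;first by apply: (le_trans H1);rewrite lee_fin ler_wpM2l// lerDl.
have mPs : mble (Phi \o ps).
 by apply: (mcomp mPhi);exact: (mble_pstep sys (ltW D0)).
have Na0 : 0 <= N%:R * a by exact: mulr_ge0.
apply: (letr (ex (chain (iid (gauss (Num.sqrt D)) N) (mble_ps_step sys D0) x0 k)
 (fun x => Phi x + N%:R * a)%R)).
 apply: (ex_le _ mPs (mbleD mPhi (mble_cst (N%:R * a)))) => x;first exact: Phi0.
 apply: (letr (Phi x + N%:R * a * D));last by rewrite lerD2l ler_piMr.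
 apply: le_trans (vp x);rewrite ler_peMl ?Phi0// lerDl.
 by apply: mulr_ge0;[apply: mulr_ge0 => //|];apply: ltW.
rewrite (exD _ mPhi (mble_cst (N%:R * a)))// ex_cst mulrDr EFinD.
exact: leeD.
Qed.

Section noise.
Context {N : nat}.
Hypothesis N0 : (0 < N)%N.
Variables (G : nat -> 'rV[R]_d -> 'rV[R]_d) (CG D : R).
Hypothesis fG : forall k, drift_field lamW m (G k) CG.
Hypothesis D0 : 0 < D.
Variable (u0 : probability 'rV[R]_d R).

Local Notation nu1 := (chain (gauss (Num.sqrt D)) (mble_mv_step sys fG D0) u0).
Local Notation nuN := (chain (iid (gauss (Num.sqrt D)) N)
 (@mble_tstep _ _ _ _ _ (mble_mv_step sys fG D0) N) (iid u0 N)).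

Let mvs k : mble (vstep gV (G k) D).
Proof. exact: (mble_vstep sys (fG k) (ltW D0)). Qed.
(** Independent copies started from a product law keep one, so the noise is the imbalance of [N]
    independent samples of the law after the implicit step. The order [2 * (4 * m).+1] covers all
    the moments required, each bounded by [1 + B]. *)
Lemma noise4_le k (B : R) (eps : R) : 0 <= B ->
 (ex (nu1 k) (fun x => enorm (vstep gV (G k) D x) ^+ (2 * (4 * m).+1))%R <= B%:E)%E ->
 eps <= N%:R^-1 ->
 (forall z, enorm (G k z - conv gW (push (nu1 k) (mvs k)) z) <= eps * (1 + enorm z ^+ (2 * m))) ->
 (ex (nuN k) (noise4 (N := N) gV gW G D k) <=
 (@imbalance_cst R d M m (1 + B) (1 + B) / N%:R)%:E)%E.
Proof.
move=> B0 HB epsN bias.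
pose tau := push (nu1 k) (mvs k).
have tm r : (r <= 2 * (4 * m).+1)%N -> (ex tau (fun x => enorm x ^+ r)%R <= (1 + B)%:E)%E.
 move=> rq;rewrite ex_push//.
 have mq q : mble (fun x => enorm (vstep gV (G k) D x) ^+ q).
 by apply: mbleX;apply: mblef_enorm;exact: mvs.
 apply: (letr (ex (nu1 k) (fun x => 1 + enorm (vstep gV (G k) D x) ^+ (2 * (4 * m).+1))%R)).
 apply: (ex_le (nu1 k) (mq r) (mbleD (mble_cst (1 : R)) (mq (2 * (4 * m).+1)%N))) => x /=;first exact: en0.
 by apply: expr_le1D => //;exact: enorm_ge0.
 rewrite (exD _ (mble_cst (1 : R)) (mq _))// ex_cst EFinD leeD2l//.
pose F (v : conf N R d) := \sum_(i < N) enorm (imbalance gW (G k) v i) ^+ 4.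
have mi i : mble (fun v : conf N R d => imbalance gW (G k) v i).
 exact: (mble_imbalance sys fG k i).
have mF : mble F.
 apply: (@measurable_sum _ _ _ _ _ _ (fun i (v : conf N R d) => enorm (imbalance gW (G k) v i) ^+ 4)) => i.
 by apply: mbleX;apply: mblef_enorm;exact: mi.
have F0 v : 0 <= F v by apply: sumr_ge0 => i _;exact: expr4_ge0.
have nE : noise4 (N := N) gV gW G D k = F \o (@tuple_map _ _ _ _ (vstep gV (G k) D) N) by [].
have mn : mble (noise4 (N := N) gV gW G D k).
 by rewrite nE;apply: (mcomp mF);exact: (mble_tuple_map (mvs k)).
have n0 y : 0 <= noise4 (N := N) gV gW G D k y by rewrite nE;exact: F0.
rewrite -(ex_iid_chain (gauss (Num.sqrt D)) (mble_mv_step sys fG D0) u0 k mn n0) nE.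
rewrite -(ex_iid_map (nu1 k) (mvs k) mF F0).
have mG := locally_lipschitz_measurable (field_locally_lipschitz (fG k)).
by apply: (imbalance_moment4 sys _ _ mG N0 epsN bias);apply: tm;lia.
Qed.

End noise.

End DiscreteMoments.

Lemma mble_gap {R : realType} {d N : nat} q : mble
 (fun z : conf N R d * conf N R d =>
 \sum_(i < N) enorm (tnth z.1 i - tnth z.2 i) ^+ q).
Proof.
apply: (@measurable_sum _ _ _ _ _ _ (fun i (z : conf N R d * conf N R d) =>
 enorm (tnth z.1 i - tnth z.2 i) ^+ q)) => i.
apply: mbleX;apply: mblef_enorm;apply: mble_rVB;
 apply: mblef_tnth;[exact: mble_fst|exact: mble_snd].
Qed.
Lemma DVle_mono {R : realType} {d1 d2} {S : measurableType d1} {E : measurableType d2}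
 (rho : probability S R) (p : S -> E) (nu : probability E R) (c c' : R) :
 c <= c' -> DVle rho p nu c -> DVle rho p nu c'.
Proof.
by move=> cc H phi mphi phi0 b a Ha;apply: (le_trans (H phi mphi phi0 b a Ha));rewrite lee_fin lerD2r.
Qed.
Lemma chain_shift_eq {R : realType} {dE dG : measure_display} {E : measurableType dE}
 {G : measurableType dG} (ga : probability G R) (f f' : nat -> E * G -> E)
 (mf : forall k, mble (f k)) (mf' : forall k, mble (f' k))
 (mu0 : probability E R) k0 k : (forall j, f' j = f (k0 + j)%N) ->
 chain ga mf mu0 (k0 + k) = chain ga mf' (chain ga mf mu0 k0) k.
Proof.
move=> fE;have E' : f' = fun j => f (k0 + j)%N by apply/funext.
move: mf';rewrite E' => mf';rewrite chain_shift.
by congr (chain _ _ _ _);exact: Prop_irrelevance.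
Qed.
Lemma fourth_root {R : realType} (x : R) : 0 < x -> exists2 y, 0 < y & y ^+ 4 = x.
Proof.
move=> x0;exists (Num.sqrt (Num.sqrt x));first by rewrite !sqrtr_gt0.
by rewrite (exprM _ 2 2) sqr_sqrtr ?sqrtr_ge0// sqr_sqrtr// ltW.
Qed.
(** [r] is the fourth root of the contraction factor of one step. Its exponential rate is [b D] up
    to a relative error of order [D], and the last bound keeps the accumulated noise of [gap_bound]
    finite as the mesh goes to 0. *)
Lemma contraction_rate {R : realType} (b D : R) : 0 < b -> 0 < D -> D <= 1 ->
 exists r : R, [/\ 0 < r < 1, r ^+ 4 * (1 + 4 * b * D) = 1,
 r <= expR (- (b * D / (1 + 4 * b * D))) & D * r / (1 - r) <= (1 + 4 * b) / b].
Proof.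
move=> b0 D0 D1;pose x := 4 * b * D;have x0 : 0 < x by rewrite !mulr_gt0.
have x1 : 0 < 1 + x by rewrite addr_gt0.
have [r r0 rE] := @fourth_root _ (1 + x)^-1 (etrans (invr_gt0 _) x1).
have rr : r < 1.
 rewrite -(ltr_pXn2r (n := 4))// ?nnegrE// ?ltW// rE expr1n invf_lt1//.
 by rewrite ltrDl.
have r1 : 0 < 1 - r by rewrite subr_gt0.
exists r;split;first by rewrite r0.
- by rewrite rE -/x mulVf// gt_eqF.
- rewrite -/x -(ler_pXn2r (n := 4))// ?nnegrE ?expR_ge0//;last exact: ltW.
 rewrite rE -expRM_natl.
 have -> : 4 * - (b * D / (1 + x)) = (1 + x)^-1 - 1 by rewrite /x;field;rewrite gt_eqF.
 by apply: le_trans (expR_ge1Dx _);lra.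
- rewrite ler_pdivrMr// mulrAC ler_pdivlMr//.
 have h : b * D / (1 + x) <= 1 - r.
 have e : 1 - r ^+ 4 = x / (1 + x) by rewrite rE;field;rewrite gt_eqF.
 have f : 1 - r ^+ 4 <= 4 * (1 - r).
  have r2 : r ^+ 2 <= 1 by rewrite exprn_ile1// ltW.
  have r3 : r ^+ 3 <= 1 by rewrite exprn_ile1// ltW.
  rewrite (_ : 1 - r ^+ 4 = (1 - r) * (1 + r + r ^+ 2 + r ^+ 3));last by ring.
  by rewrite [4 * _]mulrC ler_wpM2l ?ltW//;lra.
 have -> : b * D / (1 + x) = 4^-1 * (x / (1 + x)) by rewrite /x;field;rewrite gt_eqF.
 by rewrite -e;lra.
 apply: (letr ((1 + x) * (1 - r)));last first.
 by rewrite ler_pM2r// lerD2l /x ler_piMr// mulr_ge0// ltW.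
 move: h;rewrite ler_pdivrMr// => h;rewrite mulrC [leRHS]mulrC;apply: le_trans h.
 by rewrite ler_pM2l// ler_piMr//;exact: ltW.
Qed.

(** * Entropy bounds for the chains *)

Section DiscreteEntropy.
Context {R : realType} {d : nat}.
Variables (gV gW : 'rV[R]_d -> 'rV[R]_d) (lamV lamW M : R) (m : nat).
Hypothesis sys : convex_system gV gW lamV lamW M m.
Context {N : nat}.
Hypothesis N0 : (0 < N)%N.
Local Notation state := (conf N R d).
Variables (G : nat -> 'rV[R]_d -> 'rV[R]_d) (CG D : R).
Hypothesis fG : forall k, drift_field lamW m (G k) CG.
Hypothesis D0 : 0 < D.

Local Notation beta := (beta_cst lamV lamW).
Local Notation gaN := (iid (gauss (Num.sqrt D) : probability 'rV[R]_d R) N).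
Local Notation ps := (pstep gV gW D : state -> state).
Local Notation mu x0 := (chain gaN (mble_ps_step sys D0) x0).
Local Notation nu y0 := (chain gaN (@mble_tstep _ _ _ _ _ (mble_mv_step sys fG D0) N) y0).

Variables (x0 y0 : probability state R) (eta Mx : R) (n : nat).
Hypotheses (eta0 : 0 < eta) (Mx0 : 0 <= Mx).
Hypothesis Hnoise : forall k, (k < n)%N ->
 (ex (nu y0 k) (noise4 (N := N) gV gW G D k) <= (eta ^+ 4)%:E)%E.
Hypothesis Hmu : forall k, (k < n)%N ->
 (ex (mu x0 k) (fun x => \sum_(i < N) enorm (tnth (ps x) i) ^+ (4 * m))%R <= (N%:R * Mx)%:E)%E.
Hypothesis Hnu : forall k, (k < n)%N ->
 (ex (nu y0 k) (fun y => \sum_(i < N) enorm (vstep gV (G k) D (tnth y i)) ^+ (4 * m))%R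
 <= (N%:R * Mx)%:E)%E.

Definition unbalance_cst : R := 2 * (8 * (CG + M * 2 ^+ m) ^+ 2) * (1 + 27 * (1 + 2 * Mx)).
Local Notation C1 := unbalance_cst.

Lemma unbalance_cst_ge0 : 0 <= C1.
Proof.
rewrite /unbalance_cst;apply: mulr_ge0;last by rewrite addr_ge0// mulr_ge0// addr_ge0// mulr_ge0.
by apply: mulr_ge0 => //;apply: mulr_ge0 => //;exact: sqr_ge0.
Qed.

Variables (r B0 : R) (pi0 : probability (state * state)%type R).
Hypotheses (r01 : 0 < r < 1) (rE : r ^+ 4 * (1 + 4 * beta * D) = 1) (B00 : 0 < B0).
Hypothesis pi_fst : forall g : state -> R, mble g -> (forall x, 0 <= g x) ->
 ex pi0 (g \o fst) = ex x0 g.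
Hypothesis pi_snd : forall g : state -> R, mble g -> (forall x, 0 <= g x) ->
 ex pi0 (g \o snd) = ex y0 g.
Hypothesis pi_gap : (ex pi0 (@gap4 R d N) <= (B0 ^+ 4)%:E)%E.

Local Notation Pi := (chain gaN (mble_sync_pair sys fG D0) pi0).
Local Notation gb := (gap_bound D eta r B0).

Let r0 : 0 < r. Proof. by case/andP: r01. Qed.
Let r1 : r < 1. Proof. by case/andP: r01. Qed.
Let gb0 k : 0 < gb k. Proof. exact: gap_bound_gt0. Qed.
Let gb_le j k : (j <= k)%N -> gb k <= gb j.
Proof.
move=> jk;rewrite /gap_bound lerD2r ler_wpM2r//;first exact: ltW.
by rewrite ler_wiXn2l// ltW.
Qed.
Let unb k0 k : (k0 <= k)%N -> (k < n)%N ->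
 (ex (mu x0 k) (fun x => \sum_(i < N) enorm (imbalance gW (G k) (ps x) i) ^+ 2)%R <=
 (C1 * (Num.sqrt N%:R * gb k0 ^+ 2) + (1 + N%:R * eta ^+ 4))%:E)%E.
Proof.
move=> k0k kn.
have [//|_ Hs] := gap4_le (sys := sys) (fG := fG) (D0 := D0) pi_snd eta0 r01 rE B00 (k := k) pi_gap.
 by move=> j jk;apply: Hnoise;exact: leq_ltn_trans jk kn.
have Kd0 : 0 <= 8 * (CG + M * 2 ^+ m) ^+ 2 by rewrite mulr_ge0// sqr_ge0.
have := imbalance_mu pi_fst pi_snd eta0 r01 B00 Kd0 N0
 (fun k u v th => imbalance_dist sys u v (fG k) N0) (Hnoise kn) Hs (Hmu kn) (Hnu kn).
move=> H;apply: (le_trans H);rewrite lee_fin lerD2r -/C1 ler_wpM2l ?unbalance_cst_ge0//.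
rewrite ler_wpM2l ?sqrtr_ge0//;apply: lerXn2r;rewrite ?nnegrE;[exact: ltW|exact: ltW|].
by apply: gb_le;exact: leqW.
Qed.
(** Cauchy-Schwarz over the particles, linearized around the value [B]: the origin of the factor
    [Num.sqrt N]. *)
Lemma gap2_le k B : 0 < B -> (ex (Pi k) (@gap4 R d N) <= (B ^+ 4)%:E)%E ->
 (ex (Pi k) (@gap2 R d N) <= (Num.sqrt N%:R * B ^+ 2)%:E)%E.
Proof.
move=> Bp HB;have NR : 0 < N%:R :> R by rewrite ltr0n.
pose s : R := Num.sqrt N%:R;have s0 : 0 < s by rewrite sqrtr_gt0.
have sE : s ^+ 2 = N%:R by rewrite sqr_sqrtr// ltW.
pose a : R := s / B ^+ 2 / 2;have a0 : 0 < a by rewrite !divr_gt0// exprn_gt0.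
pose b : R := N%:R * (B ^+ 2 / s / 2).
have b0 : 0 <= b by rewrite mulr_ge0// !divr_ge0// ?sqr_ge0// ltW.
have m4 : mble (@gap4 R d N).
 by exact: mble_gap.
have m2 : mble (@gap2 R d N).
 by exact: mble_gap.
have p4 q : 0 <= @gap4 R d N q by apply: sumr_ge0 => i _;exact: expr4_ge0.
have p2 q : 0 <= @gap2 R d N q by apply: sumr_ge0 => i _;exact: sqr_ge0.
apply: (letr (ex (Pi k) (fun q => a * @gap4 R d N q + b)%R)).
 apply: (ex_le _ m2) => //;first by apply: mbleD => //;exact: mbleM.
 move=> q;rewrite /gap2 /gap4 /b [N%:R * _]mulr_natl -[X in _ *+ X](card_ord N) -sumr_const.
 rewrite mulr_sumr -big_split /=;apply: ler_sum => i _.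
 set e := enorm _;have B2 : 0 < B ^+ 2 by rewrite exprn_gt0.
 have h : 0 <= (s * e ^+ 2 - B ^+ 2) ^+ 2 / (2 * s * B ^+ 2).
 by rewrite divr_ge0 ?sqr_ge0// !mulr_ge0// ltW.
 rewrite -subr_ge0 /a (_ : _ - _ = (s * e ^+ 2 - B ^+ 2) ^+ 2 / (2 * s * B ^+ 2))//.
 by field;rewrite !gt_eqF.
have ma : mble (fun q => a * @gap4 R d N q) by exact: mbleM.
rewrite (exD _ ma (mble_cst b))//;last by move=> q;rewrite mulr_ge0// ltW.
rewrite (exZ _ m4 p4 (ltW a0)) ex_cst.
apply: (le_trans (leeD (lee_wpmul2l _ HB) (lexx _)));first by rewrite lee_fin ltW.
rewrite -EFinM -EFinD lee_fin;apply: eqW.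
rewrite -/s /a /b -sE;field;rewrite !gt_eqF//.
Qed.
Let window_sum K (h : R) : \sum_(j < K) D / 2 * h = D * K%:R / 2 * h.
Proof. by rewrite sumr_const card_ord -mulr_natl;field. Qed.
Let shifted k0 j : drift_field lamW m (G (k0 + j)%N) CG := fG (k0 + j)%N.

(** Up to [k0] the coupling is synchronous, and its second component has exactly the reference law:
    the window starts at no entropic cost, with a gap to close. *)
Lemma coupled_window k0 K w : (0 < K)%N -> (k0 + K)%N = n ->
 (ex (Pi k0) (@gap2 R d N) <= w%:E)%E ->
 DVle (mu x0 n) id (nu y0 n)
 (w / (2 * D * K%:R) + D * K%:R / 2 * (C1 * (Num.sqrt N%:R * gb k0 ^+ 2) + (1 + N%:R * eta ^+ 4))).
Proof.
move=> K0 nE Hw.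
have psE j : ps_step gV gW D j = ps_step gV gW D (k0 + j) :> (state * state -> state) by [].
have mvE j : tstep (mv_step gV (fun j => G (k0 + j)%N) D) j =
 tstep (n := N) (mv_step gV G D) (k0 + j) by [].
pose h := C1 * (Num.sqrt N%:R * gb k0 ^+ 2) + (1 + N%:R * eta ^+ 4).
have DV0 : DVle (Pi k0) snd (nu y0 k0) 0.
 move=> phi mphi phi0 phiM a Ha.
 by rewrite (sync_snd sys fG D0 pi_snd k0 mphi phi0);apply: (DVle_id mphi phi0 phiM Ha).
have := @window_DVle _ _ _ _ _ _ _ _ sys _ _ _ _ (shifted k0) D0 _ K0 _ _ _ _ _ (fun=> h)
 (sync_fst sys fG D0 pi_fst k0) DV0 Hw.
rewrite window_sum -(chain_shift_eq _ (mble_ps_step sys D0) _ _ K psE).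
rewrite -(chain_shift_eq _ (@mble_tstep _ _ _ _ _ (mble_mv_step sys fG D0) N) _ _ K mvE) nE.
rewrite add0r;apply.
move=> j jK;rewrite -(chain_shift_eq _ (mble_ps_step sys D0) _ _ j psE).
by apply: unb;rewrite ?leq_addr// -nE ltn_add2l.
Qed.
Lemma late_gap k0 : (k0 < n)%N ->
 (ex (Pi k0) (@gap2 R d N) <= (Num.sqrt N%:R * gb k0 ^+ 2)%:E)%E.
Proof.
move=> kn;apply: gap2_le => //.
have [|//] := gap4_le (sys := sys) (fG := fG) (D0 := D0) pi_snd eta0 r01 rE B00 (k := k0) pi_gap.
by move=> j jk;apply: Hnoise;exact: leq_ltn_trans kn.
Qed.
(** Both components start from the particle configuration: there is no gap to close, and the initial
    entropy is carried along as an initial cost. *)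
Lemma entropic_window (E0 : R) : (0 < n)%N -> DVle x0 id y0 E0 ->
 DVle (mu x0 n) id (nu y0 n)
 (E0 + D * n%:R / 2 * (C1 * (Num.sqrt N%:R * gb 0 ^+ 2) + (1 + N%:R * eta ^+ 4))).
Proof.
move=> n0 HE.
pose dg (x : state) := (x, x).
have mdg : mble dg by apply: mble_pair;exact: measurable_id.
pose rho0 := push x0 mdg.
have mg2 : mble (@gap2 R d N).
 by exact: mble_gap.
have rho_fst (g : state -> R) : mble g -> (forall x, 0 <= g x) ->
 ex rho0 (g \o fst) = ex x0 g.
 move=> mg g0;rewrite ex_push//.
 by apply: (mcomp mg);exact: mble_fst.
 by move=> q;exact: g0.
have DV0 : DVle rho0 snd y0 E0 by apply/DVle_push => //;exact: mble_snd.
have Hw : (ex rho0 (@gap2 R d N) <= 0%:E)%E.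
 rewrite ex_push//;last by move=> q;apply: sumr_ge0 => i _;exact: sqr_ge0.
 rewrite (eq_ex _ (_ : _ =1 fun=> 0)) ?ex_cst// => x /=.
 by rewrite /gap2 /dg /= big1// => i _;rewrite subrr enorm0 expr0n.
have := window_DVle n0 rho_fst DV0 Hw (fun j jn => unb (leq0n j) jn).
by rewrite mul0r add0r window_sum.
Qed.

End DiscreteEntropy.

(** * Realizing the chains on a filtered space *)

Section Adapted.
Context {R : realType} {dO : measure_display} {Om : measurableType dO} (P : probability Om R).
Variable F : R -> set (set Om).
Hypothesis hF : filtration F.

(* Measurability with respect to F t, as an ordinary [measurable_fun]. *)
Definition fmeas {dE} {E : measurableType dE} (t : R) (X : Om -> E) : Prop :=
 @measurable_fun _ _ (g_sigma_algebraType (F t)) E setT X.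

Lemma fmeasP {dE} {E : measurableType dE} t (X : Om -> E) : 0 <= t ->
 fmeas t X <-> forall A, measurable A -> F t (X @^-1` A).
Proof.
case: hF => + _ => /(_ t) H t0;have [sF _] := H t0;split => [mX A mA|H1 _ A mA].
 by have := mX measurableT A mA;rewrite setTI /measurable /= sigma_algebra_id.
by rewrite setTI /measurable /= sigma_algebra_id//;exact: H1.
Qed.
Lemma fmeas_measurable {dE} {E : measurableType dE} t (X : Om -> E) : 0 <= t ->
 fmeas t X -> mble X.
Proof.
move=> t0 /fmeasP -/(_ t0) H _ A mA;rewrite setTI.
by case: hF => + _ => /(_ t t0) [_];apply;exact: H.
Qed.
Lemma fmeas_le {dE} {E : measurableType dE} s t (X : Om -> E) : 0 <= s -> s <= t ->
 fmeas s X -> fmeas t X.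
Proof.
move=> s0 st /fmeasP -/(_ s0) H;apply/fmeasP;first exact: le_trans st.
by move=> A mA;case: hF => _ /(_ s t s0 st);apply;exact: H.
Qed.

Definition findep {dG} {G : measurableType dG} (t : R) (Z : Om -> G) (ga : probability G R) :=
 forall A, F t A -> forall B, measurable B -> (P (A `&` Z @^-1` B) = P A * ga B)%E.

Lemma law_pair {dE dG} {E : measurableType dE} {G : measurableType dG} t
 (Y : Om -> E) (Z : Om -> G) (rho : probability E R) (ga : probability G R) :
 0 <= t -> fmeas t Y -> has_law P Y rho -> mble Z -> findep t Z ga ->
 has_law P (fun w => (Y w, Z w)) (rho \x ga)%E.
Proof.
move=> t0 fY lY mZ iZ C mC.
have mY := fmeas_measurable t0 fY.
have mYZ : mble (fun w => (Y w, Z w)) by exact: mble_pair.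
suff H A B : measurable A -> measurable B -> push P mYZ (A `*` B) = (rho A * ga B)%E.
 by apply/esym;exact: (product_measure_unique H mC).
move=> mA mB;rewrite pushE -(lY A mA);apply: (iZ (Y @^-1` A) _ B mB).
by move/fmeasP : fY;apply.
Qed.

Section chain_law.
Context {dE dG : measure_display} {E : measurableType dE} {G : measurableType dG}.
Variables (ga : probability G R) (f : nat -> E * G -> E).
Hypothesis mf : forall k, mble (f k).
Variables (mu0 : probability E R) (D : R) (Y : nat -> Om -> E) (Z : nat -> Om -> G).
Hypotheses (D0 : 0 <= D) (fY0 : fmeas 0 (Y 0%N)) (lY0 : has_law P (Y 0%N) mu0).
Hypothesis YS : forall k w, Y k.+1 w = f k (Y k w, Z k w).
Hypothesis fZ : forall k, fmeas (k.+1%:R * D) (Z k).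
Hypothesis iZ : forall k, findep (k%:R * D) (Z k) ga.

(** Adaptedness is proved together with the law: the next increment is known to be independent of
    the filtration only, and this is what makes its joint law with [Y k] a product. *)
Lemma chain_law k : fmeas (k%:R * D) (Y k) /\ has_law P (Y k) (chain ga mf mu0 k).
Proof.
elim: k => [|k [fY lY]];first by rewrite mul0r.
have t0 : 0 <= k%:R * D by rewrite mulr_ge0.
have t1 : 0 <= k.+1%:R * D by rewrite mulr_ge0.
have tt : k%:R * D <= k.+1%:R * D by rewrite ler_wpM2r// ler_nat.
have YE : Y k.+1 = f k \o (fun w => (Y k w, Z k w)) by apply/funext => w;exact: YS.
split.
 rewrite /fmeas YE;apply: mcomp => //.
 by apply: mble_pair;[exact: (fmeas_le t0 tt fY)|exact: fZ].
move=> A mA;rewrite YE comp_preimage.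
have mZ : mble (Z k) by apply: (fmeas_measurable t1);exact: fZ.
have iZk : findep (k%:R * D) (Z k) ga by exact: iZ.
rewrite (law_pair t0 fY lY mZ iZk)//.
by rewrite -[X in measurable X]setTI;exact: mf.
Qed.

End chain_law.

End Adapted.

Lemma iid_gauss_tbox {R : realType} {N d : nat} (s : R) (A : 'I_N -> 'I_d -> set R) :
 (forall i k, measurable (A i k)) ->
 iid (gauss s) N [set x : conf N R d | forall i k, A i k (tnth x i 0 k)] =
 (\prod_(i < N) \prod_(k < d) normal_prob 0 s (A i k))%E.
Proof.
move=> mA;pose B i := [set x : 'rV[R]_d | forall k, A i k (x 0 k)].
have BE i : B i = \bigcap_(k in [set: 'I_d]) ((fun x : 'rV[R]_d => x 0 k) @^-1` A i k).
 by apply/seteqP;split => x /= H k;[move=> _;exact: H|exact: H].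
have mB i : measurable (B i).
 rewrite BE;apply: fin_bigcap_measurable => // k _.
 by rewrite -[X in measurable X]setTI;apply: mble_coord.
rewrite (iid_box (gauss s) mB);apply: eq_bigr => i _.
rewrite /gauss pushE -(iid_box (gauss1 s) (mA i)) ;congr (iid _ _ _).
by apply/seteqP;split => x /= H k;have := H k;rewrite mxE.
Qed.

Section Increments.
Context {R : realType} {dO : measure_display} {Om : measurableType dO} (P : probability Om R).
Context {N d : nat}.
Variables (F : R -> set (set Om)) (B : 'I_N -> R -> Om -> 'rV[R]_d).
Hypotheses (hF : filtration F) (hB : brownian_family P F B).

Definition increment s t w : conf N R d := [tuple B i t w - B i s w | i < N].

Lemma fmeas_increment s t : 0 <= s -> s <= t -> fmeas F t (increment s t).
Proof.
move=> s0 st;have t0 := le_trans s0 st.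
have fB i r : 0 <= r -> r <= t -> fmeas F t (B i r).
 move=> r0 rt;apply: (fmeas_le hF r0 rt);apply/(fmeasP hF _ r0).
 exact: (brownian_adapted hB).
apply: mblef_mktuple => i;apply: mble_rVB;exact: fB.
Qed.
(** The definition of the Brownian family speaks of boxes of coordinates. For a non-null event [A]
    the law of the increment conditioned on [A] is a probability that agrees with the Gaussian on
    boxes, hence everywhere; null events are trivial. *)
Lemma findep_increment s t : 0 <= s -> s < t ->
 findep P F s (increment s t) (iid (gauss (Num.sqrt (t - s))) N).
Proof.
move=> s0 st A FA C mC;have t0 := le_trans s0 (ltW st).
have mA : measurable A by case: hF => + _ => /(_ s s0) [_];apply.
have mZ := fmeas_measurable hF t0 (fmeas_increment s0 (ltW st)).
have [PA0|PA0] := eqVneq (P A) 0%E.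
 rewrite PA0 mul0e;apply/eqP;rewrite eq_le measure_ge0 andbT -PA0.
 apply: le_measure;[|by rewrite inE|exact: subIsetl];rewrite inE.
 by apply: measurableI => //;rewrite -[X in measurable X]setTI;exact: mZ.
have PAf : P A \is a fin_num by exact: fin_num_measure.
have fA0 : fine (P A) != 0 by apply: contraNneq PA0 => h;rewrite -(fineK PAf) h.
have nE X : measurable X -> mnormalize (mrestr P mA) P X = (P (X `&` A) * (fine (P A))^-1%:E)%E.
 move=> mX;rewrite /mnormalize /= /mrestr /= setTI.
 by rewrite (negbTE PA0) /= lt_eqF// ltey_eq PAf.
pose Q : probability _ R := push (mnormalize (mrestr P mA) P) mZ.
have mZC X : measurable X -> measurable (increment s t @^-1` X).
 by move=> mX;rewrite -[X in measurable X]setTI;exact: (mZ measurableT _ mX).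
have QN X : measurable X -> Q X = (P (increment s t @^-1` X `&` A) * (fine (P A))^-1%:E)%E.
 by move=> mX;rewrite /Q pushE;exact: (nE _ (mZC _ mX)).
have QE : forall X, measurable X -> Q X = iid (gauss (Num.sqrt (t - s))) N X.
 apply: tbox_unique => E mE;rewrite iid_gauss_tbox// QN;last first.
 rewrite (_ : mkset _ = \bigcap_(i in [set: 'I_N]) \bigcap_(k in [set: 'I_d])
  ((fun x : conf N R d => tnth x i 0 k) @^-1` E i k));last first.
  by apply/seteqP;split => x /= H i;[move=> _ k _;exact: H|move=> k;exact: H].
 apply: fin_bigcap_measurable => // i _;apply: fin_bigcap_measurable => // k _.
 rewrite -[X in measurable X]setTI;apply: mblef_coord => //.
 exact: mble_tnth.
 have := brownian_increments hB s0 st FA mE.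
 rewrite setIC (_ : [set w | _] = increment s t @^-1` [set x : conf N R d |
 forall i k, E i k (tnth x i 0 k)]);last first.
 by apply/seteqP;split => w /= H i k;have := H i k;rewrite !mxE tnth_mktuple !mxE.
 move=> ->;rewrite -[P A in LHS]fineK// muleAC -EFinM mulfV// mul1e.
 by [].
have := QE C mC;rewrite QN//.
rewrite setIC => <-;rewrite muleC -muleA -[P A in RHS]fineK// -EFinM mulVf// mule1.
by [].
Qed.

End Increments.

Section Increment1.
Context {R : realType} {dO : measure_display} {Om : measurableType dO} (P : probability Om R).
Context {d : nat}.
Variables (F : R -> set (set Om)) (B : R -> Om -> 'rV[R]_d).
Hypotheses (hF : filtration F) (hB : brownian_family P F (fun _ : 'I_1 => B)).

Lemma fmeas_increment1 s t : 0 <= s -> s <= t -> fmeas F t (fun w => B t w - B s w).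
Proof.
move=> s0 st;have H := fmeas_increment hF hB s0 st.
rewrite (_ : (fun w => _) = fun w => tnth (increment (fun _ : 'I_1 => B) s t w) ord0);last first.
 by apply/funext => w;rewrite tnth_mktuple.
exact: (mblef_tnth _ H).
Qed.
Lemma findep_increment1 s t : 0 <= s -> s < t ->
 findep P F s (fun w => B t w - B s w) (gauss (Num.sqrt (t - s))).
Proof.
move=> s0 st A FA C mC.
have := findep_increment hF hB s0 st FA (_ : measurable ((fun x : 1.-tuple 'rV[R]_d => tnth x ord0) @^-1` C)).
rewrite (_ : _ @^-1` C = [set x : 1.-tuple 'rV[R]_d | forall i, C (tnth x i)]);last first.
 by apply/seteqP;split => x /= H;[move=> i;rewrite (ord1 i)|exact: H].
rewrite (iid_box (gauss (Num.sqrt (t - s))) (fun _ : 'I_1 => mC)) big_ord1 => <-.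
 congr (P (_ `&` _));apply/seteqP;split => w /= H;last by have := H ord0;rewrite tnth_mktuple.
 by move=> i;rewrite tnth_mktuple.
rewrite (_ : mkset _ = (fun x : 1.-tuple 'rV[R]_d => tnth x ord0) @^-1` C);last first.
 by apply/seteqP;split => x /= H;[exact: H|move=> i;rewrite (ord1 i)].
by rewrite -[X in measurable X]setTI;apply: mble_tnth.
Qed.

End Increment1.

(** * Pathwise estimates *)

Section Paths.
Context {R : realType} {d : nat}.
Implicit Types (X B b : R -> 'rV[R]_d).

Definition path_continuous X : Prop := forall s e : R, 0 <= s -> 0 < e ->
 exists2 dl : R, 0 < dl & forall t, 0 <= t -> `|t - s| < dl -> enorm (X t - X s) < e.

Lemma enorm_le_coord (x : 'rV[R]_d) (e : R) : (forall k, `|x 0 k| <= e) -> enorm x <= d%:R * e.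
Proof.
move=> H;apply: (le_trans (enorm_le_sum x)).
apply: (letr (\sum_(k < d) e));first exact: ler_sum.
by rewrite sumr_const card_ord -[leLHS]mulr_natl.
Qed.
Lemma within_path_continuous X : {within `[0, +oo[, continuous X} -> path_continuous X.
Proof.
move=> /subspace_continuousP cX s e s0 e0.
have d1 : 0 < d%:R + 1 :> R by rewrite ltr_wpDl.
have /cvgrPdist_lt /(_ (e / (d%:R + 1)) (divr_gt0 e0 d1)) : X @ within `[0, +oo[ (nbhs s) --> X s.
 by apply: cX;rewrite /= in_itv /= s0.
move=> /nbhs_ballP [dl /= dl0 H];exists dl => // t t0 ts.
have h : `|X s - X t| < e / (d%:R + 1).
 by apply: H;rewrite /= ?in_itv /= ?t0// /ball /= distrC.
apply: (@le_lt_trans _ _ (d%:R * (e / (d%:R + 1)))).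
 by apply: (le_trans (enorm_le_mx _));rewrite ler_wpM2l// distrC ltW.
rewrite mulrA ltr_pdivrMr// mulrC ltr_pM2l//;by rewrite ltrDl.
Qed.
(** Heine-Cantor, by taking the supremum of the times up to which a uniform modulus exists. *)
Lemma path_continuous_unif X (T e : R) : path_continuous X -> 0 < e ->
 exists2 dl : R, 0 < dl & forall s t, 0 <= s -> s <= T -> 0 <= t -> t <= T ->
 `|t - s| < dl -> enorm (X t - X s) < e.
Proof.
move=> cX e0;have [T0|T0] := ltP T 0.
 by exists 1 => // s t s0 sT;have := le_lt_trans sT T0;rewrite ltNge s0.
pose P (t : R) := exists2 dl : R, 0 < dl & forall a b : R, 0 <= a -> a <= t -> 0 <= b -> b <= t ->
 `|b - a| < dl -> enorm (X b - X a) < e.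
pose S := [set t | 0 <= t <= T /\ P t].
have S0 : S 0.
 split;rewrite ?lexx//;exists 1 => // a b a0 a1 b0 b1 _.
 have -> : a = 0 by apply/eqP;rewrite eq_le a1.
 by have -> : b = 0;[apply/eqP;rewrite eq_le b1|rewrite subrr enorm0].
have hS : has_sup S by split;[exists 0|exists T => t [/andP[]]].
pose c := sup S;have c0 : 0 <= c by exact: (sup_upper_bound hS).
have cT : c <= T by apply: ge_sup;[exists 0|move=> t [/andP[]]].
have [dc dc0 Hc] := cX c (e / 2) c0 (divr_gt0 e0 (ltr0Sn R 1)).
have [t0 [/andP[t00 t0T] [d0 d00 H0]] ct0] := sup_adherent dc0 hS;rewrite -/c in ct0.
have t0c : t0 <= c by apply: (sup_upper_bound hS);split;[rewrite t00|exists d0].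
pose t1 := Num.min T (c + dc / 2).
have P1 : P t1.
 exists (Num.min d0 (t0 - (c - dc)));first by rewrite lt_min d00 subr_gt0.
 move=> a b a0 at1 b0 bt1;rewrite lt_min => /andP[ab1 ab2].
 suff near : c - dc < a -> c - dc < b -> enorm (X b - X a) < e.
 have [at0|at0] := leP a t0;have [bt0|bt0] := leP b t0;first exact: H0.
 - by apply: near;move: ab2;rewrite ltr_norml => /andP[ab2 ab3];lra.
 - by apply: near;move: ab2;rewrite ltr_norml => /andP[ab2 ab3];lra.
 - by apply: near;lra.
 move=> ca cb;move: at1 bt1;rewrite /t1 !le_min => /andP[_ at1] /andP[_ bt1].
 have ha : enorm (X a - X c) < e / 2 by apply: Hc => //;rewrite ltr_norml;apply/andP;split;lra.
 have hb : enorm (X b - X c) < e / 2 by apply: Hc => //;rewrite ltr_norml;apply/andP;split;lra.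
 rewrite (_ : X b - X a = (X b - X c) - (X a - X c));last by apply/rowP => k;rewrite !mxE;ring.
 by apply: (le_lt_trans (enormB _ _));lra.
have t1c : t1 <= c.
 apply: (sup_upper_bound hS);split => //;rewrite /t1 le_min T0 /= ge_min lexx andbT.
 by rewrite addr_ge0// divr_ge0// ltW.
have TE : T <= t1.
 rewrite /t1 le_min lexx /= leNgt;apply/negP => h;move: t1c;rewrite /t1 (min_r (ltW h));lra.
case: P1 => dl dl0 H;exists dl => // s t s0 sT t0' tT.
by apply: H => //;exact: le_trans TE.
Qed.

Local Notation leb := (@lebesgue_measure R).

Lemma Rintegral_incr_le (f : R -> R) (s t c : R) : 0 <= s -> s <= t ->
 leb.-integrable `[0, t] (fun r => (f r)%:E) -> (forall r, s <= r -> r <= t -> f r <= c) ->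
 \int[leb]_(r in `[0, t]) f r - \int[leb]_(r in `[0, s]) f r <= (t - s) * c.
Proof.
move=> s0 st If fc.
move: st;rewrite le_eqVlt => /orP[/eqP <-|st];first by rewrite !subrr mul0r.
rewrite (Rintegral_itvB (a := BLeft 0) (b := BRight t) (x := s) If)//=;rewrite ?bnd_simp ?(ltW st)//.
have I1 : leb.-integrable `]s, t] (EFin \o f).
 apply: (integrableS _ _ _ If) => //.
 by move=> x /=;rewrite !in_itv /= => /andP[sx ->];rewrite andbT (le_trans s0)// ltW.
have Ic : leb.-integrable `]s, t] (EFin \o (fun=> c)).
 have I2 : leb.-integrable `[s, t] (EFin \o (fun=> c)).
 apply: continuous_compact_integrable;first exact: segment_compact.
 by apply: continuous_subspaceT => x;exact: cvg_cst.
 apply: (integrableS _ _ _ I2) => //.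
 by move=> x /=;rewrite !in_itv /= => /andP[/ltW -> ->].
apply: (letr (\int[leb]_(r in `]s, t]) c)).
 apply: le_Rintegral => // x;rewrite /= in_itv /= => /andP[sx xt];apply: fc => //;exact: ltW.
have E3 : \int[leb]_(r in `]s, t]) c = c * fine (leb `]s, t]) by exact: Rintegral_cst.
have E4 : leb `]s, t] = (t - s)%:E.
 by apply: (etrans (lebesgue_measure_itv _));rewrite /= lte_fin st.
by rewrite E3 E4 mulrC.
Qed.
Lemma Rintegral_dotp (t : R) b (v : 'rV[R]_d) :
 (forall k, leb.-integrable `[0, t] (fun s => (b s 0 k)%:E)) ->
 leb.-integrable `[0, t] (fun s => (dotp (b s) v)%:E) /\
 \int[leb]_(s in `[0, t]) dotp (b s) v = dotp (\row_k \int[leb]_(s in `[0, t]) b s 0 k) v.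
Proof.
move=> Ib;rewrite /dotp.
elim: (index_enum 'I_d) => [|k r [I1 E1]].
 have E0 : (fun s => \sum_(k <- [::]) b s 0 k * v 0 k) = fun=> 0.
 by apply/funext => s;rewrite big_nil.
 have E1 : (fun s => (\sum_(k <- [::]) b s 0 k * v 0 k)%:E) = cst 0%E :> (R -> \bar R).
 by apply/funext => s;rewrite big_nil.
 rewrite E1 E0 big_nil;split;first exact: integrable0.
 by rewrite Rintegral_cst// mul0r.
have Ik : leb.-integrable `[0, t] (EFin \o (fun s => b s 0 k * v 0 k)).
 rewrite (_ : EFin \o _ = (fun s => (v 0 k)%:E * (b s 0 k)%:E)%E);last first.
 by apply/funext => s /=;rewrite -EFinM mulrC.
 exact: integrableZl.
have E (s : R) : \sum_(j <- k :: r) b s 0 j * v 0 j = b s 0 k * v 0 k + \sum_(j <- r) b s 0 j * v 0 j.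
 by rewrite big_cons.
split.
 have E2 : (fun s => (\sum_(j <- k :: r) b s 0 j * v 0 j)%:E) =
  (fun s => (b s 0 k * v 0 k)%:E + (\sum_(j <- r) b s 0 j * v 0 j)%:E)%E.
 by apply/funext => s;rewrite E EFinD.
 by rewrite E2;exact: (integrableD _ Ik I1).
under eq_Rintegral do rewrite E.
rewrite (RintegralD _ Ik I1)// E1 big_cons mxE;congr (_ + _).
by apply: RintegralZr => //;exact: Ib.
Qed.

Definition path_solution b B X : Prop := forall t, 0 <= t ->
 (forall k, leb.-integrable `[0, t] (fun s => (b s 0 k)%:E)) /\
 X t = X 0 + Num.sqrt 2 *: B t + \row_k \int[leb]_(s in `[0, t]) b s 0 k.

(** The consistency error of the implicit scheme: the drift is frozen at the right end point [t],
    and the error is uniformly small relative to the length of the step. *)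
Lemma path_residual b B X (T e : R) : path_solution b B X -> path_continuous b -> 0 < e ->
 exists2 dl : R, 0 < dl & forall s t, 0 <= s -> s <= t -> t <= T -> t - s < dl ->
 enorm (X t - X s - Num.sqrt 2 *: (B t - B s) - (t - s) *: b t) <= e * (t - s).
Proof.
move=> sol cb e0;have d1 : 0 < d%:R + 1 :> R by rewrite ltr_wpDl.
pose e' := e / (d%:R + 1);have e'0 : 0 < e' by rewrite divr_gt0.
have [dl dl0 H] := path_continuous_unif T cb e'0.
exists dl => // s t s0 st tT ts;have t0 := le_trans s0 st.
have ts0 : 0 <= t - s by rewrite subr_ge0.
have [It Et] := sol t t0;have [_ Es] := sol s s0.
apply: (letr (d%:R * (e' * (t - s))));last first.
 rewrite mulrA ler_wpM2r// /e' mulrCA ler_piMr//;first exact: ltW.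
 by rewrite ler_pdivrMr// mul1r lerDl.
apply: enorm_le_coord => k.
have -> : (X t - X s - Num.sqrt 2 *: (B t - B s) - (t - s) *: b t) 0 k =
 (\int[leb]_(r in `[0, t]) b r 0 k - \int[leb]_(r in `[0, s]) b r 0 k) - (t - s) * b t 0 k.
 by rewrite Et Es !mxE;ring.
have bk r : s <= r -> r <= t -> `|b r 0 k - b t 0 k| <= e'.
 move=> sr rt;have := coord_le_enorm (b r - b t) k;rewrite !mxE => h;apply: (le_trans h).
 apply/ltW/H => //;[exact: le_trans sr|exact: le_trans tT|].
 by rewrite ltr_norml;apply/andP;split;lra.
rewrite ler_norml;apply/andP;split;last first.
 have := @Rintegral_incr_le (fun r => b r 0 k) s t (b t 0 k + e') s0 st (It k).
 move=> h;rewrite lerBlDr;apply: (le_trans (h _)).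
 by move=> r sr rt;have := bk r sr rt;rewrite ler_norml => /andP[];lra.
 by rewrite mulrDr addrC [e' * _]mulrC.
have IN : leb.-integrable `[0, t] (fun r => (- b r 0 k)%:E).
 rewrite (_ : (fun r => _) = (fun r => (-1)%:E * (b r 0 k)%:E)%E);first exact: integrableZl.
 by apply/funext => r;rewrite -EFinM mulN1r.
have IS : leb.-integrable `[0, s] (fun r => (b r 0 k)%:E) by have [] := sol s s0.
have := @Rintegral_incr_le (fun r => - b r 0 k) s t (e' - b t 0 k) s0 st IN.
move=> h;have {}h : \int[leb]_(r in `[0, t]) - b r 0 k - \int[leb]_(r in `[0, s]) - b r 0 k <= (t - s) * (e' - b t 0 k).
 by apply: h => r sr rt;have := bk r sr rt;rewrite ler_norml => /andP[];lra.
have EN r : leb.-integrable `[0, r] (fun x => (b x 0 k)%:E) ->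
 \int[leb]_(x in `[0, r]) - b x 0 k = - \int[leb]_(x in `[0, r]) b x 0 k.
 move=> I1;under eq_Rintegral do rewrite -mulN1r.
 by rewrite RintegralZl// mulN1r.
rewrite (EN t (It k)) (EN s IS) in h;rewrite -subr_ge0.
by move: h;rewrite -subr_ge0 => h;apply: (le_trans h);apply: eqW;ring.
Qed.

(* Comparing with the noise alone, monotonicity of the drift leaves only its
 value along the noise. *)
Lemma path_growth (A : R -> 'rV[R]_d -> 'rV[R]_d) B X (T C : R) (q : nat) :
 path_solution (fun s => - A s (X s)) B X -> path_continuous X ->
 (forall r x y, 0 <= r -> r <= T -> 0 <= dotp (A r x - A r y) (x - y)) ->
 (forall rho : R, exists2 L : R, 0 <= L & forall r x y, 0 <= r -> r <= T ->
 enorm x <= rho -> enorm y <= rho -> enorm (A r x - A r y) <= L * enorm (x - y)) ->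
 (forall r x, 0 <= r -> r <= T -> enorm (A r x) <= C * (1 + enorm x ^+ q)) ->
 exists2 dl : R, 0 < dl & forall s t, 0 <= s -> s <= t -> t <= T -> t - s < dl ->
 enorm (X t - Num.sqrt 2 *: B t) <= enorm (X s - Num.sqrt 2 *: B s)
 + (t - s) * (C * (1 + enorm (Num.sqrt 2 *: B t) ^+ q) + 1).
Proof.
move=> sol cX mono lip growth.
have [d1 d10 H1] := path_continuous_unif T cX ltr01.
have d12 : 0 < d1 / 2 by rewrite divr_gt0.
(* The path moves by less than 1 over a step [d1 / 2], so the number of steps bounds it on the whole
   interval. *)
have [rho Hrho] : exists rho : R, forall t, 0 <= t -> t <= T -> enorm (X t) <= rho.
 exists (enorm (X 0) + (Num.truncn (T / (d1 / 2))).+1%:R) => t t0 tT.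
 have step k : forall s : R, 0 <= s -> s <= T -> s < k%:R * (d1 / 2) -> enorm (X s) <= enorm (X 0) + k%:R.
 elim: k => [|k IH] s s0 sT;first by rewrite mul0r ltNge s0.
 move=> sk;pose s' := Num.max 0 (s - d1 / 2).
 have s'0 : 0 <= s' by rewrite /s' le_max lexx.
 have s's : s' <= s by rewrite /s' ge_max s0 /= lerBlDr lerDl ltW.
 have s'd : s - d1 / 2 <= s' by rewrite /s' le_max lexx orbT.
 have h1 : enorm (X s') <= enorm (X 0) + k%:R.
  have [h|h] := leP 0 (s - d1 / 2);last by rewrite /s' (max_l (ltW h)) lerDl.
  rewrite /s' (max_r h);apply: IH => //;first by apply: le_trans sT;rewrite lerBlDr lerDl ltW.
  by rewrite ltrBlDr -[X in _ < _ + X]mul1r -mulrDl -natr1 in sk *.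
 have h2 : enorm (X s - X s') < 1.
  apply: H1 => //;first exact: le_trans sT.
  by rewrite ger0_norm ?subr_ge0//;lra.
 have h3 : enorm (X s) <= enorm (X s') + enorm (X s - X s').
  by apply: le_trans (enormD _ _);rewrite addrC subrK.
 by rewrite -natr1;lra.
 apply: step => //;rewrite -ltr_pdivrMr//.
 by apply: le_lt_trans (truncnS_gt _);rewrite ler_wpM2r// invr_ge0 ltW.
have [L L0 HL] := lip rho.
have L1 : 0 < L + 1 by rewrite ltr_wpDl.
have [dl dl0 H2] := path_continuous_unif T cX (divr_gt0 ltr01 L1).
exists dl => // s t s0 st tT ts;have t0 := le_trans s0 st.
have ts0 : 0 <= t - s by rewrite subr_ge0.
pose v := Num.sqrt 2 *: B t;pose u := X t - v;pose w := X s - Num.sqrt 2 *: B s.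
pose K := C * (1 + enorm v ^+ q) + 1.
have K0 : 0 <= K by rewrite addr_ge0//;apply: le_trans (growth t v t0 tT);exact: enorm_ge0.
have [It Et] := sol t t0;have [Is Es] := sol s s0.
have [Jt Ft] := Rintegral_dotp u It;have [Js Fs] := Rintegral_dotp u Is.
have fc r : s <= r -> r <= t -> dotp (- A r (X r)) u <= enorm u * K.
 move=> sr rt;have r0 := le_trans s0 sr;have rT := le_trans rt tT.
 have -> : dotp (- A r (X r)) u = dotp (A r (X t) - A r (X r)) u
  - dotp (A r (X t) - A r v) u - dotp (A r v) u.
 by rewrite !dotpBl dotpNl;ring.
 have h1 : dotp (A r (X t) - A r (X r)) u <= enorm u.
 apply: (le_trans (dotp_le _ _));rewrite ler_piMl ?enorm_ge0//.
 apply: (le_trans (HL r _ _ r0 rT (Hrho _ t0 tT) (Hrho _ r0 rT))).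
 have h : enorm (X t - X r) < 1 / (L + 1).
  by apply: H2 => //;rewrite ger0_norm ?subr_ge0//;lra.
 apply: (letr (L * (1 / (L + 1))));first by rewrite ler_wpM2l// ltW.
 by rewrite mul1r ler_pdivrMr// mul1r lerDl.
 have h2 := mono r (X t) v r0 rT;rewrite -/u in h2.
 have h3 : - dotp (A r v) u <= enorm u * (C * (1 + enorm v ^+ q)).
 apply: (letr (enorm (A r v) * enorm u)).
  by rewrite -dotpNl -(enormN (A r v));exact: dotp_le.
 by rewrite mulrC ler_wpM2l ?enorm_ge0//;exact: growth.
 by rewrite /K mulrDr mulr1;lra.
have := Rintegral_incr_le s0 st Jt fc.
rewrite Ft Fs -dotpBl.
have -> : (\row_k \int[leb]_(s in `[0, t]) (- A s (X s)) 0 k) -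
 (\row_k \int[leb]_(s0 in `[0, s]) (- A s0 (X s0)) 0 k) = u - w.
 have H (a b c e f : 'rV[R]_d) : e = a + b + c -> c = e - a - b.
 by move=> ->;apply/rowP => k;rewrite !mxE;ring.
 rewrite (H _ _ _ _ 0 Et) (H _ _ _ _ 0 Es) /u /w /v;apply/rowP => k;rewrite !mxE;ring.
rewrite dotpBl -enorm_sqr -/v -/u -/w -/K => h.
have h2 : enorm u * enorm u <= enorm u * (enorm w + (t - s) * K).
 have := dotp_le w u;move: h;set p := dotp w u;set U := enorm u;set W := enorm w;nra.
have [u0|u0] := eqVneq (enorm u) 0;first by rewrite u0 addr_ge0 ?enorm_ge0// mulr_ge0.
by move: h2;rewrite ler_pM2l// lt_neqAle eq_sym u0 enorm_ge0.
Qed.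

End Paths.

Lemma discrete_gronwall {R : realType} (e : nat -> R) (D b : R) n : 0 <= D -> 0 <= b ->
 0 <= e 0%N -> (forall k, (k < n)%N -> e k.+1 <= (1 + D) * e k + b) ->
 forall k, (k <= n)%N -> e k <= expR (k%:R * D) * (e 0%N + k%:R * b).
Proof.
move=> D0 b0 e0 H;elim=> [|k IH] kn;first by rewrite !mul0r expR0 mul1r addr0.
apply: (le_trans (H k kn)).
have E : expR (k.+1%:R * D) = expR D * expR (k%:R * D) by rewrite -expRD -natr1 mulrDl mul1r addrC.
have h1 : 1 + D <= expR D by exact: expR_ge1Dx.
have h2 : 1 <= expR (k.+1%:R * D) by rewrite -expR0 ler_expR mulr_ge0.
apply: (letr (expR D * (expR (k%:R * D) * (e 0%N + k%:R * b)) + expR (k.+1%:R * D) * b)).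
 apply: lerD;last by rewrite ler_peMl.
 have d1 : 0 <= 1 + D by rewrite addr_ge0.
 apply: (le_trans (ler_wpM2l d1 (IH (ltnW kn))));rewrite ler_wpM2r//.
 by rewrite mulr_ge0 ?expR_ge0// addr_ge0// mulr_ge0.
rewrite E -[k.+1%:R]natr1;apply: eqW;ring.
Qed.

Section Laws.
Context {R : realType} {dO dT : measure_display}.
Context {Om : measurableType dO} {T : measurableType dT}.
Variables (P : probability Om R) (X : Om -> T) (mu : probability T R).
Hypotheses (mX : mble X) (lX : has_law P X mu).

Lemma has_law_ex (g : T -> R) : mble g -> (forall x, 0 <= g x) ->
 ex mu g = ex P (g \o X).
Proof.
by move=> mg g0;rewrite -(ex_push P mX mg g0);apply: eq_measure_ex => A mA;exact/esym/lX.
Qed.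
Lemma has_law_Rintegral (g : T -> R) : mble g ->
 P.-integrable setT (EFin \o (g \o X)) -> \int[mu]_x g x = \int[P]_w g (X w).
Proof.
move=> mg ig;rewrite /Rintegral;congr fine.
rewrite (_ : \int[mu]_x (g x)%:E = \int[push P mX]_x (g x)%:E)%E;last first.
 by apply: eq_measure_integral => A mA _;exact/esym/lX.
by rewrite (integral_distribution (X := HB.pack X (isMeasurableFun.Build _ _ _ _ X mX)))//;exact/mbleEFin.
Qed.

End Laws.

Lemma ex_lin2 {R : realType} {dT} {T : measurableType dT} (P : probability T R)
 (f1 f2 : T -> R) (a b c g1 g2 : R) :
 mble f1 -> mble f2 -> (forall x, 0 <= f1 x) -> (forall x, 0 <= f2 x) ->
 0 <= a -> 0 <= b -> 0 <= c -> (ex P f1 <= g1%:E)%E -> (ex P f2 <= g2%:E)%E ->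
 (ex P (fun x => a + b * f1 x + c * f2 x)%R <= (a + b * g1 + c * g2)%:E)%E.
Proof.
move=> m1 m2 p1 p2 a0 b0 c0 h1 h2.
have mb : mble (fun x => b * f1 x) by exact: mbleM.
have mc : mble (fun x => c * f2 x) by exact: mbleM.
have mab : mble (fun x => a + b * f1 x) by exact: mbleD.
rewrite (exD _ mab mc);[|by move=> x;rewrite addr_ge0// mulr_ge0|by move=> x;rewrite mulr_ge0].
rewrite (exD _ (mble_cst a) mb)//;last by move=> x;rewrite mulr_ge0.
rewrite ex_cst (exZ _ m1 p1 b0) (exZ _ m2 p2 c0) !EFinD !EFinM.
by apply: leeD;[apply: leeD => //|];apply: lee_wpmul2l;rewrite ?lee_fin.
Qed.
(** Jensen's inequality for a power: [young_power] with [b] equal to the mean is the tangent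
    inequality at the mean, summed over the terms. *)
Lemma power_mean {R : realType} n (a : 'I_n.+1 -> R) p : (forall i, 0 <= a i) ->
 (n.+1%:R^-1 * \sum_i a i) ^+ p.+1 <= n.+1%:R^-1 * \sum_i a i ^+ p.+1.
Proof.
move=> a0;set A := n.+1%:R^-1 * _;have A0 : 0 <= A by rewrite mulr_ge0// sumr_ge0.
have nz : n.+1%:R != 0 :> R by rewrite pnatr_eq0.
have H : \sum_i p.+1%:R * (a i * A ^+ p) <= \sum_i (a i ^+ p.+1 + p%:R * A ^+ p.+1).
 by apply: ler_sum => i _;exact: young_power.
have Es : \sum_(i < n.+1) p%:R * A ^+ p.+1 = n.+1%:R * (p%:R * A ^+ p.+1).
 by rewrite sumr_const card_ord [RHS]mulr_natl.
move: H;rewrite -mulr_sumr -mulr_suml big_split /= Es.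
have -> : \sum_i a i = n.+1%:R * A by rewrite /A mulrA mulfV// mul1r.
rewrite exprS;set S := \sum_i _;set Ap := A ^+ p => H.
rewrite ler_pdivlMl;last by rewrite ltr0n.
by move: H;rewrite -[p.+1%:R]natr1;nra.
Qed.

(** * Stability of the mean field in the law *)

Section ConvDist.
Context {R : realType} {d : nat}.
Variables (gV gW : 'rV[R]_d -> 'rV[R]_d) (lamV lamW M : R) (m : nat).
Hypothesis sys : convex_system gV gW lamV lamW M m.
Context {dO : measure_display} {Om : measurableType dO}.
Variables (P : probability Om R) (Y Z : Om -> 'rV[R]_d) (mu tau : probability 'rV[R]_d R).
Variables (K2 : R).
Hypotheses (mY : mble Y) (mZ : mble Z).
Hypotheses (lY : has_law P Y mu) (lZ : has_law P Z tau).
Hypothesis muK : (ex mu (fun x => enorm x ^+ (2 * m))%R <= K2%:E)%E.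
Hypothesis tauK : (ex tau (fun x => enorm x ^+ (2 * m))%R <= K2%:E)%E.

(** The truncation at 1 matches the growth condition on [gW]; it makes almost sure convergence
    enough for the expectation to vanish. *)
Definition dist1 w : R := Num.min (enorm (Y w - Z w)) 1 ^+ 2.

Definition conv_dist_cst : R := 4 * (1 + 4 ^+ m * (4 + 2 * K2)).

Lemma mble_dist1 : mble dist1.
Proof.
apply: mbleX;apply: measurable_minr;last exact: mble_cst.
by apply: mblef_enorm;exact: mble_rVB.
Qed.
(** The growth condition gives a product of the truncated distance and a polynomial weight; [kap]
    splits it, leaving the distance with expectation [eps] and the weight with a small factor. *)
Lemma conv_dist x (kap eps : R) : 0 < kap -> (ex P dist1 <= eps%:E)%E ->
 enorm (conv gW mu x - conv gW tau x) <=
 d%:R * (M * (kap^-1 * eps + kap * (conv_dist_cst * (1 + enorm x ^+ (2 * m))))).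
Proof.
move=> k0 He;have M0 : 0 <= M := ltW (sys_M sys).
have en0 (y : 'rV[R]_d) q : 0 <= enorm y ^+ q by rewrite exprn_ge0// enorm_ge0.
pose q (y : 'rV[R]_d) := enorm y ^+ (2 * m).
have mq : mble q by apply: mbleX;exact: mble_enorm.
have [pY pZ] : (ex P (q \o Y) <= K2%:E)%E /\ (ex P (q \o Z) <= K2%:E)%E.
 have q0 y : 0 <= q y by exact: en0.
 by rewrite -(has_law_ex mY lY mq q0) -(has_law_ex mZ lZ mq q0).
have K20 : 0 <= K2 by rewrite -lee_fin;apply: le_trans muK;exact: ex_ge0.
pose Wt w := 4 * (1 + 4 ^+ m * (4 * q x)) + 4 * 4 ^+ m * q (Y w) + 4 * 4 ^+ m * q (Z w).
have four : 0 <= 4 ^+ m :> R by rewrite exprn_ge0.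
have mqY : mble (q \o Y) by exact: mcomp.
have mqZ : mble (q \o Z) by exact: mcomp.
have mWt : mble Wt.
 by apply: mbleD;[apply: mbleD => //|];exact: mbleM.
have c0 : 0 <= 4 * 4 ^+ m :> R by rewrite mulr_ge0.
have a0 : 0 <= 4 * (1 + 4 ^+ m * (4 * q x)) by rewrite mulr_ge0// addr_ge0// mulr_ge0// mulr_ge0// en0.
have Wt0 w : 0 <= Wt w by rewrite /Wt addr_ge0 ?addr_ge0// mulr_ge0// en0.
have EWt : (ex P Wt <= (conv_dist_cst * (1 + q x))%:E)%E.
 apply: (le_trans (@ex_lin2 _ _ _ P _ _ _ _ _ K2 K2 mqY mqZ (fun w => en0 _ _) (fun w => en0 _ _) a0 c0 c0 pY pZ)).
 rewrite lee_fin /conv_dist_cst;have := en0 x (2 * m)%N;rewrite -/(q x) => qx.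
 have h : 0 <= 4 ^+ m * K2 * q x by rewrite !mulr_ge0.
 have h' : 0 <= 4 ^+ m * 1 :> R by rewrite mulr1.
 lra.
pose g w := 0 + (M * kap^-1) * dist1 w + (M * kap) * Wt w.
have Mk : 0 <= M * kap^-1 by rewrite mulr_ge0// invr_ge0 ltW.
have Mk' : 0 <= M * kap by rewrite mulr_ge0// ltW.
have Eg : (ex P g <= (M * (kap^-1 * eps + kap * (conv_dist_cst * (1 + q x))))%:E)%E.
 apply: (le_trans (ex_lin2 mble_dist1 mWt (fun w => sqr_ge0 _) Wt0 (lexx 0) Mk Mk' He EWt)).
 by rewrite lee_fin;apply: eqW;rewrite /q;ring.
have mg : mble g.
 by apply: mbleD;[apply: mbleD => //|];apply: mbleM => //;exact: mble_dist1.
have mW (U : Om -> 'rV[R]_d) k : mble U ->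
 mble (fun w => gW (x - U w) 0 k).
 move=> mU;apply: mblef_coord;apply: (mcomp (mble_gW sys)).
 by apply: mble_rVB => //;exact: mble_cst.
have K1 (nu : probability 'rV[R]_d R) : (ex nu (fun x => enorm x ^+ (2 * m))%R <= K2%:E)%E ->
 (ex nu (fun x => enorm x ^+ m)%R <= (1 + K2)%:E)%E.
 move=> h;apply: (letr (ex nu (fun x => 1 + enorm x ^+ (2 * m))%R)).
 apply: ex_le => // [||y];first by apply: mbleX;exact: mble_enorm.
  by apply: mbleD => //;apply: mbleX;exact: mble_enorm.
 by apply: expr_le1D;[exact: enorm_ge0|exact: leq_pmull].
 rewrite (exD nu (mble_cst (1 : R)) mq (fun _ => ler01) (fun y => en0 y _)) ex_cst EFinD.
 exact: leeD.
have IW (U : Om -> 'rV[R]_d) nu k : mble U -> has_law P U nu ->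
 (ex nu (fun x => enorm x ^+ (2 * m))%R <= K2%:E)%E ->
 P.-integrable setT (EFin \o (fun w => gW (x - U w) 0 k)) /\
 conv gW nu x 0 k = \int[P]_w gW (x - U w) 0 k.
 move=> mU lU nK.
 pose h (y : 'rV[R]_d) := `|gW (x - y) 0 k|.
 have mgx : mble (fun y : 'rV[R]_d => gW (x - y) 0 k).
 apply: mblef_coord;apply: (mcomp (mble_gW sys)).
 by apply: mble_rVB;[exact: mble_cst|exact: measurable_id].
 have mh : mble h by exact: mcomp.
 have /integrableP[_ Ih] := conv_integrable sys (K1 _ nK) x k.
 have IU : P.-integrable setT (EFin \o (fun w => gW (x - U w) 0 k)).
 apply/integrableP;split;first by apply/mbleEFin;exact: mW.
 have H : ex nu h = ex P (h \o U) := has_law_ex mU lU mh (fun y => normr_ge0 _).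
 by move: Ih;rewrite -/(ex nu h) H.
 by split => //;rewrite mxE (has_law_Rintegral mU lU mgx).
apply: enorm_le_coord => k.
have [IY EY] := IW Y mu k mY lY muK;have [IZ EZ] := IW Z tau k mZ lZ tauK.
rewrite mxE [X in _ + X]mxE EY EZ -RintegralB//.
apply: (proj2 (Rintegral_bound _ mg _ Eg));first by apply: measurable_funB;exact: mW.
move=> w;have := coord_le_enorm (gW (x - Y w) - gW (x - Z w)) k.
rewrite !mxE => h;apply: (le_trans h);apply: (le_trans (sys_growthW sys _ _)).
have -> : x - Y w - (x - Z w) = - (Y w - Z w) by apply/rowP => j;rewrite !mxE;ring.
rewrite enormN;set mn := Num.min _ _;set W := 1 + _ + _.
have W2 : W ^+ 2 <= Wt w.
 have := enormB_pow m x (Y w);have := enormB_pow m x (Z w).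
 have fE : 4 ^+ m = (2 ^+ m) ^+ 2 :> R by rewrite -exprM mulnC exprM expr2 -natrM.
 rewrite /Wt fE /q ![_ ^+ (2 * m)](fun a => etrans (exprM a 2 m) (exprAC a 2 m)) /W.
 have := en0 (x - Y w) m;have := en0 (x - Z w) m.
 have := en0 x m;have := en0 (Y w) m;have := en0 (Z w) m.
 set a := enorm (x - Y w) ^+ m;set b := enorm (x - Z w) ^+ m;set e := 2 ^+ m.
 set X := enorm x ^+ m;set y := enorm (Y w) ^+ m;set z := enorm (Z w) ^+ m.
 move=> z0 y0 X0 b0 aa0 hb ha.
 have s0 : 0 <= 1 + a + b by rewrite addr_ge0// addr_ge0.
 apply: (letr ((1 + 2 * (e * X) + e * y + e * z) ^+ 2)).
 by rewrite lerXn2r ?nnegrE//;lra.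
 set p1 := e * X;set p2 := e * y;set p3 := e * z.
 have -> : 4 * (1 + e ^+ 2 * (4 * X ^+ 2)) + 4 * e ^+ 2 * y ^+ 2 + 4 * e ^+ 2 * z ^+ 2 =
 4 * (1 + (2 * p1) ^+ 2 + p2 ^+ 2 + p3 ^+ 2) by rewrite /p1 /p2 /p3;ring.
 have := sqr_ge0 (1 - 2 * p1);have := sqr_ge0 (1 - p2);have := sqr_ge0 (1 - p3).
 have := sqr_ge0 (2 * p1 - p2);have := sqr_ge0 (2 * p1 - p3);have := sqr_ge0 (p2 - p3).
 rewrite !expr2;lra.
apply: (letr (M * (kap^-1 * mn ^+ 2 + kap * W ^+ 2)));last first.
 rewrite (_ : M * _ = M * kap^-1 * mn ^+ 2 + M * kap * W ^+ 2);last by ring.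
 by rewrite /g /dist1 -/mn add0r;apply: lerD => //;apply: ler_wpM2l.
rewrite -mulrA ler_wpM2l// -subr_ge0.
have -> : kap^-1 * mn ^+ 2 + kap * W ^+ 2 - mn * W =
 (kap^-1 * (mn - kap * W) ^+ 2 + kap^-1 * mn ^+ 2 + kap * W ^+ 2) / 2.
 by field;rewrite gt_eqF.
by rewrite divr_ge0// !addr_ge0// mulr_ge0 ?sqr_ge0// ?invr_ge0 ltW.
Qed.

End ConvDist.

(** * Moments and continuity of the McKean-Vlasov flow *)

Section McKean.
Context {R : realType} {d : nat}.
Variables (gV gW : 'rV[R]_d -> 'rV[R]_d) (lamV lamW M : R) (m : nat).
Hypothesis sys : convex_system gV gW lamV lamW M m.
Context {dO : measure_display} {Om : measurableType dO}.
Variables (P : probability Om R) (F : R -> set (set Om)).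
Variables (B X : R -> Om -> 'rV[R]_d) (u : R -> probability 'rV[R]_d R).
Hypotheses (hF : filtration F) (hB : brownian_family P F (fun _ : 'I_1 => B)).
Hypotheses (aX : adapted F X) (cX : continuous_paths P X).
Hypothesis solX : {ae P, forall w, path_solution
 (fun s => - (gV (X s w) + conv gW (u s) (X s w))) (B ^~ w) (X ^~ w)}.
Hypothesis lX : forall t, 0 <= t -> has_law P (X t) (u t).
Hypothesis uK : forall T : R, exists K : R, forall t, 0 <= t -> t <= T ->
 (ex (u t) (fun x => enorm x ^+ m)%R <= K%:E)%E.
Hypothesis u0M : forall q, exists C : R, (ex (u 0) (fun x => enorm x ^+ q)%R <= C%:E)%E.

Let A s x := gV x + conv gW (u s) x.

Let en0 (x : 'rV[R]_d) q : 0 <= enorm x ^+ q. Proof. by rewrite exprn_ge0// enorm_ge0. Qed.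
Let menp q : mble (fun x : 'rV[R]_d => enorm x ^+ q).
Proof. by apply: mbleX;exact: mble_enorm. Qed.
Let mX t : 0 <= t -> mble (X t).
Proof. by move=> t0;apply: (fmeas_measurable hF t0);apply/(fmeasP hF _ t0);exact: aX. Qed.
Let mB s t : 0 <= s -> s <= t -> mble (fun w => B t w - B s w).
Proof. by move=> s0 st;apply: (fmeas_measurable hF (le_trans s0 st));exact: (fmeas_increment1 hF hB). Qed.
Lemma good_paths : {ae P, forall w, [/\ path_solution (fun s => - A s (X s w)) (B ^~ w) (X ^~ w),
 path_continuous (X ^~ w) & B 0 w = 0]}.
Proof.
have HB := brownian_start hB ord0.
by near=> w;split;[near: w|apply: within_path_continuous;near: w|near: w].
Unshelve. all: by end_near. Qed.
Lemma drift_monotone T K : (forall t, 0 <= t -> t <= T ->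
 (ex (u t) (fun x => enorm x ^+ m)%R <= K%:E)%E) ->
 forall r x y, 0 <= r -> r <= T -> 0 <= dotp (A r x - A r y) (x - y).
Proof.
move=> uT r x y r0 rT;have h2 := sys_V sys x y;have h1 := conv_monotone sys (uT r r0 rT) x y.
rewrite (_ : A r x - A r y = (gV x - gV y) + (conv gW (u r) x - conv gW (u r) y));last first.
 by apply/rowP => k;rewrite !mxE;ring.
rewrite dotpDl;apply: le_trans (lerD h2 h1).
by rewrite -mulrDl mulr_ge0 ?sqr_ge0// ltW// (sum_lam_gt0 sys).
Qed.
Lemma drift_growth T K : (forall t, 0 <= t -> t <= T ->
 (ex (u t) (fun x => enorm x ^+ m)%R <= K%:E)%E) ->
 exists C q, 0 <= C /\ forall r x, 0 <= r -> r <= T -> enorm (A r x) <= C * (1 + enorm x ^+ q).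
Proof.
move=> uT;have [C1 [q1 H1]] := sys_growthV sys.
exists (2 * (`|C1| + `|@conv_cst R d M m K|)), (q1 + m)%N.
split=> [|r x r0 rT];first by rewrite mulr_ge0// addr_ge0.
apply: (le_trans (enormD _ _)).
have h1 := expr_le1D (enorm_ge0 x) (leq_addr m q1).
have h2 := expr_le1D (enorm_ge0 x) (leq_addl q1 m).
have h3 := conv_bound sys (uT r r0 rT) x;have h4 := H1 x.
have y0 := en0 x (q1 + m)%N.
have h k c : enorm x ^+ k <= 1 + enorm x ^+ (q1 + m) ->
 c * (1 + enorm x ^+ k) <= `|c| * (2 * (1 + enorm x ^+ (q1 + m))).
 move=> hk;apply: (letr (`|c| * (1 + enorm x ^+ k))).
 by rewrite ler_wpM2r ?ler_norm// addr_ge0.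
 by rewrite ler_wpM2l//;lra.
apply: (le_trans (lerD (le_trans h4 (h _ _ h1)) (le_trans h3 (h _ _ h2)))).
by apply: eqW;ring.
Qed.
Lemma drift_lipschitz T K : (forall t, 0 <= t -> t <= T ->
 (ex (u t) (fun x => enorm x ^+ m)%R <= K%:E)%E) ->
 forall rho : R, exists2 L : R, 0 <= L & forall r x y, 0 <= r -> r <= T ->
 enorm x <= rho -> enorm y <= rho -> enorm (A r x - A r y) <= L * enorm (x - y).
Proof.
move=> uT rho;have [L1 H1] := sys_lip sys rho;pose cc := @conv_cst R d M m K.
exists (`|L1| + `|cc| * (1 + 2 * `|rho| ^+ m));first by rewrite addr_ge0// mulr_ge0// addr_ge0// mulr_ge0// exprn_ge0.
move=> r x y r0 rT xr yr;have e0 := enorm_ge0 (x - y).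
rewrite (_ : A r x - A r y = (gV x - gV y) + (conv gW (u r) x - conv gW (u r) y));last first.
 by apply/rowP => k;rewrite !mxE;ring.
apply: (le_trans (enormD _ _));rewrite mulrDl;apply: lerD.
 by apply: (le_trans (H1 x y xr yr));rewrite ler_wpM2r// ler_norm.
apply: (le_trans (conv_lip sys (uT r r0 rT) x y));rewrite -/cc.
have pw (z : 'rV[R]_d) : enorm z <= rho -> enorm z ^+ m <= `|rho| ^+ m.
 by move=> zr;rewrite lerXn2r ?nnegrE ?enorm_ge0//;apply: le_trans (ler_norm _).
have hx := pw x xr;have hy := pw y yr.
rewrite mulrAC ler_wpM2r//;apply: (letr (`|cc| * (1 + enorm x ^+ m + enorm y ^+ m))).
 by rewrite ler_wpM2r ?ler_norm// !addr_ge0.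
by rewrite ler_wpM2l//;lra.
Qed.
Let N w s := enorm (Num.sqrt 2 *: (B s w - B 0 w)).

Let mN s : 0 <= s -> mble (N ^~ s).
Proof.
move=> s0;apply: mblef_enorm;apply: mble_rVZ;first exact: mble_cst.
exact: mB.
Qed.
Lemma noise_moment r T : exists2 g : R, 0 <= g & forall s, 0 < s -> s <= T ->
 (ex P (fun w => N w s ^+ r)%R <= g%:E)%E.
Proof.
pose c T' : R := d%:R ^+ r.+2 * (2 * r.+1`!%:R * 4 ^+ r.+1 * T' ^+ r.+1).
have c0 : 0 <= c `|T| by rewrite /c;apply: mulr_ge0;rewrite ?exprn_ge0// mulr_ge0 ?exprn_ge0// mulr_ge0// exprn_ge0.
exists (1 + 2 ^+ r.+1 * c `|T| + 0 * 0).
 by rewrite mul0r addr0;apply: addr_ge0 => //;apply: mulr_ge0 => //;exact: exprn_ge0.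
move=> s s0 sT;have s00 := ltW s0.
have lZ : has_law P (fun w => B s w - B 0 w) (gauss (Num.sqrt (s - 0))).
 move=> C mC;have := findep_increment1 hF hB (lexx 0) s0 (A := setT) _ mC.
 rewrite setTI probability_setT mul1e;apply.
 by case: hF => + _ => /(_ 0 (lexx 0)) [[+ + _] _] => h0 hC;have := hC _ h0;rewrite setD0.
pose h (x : 'rV[R]_d) := enorm (Num.sqrt 2 *: x) ^+ r.
have mh : mble h.
 apply: mbleX;apply: mblef_enorm;apply: mble_rVZ => //.
have h0 x : 0 <= h x by exact: en0.
rewrite (_ : (fun w => _) = h \o (fun w => B s w - B 0 w))//.
rewrite -(has_law_ex (mB (lexx 0) s00) lZ mh h0).
apply: (letr (ex (gauss (Num.sqrt (s - 0))) (fun x : 'rV[R]_d => 1 + 2 ^+ r.+1 * enorm x ^+ (2 * r.+1) + 0 * (fun=> 0) x)%R)).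
 apply: ex_le => //.
 apply: mbleD;last by apply: mbleM;exact: mble_cst.
 by apply: mbleD => //;apply: mbleM => //;exact: menp.
 move=> x;rewrite mul0r addr0 /h.
 have -> : 2 ^+ r.+1 * enorm x ^+ (2 * r.+1) = enorm (Num.sqrt 2 *: x) ^+ (2 * r.+1).
 by rewrite enormZ exprMn ger0_norm ?sqrtr_ge0// [Num.sqrt 2 ^+ _]exprM sqr_sqrtr.
 by apply: expr_le1D;rewrite ?enorm_ge0//;lia.
have z0 : (ex (gauss (Num.sqrt (s - 0))) (fun _ : 'rV[R]_d => (0 : R)%R) <= 0%:E)%E by rewrite ex_cst.
apply: (ex_lin2 (menp _) (mble_cst (0 : R)) (fun x => en0 x _) (fun=> lexx 0) ler01 _ (lexx 0) _ z0).
 by rewrite exprn_ge0.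
apply: (le_trans (ex_gauss_moment (s := Num.sqrt (s - 0)) _ r));first by rewrite sqrtr_gt0 subr0.
rewrite lee_fin /c subr0 sqr_sqrtr//;apply: ler_wpM2l;first exact: exprn_ge0.
apply: ler_wpM2l;first by rewrite mulr_ge0 ?exprn_ge0// mulr_ge0.
by rewrite lerXn2r ?nnegrE//;apply: (le_trans sT);exact: ler_norm.
Qed.
(** Moments of order [m] are assumed locally bounded, and they make the mean-field drift monotone
    with polynomial growth. Summing [path_growth] along a mesh bounds the path by its starting
    point, the noise and a Riemann mean of powers of the noise, which have moments of all orders. *)
Lemma mckean_moment p T : exists K' : R, forall t, 0 <= t -> t <= T ->
 (ex (u t) (fun x => enorm x ^+ p)%R <= K'%:E)%E.
Proof.
case: p => [|p];first by exists 1 => t _ _;rewrite (eq_ex _ (_ : _ =1 fun=> 1)) ?ex_cst// => x;rewrite expr0.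
have [T0|T0] := ltP T 0;first by exists 0 => t t0 tT;have := le_lt_trans tT T0;rewrite ltNge t0.
have [K uT] := uK T;have [C [q [C0 gr]]] := drift_growth uT.
have [g1 g10 Hg1] := noise_moment p.+1 T;have [g2 g20 Hg2] := noise_moment (q * p.+1)%N T.
have [m0 Hm0] := u0M p.+1.
have m00 : 0 <= m0 by rewrite -lee_fin;apply: le_trans Hm0;exact: ex_ge0.
pose al := T * (C + 1);pose ga := T * C;pose Q : R := 2 ^+ p.+1 * 2 ^+ p.+1.
have al0 : 0 <= al by rewrite mulr_ge0// addr_ge0.
have ga0 : 0 <= ga by rewrite mulr_ge0.
have Q0 : 0 <= Q by rewrite mulr_ge0// exprn_ge0.
pose b := Q * al ^+ p.+1 + Q * (m0 + g1) + Q * ga ^+ p.+1 * g2.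
have Qg : 0 <= Q * ga ^+ p.+1 by apply: mulr_ge0 => //;exact: exprn_ge0.
have Qa : 0 <= Q * al ^+ p.+1 by apply: mulr_ge0 => //;exact: exprn_ge0.
have b0 : 0 <= b.
 rewrite /b;apply: addr_ge0;last exact: mulr_ge0.
 by apply: addr_ge0 => //;apply: mulr_ge0 => //;exact: addr_ge0.
exists (m0 + b) => t;rewrite le_eqVlt => /orP[/eqP <- _|t0 tT].
 by apply: (le_trans Hm0);rewrite lee_fin lerDl.
have t00 := ltW t0.
rewrite (has_law_ex (mX t00) (lX t00) (menp p.+1) (fun x => en0 x p.+1)).
pose tm n (k : 'I_n.+1) : R := k.+1%:R * (t / n.+1%:R).
have tm0 n k : 0 < tm n k by rewrite /tm mulr_gt0// divr_gt0.
have tmT n k : tm n k <= T.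
 apply: le_trans tT;rewrite /tm mulrA ler_pdivrMr// mulrC ler_wpM2l// ler_nat.
 exact: ltn_ord.
pose f1 w := enorm (X 0 w) ^+ p.+1 + N w t ^+ p.+1.
pose f2 n k w := N w (tm n k) ^+ (q * p.+1).
pose ck n k w := Q * al ^+ p.+1 + Q * f1 w + Q * ga ^+ p.+1 * f2 n k w.
have mX0 : mble (fun w => enorm (X 0 w) ^+ p.+1).
 by apply: (mcomp (menp p.+1));exact: mX.
have mNt r s : 0 <= s -> mble (fun w => N w s ^+ r).
 by move=> s0;apply: mbleX;exact: mN.
have N0 w s r : 0 <= N w s ^+ r by exact: en0.
have mf1 : mble f1 by apply: mbleD => //;exact: mNt.
have f10 w : 0 <= f1 w by rewrite addr_ge0.
have mf2 n k : mble (f2 n k) by apply: mNt;exact: ltW.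
have f20 n k w : 0 <= f2 n k w by exact: N0.
have mck n k : mble (ck n k).
 by apply: mbleD;[apply: mbleD => //|];exact: mbleM.
have ck0 n k w : 0 <= ck n k w by rewrite !addr_ge0// mulr_ge0.
have Eck n k : (ex P (ck n k) <= b%:E)%E.
 apply: ex_lin2 => //;last exact: (Hg2 _ (tm0 n k) (tmT n k)).
 rewrite (exD P mX0 (mNt _ _ t00) (fun w => en0 _ _) (fun w => N0 _ _ _)).
 rewrite EFinD;apply: leeD;last exact: Hg1.
 by apply: le_trans Hm0;rewrite (has_law_ex (mX (lexx 0)) (lX (lexx 0)) (menp p.+1) (fun x => en0 x p.+1)).
pose sn n w := n.+1%:R^-1 * \sum_(k < n.+1) ck n k w.
have msn n : mble (sn n).
 apply: mbleM => //;apply: (@measurable_sum _ _ _ _ _ _ (fun k w => ck n k w)) => k;exact: mck.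
have n1 n : 0 <= n.+1%:R^-1 :> R by rewrite invr_ge0.
have sn0 n w : 0 <= sn n w by rewrite mulr_ge0// sumr_ge0.
have Esn n : (ex P (sn n) <= (m0 + b)%:E)%E.
 rewrite exZ//;last by move=> w;rewrite sumr_ge0.
 rewrite (ex_sum _ _ (mck n) (ck0 n)).
 apply: (letr ((n.+1%:R^-1)%:E * \sum_(k < n.+1) b%:E)%E).
  by rewrite lee_wpmul2l ?lee_fin//;apply: lee_sum => k _;exact: Eck.
 rewrite sumEFin -EFinM lee_fin sumr_const card_ord -[b *+ _]mulr_natl mulrA mulVf ?pnatr_eq0// mul1r lerDr//.
 by apply: (@measurable_sum _ _ _ _ _ _ (fun k w => ck n k w)) => k;exact: mck.
pose f w := enorm (X t w) ^+ p.+1.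
have mf : mble f by apply: (mcomp (menp p.+1));exact: mX.
(* The mesh from which [sn] dominates depends on the path, so the bound holds only eventually; the
   minimum with [sn] converges almost surely and is bounded in mean for every [n]. *)
apply: (@ex_fatou _ _ _ P (fun n w => Num.min (f w) (sn n w)) f (fun=> m0 + b) _ 0).
- by move=> n;exact: measurable_minr.
- by move=> n w;rewrite le_min sn0 andbT;exact: en0.
- exact: mf.
- by move=> w;exact: en0.
- apply: filterS good_paths => w [sol cXw B0].
 have [dl dl0 H] := path_growth (T := T) (C := C) (q := q) sol cXw
 (drift_monotone uT) (drift_lipschitz uT) gr.
 pose n0 := Num.truncn (t / dl).
 suff E n : (n0 <= n)%N -> f w <= sn n w.
 by apply/cvgrPdist_lt => e e0;exists n0 => // n /= n0n;rewrite min_l ?E// subrr normr0.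
 move=> n0n;pose D := t / n.+1%:R.
 have D0 : 0 <= D by rewrite divr_ge0.
 have Ddl : D < dl.
 rewrite /D ltr_pdivrMr// mulrC -ltr_pdivrMr//;apply: (lt_le_trans (truncnS_gt _)).
 by rewrite ler_nat.
 pose hh s := enorm (X s w - Num.sqrt 2 *: B s w).
 pose aa s := C * (1 + N w s ^+ q) + 1.
 have aa0 s : 0 <= aa s by rewrite addr_ge0// mulr_ge0// addr_ge0.
 have NE s : enorm (Num.sqrt 2 *: B s w) = N w s by rewrite /N B0 subr0.
 have step k : (k <= n.+1)%N -> hh (k%:R * D) <= hh 0 + \sum_(j < k) D * aa (j.+1%:R * D).
 elim: k => [|k IH] kn;first by rewrite mul0r big_ord0 addr0.
 have s0 : 0 <= k%:R * D by rewrite mulr_ge0.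
 have dk : k.+1%:R * D - k%:R * D = D by rewrite -natr1;ring.
 have sk : k%:R * D <= k.+1%:R * D by rewrite ler_wpM2r// ler_nat.
 have kT : k.+1%:R * D <= T.
  by apply: le_trans tT;rewrite /D mulrA ler_pdivrMr// mulrC ler_wpM2l// ler_nat.
 have := H _ _ s0 sk kT;rewrite dk => /(_ Ddl);rewrite NE -/(hh _) -/(hh _) -/(aa _) => h.
 rewrite big_ord_recr /= addrA;apply: (le_trans h);rewrite lerD2r;apply: IH;exact: ltnW.
 have tE : n.+1%:R * D = t by rewrite /D mulrC divfK.
 have Xt : enorm (X t w) <= n.+1%:R^-1 * \sum_(k < n.+1) (enorm (X 0 w) + N w t + (al + ga * N w (tm n k) ^+ q)).
 have h1 : enorm (X t w) <= hh t + N w t.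
  by rewrite -NE;apply: le_trans (enormD _ _);rewrite subrK.
 have h0 : hh 0 = enorm (X 0 w) by rewrite /hh B0 scaler0 subr0.
 have := step n.+1 (leqnn _);rewrite tE h0 => h2.
 have h3 : \sum_(j < n.+1) D * aa (j.+1%:R * D) <= n.+1%:R^-1 * \sum_(k < n.+1) (al + ga * N w (tm n k) ^+ q).
  rewrite mulr_sumr;apply: ler_sum => j _;apply: (letr (D * aa (tm n j)));first by [].
  rewrite (_ : D * _ = n.+1%:R^-1 * (t * aa (tm n j)));last by rewrite /D mulrA [_^-1 * t]mulrC.
  rewrite ler_wpM2l//.
  apply: (letr (T * aa (tm n j)));first by rewrite ler_wpM2r.
  by rewrite /aa /al /ga;apply: eqW;ring.
 have Ec : \sum_(k < n.+1) (enorm (X 0 w) + N w t) = n.+1%:R * (enorm (X 0 w) + N w t).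
  by rewrite sumr_const card_ord mulr_natl.
 rewrite big_split /= Ec [leRHS]mulrDr mulrA mulVf ?pnatr_eq0// mul1r.
 apply: (le_trans h1);rewrite [leRHS]addrAC lerD2r.
 by apply: (le_trans h2);rewrite lerD2l.
 rewrite /f;apply: (letr ((n.+1%:R^-1 * \sum_(k < n.+1) (enorm (X 0 w) + N w t + (al + ga * N w (tm n k) ^+ q))) ^+ p.+1)).
 by rewrite lerXn2r ?nnegrE ?enorm_ge0//;apply: le_trans Xt;exact: enorm_ge0.
 have Nw s : 0 <= N w s by exact: enorm_ge0.
 have p1 : 0 <= enorm (X 0 w) + N w t by rewrite addr_ge0// enorm_ge0.
 have p2 k : 0 <= al + ga * N w (tm n k) ^+ q by rewrite addr_ge0// mulr_ge0.
 apply: (le_trans (power_mean _ _));first by move=> k;rewrite addr_ge0.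
 rewrite /sn ler_wpM2l//;apply: ler_sum => k _.
 apply: (le_trans (powD_le _ p1 (p2 k))).
 have h1 := powD_le p.+1 (enorm_ge0 (X 0 w)) (Nw t).
 have h2 := powD_le p.+1 al0 (mulr_ge0 ga0 (N0 w (tm n k) q)).
 have two : 0 <= 2 ^+ p.+1 :> R by rewrite exprn_ge0.
 apply: (le_trans (ler_wpM2l two (lerD h1 h2))).
 have -> : (ga * N w (tm n k) ^+ q) ^+ p.+1 = ga ^+ p.+1 * N w (tm n k) ^+ (q * p.+1) by rewrite exprMn -exprM.
 rewrite /ck /f1 /f2 /Q;apply: eqW;ring.
- by move=> n _;apply: le_trans (Esn n);apply: ex_le => //;
 [exact: measurable_minr|move=> w;rewrite le_min sn0 andbT;exact: en0|move=> w;rewrite ge_min lexx orbT].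
- exact: cvg_cst.
Qed.



Let dist1_cvg (Y_ : nat -> Om -> 'rV[R]_d) (Z_ : nat -> Om -> 'rV[R]_d) :
 (forall n, mble (Y_ n)) -> (forall n, mble (Z_ n)) ->
 {ae P, forall w, forall e : R, 0 < e -> exists n0, forall n, (n0 <= n)%N ->
 enorm (Y_ n w - Z_ n w) < e} ->
 forall e : R, 0 < e -> exists n0, forall n, (n0 <= n)%N -> (ex P (dist1 (Y_ n) (Z_ n)) <= e%:E)%E.
Proof.
move=> mY mZ H.
have m01 a : 0 <= a -> 0 <= Num.min a 1 :> R by move=> a0;rewrite le_min a0 ler01.
apply: (ex_bounded_cvg0 (B := 1)).
- by move=> n;exact: mble_dist1.
- by move=> n w;exact: sqr_ge0.
- by move=> n w;rewrite /dist1 exprn_ile1 ?m01 ?enorm_ge0// ge_min lexx orbT.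
apply: filterS H => w H;apply/cvgrPdist_lt => e e0;have [n0 Hn0] := H e e0.
exists n0 => // n /= n0n;have h := Hn0 n n0n;have E0 := enorm_ge0 (Y_ n w - Z_ n w).
rewrite sub0r normrN ger0_norm ?sqr_ge0//;apply: le_lt_trans h.
rewrite /dist1 expr2;apply: (letr (Num.min (enorm (Y_ n w - Z_ n w)) 1)).
 by rewrite ler_piMr ?m01// ge_min lexx orbT.
by rewrite ge_min lexx.
Qed.

(* Convergence in probability together with a bound on moments of order [2 m]
 gives convergence of the convolutions, with a polynomial weight. *)
Lemma conv_cvg (Y_ Z_ : nat -> Om -> 'rV[R]_d) (mu_ tau_ : nat -> probability 'rV[R]_d R) (K2 : R) :
 (forall n, mble (Y_ n)) -> (forall n, mble (Z_ n)) ->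
 (forall n, has_law P (Y_ n) (mu_ n)) -> (forall n, has_law P (Z_ n) (tau_ n)) ->
 (forall n, (ex (mu_ n) (fun x => enorm x ^+ (2 * m))%R <= K2%:E)%E) ->
 (forall n, (ex (tau_ n) (fun x => enorm x ^+ (2 * m))%R <= K2%:E)%E) ->
 {ae P, forall w, forall e : R, 0 < e -> exists n0, forall n, (n0 <= n)%N ->
 enorm (Y_ n w - Z_ n w) < e} ->
 forall e : R, 0 < e -> exists n0, forall n, (n0 <= n)%N -> forall x,
 enorm (conv gW (mu_ n) x - conv gW (tau_ n) x) <= e * (1 + enorm x ^+ (2 * m)).
Proof.
move=> mY mZ lY lZ muK tauK H e e0.
have K20 : 0 <= K2 by rewrite -lee_fin;apply: le_trans (muK 0%N);exact: ex_ge0.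
pose c := d%:R * M + 1;pose C := conv_dist_cst m K2 + 1.
have M0 : 0 <= M := ltW (sys_M sys).
have c0 : 0 < c by rewrite ltr_wpDl// mulr_ge0.
have Cc0 : 0 <= conv_dist_cst m K2.
 by rewrite /conv_dist_cst mulr_ge0// addr_ge0// mulr_ge0 ?exprn_ge0// addr_ge0// mulr_ge0.
have C0 : 0 < C by rewrite ltr_wpDl.
pose kap := e / (2 * c * C);have k0 : 0 < kap by rewrite divr_gt0// !mulr_gt0.
pose eps := kap * (e / (2 * c));have eps0 : 0 < eps by rewrite mulr_gt0// divr_gt0// mulr_gt0.
have [n0 Hn0] := dist1_cvg mY mZ H eps0;exists n0 => n n0n x.
apply: (le_trans (conv_dist sys (mY n) (mZ n) (lY n) (lZ n) (muK n) (tauK n) x k0 (Hn0 n n0n))).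
set q := enorm x ^+ _;have q0 : 0 <= q by exact: en0.
have -> : kap^-1 * eps = e / (2 * c) by rewrite /eps mulKf// gt_eqF.
have h1 : kap * (conv_dist_cst m K2 * (1 + q)) <= e / (2 * c) * (1 + q).
 rewrite mulrA ler_wpM2r ?addr_ge0//.
 apply: (letr (kap * C));first by rewrite ler_wpM2l ?ltW// ltrDl.
 by rewrite /kap;apply: eqW;field;rewrite !gt_eqF.
have ec : 0 <= e / (2 * c) by rewrite divr_ge0 ?ltW// mulr_gt0.
have h2 : e / (2 * c) <= e / (2 * c) * (1 + q) by rewrite ler_peMr// lerDl.
rewrite mulrA;apply: (letr (c * (e / (2 * c) * (1 + q) + e / (2 * c) * (1 + q)))).
 apply: ler_pM;[exact: mulr_ge0|apply: addr_ge0 => //|by rewrite /c lerDl|exact: lerD].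
 by apply: mulr_ge0;[exact: ltW|apply: mulr_ge0 => //;exact: addr_ge0].
by apply: eqW;field;rewrite gt_eqF.
Qed.
(** Otherwise some sequence of times tending to [s] keeps the distance above [e], which contradicts
    [conv_cvg] along the continuous paths. *)
Lemma conv_continuous x (s e : R) : 0 <= s -> 0 < e -> exists2 dl : R, 0 < dl &
 forall t, 0 <= t -> `|t - s| < dl -> enorm (conv gW (u t) x - conv gW (u s) x) < e.
Proof.
move=> s0 e0;have [//|H] := pselect (exists2 dl : R, 0 < dl & forall t, 0 <= t ->
 `|t - s| < dl -> enorm (conv gW (u t) x - conv gW (u s) x) < e).
exfalso.
have /choice[t_ Ht] : forall n : nat, exists t, [/\ 0 <= t, `|t - s| < n.+1%:R^-1 &
 e <= enorm (conv gW (u t) x - conv gW (u s) x)].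
 move=> n;apply: contrapT => K;apply: H;exists n.+1%:R^-1;first by rewrite invr_gt0.
 by move=> t t0 ts;rewrite ltNge;apply/negP => h;apply: K;exists t.
have [K2 HK2] := mckean_moment (2 * m) (s + 1).
have t1 n : t_ n <= s + 1.
 have [_ h _] := Ht n;have : n.+1%:R^-1 <= 1 :> R by rewrite invf_le1// ler1n.
 by move: h;rewrite ltr_norml => /andP[_ h1] h2;have := lt_le_trans h1 h2;lra.
have t0 n : 0 <= t_ n by case: (Ht n).
pose e' := e / (2 * (1 + enorm x ^+ (2 * m))).
have q0 : 0 < 1 + enorm x ^+ (2 * m) by rewrite ltr_pwDl.
have e'0 : 0 < e' by rewrite divr_gt0// mulr_gt0.
have [|||||||n0 Hn0] := @conv_cvg (fun n => X (t_ n)) (fun n => X s) (fun n => u (t_ n)) (fun n => u s) K2 _ _ _ _ _ _ _ e' e'0.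
- by move=> n;exact: mX.
- by move=> n;exact: mX.
- by move=> n;exact: lX.
- by move=> n;exact: lX.
- by move=> n;exact: HK2.
- by move=> n;apply: HK2 => //;rewrite lerDl.
- apply: filterS good_paths => w [_ cXw _] a a0;have [dl dl0 Hdl] := cXw s a s0 a0.
 exists (Num.truncn dl^-1) => n nn;apply: Hdl => //;have [_ h _] := Ht n.
 apply: (lt_le_trans h);rewrite -[dl]invrK lef_pV2 ?posrE ?invr_gt0//.
 by apply: (le_trans (ltW (truncnS_gt _)));rewrite ler_nat.
have [_ _ h] := Ht n0;have := le_trans h (Hn0 n0 (leqnn _) x).
rewrite (_ : e' * _ = e / 2) => [h2|];first by lra.
by rewrite /e';field;rewrite gt_eqF.
Qed.
Lemma drift_path_continuous : {ae P, forall w, path_continuous (fun s => - A s (X s w))}.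
Proof.
apply: filterS good_paths => w [_ cXw _] s e s0 e0.
have [K uT] := uK (s + 1).
have [L L0 HL] := drift_lipschitz uT (enorm (X s w) + 1).
have L1 : 0 < 2 * (L + 1) by rewrite mulr_gt0// ltr_wpDl.
have [d1 d10 H1] := cXw s 1 s0 ltr01.
have [d2 d20 H2] := cXw s _ s0 (divr_gt0 e0 L1).
have e20 : 0 < e / 2 by rewrite divr_gt0.
have [d3 d30 H3] := conv_continuous (X s w) s0 e20.
exists (Num.min (Num.min d1 1) (Num.min d2 d3));first by rewrite !lt_min d10 d20 d30 ltr01.
move=> t t0;rewrite !lt_min => /andP[/andP[h1 h1'] /andP[h2 h3]].
have t1 : t <= s + 1 by move: h1';rewrite ltr_norml => /andP[_ h];lra.
have g1 := H1 t t0 h1;have g2 := H2 t t0 h2;have g3 := H3 t t0 h3.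
have -> : - A t (X t w) - - A s (X s w) =
 - ((A t (X t w) - A t (X s w)) + (conv gW (u t) (X s w) - conv gW (u s) (X s w))).
 by rewrite /A;apply/rowP => k;rewrite !mxE;ring.
rewrite enormN;apply: (le_lt_trans (enormD _ _)).
have f1 : enorm (A t (X t w) - A t (X s w)) <= L * enorm (X t w - X s w).
 apply: HL => //;last by rewrite lerDl.
 have : enorm (X t w) <= enorm (X s w) + enorm (X t w - X s w).
 by apply: le_trans (enormD _ _);rewrite addrC subrK.
 by move: g1;lra.
have f2 : L * enorm (X t w - X s w) <= e / 2.
 apply: (letr (L * (e / (2 * (L + 1)))));first by rewrite ler_wpM2l// ltW.
 rewrite mulrA ler_pdivrMr// (_ : e / 2 * (2 * (L + 1)) = (L + 1) * e);last by field.
 by rewrite ler_wpM2r ?ltW// ltrDl.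
lra.
Qed.

End McKean.

Lemma has_law_push {R : realType} {d1 d2 d3 : measure_display} {Om : measurableType d1}
 {E : measurableType d2} {G : measurableType d3} (P : probability Om R) (Y : Om -> E)
 (mu : probability E R) (f : E -> G) (mf : mble f) :
 has_law P Y mu -> has_law P (f \o Y) (push mu mf).
Proof.
move=> lY A mA;have mfA : measurable (f @^-1` A).
 by rewrite -[X in measurable X]setTI;exact: (mf measurableT _ mA).
exact: (lY _ mfA).
Qed.
Lemma ex_scont_cvg {R : realType} {dO} {Om : measurableType dO} {N d : nat}
 (P : probability Om R) (z_ : nat -> Om -> conf N R d) (z : Om -> conf N R d)
 (phi : conf N R d -> R) (b : R) :
 (forall n, mble (z_ n)) -> mble z ->
 {ae P, forall w, forall i (e : R), 0 < e -> exists n0, forall n, (n0 <= n)%N ->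
 enorm (tnth (z_ n w) i - tnth (z w) i) < e} ->
 mble phi -> (forall x, 0 <= phi x <= b) -> scont phi ->
 forall e : R, 0 < e -> exists n0, forall n, (n0 <= n)%N ->
 (ex P (phi \o z_ n) <= ex P (phi \o z) + e%:E)%E /\
 (ex P (phi \o z) <= ex P (phi \o z_ n) + e%:E)%E.
Proof.
move=> mz_ mz cz mphi phib cphi e e0.
have phi0 x : 0 <= phi x by case/andP: (phib x).
have phiB x : phi x <= b by case/andP: (phib x).
have b0 : 0 <= b by apply: le_trans (phi0 [tuple 0 | _ < N]) (phiB _).
have mpz n : mble (phi \o z_ n) by exact: mcomp.
have mpz0 : mble (phi \o z) by exact: mcomp.
have mD n : mble (fun w => `|phi (z_ n w) - phi (z w)|).
 have h : mble (fun w => phi (z_ n w) - phi (z w)) by exact: (measurable_funB (mpz n) mpz0).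
 by apply: mcomp.
have [|||n0 Hn0] := @ex_bounded_cvg0 _ _ _ P (fun n w => `|phi (z_ n w) - phi (z w)|) (2 * b) mD _ _ _ e e0.
- by move=> n w;exact: normr_ge0.
- move=> n w;rewrite ler_norml;have := phib (z_ n w);have := phib (z w).
 by move=> /andP[h1 h2] /andP[h3 h4];apply/andP;split;lra.
- apply: filterS cz => w cz.
 have H : phi (z_ n w) @[n --> \oo] --> phi (z w).
 apply: cphi => i k;apply/cvgrPdist_lt => a' a'0;have [n2 Hn2] := cz i a' a'0.
 exists n2 => // n /= n2n;have := coord_le_enorm (tnth (z_ n w) i - tnth (z w) i) k.
 by rewrite !mxE distrC => h;exact: (le_lt_trans h (Hn2 n n2n)).
 move/cvgrPdist_lt : H => H;apply/cvgrPdist_lt => a a0;have [n1 _ Hn1] := H a a0.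
 by exists n1 => // n /= n1n;rewrite sub0r normrN normr_id distrC;exact: Hn1.
exists n0 => n n0n;have HD := Hn0 n n0n.
have H (f g : Om -> R) : mble f -> mble g -> (forall w, 0 <= f w) ->
 (forall w, 0 <= g w) -> (forall w, f w <= g w + `|phi (z_ n w) - phi (z w)|) ->
 (ex P f <= ex P g + e%:E)%E.
 move=> mf mg f0 g0 fg;apply: (le_trans (ex_le P mf (mbleD mg (mD n)) f0 fg)).
 by rewrite (exD P mg (mD n) g0 (fun w => normr_ge0 _)) leeD2l.
split;[apply: (H _ _ (mpz n) mpz0 (fun w => phi0 _) (fun w => phi0 _)) => w /=|
 apply: (H _ _ mpz0 (mpz n) (fun w => phi0 _) (fun w => phi0 _)) => w /=].
 by rewrite -lerBlDl ler_norm.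
by rewrite -lerBlDl distrC ler_norm.
Qed.
Lemma iid_ae {R : realType} {dO} {Om : measurableType dO} (P : probability Om R) (Q : Om -> Prop) n :
 {ae P, forall w, Q w} -> {ae iid P n, forall w, forall i : 'I_n, Q (tnth w i)}.
Proof.
move=> [A [mA PA QA]];pose A' (i : 'I_n) := [set w : n.-tuple Om | A (tnth w i)].
have mA' i : measurable (A' i) by rewrite -[X in measurable X]setTI;apply: mble_tnth.
have A0 i : iid P n (A' i) = 0%E.
 pose E j := if j == i then A else setT.
 have mE j : measurable (E j) by rewrite /E;case: ifP.
 have -> : A' i = [set w | forall j, E j (tnth w j)].
 apply/seteqP;split => w /=;first by move=> Aw j;rewrite /E;case: eqP => [->|].
 by move=> /(_ i);rewrite /E eqxx.
 by rewrite (iid_box P mE) (bigD1 i)//= /E eqxx PA mul0e.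
apply: filter_forall => i;exists (A' i);split;[exact: mA'|exact: A0|].
by move=> w /= nQ;exact: QA.
Qed.
Lemma iid_ext {R : realType} {d n : nat} (mu nu : probability 'rV[R]_d R) :
 (forall A, measurable A -> mu A = nu A) ->
 forall A, measurable A -> iid mu n A = iid nu n A.
Proof.
move=> H;apply: tbox_unique => E mE.
pose B i := [set x : 'rV[R]_d | forall k, E i k (x 0 k)].
have mB i : measurable (B i).
 rewrite (_ : B i = \bigcap_(k in [set: 'I_d]) ((fun x : 'rV[R]_d => x 0 k) @^-1` E i k));last first.
 by apply/seteqP;split => x /= h k;[move=> _;exact: h|exact: h].
 apply: fin_bigcap_measurable => // k _.
 by rewrite -[X in measurable X]setTI;apply: mble_coord.
by rewrite (iid_box mu mB) (iid_box nu mB);apply: eq_bigr => i _;exact: H.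
Qed.

(** * Convergence of the mean-field scheme *)

Section McKeanScheme.
Context {R : realType} {d : nat}.
Variables (gV gW : 'rV[R]_d -> 'rV[R]_d) (lamV lamW M : R) (m : nat).
Hypothesis sys : convex_system gV gW lamV lamW M m.
Context {dO : measure_display} {Om : measurableType dO}.
Variables (P : probability Om R) (F : R -> set (set Om)).
Variables (B X : R -> Om -> 'rV[R]_d) (u : R -> probability 'rV[R]_d R).
Hypotheses (hF : filtration F) (hB : brownian_family P F (fun _ : 'I_1 => B)).
Hypotheses (aX : adapted F X) (cX : continuous_paths P X).
Hypothesis solX : {ae P, forall w, path_solution
 (fun s => - (gV (X s w) + conv gW (u s) (X s w))) (B ^~ w) (X ^~ w)}.
Hypothesis lX : forall t, 0 <= t -> has_law P (X t) (u t).
Hypothesis uK : forall T : R, exists K : R, forall t, 0 <= t -> t <= T ->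
 (ex (u t) (fun x => enorm x ^+ m)%R <= K%:E)%E.
Hypothesis u0M : forall q, exists C : R, (ex (u 0) (fun x => enorm x ^+ q)%R <= C%:E)%E.

Variables (T K : R).
Hypothesis T0 : 0 < T.
Hypothesis uT : forall t, 0 <= t -> t <= T -> (ex (u t) (fun x => enorm x ^+ m)%R <= K%:E)%E.

Definition mesh (n : nat) : R := T / n.+1%:R.

Lemma mesh_gt0 n : 0 < mesh n. Proof. by rewrite divr_gt0. Qed.
Lemma mesh_small (a : R) : 0 < a -> exists n0, forall n, (n0 <= n)%N -> mesh n < a.
Proof.
move=> a0;exists (Num.truncn (T / a)) => n h;rewrite ltr_pdivrMr// mulrC -ltr_pdivrMr//.
by apply: (lt_le_trans (truncnS_gt _));rewrite ler_nat.
Qed.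
Lemma mesh_le n k : (k <= n.+1)%N -> k%:R * mesh n <= T.
Proof. by move=> kn;rewrite mulrA ler_pdivrMr// mulrC ler_wpM2l ?ler_nat// ltW. Qed.

(** The cap at [T] changes no node of the mesh; it lets every index, also beyond the horizon, carry
    a field with the same constants. *)
Definition mv_field n k : 'rV[R]_d -> 'rV[R]_d := conv gW (u (Num.min (k%:R * mesh n) T)).

Lemma mv_field_drift n k : drift_field lamW m (mv_field n k) (@conv_cst R d M m K).
Proof.
apply: (conv_field sys);apply: uT;last by rewrite ge_min lexx orbT.
by rewrite le_min;apply/andP;split;[apply: mulr_ge0 => //;exact: ltW (mesh_gt0 n)|exact: ltW].
Qed.

Local Notation fG := mv_field_drift.
Local Notation D0 := mesh_gt0.
Local Notation nu n := (chain (gauss (Num.sqrt (mesh n))) (mble_mv_step sys (fG n) (D0 n)) (u 0)).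
Local Notation vs n k := (vstep gV (mv_field n k) (mesh n)).

Fixpoint mv_scheme n k w : 'rV[R]_d :=
 if k is k'.+1 then mv_step gV (mv_field n) (mesh n) k'
 (mv_scheme n k' w, B (k'.+1%:R * mesh n) w - B (k'%:R * mesh n) w) else X 0 w.
Local Notation Y := mv_scheme.

Let D0' n : 0 <= mesh n. Proof. exact/ltW/D0. Qed.
Let mvs n k : mble (vs n k). Proof. exact: (mble_vstep sys (fG n k) (D0' n)). Qed.
Let mX t : 0 <= t -> mble (X t).
Proof. by move=> t0;apply: (fmeas_measurable hF t0);apply/(fmeasP hF _ t0);exact: aX. Qed.
Lemma mv_scheme_law n k : mble (Y n k) /\ has_law P (Y n k) (nu n k).
Proof.
pose Z j w := B (j.+1%:R * mesh n) w - B (j%:R * mesh n) w.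
have tj j : 0 <= j%:R * mesh n by exact: mulr_ge0.
have tS j : j%:R * mesh n < j.+1%:R * mesh n by rewrite ltr_pM2r ?D0// ltr_nat.
have [|||||H1 H2] := @chain_law _ _ _ P F hF _ _ _ _ (gauss (Num.sqrt (mesh n))) _
 (mble_mv_step sys (fG n) (D0 n)) (u 0) (mesh n) (Y n) Z (D0' n) _ _ _ _ _ k.
- by apply/(fmeasP hF _ (lexx 0));exact: aX.
- exact: lX.
- by [].
- by move=> j;apply: (fmeas_increment1 hF hB) => //;exact: ltW.
- move=> j;have := findep_increment1 hF hB (tj j) (tS j).
 by rewrite (_ : _ - _ = mesh n)// -natr1 mulrDl mul1r addrC addKr.
by split;[exact: (fmeas_measurable hF (tj k) H1)|exact: H2].
Qed.
(** Errors are measured before the implicit step, at points that this step sends exactly to the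
    solution. The step being nonexpansive, errors only add up, and the residuals sum to a small
    multiple of [T]. *)
Lemma mv_scheme_cvg : {ae P, forall w, forall e : R, 0 < e -> exists n0, forall n, (n0 <= n)%N ->
 (forall k, (k <= n)%N -> enorm (vs n k (Y n k w) - X (k%:R * mesh n) w) < e) /\
 enorm (Y n n.+1 w - X T w) < e}.
Proof.
have := drift_path_continuous sys hF hB aX cX solX lX uK u0M.
apply: filterS2 solX => w sol cb e e0.
pose b s := - (gV (X s w) + conv gW (u s) (X s w)).
have Tn : 0 < 4 * T by rewrite mulr_gt0.
have e1 : 0 < e / (4 * T) by rewrite divr_gt0.
have [dl dl0 Hdl] := path_residual T sol cb e1.
pose a := e / (4 * (enorm (b 0) + enorm (b T) + 1)).
have bb : 0 < enorm (b 0) + enorm (b T) + 1 by rewrite ltr_wpDl// addr_ge0// enorm_ge0.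
have a0 : 0 < a by rewrite divr_gt0// mulr_gt0.
have [n1 Hn1] := mesh_small dl0;have [n2 Hn2] := mesh_small a0.
exists (maxn n1 n2) => n;rewrite geq_max => /andP[n1n n2n].
have Ddl := Hn1 n n1n;have Da := Hn2 n n2n;set D := mesh n in Ddl Da *.
have ab (x : R) : 0 <= x -> x <= enorm (b 0) + enorm (b T) + 1 -> D * x <= e / 4.
 move=> x0 xb;apply: (letr (a * (enorm (b 0) + enorm (b T) + 1))).
 by apply: ler_pM => //;[exact: D0'|exact: ltW].
 by apply: eqW;rewrite /a;field;rewrite gt_eqF.
(* The preimage of [X] at the node under the implicit step: [b] is minus the total force. *)
pose xi k := X (k%:R * D) w - D *: b (k%:R * D).
have vxi k : (k <= n)%N -> vs n k (xi k) = X (k%:R * D) w.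
 move=> kn;apply/eqP;rewrite -subr_eq0;apply/eqP;apply: enorm_eq0;apply/eqP.
 rewrite eq_le enorm_ge0 andbT.
 apply: (le_trans (vstep_expand sys (fG n k) (D0' n) _ _)).
 rewrite (vstepK sys (fG n k) (D0' n)) /mv_field min_l;last by apply: mesh_le;exact: leqW.
 rewrite (_ : xi k - _ = 0) ?enorm0// /xi /b scalerN opprK;exact: subrr.
have Yxi k : (k <= n.+1)%N -> enorm (Y n k w - xi k) <= D * enorm (b 0) + k%:R * (e / (4 * T) * D).
 elim: k => [|k IH] kn.
 by rewrite /xi /= !mul0r addr0 opprB addrC subrK enormZ ger0_norm//;exact: D0'.
 have s0 : 0 <= k%:R * D by rewrite mulr_ge0// D0'.
 have dk : k.+1%:R * D - k%:R * D = D by rewrite -natr1;ring.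
 have sk : k%:R * D <= k.+1%:R * D by rewrite ler_wpM2r ?D0'// ler_nat.
 have := Hdl _ _ s0 sk (mesh_le kn);rewrite dk => /(_ Ddl) hr.
 have hv := vstep_nonexpansive sys (fG n k) (D0' n) (Y n k w) (xi k).
 rewrite vxi// in hv;have := le_trans hv (IH (ltnW kn)) => {}hv.
 rewrite (_ : Y n k.+1 w - xi k.+1 = (vs n k (Y n k w) - X (k%:R * D) w) -
 (X (k.+1%:R * D) w - X (k%:R * D) w - Num.sqrt 2 *: (B (k.+1%:R * D) w - B (k%:R * D) w)
 - D *: b (k.+1%:R * D)));last first.
 by rewrite /= /mv_step /= /xi -/D;apply/rowP => j;rewrite !mxE;ring.
 apply: (le_trans (enormB _ _));apply: (le_trans (lerD hv hr)).
 by rewrite -natr1;apply: eqW;ring.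
have Yb k : (k <= n.+1)%N -> enorm (Y n k w - xi k) <= e / 2.
 move=> kn;apply: (le_trans (Yxi k kn)).
 have h1 : D * enorm (b 0) <= e / 4.
 by apply: ab;rewrite ?enorm_ge0//;have := enorm_ge0 (b T);lra.
 have h2 : k%:R * (e / (4 * T) * D) <= e / 4.
 rewrite mulrCA;apply: (letr (e / (4 * T) * T)).
  by rewrite ler_pM2l//;exact: mesh_le.
 by apply: eqW;field;rewrite gt_eqF.
 by lra.
split=> [k kn|].
 have hv := vstep_nonexpansive sys (fG n k) (D0' n) (Y n k w) (xi k).
 rewrite vxi// in hv;have := le_trans hv (Yb k (leqW kn));lra.
have tE : n.+1%:R * D = T by rewrite /D /mesh mulrC divfK.
have h1 := Yb n.+1 (leqnn _).
have h2 : D * enorm (b T) <= e / 4.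
 by apply: ab;rewrite ?enorm_ge0//;have := enorm_ge0 (b 0);lra.
rewrite (_ : _ - X T w = (Y n n.+1 w - xi n.+1) - D *: b T);last first.
 by rewrite /xi tE;apply/rowP => j;rewrite !mxE;ring.
apply: (le_lt_trans (enormB _ _));rewrite enormZ ger0_norm ?D0'//;lra.
Qed.
(** The bound has to hold for all [k <= n] at once. If it fails, the bad pairs of indices form a
    sequence along which scheme and solution get close, which contradicts [conv_cvg]. The quantified
    proof [mv] lets the bound meet [push] with any measurability proof. *)
Lemma mv_scheme_bias (e : R) : 0 < e -> exists n0, forall n, (n0 <= n)%N -> forall k, (k <= n)%N ->
 forall (mv : mble (vs n k)) z,
 enorm (mv_field n k z - conv gW (push (nu n k) mv) z) <= e * (1 + enorm z ^+ (2 * m)).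
Proof.
move=> e0;apply: contrapT => H.
have [n1 Hn1] := mesh_small ltr01.
have /choice[nk Hnk] : forall j : nat, exists nk : nat * nat, [/\ (j <= nk.1)%N, (n1 <= nk.1)%N, (nk.2 <= nk.1)%N &
 exists z, e * (1 + enorm z ^+ (2 * m)) <
  enorm (mv_field nk.1 nk.2 z - conv gW (push (nu nk.1 nk.2) (mvs nk.1 nk.2)) z)].
 move=> j;apply: contrapT => K';apply: H;exists (maxn j n1) => n;rewrite geq_max => /andP[jn n1n] k kn mv z.
 by rewrite (Prop_irrelevance mv (mvs n k)) leNgt;apply/negP => h;apply: K';exists (n, k);split => //;exists z.
have kD j : 0 <= (nk j).2%:R * mesh (nk j).1 by rewrite mulr_ge0.
have kT j : (nk j).2%:R * mesh (nk j).1 <= T.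
 by apply: mesh_le;case: (Hnk j) => _ _ h _;exact: leqW.
have [Ka HKa] := mckean_moment sys hF hB aX cX solX lX uK u0M (2 * m) T.
have [m0 Hm0] := u0M (2 * m.+1).
have [Bb Bb0 HB] := mv_chain_moment sys m (@conv_cst R d M m K) m0.
have mq q : mble (fun x : 'rV[R]_d => enorm x ^+ q).
 by apply: mbleX;exact: mble_enorm.
have en0 (x : 'rV[R]_d) q : 0 <= enorm x ^+ q by rewrite exprn_ge0// enorm_ge0.
have Ka0 : 0 <= Ka by rewrite -lee_fin;apply: le_trans (HKa 0 (lexx 0) (ltW T0));exact: ex_ge0.
have [|||||||n0 Hn0] := @conv_cvg _ _ _ _ _ _ _ _ sys _ _ P
 (fun j => X ((nk j).2%:R * mesh (nk j).1)) (fun j => vs (nk j).1 (nk j).2 \o Y (nk j).1 (nk j).2)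
 (fun j => u ((nk j).2%:R * mesh (nk j).1))
 (fun j => push (nu (nk j).1 (nk j).2) (mvs (nk j).1 (nk j).2)) (Ka + (1 + Bb)) _ _ _ _ _ _ _ e e0.
- by move=> j;exact: mX.
- by move=> j;apply: mcomp => //;case: (mv_scheme_law (nk j).1 (nk j).2).
- by move=> j;exact: lX.
- by move=> j;apply: has_law_push;case: (mv_scheme_law (nk j).1 (nk j).2).
- by move=> j;apply: (le_trans (HKa _ (kD j) (kT j)));rewrite lee_fin lerDl addr_ge0.
- move=> j;rewrite (ex_push _ _ (mq _) (fun x => en0 x _)).
 case: (Hnk j) => _ h1 _ _.
 have [_ h] := HB _ _ (fG (nk j).1) (D0 (nk j).1) (ltW (Hn1 _ h1)) (u 0) Hm0 (nk j).2.
 have mv q : mble (fun x => enorm (vs (nk j).1 (nk j).2 x) ^+ q).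
 by apply: (mcomp (mq q));exact: mvs.
 apply: (letr (ex (nu (nk j).1 (nk j).2) (fun x => 1 + enorm (vs (nk j).1 (nk j).2 x) ^+ (2 * m.+1))%R)).
 apply: (ex_le _ (mv _) (mbleD (mble_cst (1 : R)) (mv _)) (fun x => en0 _ _)) => x /=.
 by apply: expr_le1D;[exact: enorm_ge0|rewrite leq_mul2l leqnSn orbT].
 rewrite (exD _ (mble_cst (1 : R)) (mv _) (fun _ => ler01) (fun y => en0 _ _)) ex_cst.
 rewrite EFinD;apply: (letr (1%:E + Bb%:E)%E);first by rewrite leeD2l.
 by rewrite -!EFinD lee_fin lerDr.
- apply: filterS mv_scheme_cvg => w Hw a a0;have [n2 Hn2] := Hw a a0.
 exists n2 => j n2j;rewrite enormBC;case: (Hnk j) => h1 _ h2 _.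
 by case: (Hn2 _ (leq_trans n2j h1)) => + _;apply.
case: (Hnk n0) => _ _ h [z];rewrite ltNge => /negP;apply.
have E : mv_field (nk n0).1 (nk n0).2 z = conv gW (u ((nk n0).2%:R * mesh (nk n0).1)) z.
 by rewrite /mv_field min_l//;exact: kT.
by rewrite E;exact: Hn0.
Qed.
Lemma mv_scheme_limit N (phi : conf N R d -> R) (b : R) :
 mble phi -> (forall x, 0 <= phi x <= b) -> scont phi ->
 forall e : R, 0 < e -> exists n0, forall n, (n0 <= n)%N ->
 (ex (iid (nu n n.+1) N) phi <= ex (iid (u T) N) phi + e%:E)%E /\
 (ex (iid (u T) N) phi <= ex (iid (nu n n.+1) N) phi + e%:E)%E.
Proof.
move=> mphi phib cphi e e0;have phi0 x : 0 <= phi x by case/andP: (phib x).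
have T00 := ltW T0.
have E n : ex (iid (nu n n.+1) N) phi = ex (iid P N) (phi \o @tuple_map _ _ _ _ (Y n n.+1) N).
 have [mY lY] := mv_scheme_law n n.+1.
 rewrite -(ex_iid_map P mY mphi phi0);apply: eq_measure_ex;apply: iid_ext => A mA.
 exact: (esym (lY A mA)).
have ET : ex (iid (u T) N) phi = ex (iid P N) (phi \o @tuple_map _ _ _ _ (X T) N).
 rewrite -(ex_iid_map P (mX T00) mphi phi0);apply: eq_measure_ex;apply: iid_ext => A mA.
 exact: (esym (lX T00 mA)).
have [|||n0 Hn0] := @ex_scont_cvg _ _ _ _ _ (iid P N) (fun n => @tuple_map _ _ _ _ (Y n n.+1) N)
 (@tuple_map _ _ _ _ (X T) N) phi b _ _ _ mphi phib cphi e e0.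
- by move=> n;apply: mble_tuple_map;case: (mv_scheme_law n n.+1).
- by apply: mble_tuple_map;exact: mX.
- apply: filterS (iid_ae N mv_scheme_cvg) => w Hw i a a0;have [n0 Hn0] := Hw i a a0.
 by exists n0 => n n0n;rewrite !tnth_mktuple;case: (Hn0 n n0n).
by exists n0 => n n0n;rewrite E ET;exact: Hn0.
Qed.
Lemma mv_scheme_fatou q (b : R) n0 :
 (forall n, (n0 <= n)%N -> (ex (nu n n.+1) (fun x => enorm x ^+ q)%R <= b%:E)%E) ->
 (ex (u T) (fun x => enorm x ^+ q)%R <= b%:E)%E.
Proof.
move=> H;have T00 := ltW T0.
have mq : mble (fun x : 'rV[R]_d => enorm x ^+ q).
 by apply: mbleX;exact: mble_enorm.
have q0 (x : 'rV[R]_d) : 0 <= enorm x ^+ q by rewrite exprn_ge0// enorm_ge0.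
rewrite (has_law_ex (mX T00) (lX T00) mq q0).
apply: (@ex_fatou _ _ _ P (fun n w => enorm (Y n n.+1 w) ^+ q) _ (fun=> b) b n0) => //.
- by move=> n;apply: (mcomp mq);case: (mv_scheme_law n n.+1).
- by apply: (mcomp mq);exact: mX.
- by move=> w;exact: q0.
- apply: filterS mv_scheme_cvg => w Hw.
 apply: (@cvg_comp _ _ _ (fun n => enorm (Y n n.+1 w)) (fun x : R => x ^+ q));last exact: exprn_continuous.
 apply/cvgrPdist_lt => e e0;have [n1 Hn1] := Hw e e0;exists n1 => // n /= n1n.
 by apply: (le_lt_trans (enorm_dist_abs _ _));rewrite enormBC;case: (Hn1 n n1n).
- move=> n n0n;have [mY lY] := mv_scheme_law n n.+1.
 by apply: le_trans (H n n0n);rewrite (has_law_ex mY lY mq q0).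
- exact: cvg_cst.
Qed.

End McKeanScheme.

Lemma finite_min {R : realType} n (a : 'I_n -> R) : (forall j, 0 < a j) ->
 exists2 b : R, 0 < b & forall j, b <= a j.
Proof.
move=> a0;exists (\big[Num.min/1]_(j < n) a j);first by apply: lt_bigmin => // j _.
by move=> j;exact: bigmin_le_cond.
Qed.

(** * Convergence of the particle scheme *)

Section ParticleScheme.
Context {R : realType} {d : nat}.
Variables (gV gW : 'rV[R]_d -> 'rV[R]_d) (lamV lamW M : R) (m : nat).
Hypothesis sys : convex_system gV gW lamV lamW M m.
Context {dO : measure_display} {Om : measurableType dO} {N : nat}.
Local Notation state := (conf N R d).
Variables (P : probability Om R) (F : R -> set (set Om)).
Variables (B : 'I_N -> R -> Om -> 'rV[R]_d) (X : R -> Om -> state) (uN : R -> probability state R).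
Hypotheses (hF : filtration F) (hB : brownian_family P F B) (aX : adapted F X).
Hypothesis cX : forall i, continuous_paths P (fun s w => tnth (X s w) i).
Hypothesis solX : forall i, {ae P, forall w, path_solution
 (fun s => - pforce gV gW (X s w) i) (B i ^~ w) (fun s => tnth (X s w) i)}.
Hypothesis lX : forall t, 0 <= t -> has_law P (X t) (uN t).
Variable (T : R).
Hypothesis T0 : 0 < T.
Local Notation D0 := (mesh_gt0 T0).
Local Notation D n := (mesh T n).
Local Notation ps n := (pstep gV gW (D n) : state -> state).
Local Notation mu n := (chain (iid (gauss (Num.sqrt (D n))) N) (mble_ps_step sys (D0 n)) (uN 0)).

Fixpoint ps_scheme n k w : state :=
 if k is k'.+1 then ps_step gV gW (D n) k'
 (ps_scheme n k' w, increment B (k'%:R * D n) (k'.+1%:R * D n) w) else X 0 w.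
Local Notation Y := ps_scheme.

Let D0' n : 0 <= D n. Proof. exact/ltW/D0. Qed.
Let mX t : 0 <= t -> mble (X t).
Proof. by move=> t0;apply: (fmeas_measurable hF t0);apply/(fmeasP hF _ t0);exact: aX. Qed.
Lemma ps_scheme_law n k : mble (Y n k) /\ has_law P (Y n k) (mu n k).
Proof.
have tj j : 0 <= j%:R * D n by exact: mulr_ge0.
have tS j : j%:R * D n < j.+1%:R * D n by rewrite ltr_pM2r ?D0// ltr_nat.
have [|||||H1 H2] := @chain_law _ _ _ P F hF _ _ _ _ (iid (gauss (Num.sqrt (D n))) N) _
 (mble_ps_step sys (D0 n)) (uN 0) (D n) (Y n)
 (fun j => increment B (j%:R * D n) (j.+1%:R * D n)) (D0' n) _ _ _ _ _ k.
- by apply/(fmeasP hF _ (lexx 0));exact: aX.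
- exact: lX.
- by [].
- by move=> j;apply: (fmeas_increment hF hB) => //;exact: ltW.
- move=> j;have := findep_increment hF hB (tj j) (tS j).
 by rewrite (_ : _ - _ = D n)// -natr1 mulrDl mul1r addrC addKr.
by split;[exact: (fmeas_measurable hF (tj k) H1)|exact: H2].
Qed.
Lemma pforce_path_continuous (x : R -> state) i :
 (forall j, path_continuous (fun s => tnth (x s) j)) ->
 path_continuous (fun s => - pforce gV gW (x s) i).
Proof.
move=> cx s e s0 e0;pose rho := \sum_(j < N) enorm (tnth (x s) j) + 1.
have le1 j : enorm (tnth (x s) j) <= \sum_(j < N) enorm (tnth (x s) j).
 by rewrite (bigD1 j)//= lerDl sumr_ge0// => l _;exact: enorm_ge0.
have [L HL] := pforce_lipschitz sys (N := N) rho.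
pose a := Num.min 1 (e / ((`|L| + 1) * (N%:R + 1))).
have L1 : 0 < `|L| + 1 by rewrite ltr_wpDl.
have N1 : 0 < N%:R + 1 :> R by rewrite ltr_wpDl.
have a0 : 0 < a by rewrite lt_min ltr01 divr_gt0// mulr_gt0.
have /choice[dl Hdl] : forall j, exists dl : R, 0 < dl /\ forall t, 0 <= t -> `|t - s| < dl ->
 enorm (tnth (x t) j - tnth (x s) j) < a.
 by move=> j;have [dl dl0 H] := cx j s a s0 a0;exists dl.
have [dm dm0 dmj] := finite_min (fun j => proj1 (Hdl j)).
exists dm => // t t0 ts.
have H j : enorm (tnth (x t) j - tnth (x s) j) < a.
 by case: (Hdl j) => _;apply => //;exact: lt_le_trans (dmj j).
have -> : - pforce gV gW (x t) i - - pforce gV gW (x s) i =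
 - (pforce gV gW (x t) i - pforce gV gW (x s) i).
 by apply/rowP => k;rewrite !mxE;ring.
rewrite enormN;apply: (@le_lt_trans _ _ (L * \sum_(j < N) enorm (tnth (x t) j - tnth (x s) j))).
 apply: HL => j;last by apply: (le_trans (le1 j));rewrite lerDl.
 have : enorm (tnth (x t) j) <= enorm (tnth (x s) j) + enorm (tnth (x t) j - tnth (x s) j).
 by apply: le_trans (enormD _ _);rewrite addrC subrK.
 have := H j;rewrite lt_min => /andP[h _] h';have := le1 j;rewrite /rho;lra.
have hS : \sum_(j < N) enorm (tnth (x t) j - tnth (x s) j) <= N%:R * a.
 apply: (letr (\sum_(j < N) a));first by apply: ler_sum => j _;exact: ltW.
 by rewrite sumr_const card_ord -[leLHS]mulr_natl.
have S0 : 0 <= \sum_(j < N) enorm (tnth (x t) j - tnth (x s) j) by apply: sumr_ge0 => j _;exact: enorm_ge0.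
apply: (@le_lt_trans _ _ (`|L| * (N%:R * a))).
 by apply: (letr (`|L| * \sum_(j < N) enorm (tnth (x t) j - tnth (x s) j)));
 [rewrite ler_wpM2r// ler_norm|rewrite ler_wpM2l].
have ha : a <= e / ((`|L| + 1) * (N%:R + 1)) by rewrite ge_min lexx orbT.
apply: (@lt_le_trans _ _ ((`|L| + 1) * ((N%:R + 1) * a))).
 apply: (@le_lt_trans _ _ ((`|L| + 1) * (N%:R * a))).
 by rewrite ler_wpM2r ?lerDl// mulr_ge0// ltW.
 by rewrite ltr_pM2l// ltr_pM2r// ltrDl.
by rewrite mulrA mulrC -ler_pdivlMr// mulr_gt0.
Qed.
Lemma pstep_expand n (x y : state) : \sum_(i < N) enorm (tnth x i - tnth y i) ^+ 2 <=
 \sum_(i < N) enorm ((tnth x i + D n *: pforce gV gW x i) - (tnth y i + D n *: pforce gV gW y i)) ^+ 2.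
Proof.
pose dl i := tnth x i - tnth y i.
pose op i := (tnth x i + D n *: pforce gV gW x i) - (tnth y i + D n *: pforce gV gW y i).
have opE i : op i = dl i + D n *: (pforce gV gW x i - pforce gV gW y i).
 by apply/rowP => k;rewrite !mxE;ring.
have H : \sum_(i < N) enorm (dl i) ^+ 2 <= \sum_(i < N) dotp (op i) (dl i).
 rewrite [leRHS](eq_bigr (fun i => enorm (dl i) ^+ 2 + D n * dotp (pforce gV gW x i - pforce gV gW y i) (dl i)));last first.
 by move=> i _;rewrite opE dotpDl dotpZl enorm_sqr.
 rewrite big_split /= lerDl -mulr_sumr mulr_ge0//.
 have := pforce_contraction sys 0 x y;under [leRHS]eq_bigr => i _ do rewrite /psi muln0 expr0 scale1r.
 apply: le_trans;rewrite mulr_ge0 ?sumr_ge0//;first exact/ltW/(beta_gt0 sys).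
 by move=> i _;rewrite exprn_ge0// enorm_ge0.
have H2 : \sum_(i < N) dotp (op i) (dl i) <= \sum_(i < N) (enorm (op i) ^+ 2 / 2 + enorm (dl i) ^+ 2 / 2).
 apply: ler_sum => i _;have := dotp_ge0 (op i - dl i).
 by rewrite -enorm_sqr enorm_sqrB;lra.
move: H2;rewrite big_split /= -!mulr_suml -/(op _);rewrite -/(dl _).
by move: H;rewrite /dl /op;lra.
Qed.
(** The preimages of the solution under the implicit step are used again. Expansion holds for the
    sum of squares over the particles, so the residual is separated by Young's inequality at the
    cost of a factor [1 + D] per step, and Gronwall's lemma replaces plain summation. *)
Let ps_scheme_err : {ae P, forall w, forall i (e : R), 0 < e -> exists n0, forall n, (n0 <= n)%N ->
 forall K, K = n.+1 -> enorm (tnth (Y n K w) i - tnth (X T w) i) < e}.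
Proof.
have sum_le (x y z : R) : x <= z / 16 -> y <= z / 8 -> 0 <= z -> x + y <= z / 4 by move=> *;lra.
have H1 : {ae P, forall w, forall i, path_solution
 (fun s => - pforce gV gW (X s w) i) (B i ^~ w) (fun s => tnth (X s w) i)} by exact: filter_forall.
have H2 : {ae P, forall w, forall i, path_continuous (fun s => tnth (X s w) i)}.
 apply: filter_forall => i;apply: filterS (cX i) => w;exact: within_path_continuous.
apply: filterS2 H1 H2 => w sol cw i e e0.
pose b j s := - pforce gV gW (X s w) j.
pose S := \sum_(j < N) enorm (b j 0) ^+ 2;have S0 : 0 <= S by apply: sumr_ge0 => j _;exact: sqr_ge0.
pose E := expR T;have E0 : 0 < E by exact: expR_gt0.
have E00 := ltW E0;have T00 := ltW T0;have e00 := ltW e0.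
pose c := 1 + N%:R * T * E;have c1 : 1 <= c by rewrite /c lerDl;apply: mulr_ge0 => //;exact: mulr_ge0.
have c0 : 0 < c by exact: lt_le_trans c1.
pose e1 := e / (4 * c);have e10 : 0 < e1 by rewrite divr_gt0// mulr_gt0.
have /choice[dl Hdl] : forall j, exists dl : R, 0 < dl /\ forall s t, 0 <= s -> s <= t -> t <= T -> t - s < dl ->
 enorm (tnth (X t w) j - tnth (X s w) j - Num.sqrt 2 *: (B j t w - B j s w) - (t - s) *: b j t) <= e1 * (t - s).
 move=> j;have [dl dl0 H] := path_residual T (sol j) (pforce_path_continuous j cw) e10.
 by exists dl.
have [dm dm0 dmj] := finite_min (fun j => proj1 (Hdl j)).
pose a := Num.min (Num.min 1 dm) (Num.min (e / (4 * (1 + S * E))) (e / (4 * (1 + enorm (b i T))))).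
have SE : 0 < 1 + S * E by rewrite ltr_pwDl// mulr_ge0.
have bT : 0 < 1 + enorm (b i T) by rewrite ltr_pwDl// enorm_ge0.
have a0 : 0 < a by rewrite !lt_min ltr01 dm0 !divr_gt0// mulr_gt0.
have [n0 Hn0] := mesh_small T a0;exists n0 => n /Hn0 + K KE;rewrite !lt_min.
have := D0 n;set d0 := D n => d00;have d0' := ltW d00;have e1' := ltW e10;move=> /andP[/andP[dn1 dndm] /andP[dnS dnT]].
pose xi k : state := [tuple tnth (X (k%:R * d0) w) j - d0 *: b j (k%:R * d0) | j < N].
pose q k := \sum_(j < N) enorm (tnth (Y n k w) j - tnth (xi k) j) ^+ 2.
have HK k : k%:R * d0 = T -> q k <= (e / 2) ^+ 2 -> enorm (tnth (Y n k w) i - tnth (X T w) i) < e.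
 move=> tE qn.
 have h1 : enorm (tnth (Y n k w) i - tnth (xi k) i) <= e / 2.
 have sl (x y : R) : 0 <= x -> 0 <= y -> x ^+ 2 <= y ^+ 2 -> x <= y.
  by move=> x0 y0;rewrite ler_sqr ?nnegrE.
 apply: sl;[exact: enorm_ge0|exact: divr_ge0|apply: (le_trans _ qn)].
 by rewrite /q (bigD1 i)//= lerDl;apply: sumr_ge0 => j _;exact: sqr_ge0.
 have -> : tnth (Y n k w) i - tnth (X T w) i =
 (tnth (Y n k w) i - tnth (xi k) i) - d0 *: b i T.
 by rewrite /xi [tnth (mktuple _) i]tnth_mktuple tE;apply/rowP => l;rewrite !mxE;ring.
 apply: (le_lt_trans (enormB _ _));rewrite enormZ ger0_norm//.
 have : d0 * enorm (b i T) <= e / 4.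
 apply: (letr (e / (4 * (1 + enorm (b i T))) * (1 + enorm (b i T)))).
  by apply: ler_pM => //;[exact: enorm_ge0|exact: ltW|rewrite lerDr].
 by apply: eqW;field;rewrite gt_eqF.
 lra.
have qS k : (k < K)%N -> q k.+1 <= (1 + d0) * q k + 2 * N%:R * d0 * e1 ^+ 2.
 move=> kn;have kn' : (k < n.+1)%N by rewrite -KE.
 have s0 : 0 <= k%:R * d0 by rewrite mulr_ge0.
 have dk : k.+1%:R * d0 - k%:R * d0 = d0 by rewrite -natr1;ring.
 have sk : k%:R * d0 <= k.+1%:R * d0 by rewrite ler_wpM2r// ler_nat.
 pose v := ps n (Y n k w).
 pose rr j := tnth (X (k.+1%:R * d0) w) j - tnth (X (k%:R * d0) w) j -
 Num.sqrt 2 *: (B j (k.+1%:R * d0) w - B j (k%:R * d0) w) - d0 *: b j (k.+1%:R * d0).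
 have hr j : enorm (rr j) ^+ 2 <= (e1 * d0) ^+ 2.
 rewrite lerXn2r ?nnegrE ?enorm_ge0 ?(mulr_ge0 e1' d0')//.
 case: (Hdl j) => _ /(_ _ _ s0 sk (mesh_le T0 kn'));rewrite dk;apply.
 exact: lt_le_trans dndm (dmj j).
 pose al j := tnth v j - tnth (X (k%:R * d0) w) j.
 have hv : \sum_(j < N) enorm (al j) ^+ 2 <= q k.
 apply: (le_trans (pstep_expand n v (X (k%:R * d0) w))).
 rewrite /q;apply: eqW;apply: eq_bigr => j _.
 by rewrite /v (pstepK sys (D0' n)) tnth_mktuple /b scalerN opprK.
 have hq j : enorm (tnth (Y n k.+1 w) j - tnth (xi k.+1) j) ^+ 2 <=
  (1 + d0) * enorm (al j) ^+ 2 + (1 + d0^-1) * (e1 * d0) ^+ 2.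
 have -> : tnth (Y n k.+1 w) j - tnth (xi k.+1) j = al j - rr j.
  rewrite /xi [tnth (mktuple _) j]tnth_mktuple /al /rr /v /=.
  rewrite /ps_step [tnth (mktuple _) j]tnth_mktuple /= [tnth (increment _ _ _ _) j]tnth_mktuple.
  by apply/rowP => l;rewrite !mxE;ring.
 have d1 : 0 <= 1 + d0^-1 by rewrite addr_ge0// invr_ge0 ltW.
 apply: (letr ((1 + d0) * enorm (al j) ^+ 2 + (1 + d0^-1) * enorm (rr j) ^+ 2)).
  apply: (letr ((enorm (al j) + enorm (rr j)) ^+ 2)).
  by rewrite lerXn2r ?nnegrE ?addr_ge0 ?enorm_ge0//;exact: enormB.
  set x := enorm (al j);set y := enorm (rr j).
  have h : 0 <= d0^-1 * (d0 * x - y) ^+ 2 by rewrite mulr_ge0 ?sqr_ge0// invr_ge0 ltW.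
  rewrite -subr_ge0 (_ : _ - _ = d0^-1 * (d0 * x - y) ^+ 2)//.
  by field;rewrite gt_eqF.
 by rewrite lerD2l ler_wpM2l.
 apply: (letr (\sum_(j < N) ((1 + d0) * enorm (al j) ^+ 2 + (1 + d0^-1) * (e1 * d0) ^+ 2))).
 by apply: ler_sum => j _;exact: hq.
 rewrite big_split /= -mulr_sumr sumr_const card_ord;apply: lerD.
 by rewrite ler_wpM2l// addr_ge0.
 rewrite -[leLHS]mulr_natl.
 rewrite (_ : N%:R * _ = N%:R * ((d0 + 1) * (d0 * e1 ^+ 2)));last by field;rewrite gt_eqF.
 have -> : 2 * N%:R * d0 * e1 ^+ 2 = N%:R * (2 * (d0 * e1 ^+ 2)) by ring.
 rewrite ler_wpM2l// ler_wpM2r//;first by rewrite mulr_ge0 ?sqr_ge0.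
 by lra.
have q00 : q 0%N = d0 ^+ 2 * S.
 rewrite /q /S mulr_sumr;apply: eq_bigr => j _.
 rewrite /xi tnth_mktuple /= mul0r opprB addrC subrK enormZ exprMn ger0_norm//;exact: ltW.
have tE : K%:R * d0 = T by rewrite KE /d0 /mesh mulrC divfK.
have qn : q K <= (e / 2) ^+ 2.
 have b1 : 0 <= 2 * N%:R * d0 * e1 ^+ 2 by apply: mulr_ge0;[apply: mulr_ge0 => //;exact: mulr_ge0|exact: sqr_ge0].
 have q0' : 0 <= q 0%N by apply: sumr_ge0 => j _;exact: sqr_ge0.
 have := discrete_gronwall (ltW d00) b1 q0' qS (leqnn _);rewrite tE -/E q00 => h.
 apply: (le_trans h).
 have g1 : E * (d0 ^+ 2 * S) <= e ^+ 2 / 16.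
 apply: (letr ((e / (4 * (1 + S * E))) ^+ 2 * (1 + S * E) ^+ 2)).
  rewrite mulrCA;apply: ler_pM;[exact: sqr_ge0|exact: mulr_ge0| |].
  2: (apply: (letr (1 + S * E));first by rewrite [E * S]mulrC lerDr).
  2: by rewrite expr2 ler_peMr// ?(ltW SE)// lerDl mulr_ge0.
  have SE4 : 0 <= 4 * (1 + S * E) by rewrite mulr_ge0// ltW.
  by apply: lerXn2r;rewrite ?nnegrE//;[exact: divr_ge0|exact: ltW].
 by apply: eqW;field;rewrite gt_eqF.
 have g2 : E * (K%:R * (2 * N%:R * d0 * e1 ^+ 2)) <= e ^+ 2 / 8.
 rewrite (_ : E * _ = 2 * (N%:R * (K%:R * d0) * E) * e1 ^+ 2);last by ring.
 rewrite tE;apply: (letr (2 * (c * c) * e1 ^+ 2)).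
  rewrite ler_wpM2r ?sqr_ge0// ler_wpM2l//;apply: (letr c);first by rewrite lerDr.
  by rewrite ler_peMl//;exact: ltW.
 by rewrite /e1;apply: eqW;field;rewrite gt_eqF.
 rewrite mulrDr (_ : (e / 2) ^+ 2 = e ^+ 2 / 4);last by field.
 exact: (sum_le _ _ _ g1 g2 (sqr_ge0 e)).
exact: (HK K tE qn).
Qed.
Lemma ps_scheme_cvg : {ae P, forall w, forall i (e : R), 0 < e -> exists n0, forall n, (n0 <= n)%N ->
 enorm (tnth (Y n n.+1 w) i - tnth (X T w) i) < e}.
Proof.
apply: filterS ps_scheme_err => w H i e e0;have [n0 Hn0] := H i e e0.
by exists n0 => n n0n;exact: (Hn0 n n0n n.+1 erefl).
Qed.
Lemma ps_scheme_limit (phi : state -> R) (b : R) :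
 mble phi -> (forall x, 0 <= phi x <= b) -> scont phi ->
 forall e : R, 0 < e -> exists n0, forall n, (n0 <= n)%N ->
 (ex (uN T) phi <= ex (mu n n.+1) phi + e%:E)%E.
Proof.
move=> mphi phib cphi e e0;have phi0 x : 0 <= phi x by case/andP: (phib x).
have T00 := ltW T0.
have [||n0 Hn0] := @ex_scont_cvg _ _ _ _ _ P (fun n => Y n n.+1) (X T) phi b _ _ ps_scheme_cvg mphi phib cphi e e0.
- by move=> n;case: (ps_scheme_law n n.+1).
- exact: mX.
exists n0 => n n0n;case: (Hn0 n n0n) => _.
case: (ps_scheme_law n n.+1) => mY lY.
by rewrite -(has_law_ex mY lY mphi phi0) -(has_law_ex (mX T00) (lX T00) mphi phi0).
Qed.

End ParticleScheme.

(** For quadratic [W] the gradient is linear and the pair inequality is an equality. For [d = 1] the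
    scalar products are plain products and the increment of [psi] has the sign of the increment of
    its argument, so monotonicity can be multiplied by their ratio. *)
Lemma convex_system_H {R : realType} {d : nat} (V W : 'rV[R]_d -> R) (lamV lamW M : R) (m : nat) :
 assumption_H V W lamV lamW M m ->
 (forall x, W x = lamW * (enorm x ^+ 2 / 2)) \/ d = 1%N ->
 convex_system (grad V) (grad W) lamV lamW M m.
Proof.
move=> H qd;split;[exact: H_gradV_monotone H|exact: H_lamV_gt0 H|exact: H_gradV_lipschitz H|
 exact: H_gradV_growth H|exact: H_gradW_odd H|exact: H_gradW_monotone H|exact: H_convex H|
 exact: H_M_gt0 H|exact: H_gradW_growth H|].
move=> p x y a b ab;case: qd => [WE|d1].
 have gE z : grad W z = lamW *: z.
 apply/rowP => k;rewrite !mxE /partial.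
 have -> : W = (lamW / 2) *: (fun z => enorm z ^+ 2).
  by apply/funext => t;rewrite WE [_ / 2]mulrC mulrA.
 have /(is_deriveZ (lamW / 2)) [_ ->] := is_derive_sqr k z.
 by rewrite /GRing.scale /=;field.
 by rewrite !gE -scalerBr ab dotpZl.
have aux (g t s l : R) : l * (t * t) <= g * t -> 0 <= t * s -> (t = 0 -> s = 0) -> l * (t * s) <= g * s.
 move=> h1 h2 h3;have [e|tn] := eqVneq t 0;first by rewrite h3// !mulr0.
 have t2 : 0 < t * t by rewrite -expr2 lt_neqAle sqr_ge0 eq_sym expf_neq0.
 rewrite -subr_ge0 -(pmulr_rge0 _ t2).
 rewrite [X in 0 <= X](_ : _ = (g * t - l * (t * t)) * (t * s));last by ring.
 by rewrite mulr_ge0 ?subr_ge0.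
have mW := H_gradW_monotone H a b.
subst d;have D1 (s t : 'rV[R]_1) : dotp s t = s 0 0 * t 0 0 by rewrite /dotp big_ord1.
have pm := psi_monotone p x y;rewrite enorm_sqr !D1 in mW pm *.
have t0 : (x - y) 0 0 = 0 -> (psi p x - psi p y) 0 0 = 0.
 move=> e;have -> : x = y;last by rewrite subrr mxE.
 by apply/eqP;rewrite -subr_eq0;apply/eqP/rowP => k;rewrite (ord1 k) e mxE.
rewrite ab in mW.
exact: (aux _ _ _ _ mW pm t0).
Qed.

(** * Moments of the McKean-Vlasov flow, uniform in time *)

Section UniformMoment.
Context {R : realType} {d : nat}.
Variables (gV gW : 'rV[R]_d -> 'rV[R]_d) (lamV lamW M : R) (m : nat).
Hypothesis sys : convex_system gV gW lamV lamW M m.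

Let en0 (x : 'rV[R]_d) q : 0 <= enorm x ^+ q. Proof. by rewrite exprn_ge0// enorm_ge0. Qed.
Let menp q : mble (fun x : 'rV[R]_d => enorm x ^+ q).
Proof. by apply: mbleX;exact: mble_enorm. Qed.
Let msum N q : mble (fun x : conf N R d => \sum_(i < N) enorm (tnth x i) ^+ q).
Proof.
apply: (@measurable_sum _ _ _ _ _ _ (fun i (x : conf N R d) => enorm (tnth x i) ^+ q)) => i.
by apply: mbleX;apply: mblef_enorm;exact: mble_tnth.
Qed.
Let sum0 N q (x : conf N R d) : 0 <= \sum_(i < N) enorm (tnth x i) ^+ q.
Proof. by apply: sumr_ge0. Qed.
Lemma ex_iid_sum (mu : probability 'rV[R]_d R) N (g : 'rV[R]_d -> R) :
 mble g -> (forall x, 0 <= g x) ->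
 ex (iid mu N) (fun x => \sum_(i < N) g (tnth x i))%R = (N%:R%:E * ex mu g)%E.
Proof.
move=> mg g0;rewrite (@ex_sum _ _ _ _ _ (index_enum 'I_N) (fun i (x : conf N R d) => g (tnth x i))) => [|i|i x];last exact: g0.
 under eq_bigr => i _ do rewrite (ex_iid_coord mu i mg g0).
 by rewrite sumr_const card_ord mule_natl.
by apply: (mcomp mg);exact: mble_tnth.
Qed.
Lemma ex_sum_power_le N (nu : probability (conf N R d) R) q q' (b : R) : (q <= q')%N ->
 (ex nu (fun x => \sum_(i < N) enorm (tnth x i) ^+ q')%R <= (N%:R * b)%:E)%E ->
 (ex nu (fun x => \sum_(i < N) enorm (tnth x i) ^+ q)%R <= (N%:R * (1 + b))%:E)%E.
Proof.
move=> qq H;apply: (letr (ex nu (fun x => N%:R + \sum_(i < N) enorm (tnth x i) ^+ q')%R)).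
 apply: ex_le => [||x|x] /=;[exact: msum|apply: mbleD => //;exact: msum|exact: sum0|].
 rewrite -[X in X%:R](card_ord N) -sumr_const -big_split /=;apply: ler_sum => i _.
 exact: (expr_le1D (enorm_ge0 _) qq).
rewrite (exD nu (mble_cst (N%:R : R)) (@msum N q') (fun=> ler0n _ _) (@sum0 N q')) ex_cst.
by rewrite mulrDr mulr1 EFinD leeD2l.
Qed.
(** If [z <= 1], then [y] is within 1 of [x]. If [z > 1], a factor [z^2] can be inserted in [y^m]
    for free and then split off by Young's inequality. *)
Lemma power_split (x y : R) (de : R) : 0 <= x -> 0 <= y -> 0 < de ->
 forall z, `|y - x| <= z -> y ^+ m <= 2 ^+ m * (1 + x ^+ m) + (de * y ^+ (2 * m) + de^-1 * z ^+ 4).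
Proof.
move=> x0 y0 de0 z yz;have z0 : 0 <= z by exact: le_trans yz.
have r0 : 0 <= de * y ^+ (2 * m) + de^-1 * z ^+ 4.
 by apply: addr_ge0;apply: mulr_ge0;rewrite ?invr_ge0 ?exprn_ge0// ltW.
have l0 : 0 <= 2 ^+ m * (1 + x ^+ m) by rewrite mulr_ge0 ?addr_ge0 ?exprn_ge0.
have [z1|z1] := leP z 1.
 apply: (letr (2 ^+ m * (1 + x ^+ m)));last by rewrite lerDl.
 apply: (letr ((1 + x) ^+ m)).
 rewrite lerXn2r ?nnegrE ?addr_ge0//;move: yz;rewrite ler_norml => /andP[_ h];lra.
 by have := powD_le m ler01 x0;rewrite expr1n.
apply: (letr (de * y ^+ (2 * m) + de^-1 * z ^+ 4));last by rewrite lerDr.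
have h : y ^+ m * z ^+ 2 <= de * y ^+ (2 * m) + de^-1 * z ^+ 4.
 rewrite mulnC exprM (exprM z 2 2);set a := y ^+ m;set b := z ^+ 2.
 have := sqr_ge0 (de * a - b);have := sqr_ge0 (de * a);have := sqr_ge0 b => h1 h2 h3.
 rewrite -(ler_pM2l de0) (_ : de * (de * a ^+ 2 + de^-1 * b ^+ 2) = (de * a) ^+ 2 + b ^+ 2);last by field;rewrite gt_eqF.
 by move: h3;rewrite sqrrB => h3;rewrite mulrA;move: h3 h2 h1;set c := de * a;lra.
by apply: le_trans h;rewrite ler_peMr ?exprn_ge0//;apply: exprn_ege1;exact: ltW.
Qed.
Lemma ex_power_le {dT} {T : measurableType dT} (nu : probability T R) (f : T -> R) q q' (c : R) :
 mble f -> (forall x, 0 <= f x) -> (q <= q')%N ->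
 (ex nu (fun x => f x ^+ q')%R <= c%:E)%E -> (ex nu (fun x => f x ^+ q)%R <= (1 + c)%:E)%E.
Proof.
move=> mf f0 qm h;have mq p : mble (fun x => f x ^+ p) by exact: mbleX.
have q0 p x : 0 <= f x ^+ p by rewrite exprn_ge0.
apply: (le_trans (ex_le _ (mq q) (mbleD (mble_cst (1 : R)) (mq q')) (q0 q) (fun x => expr_le1D (f0 x) qm))).
by rewrite (exD nu (mble_cst (1 : R)) (mq _) (fun _ => ler01) (q0 _)) ex_cst EFinD leeD2l.
Qed.

Section DiscreteMoment.
Context {N : nat}.
Hypothesis N0 : (0 < N)%N.
Variables (G : nat -> 'rV[R]_d -> 'rV[R]_d) (CG D : R).
Hypothesis fG : forall k, drift_field lamW m (G k) CG.
Hypothesis D0 : 0 < D.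
Variable u0 : probability 'rV[R]_d R.
Local Notation nu1 := (chain (gauss (Num.sqrt D)) (mble_mv_step sys fG D0) u0).
Local Notation nuN := (chain (iid (gauss (Num.sqrt D)) N)
 (@mble_tstep _ _ _ _ _ (mble_mv_step sys fG D0) N) (iid u0 N)).

Lemma noise4_small k (B : R) : 0 <= B ->
 (ex (nu1 k) (fun x => enorm (vstep gV (G k) D x) ^+ (2 * (4 * m).+1))%R <= B%:E)%E ->
 (forall (mv : mble (vstep gV (G k) D)) z,
 enorm (G k z - conv gW (push (nu1 k) mv) z) <= N%:R^-1 * (1 + enorm z ^+ (2 * m))) ->
 (ex (nuN k) (noise4 (N := N) gV gW G D k) <=
 ((`|@imbalance_cst R d M m (1 + B) (1 + B)| + 1) / N%:R)%:E)%E.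
Proof.
move=> B0 h bias;apply: (le_trans (noise4_le N0 B0 h (lexx _) (fun z => bias _ z))).
by rewrite lee_fin ler_pM2r ?invr_gt0 ?ltr0n//;apply: (le_trans (ler_norm _));rewrite lerDl.
Qed.
(** The copies are compared with particles started at the same points, whose moment bound [Bp] does
    not involve the mean field. The quantities that do, [B1] and [L], enter only through the
    largeness condition on [N], and are absent from the bound. *)
Lemma discrete_moment (B1 Bp L eta : R) n : D <= 1 -> 0 <= B1 -> 0 < eta ->
 (forall k, (k <= n)%N -> (ex (nuN k) (noise4 (N := N) gV gW G D k) <= (eta ^+ 4)%:E)%E) ->
 (ex (chain (iid (gauss (Num.sqrt D)) N) (mble_ps_step sys D0) (iid u0 N) n.+1)
 (fun x => \sum_(i < N) enorm (tnth x i) ^+ (2 * m.+1))%R <= (N%:R * Bp)%:E)%E ->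
 (ex (nu1 n.+1) (fun x => enorm x ^+ (2 * m.+1))%R <= B1%:E)%E ->
 eta ^+ 4 = L / N%:R -> 0 <= L ->
 (1 + (1 + 4 * beta_cst lamV lamW) / beta_cst lamV lamW) ^+ 4 * L * (2 + B1) <= N%:R ->
 (ex (nu1 n.+1) (fun x => enorm x ^+ m)%R <= (2 ^+ m * (1 + (1 + Bp)) + 2)%:E)%E.
Proof.
set beta := beta_cst lamV lamW;set kp := 1 + _ / beta;set A := _ * (2 + B1).
move=> D1 B10 eta0 noise hmu hnu etaE L0 AN;have b0 : 0 < beta := beta_gt0 sys.
have kp0 : 0 < kp by rewrite addr_gt0// divr_gt0// addr_gt0// mulr_gt0.
have mm : (m <= 2 * m.+1)%N by rewrite mul2n -addnn;apply: leq_trans (leqnSn m) (leq_addr _ _).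
have mm2 : (2 * m <= 2 * m.+1)%N by rewrite leq_mul2l leqnSn orbT.
have two1 : 0 <= 2 ^+ m :> R by exact: exprn_ge0.
have NR : 0 < N%:R :> R by rewrite ltr0n.
pose dg (x : conf N R d) := (x, x).
have mdg : mble dg by apply: mble_pair;exact: measurable_id.
pose pi0 := push (iid u0 N) mdg.
have pi_fst (g : conf N R d -> R) : mble g -> (forall x, 0 <= g x) ->
 ex pi0 (g \o fst) = ex (iid u0 N) g.
 by move=> mg g0;rewrite (ex_push _ mdg (mcomp mg mble_fst) (fun q => g0 _)).
have pi_snd (g : conf N R d -> R) : mble g -> (forall x, 0 <= g x) ->
 ex pi0 (g \o snd) = ex (iid u0 N) g.
 by move=> mg g0;rewrite (ex_push _ mdg (mcomp mg mble_snd) (fun q => g0 _)).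
have mg4 : mble (@gap4 R d N) by exact: mble_gap.
have g40 q : 0 <= @gap4 R d N q by apply: sumr_ge0 => i _;exact: expr4_ge0.
(* The initial gap is 0; [eta] serves as the positive initial bound that [gap_bound] asks for. *)
have pi_gap : (ex pi0 (@gap4 R d N) <= (eta ^+ 4)%:E)%E.
 rewrite (ex_push _ mdg mg4 g40) (eq_ex _ (_ : _ =1 fun=> 0)) ?ex_cst ?lee_fin ?exprn_ge0 ?ltW// => x.
 by rewrite /gap4 /dg /= big1// => i _;rewrite subrr enorm0 expr0n.
have [r [r01 rE _ rD]] := contraction_rate b0 D0 D1.
have Hg := gap4_leS (sys := sys) (fG := fG) (D0 := D0) pi_snd eta0 r01 rE eta0 (k := n) pi_gap noise.
case/andP: (r01) => r0 r1;have r1' : 0 < 1 - r by rewrite subr_gt0.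
have gb : gap_bound D eta r eta n.+1 <= kp * eta.
 rewrite /gap_bound /kp mulrDl mul1r;apply: lerD;first by rewrite ler_piMl ?exprn_ile1 ?(ltW eta0) ?(ltW r0) ?(ltW r1).
 by rewrite (_ : D * eta * r / (1 - r) = D * r / (1 - r) * eta) ?ler_pM2r//;ring.
have {}Hg : (ex (chain (iid (gauss (Num.sqrt D)) N) (mble_sync_pair sys fG D0) pi0 n.+1)
 (@gap4 R d N) <= (kp ^+ 4 * (L / N%:R))%:E)%E.
 apply: (le_trans Hg);rewrite lee_fin -etaE -exprMn;apply: lerXn2r;rewrite ?nnegrE//.
 exact: ltW (gap_bound_gt0 D0 eta0 r01 eta0 _).
 by apply: mulr_ge0;exact: ltW.
have {}hmu := ex_sum_power_le mm hmu.
have nuE q : ex (chain (iid (gauss (Num.sqrt D)) N)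
 (@mble_tstep _ _ _ _ _ (mble_mv_step sys fG D0) N) (iid u0 N) n.+1)
 (fun x => \sum_(i < N) enorm (tnth x i) ^+ q)%R =
 (N%:R%:E * ex (chain (gauss (Num.sqrt D)) (mble_mv_step sys fG D0) u0 n.+1) (fun x => enorm x ^+ q)%R)%E.
 by rewrite -(ex_iid_chain _ _ _ _ (@msum N q) (@sum0 N q)) (ex_iid_sum _ _ (menp _) (fun x => en0 x _)).
have B21 : 0 < 2 + B1 by rewrite ltr_wpDr.
(* With this [de] the two remainders of [power_split], summed over the particles, are at most [N]
   each: one by the moment bound [B1], the other by the largeness of [N]. *)
pose de := (2 + B1)^-1;have de0 : 0 < de by rewrite invr_gt0.
rewrite -(@lee_pmul2l _ N%:R%:E) ?lte_fin// -nuE -EFinM.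
have msn q : mble (fun z : conf N R d * conf N R d => \sum_(i < N) enorm (tnth z.2 i) ^+ q).
 by apply: (mcomp (@msum N q));exact: mble_snd.
have mfs q : mble (fun z : conf N R d * conf N R d => \sum_(i < N) enorm (tnth z.1 i) ^+ q).
 by apply: (mcomp (@msum N q));exact: mble_fst.
rewrite -(sync_snd sys fG D0 pi_snd n.+1 (@msum N m) (@sum0 N m)).
pose f2 (z : conf N R d * conf N R d) :=
 0 + de * \sum_(i < N) enorm (tnth z.2 i) ^+ (2 * m) + de^-1 * gap4 z.
have mf2 : mble f2.
 by apply: mbleD;[apply: mbleD => //|];exact: mbleM.
have idn : 0 <= de^-1 by rewrite invr_ge0 ltW.
have f20 z : 0 <= f2 z.
 by rewrite /f2 add0r;apply: addr_ge0;apply: mulr_ge0 => //;exact: ltW.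
have H2 : (ex (chain (iid (gauss (Num.sqrt D)) N) (mble_sync_pair sys fG D0) pi0 n.+1) f2 <=
 (0 + de * (N%:R * (1 + B1)) + de^-1 * (kp ^+ 4 * (L / N%:R)))%:E)%E.
 apply: ex_lin2 => //;first exact: ltW.
 rewrite (sync_snd sys fG D0 pi_snd n.+1 (@msum N (2 * m)%N) (@sum0 N (2 * m)%N)) nuE EFinM.
 by rewrite lee_wpmul2l ?lee_fin//;exact: (ex_power_le (@mble_enorm R d) (@enorm_ge0 R d) mm2 hnu).
have H1 : (ex (chain (iid (gauss (Num.sqrt D)) N) (mble_sync_pair sys fG D0) pi0 n.+1)
 (fun z => \sum_(i < N) enorm (tnth z.1 i) ^+ m)%R <= (N%:R * (1 + Bp))%:E)%E.
 by rewrite -(sync_fst sys fG D0 pi_fst n.+1 (@msum N m) (@sum0 N m)) in hmu.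
have a0 : 0 <= N%:R * 2 ^+ m :> R by exact: mulr_ge0.
pose f3 (z : conf N R d * conf N R d) :=
 N%:R * 2 ^+ m + 2 ^+ m * (\sum_(i < N) enorm (tnth z.1 i) ^+ m) + 1 * f2 z.
have mf3 : mble f3.
 by apply: mbleD;[apply: mbleD => //|];exact: mbleM.
apply: (letr (ex (chain (iid (gauss (Num.sqrt D)) N) (mble_sync_pair sys fG D0) pi0 n.+1) f3)).
 apply: ex_le => [||z|z];[exact: msn|exact: mf3|exact: sum0|].
 have -> : f3 z =
 \sum_(i < N) (2 ^+ m * (1 + enorm (tnth z.1 i) ^+ m) + (de * enorm (tnth z.2 i) ^+ (2 * m) +
  de^-1 * enorm (tnth z.1 i - tnth z.2 i) ^+ 4)).
 rewrite big_split /= -mulr_sumr big_split /= sumr_const card_ord big_split /= -!mulr_sumr /f3 /f2 /gap4.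
 by rewrite mul1r add0r mulrDr mulrC.
 apply: ler_sum => i _;apply: power_split => //;try exact: enorm_ge0.
 by rewrite enormBC enorm_dist_abs.
have H3 := ex_lin2 (mfs m) mf2 (fun z => sum0 _ _) f20 a0 two1 ler01 H1 H2.
apply: (le_trans (y := _%:E) H3).
rewrite lee_fin mul1r add0r.
have h1 : de * (N%:R * (1 + B1)) <= N%:R.
 by rewrite /de mulrCA ler_piMr// mulrC ler_pdivrMr// mul1r lerD2r ler1n.
have h2 : de^-1 * (kp ^+ 4 * (L / N%:R)) <= N%:R.
 rewrite /de invrK mulrC !mulrA [leLHS]mulrAC -/A.
 by rewrite ler_pdivrMr//;apply: (le_trans AN);rewrite ler_peMr// ler1n.
apply: (le_trans (lerD (lexx _) (lerD h1 h2)));apply: eqW;ring.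
Qed.

End DiscreteMoment.

(** Breaks a circularity: the constants of the mean field depend on moments of the flow, of which
    only bounds depending on the horizon are known. Propagation of chaos with a horizon-dependent
    number of particles transfers the uniform moments of the particle system to the flow. *)
Lemma mckean_uniform_moment (m0 : R) : exists2 K0 : R, 0 <= K0 &
 forall dO (Om : measurableType dO) (P : probability Om R) (F : R -> set (set Om))
 (B X : R -> Om -> 'rV[R]_d) (u : R -> probability 'rV[R]_d R),
 filtration F -> brownian_family P F (fun _ : 'I_1 => B) -> adapted F X -> continuous_paths P X ->
 {ae P, forall w, path_solution
 (fun s => - (gV (X s w) + conv gW (u s) (X s w))) (B ^~ w) (X ^~ w)} ->
 (forall t, 0 <= t -> has_law P (X t) (u t)) ->
 (forall T : R, exists K : R, forall t, 0 <= t -> t <= T ->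
 (ex (u t) (fun x => enorm x ^+ m)%R <= K%:E)%E) ->
 (forall q, exists C : R, (ex (u 0%R) (fun x : 'rV[R]_d => enorm x ^+ q)%R <= C%:E)%E) ->
 (ex (u 0%R) (fun x : 'rV[R]_d => enorm x ^+ (2 * m.+1))%R <= m0%:E)%E ->
 forall T, 0 <= T -> (ex (u T) (fun x => enorm x ^+ m)%R <= K0%:E)%E.
Proof.
have [Bp Bp0 HBp] := ps_chain_moment sys m (normr_ge0 m0).
exists (2 ^+ m * (1 + (1 + Bp)) + 2 + `|m0|).
 by apply: addr_ge0 => //;apply: addr_ge0 => //;apply: mulr_ge0;[exact: exprn_ge0|rewrite !addr_ge0].
move=> dO Om P F B X u hF hB aX cX solX lX uK u0M Hm0 T.
have m00 : 0 <= m0 by rewrite -lee_fin;apply: le_trans Hm0;exact: ex_ge0.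
have mm : (m <= 2 * m.+1)%N by rewrite mul2n -addnn;apply: leq_trans (leqnSn m) (leq_addr _ _).
have two1 : 0 <= 2 ^+ m :> R by exact: exprn_ge0.
rewrite le_eqVlt => /orP[/eqP <-|T0].
 apply: (le_trans (ex_power_le (@mble_enorm R d) (@enorm_ge0 R d) mm Hm0));rewrite lee_fin.
 have h : 0 <= 2 ^+ m * (1 + (1 + Bp)) by apply: mulr_ge0 => //;rewrite !addr_ge0.
 by have := ler_norm m0;lra.
have [K uT] := uK T.
pose CG := @conv_cst R d M m K.
have [B1 B10 HB1] := mv_chain_moment sys m CG m0.
have [m1 Hm1] := u0M (2 * (4 * m).+1)%N.
have [B2 B20 HB2] := mv_chain_moment sys (4 * m) CG m1.
pose L := `|@imbalance_cst R d M m (1 + B2) (1 + B2)| + 1.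
have L0 : 0 < L by rewrite ltr_wpDl.
pose beta := beta_cst lamV lamW;have b0 : 0 < beta := beta_gt0 sys.
pose kp := 1 + (1 + 4 * beta) / beta.
have kp0 : 0 < kp by rewrite addr_gt0// divr_gt0// addr_gt0// mulr_gt0.
pose A := kp ^+ 4 * L * (2 + B1);have A0 : 0 <= A.
 by rewrite /A;apply: mulr_ge0;[apply: mulr_ge0;[exact: exprn_ge0 (ltW kp0)|exact: ltW]|exact: addr_ge0].
(* [A] depends on the horizon through [K], and so does this auxiliary number of particles; it
   disappears from the final bound. *)
pose N := (Num.truncn A).+1;have N0 : (0 < N)%N by [].
have NR : 0 < N%:R :> R by rewrite ltr0n.
have AN : A <= N%:R by exact: ltW (truncnS_gt _).
have [eta eta0 etaE] := fourth_root (divr_gt0 L0 NR).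
have [n1 Hn1] := mesh_small T ltr01.
have iN0 : 0 < N%:R^-1 :> R by rewrite invr_gt0.
have [n2 Hn2] := mv_scheme_bias sys hF hB aX cX solX lX uK u0M T0 uT iN0.
apply: (mv_scheme_fatou (sys := sys) hF hB aX cX solX lX uK u0M (T0 := T0) (uT := uT) (n0 := maxn n1 n2)) => n.
rewrite geq_max => /andP[/Hn1 D1 n2n].
have h k (kn : (k <= n)%N) := noise4_small N0 B20 (HB2 _ _ (mv_field_drift sys T0 uT n) (mesh_gt0 T0 n) (ltW D1) (u 0) Hm1 k).2
 (fun mv z => Hn2 n n2n k kn mv z).
have m0N : (ex (iid (u 0%R) N) (fun x : conf N R d => \sum_(i < N) enorm (tnth x i) ^+ (2 * m.+1))%R <= (N%:R * `|m0|)%:E)%E.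
 rewrite (ex_iid_sum _ _ (menp _) (fun x => en0 x _)) EFinM lee_wpmul2l ?lee_fin//;apply: (le_trans Hm0);rewrite lee_fin;exact: ler_norm.
have [hmu _] := HBp N _ (mesh_gt0 T0 n) (ltW D1) _ m0N n.+1.
have [hnu _] := HB1 _ _ (mv_field_drift sys T0 uT n) (mesh_gt0 T0 n) (ltW D1) (u 0) Hm0 n.+1.
rewrite -/L -etaE in h.
apply: (le_trans (discrete_moment N0 (ltW D1) B10 eta0 h hmu hnu etaE (ltW L0) AN)).
by rewrite lee_fin lerDl.
Qed.

End UniformMoment.

Lemma DVle_eq {R : realType} {d1 d2} {S : measurableType d1} {E : measurableType d2}
 (rho : probability S R) (p : S -> E) (nu nu' : probability E R) (c : R) :
 (forall g : E -> R, mble g -> (forall x, 0 <= g x) -> ex nu g = ex nu' g) ->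
 DVle rho p nu c -> DVle rho p nu' c.
Proof.
move=> H HD phi mphi phi0 phib a Ha;apply: HD => //.
by rewrite (H _ (mble_funexpR mphi) (fun x => expR_ge0 _)).
Qed.
Lemma DVle_limit {R : realType} {N d : nat} (P Q : probability (conf N R d) R)
 (P_ Q_ : nat -> probability (conf N R d) R) (c : R) :
 (forall (phi : conf N R d -> R) (b : R), mble phi -> (forall x, 0 <= phi x <= b) -> scont phi ->
 forall e : R, 0 < e -> exists n0, forall n, (n0 <= n)%N ->
 (ex P phi <= ex (P_ n) phi + e%:E)%E /\ (ex (Q_ n) phi <= ex Q phi + e%:E)%E) ->
 (exists n0, forall n, (n0 <= n)%N -> DVle (P_ n) id (Q_ n) c) -> DVle P id Q c.
Proof.
move=> H [n1 HD];apply: DVle_scont => phi mphi phi0 [b phib] cphi a Ha.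
apply/lee_addgt0Pr => e e0;have e20 : 0 < e / 2 by rewrite divr_gt0.
(* The tolerance on the Laplace transform that changes [a] into [a + e / 2]; the other half of [e]
   is spent on the mean of [phi]. *)
have f0 : 0 < expR a * (expR (e / 2) - 1) by rewrite mulr_gt0 ?expR_gt0// subr_gt0 expR_gt1.
have [|n2 H2] := H phi b mphi _ cphi _ e20;first by move=> x;rewrite phi0 phib.
have [||n3 H3] := H (fun x => expR (phi x)) (expR b) (mble_funexpR mphi) _ _ _ f0.
- by move=> x;rewrite expR_ge0 ler_expR phib.
- by move=> z z0 cz;apply: continuous_cvg;[exact: continuous_expR|exact: cphi].
pose n := maxn n1 (maxn n2 n3).
have [h2 _] := H2 n (leq_trans (leq_maxl _ _) (leq_maxr _ _)).
have [_ h3] := H3 n (leq_trans (leq_maxr _ _) (leq_maxr _ _)).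
have Ha' : (ex (Q_ n) (fun x => expR (phi x)) <= (expR (a + e / 2))%:E)%E.
 apply: (le_trans h3);apply: (le_trans (leeD2r _ Ha)).
 by rewrite -EFinD lee_fin expRD;lra.
have := HD n (leq_maxl _ _) phi mphi phi0 (ex_intro _ b phib) _ Ha' => h.
apply: (le_trans h2);apply: (le_trans (leeD2r _ h));rewrite -!EFinD lee_fin;lra.
Qed.

(** * Entropy estimates uniform in the mesh *)

Section DiscreteEstimate.
Context {R : realType} {d : nat}.
Variables (gV gW : 'rV[R]_d -> 'rV[R]_d) (lamV lamW M : R) (m : nat).
Hypothesis sys : convex_system gV gW lamV lamW M m.
Context {N : nat}.
Hypothesis N0 : (0 < N)%N.
Variables (G : nat -> 'rV[R]_d -> 'rV[R]_d) (CG D : R).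
Hypothesis fG : forall k, drift_field lamW m (G k) CG.
Hypothesis D0 : 0 < D.
Local Notation beta := (beta_cst lamV lamW).
Local Notation mu x0 := (chain (iid (gauss (Num.sqrt D)) N) (mble_ps_step sys D0) x0).
Local Notation nu y0 := (chain (iid (gauss (Num.sqrt D)) N)
 (@mble_tstep _ _ _ _ _ (mble_mv_step sys fG D0) N) y0).
Local Notation nu1 u0 := (chain (gauss (Num.sqrt D)) (mble_mv_step sys fG D0) u0).

(** The moment bounds are for powers [2 * p.+1], a form that [4 * m] takes only when [m] is
    positive; for [m = 0] the sum is [N]. *)
Lemma particle_moment4 (x0 : probability (conf N R d) R) k (B Mx : R) : 0 <= B -> 1 + B <= Mx ->
 ((0 < m)%N -> (ex (mu x0 k) (fun x => \sum_(i < N) enorm (tnth (pstep gV gW D x) i) ^+ (2 * (2 * m).-1.+1))%R <= (N%:R * B)%:E)%E) ->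
 (ex (mu x0 k) (fun x => \sum_(i < N) enorm (tnth (pstep gV gW D x) i) ^+ (4 * m))%R <= (N%:R * Mx)%:E)%E.
Proof.
move=> B0 BM H;have [m0|m0] := posnP m.
 rewrite (eq_ex _ (_ : _ =1 fun=> N%:R)) ?ex_cst ?lee_fin ?ler_peMr//.
 by apply: le_trans BM;rewrite lerDl.
 have e : (4 * m = 0)%N by rewrite m0.
 by move=> x;under eq_bigr => i _ do rewrite e expr0;rewrite sumr_const card_ord.
have := H m0;rewrite prednK ?muln_gt0// mulnA => h;apply: (le_trans h).
by rewrite lee_fin ler_wpM2l//;apply: le_trans BM;rewrite lerDr.
Qed.
Lemma mckean_moment4 (u0 : probability 'rV[R]_d R) k (B Mx : R) : 1 + B <= Mx ->
 (ex (nu1 u0 k) (fun x => enorm (vstep gV (G k) D x) ^+ (2 * (4 * m).+1))%R <= B%:E)%E ->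
 (ex (nu (iid u0 N) k) (fun y => \sum_(i < N) enorm (vstep gV (G k) D (tnth y i)) ^+ (4 * m))%R <= (N%:R * Mx)%:E)%E.
Proof.
move=> BM h;pose f x := enorm (vstep gV (G k) D x).
have mf : mble f.
 by apply: mblef_enorm;exact: (mble_vstep sys (fG k) (ltW D0)).
have f0 x : 0 <= f x by exact: enorm_ge0.
have mq : mble (fun x => f x ^+ (4 * m)) by exact: mbleX.
have q0 x : 0 <= f x ^+ (4 * m) by rewrite exprn_ge0.
have ms : mble (fun y : conf N R d => \sum_(i < N) f (tnth y i) ^+ (4 * m)).
 apply: (@measurable_sum _ _ _ _ _ _ (fun i (x : conf N R d) => f (tnth x i) ^+ (4 * m))) => i.
 by apply: (mcomp mq);exact: mble_tnth.
rewrite -(ex_iid_chain _ _ _ _ ms) ?(ex_iid_sum _ _ mq q0);last by move=> y;apply: sumr_ge0 => i _;exact: q0.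
have mm : (4 * m <= 2 * (4 * m).+1)%N by rewrite mul2n -addnn;apply: leq_trans (leqnSn _) (leq_addr _ _).
by rewrite EFinM lee_wpmul2l ?lee_fin//;apply: (le_trans (ex_power_le mf f0 mm h));rewrite lee_fin.
Qed.
Let final_bound (C1 S2 L ee v g : R) : 0 <= C1 -> 0 <= S2 -> 0 <= L -> 1 <= ee -> 0 <= v ->
 g <= 2 * ee * v + S2 -> (1 + C1) * g + (1 + L) <= ((1 + C1) * (2 * ee + S2) + (1 + L)) * (1 + v).
Proof.
move=> C0 S0 L0 e1 v0 h;rewrite [leRHS]mulrDl;apply: lerD;last by rewrite ler_peMr ?addr_ge0// lerDl.
rewrite -mulrA ler_wpM2l ?addr_ge0//;apply: (le_trans h);rewrite -subr_ge0.
by rewrite (_ : _ - _ = 2 * ee + S2 * v);[rewrite addr_ge0 ?mulr_ge0// (le_trans ler01)|ring].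
Qed.
Let window_bound (C1 L g : R) (t : R) : 0 <= C1 -> 0 <= L -> 0 <= g -> 0 <= t -> t <= 1 ->
 t / 2 * (C1 * g + (1 + L)) <= C1 * g + (1 + L).
Proof.
move=> C0 L0 g0 t0 t1;rewrite ler_piMl ?addr_ge0 ?mulr_ge0//.
by rewrite ler_pdivrMr// mul1r (le_trans t1)// ler1n.
Qed.
(** The three bounds differ by the window used: the last unit of time, after the gap has contracted;
    the whole interval, with the gap closed at cost [w / (2 T)]; the whole interval from a diagonal
    start, with the initial entropy kept. The constant depends neither on the mesh nor on [T]. *)
Lemma discrete_entropy (x0 y0 : probability (conf N R d) R)
 (pi0 : probability (conf N R d * conf N R d)%type R) (B0 eta Mx L T : R) n :
 0 < eta -> 0 <= Mx -> 0 <= L -> 0 < B0 -> N%:R * eta ^+ 4 = L ->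
 0 < T -> D * n.+1%:R = T -> D <= 1 / 2 -> 8 * beta ^+ 2 * D * T <= 1 ->
 (forall k, (k < n.+1)%N -> (ex (nu y0 k) (noise4 (N := N) gV gW G D k) <= (eta ^+ 4)%:E)%E) ->
 (forall k, (k < n.+1)%N -> (ex (mu x0 k)
 (fun x => \sum_(i < N) enorm (tnth (pstep gV gW D x) i) ^+ (4 * m))%R <= (N%:R * Mx)%:E)%E) ->
 (forall k, (k < n.+1)%N -> (ex (nu y0 k)
 (fun y => \sum_(i < N) enorm (vstep gV (G k) D (tnth y i)) ^+ (4 * m))%R <= (N%:R * Mx)%:E)%E) ->
 (forall g : conf N R d -> R, mble g -> (forall x, 0 <= g x) ->
 ex pi0 (g \o fst) = ex x0 g) ->
 (forall g : conf N R d -> R, mble g -> (forall x, 0 <= g x) ->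
 ex pi0 (g \o snd) = ex y0 g) ->
 (ex pi0 (@gap4 R d N) <= (B0 ^+ 4)%:E)%E ->
 let w := Num.sqrt N%:R * B0 ^+ 2 in
 let C := (1 + @unbalance_cst R M m CG Mx) *
 (2 * expR (2 * beta + 1) + 2 * ((1 + 4 * beta) / beta) ^+ 2 * (1 + L)) + (1 + L) in
 [/\ 1 <= T -> DVle (mu x0 n.+1) id (nu y0 n.+1) (C * (1 + expR (- (2 * beta) * T) * w)),
  T <= 1 -> DVle (mu x0 n.+1) id (nu y0 n.+1) (w / (2 * T) + C * (1 + w)) &
  T <= 1 -> forall E0, DVle x0 id y0 E0 ->
  DVle (mu x0 n.+1) id (nu y0 n.+1) (E0 + C * (1 + w))].
Proof.
move=> eta0 Mx0 L0 B00 NE T0 DT D12 DT8 Hnoise Hmu Hnu pi_fst pi_snd pi_gap w C.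
have b0 : 0 < beta := beta_gt0 sys;have D1 : D <= 1 by lra.
have [r [r01 rE rexp rD]] := contraction_rate b0 D0 D1.
have C10 := unbalance_cst_ge0 M m CG Mx0;rewrite /C;set C1 := unbalance_cst M m CG Mx in C10 *.
set ee := expR (2 * beta + 1);set kp := (1 + 4 * beta) / beta in rD *;set S2 := 2 * kp ^+ 2 * (1 + L).
have kp0 : 0 <= kp by rewrite divr_ge0 ?ltW// addr_gt0// mulr_gt0.
have ee1 : 1 <= ee by rewrite -expR0 ler_expR addr_ge0// mulr_ge0// ltW.
have S20 : 0 <= S2 by apply: mulr_ge0;[apply: mulr_ge0 => //;exact: sqr_ge0|exact: addr_ge0].
have w0 : 0 <= w by rewrite mulr_ge0 ?sqrtr_ge0// sqr_ge0.
have sN := sqrtr_ge0 (N%:R : R);set s := Num.sqrt N%:R in sN w w0 *.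
have [r0 r1] := andP r01.
have hs : s * eta ^+ 2 <= 1 + L.
 have <- : (s * eta ^+ 2) ^+ 2 = L by rewrite exprMn sqr_sqrtr// -exprM.
 have := sqr_ge0 (s * eta ^+ 2 - 1);set x := s * _;rewrite sqrrB expr1n mulr1.
 have := sqr_ge0 x;set y := x ^+ 2;lra.
have g0 k : 0 <= s * gap_bound D eta r B0 k ^+ 2 by rewrite mulr_ge0 ?sqr_ge0.
have gS k : s * gap_bound D eta r B0 k ^+ 2 <= 2 * r ^+ (2 * k) * w + S2.
 rewrite /gap_bound;set x := r ^+ k * B0;set y := D * eta * r / (1 - r).
 have y0' : 0 <= y by rewrite !mulr_ge0 ?invr_ge0 ?subr_ge0 ?(ltW D0) ?(ltW eta0) ?(ltW r0) ?(ltW r1).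
 have yk : y <= kp * eta.
 by rewrite (_ : y = D * r / (1 - r) * eta) ?ler_wpM2r ?(ltW eta0)// /y;ring.
 have h1 : (x + y) ^+ 2 <= 2 * x ^+ 2 + 2 * y ^+ 2.
 by rewrite -subr_ge0 (_ : _ - _ = (x - y) ^+ 2) ?sqr_ge0//;ring.
 apply: (le_trans (ler_wpM2l sN h1));rewrite mulrDr;apply: lerD.
 by apply: eqW;rewrite /x /w mulnC exprM;ring.
 apply: (letr (2 * kp ^+ 2 * (s * eta ^+ 2)));last first.
 by rewrite ler_wpM2l// mulr_ge0 ?sqr_ge0.
 rewrite (_ : 2 * kp ^+ 2 * (s * eta ^+ 2) = s * (2 * (kp * eta) ^+ 2));last by ring.
 apply: ler_wpM2l => //;apply: ler_wpM2l => //;apply: lerXn2r;rewrite ?nnegrE//;exact: mulr_ge0 kp0 (ltW eta0).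
have g0S : s * gap_bound D eta r B0 0 ^+ 2 <= 2 * ee * w + S2.
 apply: (le_trans (gS 0%N));rewrite lerD2r ler_wpM2r// muln0 expr0 mulr1.
 by rewrite ler_peMr.
have bnd0 := final_bound C10 S20 L0 ee1 w0 g0S.
have win0 : T <= 1 -> T / 2 * (C1 * (s * gap_bound D eta r B0 0 ^+ 2) + (1 + N%:R * eta ^+ 4)) <=
 ((1 + C1) * (2 * ee + S2) + (1 + L)) * (1 + w).
 move=> T1;rewrite NE;apply: (le_trans (window_bound C10 L0 (g0 _) (ltW T0) T1)).
 by apply: le_trans bnd0;rewrite mulrDl mul1r -addrA lerDr.
split=> T1.
(* The window has length between [1 - D] and 1, hence at least one half as [D <= 1 / 2]: closing the
   gap then costs at most the gap itself. *)
- pose K := Num.truncn D^-1.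
 have iD : 0 <= D^-1 by rewrite invr_ge0 ltW.
 have /andP[K1 K2] := truncn_itv iD.
 have DK1 : D * K%:R <= 1 by have := ler_wpM2l (ltW D0) K1;rewrite mulfV ?gt_eqF.
 have DK2 : 1 < D * K%:R + D.
 by have h := K2;rewrite -(ltr_pM2l D0) mulfV ?gt_eqF// -natr1 mulrDr mulr1 in h.
 have DKh : 1 <= 2 * (D * K%:R) by move: DK2 D12;set x := D * K%:R;lra.
 have K0 : (0 < K)%N.
 by rewrite lt0n;apply/eqP => K0;move: DKh;rewrite K0 !mulr0 ler10.
 have Kn : (K <= n.+1)%N.
 by rewrite -(ler_nat R) -(ler_pM2l D0) DT;exact: le_trans DK1 T1.
 pose k0 := (n.+1 - K)%N;have kK : (k0 + K)%N = n.+1 by rewrite subnK.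
 have k0n : (k0 < n.+1)%N by rewrite -kK -[X in (X < _)%N]addn0 ltn_add2l.
 have Dk : D * k0%:R = T - D * K%:R by rewrite -DT -kK natrD mulrDr addrK.
 pose g := s * gap_bound D eta r B0 k0 ^+ 2;pose e := expR (- (2 * beta) * T).
 have e0 : 0 <= e by exact: expR_ge0.
 (* [ee] pays [2 beta] in the exponent for the window, where no contraction is counted, and 1 for
    the gap between the discrete rate and [beta], which [8 beta^2 D T <= 1] keeps bounded. *)
 have re : r ^+ (2 * k0) <= ee * e.
 apply: (letr (expR (- (beta * D / (1 + 4 * beta * D))) ^+ (2 * k0))).
  by rewrite lerXn2r ?nnegrE ?expR_ge0// ltW.
 rewrite -expRM_natl -expRD ler_expR natrM.
 set q := 1 + 4 * beta * D;have q0 : 0 < q by rewrite addr_gt0// !mulr_gt0.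
 rewrite (_ : 2 * k0%:R * _ = - (2 * beta * (D * k0%:R) / q));last by ring.
 rewrite -[leRHS]opprK lerN2 ler_pdivlMr//.
 have h1 : 0 <= D * k0%:R by rewrite mulr_ge0// ltW.
 have h2 : T - 1 <= D * k0%:R by rewrite Dk lerD2l lerN2.
 have h3 : D * k0%:R <= T by rewrite Dk gerBl mulr_ge0// ltW.
 rewrite /q;set z := D * k0%:R in h1 h2 h3 *.
 have h4 : 2 * beta * (T - 1) <= 2 * beta * z by rewrite ler_pM2l// mulr_gt0.
 have h5 : 0 <= 4 * beta * D by rewrite !mulr_ge0// ltW.
 have h6 : 8 * beta ^+ 2 * D * (T - 1) <= 1.
  by apply: le_trans DT8;rewrite ler_wpM2l ?gerBl// mulr_ge0 ?(ltW D0)// mulr_ge0// sqr_ge0.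
 rewrite (_ : _ * (1 + _) = 2 * beta * (T - 1) - 1 + (8 * beta ^+ 2 * D * (T - 1) - 4 * beta * D));last by ring.
 by move: h4 h5 h6;set x1 := 4 * beta * D;set x2 := 8 * _ * _ * _;set x3 := 2 * beta * z;set x4 := 2 * beta * _;lra.
 have gle : g <= 2 * ee * (e * w) + S2.
 apply: (le_trans (gS k0));rewrite lerD2r mulrA -[2 * ee * e]mulrA.
 by rewrite ler_wpM2r// ler_wpM2l.
 have := coupled_window (sys := sys) (fG := fG) (D0 := D0) N0 eta0 Mx0 Hnoise Hmu Hnu r01 rE B00 pi_fst pi_snd pi_gap
 K0 kK (late_gap (sys := sys) (fG := fG) (D0 := D0) N0 eta0 Hnoise r01 rE B00 pi_snd pi_gap k0n).
 apply: DVle_mono;rewrite NE -/g -/C1.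
 apply: le_trans (final_bound C10 S20 L0 ee1 (mulr_ge0 e0 w0) gle).
 rewrite [leRHS](_ : _ = g + (C1 * g + (1 + L)));last by ring.
 apply: lerD.
 by rewrite -mulrA ler_pdivrMr ?ler_peMr ?g0// (lt_le_trans ltr01).
 by apply: (window_bound C10 L0 (g0 _) _ DK1);rewrite mulr_ge0// ltW.
- have := coupled_window (sys := sys) (fG := fG) (D0 := D0) N0 eta0 Mx0 Hnoise Hmu Hnu r01 rE B00 pi_fst pi_snd pi_gap
 (k0 := 0) (ltn0Sn n) (add0n _) (gap2_le (sys := sys) (fG := fG) (D0 := D0) N0 (k := 0%N) B00 pi_gap).
 by apply: DVle_mono;rewrite -[2 * D * _]mulrA DT lerD2l;exact: win0.
- move=> E0 HE.
 have := entropic_window (sys := sys) (fG := fG) (D0 := D0) N0 eta0 Mx0 Hnoise Hmu Hnu r01 rE B00 pi_fst pi_snd pi_gap (ltn0Sn n) HE.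
 by apply: DVle_mono;rewrite DT lerD2l;exact: win0.
Qed.

End DiscreteEstimate.

(** * Passing to the limit in the mesh *)

Section Processes.
Context {R : realType} {d : nat}.
Variables (gV gW : 'rV[R]_d -> 'rV[R]_d) (m : nat).

Record mckean_process {dO} {Om : measurableType dO} (P : probability Om R)
 (F : R -> set (set Om)) (B X : R -> Om -> 'rV[R]_d) (u : R -> probability 'rV[R]_d R) : Prop :=
 McKeanProcess {
 mv_filtration : filtration F ;
 mv_brownian : brownian_family P F (fun _ : 'I_1 => B) ;
 mv_adapted : adapted F X ;
 mv_continuous : continuous_paths P X ;
 mv_solution : {ae P, forall w, path_solution
 (fun s => - (gV (X s w) + conv gW (u s) (X s w))) (B ^~ w) (X ^~ w)} ;
 mv_law : forall t, 0 <= t -> has_law P (X t) (u t) ;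
 mv_local : forall T : R, exists K : R, forall t, 0 <= t -> t <= T ->
 (ex (u t) (fun x => enorm x ^+ m)%R <= K%:E)%E }.

Record particle_process {N} {dO} {Om : measurableType dO} (P : probability Om R)
 (F : R -> set (set Om)) (B : 'I_N -> R -> Om -> 'rV[R]_d) (X : R -> Om -> conf N R d)
 (uN : R -> probability (conf N R d) R) : Prop := ParticleProcess {
 ps_filtration : filtration F ;
 ps_brownian : brownian_family P F B ;
 ps_adapted : adapted F X ;
 ps_continuous : forall i, continuous_paths P (fun s w => tnth (X s w) i) ;
 ps_solution : forall i, {ae P, forall w, path_solution
 (fun s => - pforce gV gW (X s w) i) (B i ^~ w) (fun s => tnth (X s w) i)} ;
 ps_law : forall t, 0 <= t -> has_law P (X t) (uN t) }.

Variables (lamV lamW M : R).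
Hypothesis sys : convex_system gV gW lamV lamW M m.
Local Notation beta := (beta_cst lamV lamW).

(** The order of the choices matters: the uniform moment fixes the field constant, which fixes the
    moments of the copies, the noise level and finally [C], all from [mom] and [M4]. The mesh is
    refined last, depending on [T], [N] and the processes. *)
Lemma entropy_estimate (mom : nat -> R) (M4 : R) : exists2 C : R, 0 < C &
 forall dO (Om : measurableType dO) (P : probability Om R) (F : R -> set (set Om)) B X u,
 mckean_process P F B X u ->
 (forall q, (ex (u 0%R) (fun x : 'rV[R]_d => enorm x ^+ q)%R <= (mom q)%:E)%E) ->
 forall N dO' (Om' : measurableType dO') (P' : probability Om' R) (F' : R -> set (set Om')) B' X' uN,
 (0 < N)%N -> @particle_process N dO' Om' P' F' B' X' uN ->
 (ex (uN 0%R) (fun x => \sum_(i < N) enorm (tnth x i) ^+ (4 * m))%R <= (N%:R * M4)%:E)%E ->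
 forall (pi0 : probability (conf N R d * conf N R d)%type R) (B0 : R), 0 < B0 ->
 (forall g : conf N R d -> R, mble g -> (forall x, 0 <= g x) ->
 ex pi0 (g \o fst) = ex (uN 0) g) ->
 (forall g : conf N R d -> R, mble g -> (forall x, 0 <= g x) ->
 ex pi0 (g \o snd) = ex (iid (u 0) N) g) ->
 (ex pi0 (@gap4 R d N) <= (B0 ^+ 4)%:E)%E ->
 forall T, 0 < T -> let w := Num.sqrt N%:R * B0 ^+ 2 in
 [/\ 1 <= T -> DVle (uN T) id (iid (u T) N) (C * (1 + expR (- (2 * beta) * T) * w)),
  T <= 1 -> DVle (uN T) id (iid (u T) N) (w / (2 * T) + C * (1 + w)) &
  T <= 1 -> forall E0, DVle (uN 0) id (iid (u 0) N) E0 ->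
  DVle (uN T) id (iid (u T) N) (E0 + C * (1 + w))].
Proof.
have b0 : 0 < beta := beta_gt0 sys.
have [K0 K00 HK0] := mckean_uniform_moment sys (mom (2 * m.+1)%N).
pose CG := @conv_cst R d M m K0.
have [B2 B20 HB2] := mv_chain_moment sys (4 * m) CG (mom (2 * (4 * m).+1)%N).
pose L := `|@imbalance_cst R d M m (1 + B2) (1 + B2)| + 1;have L0 : 0 < L by rewrite ltr_wpDl.
have [B3 B30 HB3] := ps_chain_moment sys (2 * m).-1 (normr_ge0 M4).
pose Mx := 1 + B2 + B3;have Mx0 : 0 <= Mx by rewrite !addr_ge0.
pose C1 := @unbalance_cst R M m CG Mx;have C10 : 0 <= C1 := unbalance_cst_ge0 M m CG Mx0.
pose kp := (1 + 4 * beta) / beta;pose S2 := 2 * kp ^+ 2 * (1 + L).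
have S20 : 0 <= S2 by rewrite mulr_ge0 ?addr_ge0 ?(ltW L0)// mulr_ge0// sqr_ge0.
pose ee := expR (2 * beta + 1);have ee1 : 1 <= ee by rewrite -expR0 ler_expR addr_ge0// mulr_ge0// ltW.
pose C := (1 + C1) * (2 * ee + S2) + (1 + L).
exists C.
 apply: ltr_wpDl;last exact: addr_gt0.
 by apply: mulr_ge0;apply: addr_ge0 => //;apply: mulr_ge0 => //;exact: expR_ge0.
move=> dO Om P F B X u [hF hB aX cX solX lX uK] Hmom N dO' Om' P' F' B' X' uN N0
 [hF' hB' aX' cX' solX' lX'] HM4 pi0 B0 B00 pi_fst pi_snd pi_gap T T0 w.
have u0M q : exists c : R, (ex (u 0%R) (fun x : 'rV[R]_d => enorm x ^+ q)%R <= c%:E)%E by exists (mom q).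
have uT t : 0 <= t -> t <= T -> (ex (u t) (fun x => enorm x ^+ m)%R <= K0%:E)%E.
 by move=> t0 _;exact: (HK0 _ _ _ _ _ _ _ hF hB aX cX solX lX uK u0M (Hmom _) t t0).
have NR : 0 < N%:R :> R by rewrite ltr0n.
have iN0 : 0 < N%:R^-1 :> R by rewrite invr_gt0.
have [eta eta0 etaE] := fourth_root (divr_gt0 L0 NR).
have NE : N%:R * eta ^+ 4 = L by rewrite etaE mulrC divfK// gt_eqF.
have [n2 Hn2] := mv_scheme_bias sys hF hB aX cX solX lX uK u0M T0 uT iN0.
(* The two mesh conditions of [discrete_entropy]. *)
have D00 : 0 < Num.min (1 / 2) (1 / (8 * beta ^+ 2 * T)).
 by rewrite lt_min divr_gt0//= divr_gt0// mulr_gt0// mulr_gt0// exprn_gt0.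
have [n1 Hn1] := mesh_small T D00.
pose mu n := chain (iid (gauss (Num.sqrt (mesh T n))) N) (mble_ps_step sys (mesh_gt0 T0 n)) (uN 0).
pose nu n := chain (gauss (Num.sqrt (mesh T n))) (mble_mv_step sys (mv_field_drift sys T0 uT n) (mesh_gt0 T0 n)) (u 0).
pose nuN n := chain (iid (gauss (Num.sqrt (mesh T n))) N)
 (@mble_tstep _ _ _ _ _ (mble_mv_step sys (mv_field_drift sys T0 uT n) (mesh_gt0 T0 n)) N) (iid (u 0) N).
have lim c : (forall n, (n1 <= n)%N -> (n2 <= n)%N -> DVle (mu n n.+1) id (nuN n n.+1) c) ->
 DVle (uN T) id (iid (u T) N) c.
 move=> H;apply: (DVle_limit (P_ := fun n => mu n n.+1) (Q_ := fun n => iid (nu n n.+1) N)).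
 move=> phi b mphi phib cphi e e0.
 have [n3 H3] := ps_scheme_limit sys hF' hB' aX' cX' solX' lX' T0 mphi phib cphi e0.
 have [n4 H4] := mv_scheme_limit sys hF hB aX cX solX lX uK u0M T0 uT mphi phib cphi e0.
 exists (maxn n3 n4) => n;rewrite geq_max => /andP[h3 h4];split;first exact: H3.
 by case: (H4 n h4).
 exists (maxn n1 n2) => n;rewrite geq_max => /andP[h1 h2];apply: DVle_eq (H n h1 h2) => g mg g0.
 by rewrite -(ex_iid_chain _ _ _ _ mg g0).
have w0 : 0 <= w by rewrite mulr_ge0 ?sqrtr_ge0// sqr_ge0.
have key n : (n1 <= n)%N -> (n2 <= n)%N -> [/\ 1 <= T -> DVle (mu n n.+1) id (nuN n n.+1) (C * (1 + expR (- (2 * beta) * T) * w)),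
 T <= 1 -> DVle (mu n n.+1) id (nuN n n.+1) (w / (2 * T) + C * (1 + w)) &
 T <= 1 -> forall E0, DVle (uN 0) id (iid (u 0) N) E0 -> DVle (mu n n.+1) id (nuN n n.+1) (E0 + C * (1 + w))].
 move=> h1 h2;have := Hn1 n h1;rewrite lt_min => /andP[/ltW Da Db].
 have D1 : mesh T n <= 1 by apply: (le_trans Da);rewrite ler_pdivrMr// mul1r ler1n.
 have DT : mesh T n * n.+1%:R = T by rewrite /mesh divfK.
 have D8 : 8 * beta ^+ 2 * mesh T n * T <= 1.
 move: Db;rewrite ltr_pdivlMr;last by rewrite mulr_gt0// mulr_gt0// exprn_gt0.
 by move/ltW;apply: le_trans;apply: eqW;set q := mesh T n;ring.
 pose fG := mv_field_drift sys T0 uT n;pose D0 := mesh_gt0 T0 n.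
 have Hnoise k : (k < n.+1)%N -> _ := fun kn => noise4_small N0 B20 (HB2 _ _ fG D0 D1 (u 0) (Hmom _) k).2
 (fun mv z => Hn2 n h2 k kn mv z).
 rewrite -/L -etaE in Hnoise.
 apply: (discrete_entropy (fG := fG) (D0 := D0) N0 eta0 Mx0 (ltW L0) B00 NE T0 DT Da D8 Hnoise _ _ pi_fst pi_snd pi_gap) => k kn.
 apply: (particle_moment4 (B := B3) B30) => [|m0];first by rewrite /Mx lerD2r lerDl.
 have hi : (ex (uN 0%R) (fun x => \sum_(i < N) enorm (tnth x i) ^+ (2 * (2 * m).-1.+1))%R <= (N%:R * `|M4|)%:E)%E.
  rewrite prednK ?muln_gt0// mulnA;apply: (le_trans HM4).
  by rewrite lee_fin ler_wpM2l// ler_norm.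
 exact: (HB3 N _ D0 D1 (uN 0) hi k).2.
 by apply: (mckean_moment4 _ (HB2 _ _ fG D0 D1 (u 0) (Hmom _) k).2);rewrite /Mx lerDl.
by split=> T1 *;apply: lim => n h1 h2;have [k1 k2 k3] := key n h1 h2;[exact: k1|exact: k2|exact: k3].
Qed.

End Processes.

(** * Combining the short-time and long-time bounds *)

Lemma DVle_ext {R : realType} {d1} {S : measurableType d1} (rho rho' nu nu' : probability S R) (c : R) :
 (forall A, measurable A -> rho A = rho' A) -> (forall A, measurable A -> nu A = nu' A) ->
 DVle rho id nu c -> DVle rho' id nu' c.
Proof.
move=> H1 H2 HD phi mphi phi0 phib a;rewrite -(eq_measure_ex _ H2) => Ha.
by rewrite -(eq_measure_ex _ H1);exact: HD.
Qed.
(** The zero test function in the dual form. *)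
Lemma Ent_ge0 {R : realType} {d1} {S : measurableType d1} (mu nu : probability S R) : (0 <= Ent mu nu)%E.
Proof.
have h (c : R) : (Ent mu nu <= c%:E)%E -> 0 <= c.
 have b : exists M : R, forall x : S, (0 : R) <= M by exists 0.
 move/Ent_DVle => /(_ (fun=> 0) (mble_cst _) (fun=> lexx _) b 0).
 rewrite (eq_ex _ (_ : _ =1 fun=> 1)) => [|x];last by rewrite expR0.
 rewrite expR0 ex_cst => /(_ (lexx _));rewrite (eq_ex _ (_ : _ =1 fun=> 0)) => [|x//].
 by rewrite ex_cst addr0 lee_fin.
case: (Ent mu nu) h => [r h|//|h];first by rewrite lee_fin h.
by have := h (-1) (leNye _);rewrite oppr_ge0 ler10.
Qed.
(** The factor [ea] in front of the entropy is recovered as follows: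
    [(1 - ea) * z <= a * t * z <= a / 2 * w], so the lost part is charged to the transport term. [G]
    compensates the decay [eg]. *)
Lemma short_time {R : realType} (a C G ea eg t w z E0 : R) : 0 <= a -> 0 <= C -> 1 <= G ->
 0 <= w -> 0 <= z -> z <= E0 -> t * z <= w / 2 -> 1 - a * t <= ea -> 0 <= ea -> 1 <= G * eg ->
 z + C * (1 + w) <= G * (a / 2 + C) + (ea * E0 + eg * (G * (a / 2 + C) * w)).
Proof.
move=> a0 C0 G1 w0 z0 zE tz ea1 ea0 Ge.
have b0 : 0 <= a / 2 by rewrite divr_ge0.
have h1 : z - a / 2 * w <= ea * E0.
 apply: (le_trans _ (ler_wpM2l ea0 zE));apply: (le_trans _ (ler_wpM2r z0 ea1)).
 by rewrite mulrBl mul1r lerD2l lerN2 -!mulrA ler_wpM2l// [2^-1 * w]mulrC.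
have h2 : (a / 2 + C) * w <= eg * (G * (a / 2 + C) * w).
 rewrite -!mulrA mulrCA mulrA [leRHS](_ : _ = G * eg * ((a / 2 + C) * w));last by ring.
 by rewrite ler_peMl// mulr_ge0// addr_ge0.
have h3 : C <= G * (a / 2 + C).
 by apply: (letr (a / 2 + C));[rewrite lerDr|rewrite ler_peMl// addr_ge0].
rewrite mulrDr mulr1;move: h2;rewrite mulrDl;move: h1 h3.
by set x1 := a / 2 * w;set x2 := G * _;set x3 := C * w;set x4 := ea * E0;set x5 := eg * _;lra.
Qed.
Lemma mckean_law_process {R : realType} {d : nat} (V W : 'rV[R]_d -> R) m (u0 : probability 'rV[R]_d R) u :
 mckean_vlasov_law V W m u0 u ->
 exists (dO : measure_display) (Om : measurableType dO) (P : probability Om R) (F : R -> set (set Om))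
 (B X : R -> Om -> 'rV[R]_d), mckean_process (grad V) (grad W) m P F B X u /\
 forall A, measurable A -> u0 A = u 0 A.
Proof.
case=> uK [dO [Om [P [F [B [X [hF [hB aX] [cX sol] l0 lX]]]]]]].
exists dO, Om, P, F, B, X;split;last first.
 by move=> A mA;rewrite -(l0 A mA);exact: (lX 0 (lexx 0) A mA).
split=> //;apply: filterS sol => w h.
by rewrite (_ : (fun s => _) = fun s => - grad V (X s w) - grad_conv W (u s) (X s w));
 last by apply/funext => s;rewrite opprD.
Qed.
Lemma particle_law_process {R : realType} {d N : nat} (V W : 'rV[R]_d -> R)
 (u0 : probability (conf N R d) R) uN :
 particle_law V W u0 uN ->
 exists (dO : measure_display) (Om : measurableType dO) (P : probability Om R) (F : R -> set (set Om))
 (B : 'I_N -> R -> Om -> 'rV[R]_d) (X : R -> Om -> conf N R d),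
 particle_process (grad V) (grad W) P F B X uN /\ forall A, measurable A -> u0 A = uN 0 A.
Proof.
case=> [dO [Om [P [F [B [X [hF [hB aX] sol l0 lX]]]]]]].
exists dO, Om, P, F, B, X;split;last first.
 by move=> A mA;rewrite -(l0 A mA);exact: (lX 0 (lexx 0) A mA).
split=> // i;first by case: (sol i).
case: (sol i) => _;apply: filterS => w h.
by rewrite (_ : (fun s => _) = fun s => particle_drift V W (X s w) i);
 last by apply/funext => s;rewrite /pforce opprD.
Qed.
Lemma ex_sum_coord_le {R : realType} {d N : nat} (nu : probability (conf N R d) R) q (c : R) :
 (forall i, (ex nu (fun x => enorm (tnth x i) ^+ q)%R <= c%:E)%E) ->
 (ex nu (fun x => \sum_(i < N) enorm (tnth x i) ^+ q)%R <= (N%:R * c)%:E)%E.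
Proof.
move=> h;rewrite (@ex_sum _ _ _ _ _ (index_enum 'I_N) (fun i (x : conf N R d) => enorm (tnth x i) ^+ q)) => [|i|i x].
- apply: (le_trans (lee_sum _ (fun i _ => h i))).
 by rewrite sumEFin lee_fin sumr_const card_ord mulr_natl.
- by apply: mbleX;apply: mblef_enorm;exact: mble_tnth.
- by rewrite exprn_ge0// enorm_ge0.
Qed.
(** For [t > 1] the transport bound decays at rate [2 b >= ga] and suffices. For [0 < t <= 1],
    [short_time] is applied to the smaller of [x0] and [w / (2 t)]: both choices satisfy [z <= x0]
    and [t * z <= w / 2]. Time 0 is separate because the bounds on processes are for positive
    times. *)
Lemma entropy_interpolation {R : realType} {d1} {S : measurableType d1} (P Q P0 Q0 : probability S R)
 (a C ga b t w x0 : R) : 0 <= a -> 0 < C -> 0 <= ga -> ga <= 2 * b -> 0 <= t -> 0 <= w -> 0 <= x0 ->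
 DVle P0 id Q0 x0 -> (t = 0 -> DVle P id Q x0) ->
 (0 < t -> [/\ 1 <= t -> DVle P id Q (C * (1 + expR (- (2 * b) * t) * w)),
 t <= 1 -> DVle P id Q (w / (2 * t) + C * (1 + w)) &
 t <= 1 -> forall E0, DVle P0 id Q0 E0 -> DVle P id Q (E0 + C * (1 + w))]) ->
 DVle P id Q (expR ga * (a / 2 + C) + (expR (- a * t) * x0 + expR (- ga * t) * (expR ga * (a / 2 + C) * w))).
Proof.
move=> a0 C0 ga0 gb t0 w0 x00 De H0 H;have C0' := ltW C0.
have G1 : 1 <= expR ga by rewrite -expR0 ler_expR.
have a20 : 0 <= a / 2 by rewrite divr_ge0.
have ea0 : 0 <= expR (- a * t) := expR_ge0 _.
have eg0 : 0 <= expR (- ga * t) := expR_ge0 _.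
have ea1 : 1 - a * t <= expR (- a * t).
 by have := expR_ge1Dx (- a * t);rewrite !mulNr.
have Gg : t <= 1 -> 1 <= expR ga * expR (- ga * t).
 by move=> t1;rewrite -expRD -expR0 ler_expR mulNr subr_ge0 ler_piMr.
have w20 : 0 <= w / 2 by rewrite divr_ge0.
have Cw : 0 <= C * (1 + w) by apply: mulr_ge0 => //;exact: addr_ge0.
have [te|tn] := eqVneq t 0.
 have t1 : t <= 1 by rewrite te.
 apply: DVle_mono (H0 te);apply: (letr (x0 + C * (1 + w)));first by rewrite lerDl.
 by apply: (short_time a0 C0' G1 w0 x00 (lexx _) _ ea1 ea0 (Gg t1));rewrite te mul0r.
have tp : 0 < t by rewrite lt_neqAle eq_sym tn.
have [k1 k2 k3] := H tp.
have tz : t * (w / (2 * t)) = w / 2 by field.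
have z0 : 0 <= w / (2 * t) by apply: divr_ge0 => //;exact: mulr_ge0.
have [t1|t1] := leP t 1;last first.
 apply: DVle_mono (k1 (ltW t1)).
 have CC : C <= expR ga * (a / 2 + C).
 by apply: (letr (a / 2 + C));[rewrite lerDr|apply: ler_peMl => //;exact: addr_ge0].
 set C' := expR ga * _ in CC *;have C'0 : 0 <= C' := le_trans C0' CC.
 rewrite mulrDr mulr1;apply: lerD => //.
 have h1 : 0 <= expR (- a * t) * x0 by exact: mulr_ge0.
 have h2 : expR (- (2 * b) * t) * w <= expR (- ga * t) * w.
 by apply: ler_wpM2r => //;rewrite ler_expR !mulNr lerN2;exact: ler_wpM2r.
 have h3 : 0 <= expR (- ga * t) * w by exact: mulr_ge0.
 apply: (letr (C' * (expR (- ga * t) * w))).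
 apply: (le_trans (ler_wpM2l C0' h2));exact: ler_wpM2r.
 by rewrite [X in _ <= _ + X]mulrCA lerDr.
have [h|h] := leP x0 (w / (2 * t)).
 apply: DVle_mono (k3 t1 _ De).
 apply: (short_time a0 C0' G1 w0 x00 (lexx _) _ ea1 ea0 (Gg t1)).
 by rewrite -tz;exact: ler_wpM2l.
apply: DVle_mono (k2 t1).
by apply: (short_time a0 C0' G1 w0 z0 (ltW h) _ ea1 ea0 (Gg t1));rewrite tz.
Qed.
(** An optimal coupling is avoided: each [y] above the squared distance [V^2] yields a coupling of
    cost below [y^2], and [y] decreases to [V^2]. If the entropy or the distance is infinite the
    right-hand side is too. Dividing [Num.sqrt N] by [N] produces the final weight. *)
Lemma wasserstein_transfer {R : realType} {d N : nat} (mu nu : probability (conf N R d) R)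
 (E P : \bar R) (ea eg C : R) : (0 < N)%N -> 0 < ea -> 0 < eg -> 0 < C -> (0 <= E)%E ->
 (forall (x0 B : R) pi, E = x0%:E -> 0 <= x0 -> 0 < B -> coupling mu nu pi ->
 (ex pi (@gap4 R d N) < (B ^+ 4)%:E)%E ->
 (P <= (C + (ea * x0 + eg * (C * (Num.sqrt N%:R * B ^+ 2))))%:E)%E) ->
 (P * (N%:R^-1)%:E <= (C / N%:R)%:E + ea%:E * (E * (N%:R^-1)%:E) +
 (eg * (C / Num.sqrt N%:R))%:E * wasserstein 4 mu nu ^+ 2)%E.
Proof.
move=> N0 ea0 eg0 C0 E0 H;have NR : 0 < N%:R :> R by rewrite ltr0n.
rewrite /wasserstein;set I := ereal_inf _.
have I0 : (0 <= I)%E.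
 apply: le_ereal_inf_tmp => _ [pi _ <-];apply: integral_ge0 => z _;rewrite lee_fin.
 by apply: sumr_ge0 => i _;rewrite exprn_ge0// enorm_ge0.
have Ni : 0 < N%:R^-1 :> R by rewrite invr_gt0.
have sN : 0 < Num.sqrt N%:R :> R by rewrite sqrtr_gt0.
have q0 : 0 < eg * (C / Num.sqrt N%:R) by apply: mulr_gt0 => //;exact: divr_gt0.
have p2 : (0 <= (eg * (C / Num.sqrt N%:R))%:E * poweR I 4%:R^-1 ^+ 2)%E.
 by apply: mule_ge0;[rewrite lee_fin ltW|rewrite expe2;apply: mule_ge0;exact: poweR_ge0].
case: E E0 H => [x0||//] E0 H;last first.
 rewrite gt0_mulye ?lte_fin// gt0_muley ?lte_fin// addey// addye ?leey//.
 by apply: contraTneq p2 => ->.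
case EI : I I0 p2 => [i0||//] I0 p2;last first.
 rewrite poweRyr ?invr_eq0 ?pnatr_eq0// expe2 mulyy gt0_muley ?lte_fin//.
 by rewrite -!EFinM -EFinD addey// leey.
rewrite !lee_fin in E0 I0;rewrite poweR_EFin;set V := i0 `^ _.
have V0 : 0 <= V by exact: powR_ge0.
have V4 : V ^+ 4 = i0 by rewrite -powR_mulrn// /V -powRrM mulVf ?pnatr_eq0// powRr1.
have est y : V ^+ 2 < y -> (P <= (C + (ea * x0 + eg * (C * (Num.sqrt N%:R * y))))%:E)%E.
 move=> Vy;have y0 : 0 < y by exact: le_lt_trans (sqr_ge0 _) Vy.
 have sy : Num.sqrt y ^+ 2 = y by rewrite sqr_sqrtr// ltW.
 have I1 : (I < ((Num.sqrt y) ^+ 4)%:E)%E.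
 rewrite EI lte_fin -V4 (exprM V 2 2) (exprM (Num.sqrt y) 2 2) sy.
 by rewrite ltr_pXn2r ?nnegrE ?sqr_ge0// ltW.
 have [_ [pi Hpi <-] Hc] := ereal_inf_lt I1.
 have yb : 0 < Num.sqrt y by rewrite sqrtr_gt0.
 by have := H x0 _ pi erefl E0 yb Hpi Hc;rewrite sy.
have fin : (P <= (C + (ea * x0 + eg * (C * (Num.sqrt N%:R * V ^+ 2))))%:E)%E.
 apply/lee_addgt0Pr => e e_gt0;pose k := eg * (C * Num.sqrt N%:R).
 have k0 : 0 < k by apply: mulr_gt0 => //;exact: mulr_gt0.
 have hy : V ^+ 2 < V ^+ 2 + e / k by rewrite ltrDl divr_gt0.
 apply: (le_trans (est _ hy));rewrite -EFinD lee_fin;apply: eqW.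
 have h : k * (e / k) = e by rewrite mulrC divfK// gt_eqF.
 by rewrite -[X in _ = _ + X]h /k;ring.
have Ni' : (0 <= (N%:R^-1)%:E :> \bar R)%E by rewrite lee_fin ltW.
apply: (le_trans (lee_wpmul2r Ni' fin)).
rewrite expe2 -!EFinM -!EFinD lee_fin;apply: eqW.
have -> : (Num.sqrt N%:R)^-1 = Num.sqrt N%:R * N%:R^-1 :> R.
 have h : Num.sqrt N%:R * Num.sqrt N%:R = N%:R :> R by rewrite -expr2 sqr_sqrtr// ltW.
 by rewrite -[X in _ = _ * X^-1]h invfM mulVKf// gt_eqF.
by rewrite expr2;ring.
Qed.
(** Moments of order [4 * m] follow from those of order [4 * m ^ 2] by [t^q <= 1 + t^q'] for
    [q <= q']. *)
Lemma sup_moment {R : realType} {d : nat} (mu : forall N : nat, probability (conf N R d) R) m :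
 (ereal_sup [set z : \bar R | exists (N : nat) (i : 'I_N),
 z = \int[mu N]_x (enorm (tnth x i) ^+ (4 * m ^ 2)%N)%:E] < +oo)%E ->
 exists M4 : R, forall N,
 (ex (mu N) (fun x => \sum_(i < N) enorm (tnth x i) ^+ (4 * m))%R <= (N%:R * M4)%:E)%E.
Proof.
set A := [set z | _] => sA.
have [M4 HM4] : exists M4 : R, forall N (i : 'I_N), (ex (mu N) (fun x => enorm (tnth x i) ^+ (4 * m ^ 2))%R <= M4%:E)%E.
 have h N (i : 'I_N) : (ex (mu N) (fun x => enorm (tnth x i) ^+ (4 * m ^ 2))%R <= ereal_sup A)%E.
 by apply: ereal_sup_ubound;exists N, i.
 case: (ereal_sup A) sA h => [r _ h|//|_ h];[by exists r|exists 0 => N i].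
 by apply: (le_trans (h N i));exact: leNye.
exists (1 + M4) => N;apply: ex_sum_coord_le => i.
apply: (ex_power_le (f := fun x : conf N R d => enorm (tnth x i)) _ _ _ (HM4 N i)).
- by apply: mblef_enorm;exact: mble_tnth.
- by move=> x;exact: enorm_ge0.
- by rewrite leq_mul2l/=;case: (m) => // k;rewrite -[X in (X <= _)%N]expn1 leq_pexp2l.
Qed.

Theorem theorem9 (R : realType) (d : nat) (V W : 'rV[R]_d -> R)
    (lamV lamW M : R) (m : nat) (c0 : R)
    (u0 : probability 'rV[R]_d R)
    (u0N : forall N : nat, probability (N.-tuple 'rV[R]_d) R) :
  (0 < d)%N ->
  assumption_H V W lamV lamW M m ->
  (ereal_sup [set z : \bar R | exists (N : nat) (i : 'I_N),
     z = \int[u0N N]_x (enorm (tnth x i) ^+ (4 * m ^ 2)%N)%:E] < +oo)%E ->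
  log_sobolev u0 c0 ->
  (forall x, W x = lamW * (enorm x ^+ 2 / 2)) \/ d = 1%N ->
  exists C_init : R, 0 < C_init /\
    forall u : R -> probability 'rV[R]_d R,
      mckean_vlasov_law V W m u0 u ->
    forall (N : nat) (uN : R -> probability (N.-tuple 'rV[R]_d) R),
      (0 < N)%N -> particle_law V W (u0N N) uN ->
    forall t : R, 0 <= t ->
      (Ent (uN t) (iid (u t) N) * (N%:R^-1)%:E
       <= (C_init / N%:R)%:E
          + (expR (- (1 / (2 * C_LSI lamV lamW c0)) * t))%:E
              * (Ent (u0N N) (iid u0 N) * (N%:R^-1)%:E)
          + (expR (- gamma_cst lamV lamW c0 * t) * (C_init / Num.sqrt N%:R))%:E
              * wasserstein 4 (u0N N) (iid u0 N) ^+ 2)%E.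
Proof.
move=> d0 H supM ls qd;have sys := convex_system_H H qd.
set c := C_LSI lamV lamW c0;set a := 1 / (2 * c);set ga := gamma_cst lamV lamW c0.
have cp : 0 < c by rewrite lt_max divr_gt0 ?orbT//;exact: sum_lam_gt0 sys.
have a0 : 0 <= a by rewrite divr_ge0// mulr_ge0// ltW.
have b0 := beta_gt0 sys;set b := beta_cst lamV lamW in b0.
have gb : ga <= 2 * b by rewrite ge_min lexx.
have ga0 : 0 <= ga by rewrite /ga /gamma_cst le_min -/c -/a a0 andbT;exact: mulr_ge0 (ler0n _ _) (ltW b0).
(* One bound per order, chosen from [u0] before any process is given, so that the constant does not
   depend on the processes. *)
have /choice[mom Hmom] : forall q, exists K : R, (ex u0 (fun x => enorm x ^+ q)%R <= K%:E)%E.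
 move=> q;have [K HK] := log_sobolev_moments ls q;exists (1 + K).
 by apply: (ex_power_le (@mble_enorm R d) (@enorm_ge0 R d) _ HK);rewrite mul2n -addnn leq_addr.
have [M4 HM4] := sup_moment supM.
have [C C0 HC] := entropy_estimate sys mom M4.
have C'0 : 0 < expR ga * (a / 2 + C).
 by apply: mulr_gt0;[exact: expR_gt0|apply: ltr_wpDl => //;exact: divr_ge0].
(* [a / 2] pays for the factor [expR (- a * t)] on the entropy up to time 1, and [expR ga] for the
   factor [expR (- ga * t)] on the transport term. *)
exists (expR ga * (a / 2 + C));split=> // u Hu N uN N0 HuN t t0.
have [dO [Om [P [F [B [X [pX e0]]]]]]] := mckean_law_process Hu.
have [dO' [Om' [P' [F' [B' [X' [pX' e0']]]]]]] := particle_law_process HuN.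
apply: wasserstein_transfer => //;[exact: expR_gt0|exact: expR_gt0|exact: Ent_ge0|].
move=> x0 B0 pi EE x00 B00 Hpi Hc.
have De : DVle (uN 0) id (iid (u 0) N) x0.
 by apply: (DVle_ext e0' (iid_ext e0));apply: Ent_DVle;rewrite EE.
have w0 : 0 <= Num.sqrt N%:R * B0 ^+ 2 by apply: mulr_ge0;[exact: sqrtr_ge0|exact: sqr_ge0].
apply: DVle_Ent;apply: (entropy_interpolation a0 C0 ga0 gb t0 w0 x00 De) => [->//|tp].
have Hm q : (ex (u 0%R) (fun x : 'rV[R]_d => enorm x ^+ q)%R <= (mom q)%:E)%E.
 by rewrite -(eq_measure_ex _ e0).
have HN : (ex (uN 0%R) (fun x => \sum_(i < N) enorm (tnth x i) ^+ (4 * m))%R <= (N%:R * M4)%:E)%E.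
 by rewrite -(eq_measure_ex _ e0').
have lf : has_law pi fst (uN 0) by move=> A mA;rewrite -e0'//;case: (Hpi A mA).
have ls' : has_law pi snd (iid (u 0) N) by move=> A mA;rewrite -(iid_ext e0)//;case: (Hpi A mA).
exact: (HC _ _ _ _ _ _ _ pX Hm _ _ _ _ _ _ _ _ N0 pX' HN pi _ B00
 (fun g mg g0 => esym (has_law_ex mble_fst lf mg g0))
 (fun g mg g0 => esym (has_law_ex mble_snd ls' mg g0)) (ltW Hc) t tp).
Qed.
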